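(* As $N\to\infty$, $$\frac{1}{N}\sum_{n=1}^N L(1/2,\chi^{4n-3})^2\ll \log^2 N.$$
   Context: Let $\eta=\frac{1+\sqrt{-7}}{2}$ with $\sqrt{-7}=i\sqrt 7$; the ring of integers of $\mathbb{Q}(\sqrt{-7})$ is $\{a+b\eta: a,b\in\mathbb{Z}\}$, and $N(a+b\eta)=a^2+ab+2b^2$. For integers $a,b$ set $\epsilon_{a,b}=\left(\frac{a^3-2a^2b-ab^2+b^3}{7}\right)$ (Legendre symbol, equal to $0$ when $7$ divides the numerator). The Hecke Grössencharacter $\chi$ is defined on ideals by $\chi((a+b\eta))=\epsilon_{a,b}(a+b\eta)$ (so it is $0$ if $a+b\eta$ is not coprime to $\sqrt{-7}$). For each integer $n\ge 1$, $L(s,\chi^{4n-3})$ is the $L$-function (normalized so that its central point is $s=1/2$) defined for $\Re s>1$ by the absolutely convergent series $$L(s,\chi^{4n-3})=\frac12\sum_{(a,b)\in\mathbb{Z}^2\setminus\{(0,0)\}}\frac{\epsilon_{a,b}\,(a+b\eta)^{4n-3}}{(a^2+ab+2b^2)^{s+2n-3/2}},$$ and elsewhere by analytic continuation; it is entire, and $\left(\frac{7}{2\pi}\right)^s\Gamma(s+2n-3/2)L(s,\chi^{4n-3})$ is invariant under $s\mapsto 1-s$. The values $L(1/2,\chi^{4n-3})$ are real. *)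

(* Defs.v *)
From HB Require Import structures.
From mathcomp Require Import all_boot all_order all_algebra.
From mathcomp Require Import all_classical all_reals all_analysis.
From mathcomp Require Import complex.
From mathcomp Require summability.

Set Implicit Arguments.
Unset Strict Implicit.
Unset Printing Implicit Defensive.

Import Order.TTheory GRing.Theory Num.Theory.
Import numFieldNormedType.Exports.

Local Open Scope ring_scope.
Local Open Scope complex_scope.
Local Open Scope classical_set_scope.

(* Meaningful for p an odd prime. *)
Definition legendre (p : nat) (a : int) : int :=
  if (p%:Z %| a)%Z then 0
  else if [exists x : 'I_p, (p%:Z %| (x : nat)%:Z ^+ 2 - a)%Z] then 1
  else -1.

Definition epsilon (a b : int) : int :=
  legendre 7 (a ^+ 3 - 2 * a ^+ 2 * b - a * b ^+ 2 + b ^+ 3).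

(* The norm of a + b eta, as a binary quadratic form. *)
Definition qnorm (a b : int) : int := a ^+ 2 + a * b + 2 * b ^+ 2.

(* eta = (1 + sqrt (-7)) / 2 *)
Definition eta (R : realType) : R[i] := (2^-1) +i* (Num.sqrt 7 / 2).

Definition cexp (R : realType) (z : R[i]) : R[i] :=
  (expR (complex.Re z))%:C * (cos (complex.Im z) +i* sin (complex.Im z)).

(* x ^ w for a real base x > 0 and a complex exponent w; junk if x <= 0. *)
Definition cpow (R : realType) (x : R) (w : R[i]) : R[i] :=
  cexp (w * (ln x)%:C).

(* The summand of the series for L(s, chi^(4n-3)), for n >= 1 (the natural
   number subtraction in the exponent is truncated); the excluded pair (0, 0)
   is given the value 0. *)
Definition Lterm (R : realType) (n : nat) (s : R[i]) (ab : int * int) : R[i] :=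
  let: (a, b) := ab in
  if ab == (0, 0) then 0
  else (epsilon a b)%:~R * (a%:~R + b%:~R * eta R) ^+ (4 * n - 3)
       / cpow (qnorm a b)%:~R (s + 2 * n%:R - 3 / 2).

(* [summability.sum] is the unordered sum: the limit of the sums over finite subsets of
   the index type. *)
Definition Lseries (R : realType) (n : nat) (s : R[i]) : R[i] :=
  2^-1 * summability.sum (Lterm n s : int * int -> R[i]^o).

(* Derivability over the field R[i] in the direction 1 is complex
   differentiability. *)
Definition entire (R : realType) (f : R[i] -> R[i]) : Prop :=
  forall s : R[i], derivable (f : R[i]^o -> R[i]^o) s 1.

(* By the identity theorem at most one function f satisfies this. *)
Definition is_Lfunction (R : realType) (n : nat) (f : R[i] -> R[i]) : Prop :=
  entire f /\ (forall s : R[i], 1 < complex.Re s -> f s = Lseries n s).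

(* Main.v *)
(** Poisson summation for Gaussians is obtained by Polya's method, as the limit of Poisson summation
    on finite cyclic groups applied to binomial coefficients. It gives the functional equation of the
    theta series with coefficients [epsilon_(a,b) (a + b eta)^k], and hence, up to a bounded factor,
    the central value as a sum over the lattice with a smooth cutoff at norms of size [n].

    To compare the value at [1/2] of the continuation with this sum, one groups the Dirichlet series
    in blocks of seven lattice points: the character kills the terms of order zero and one, and the
    series of blocks converges absolutely for [Re s >= 1/4]; a Cauchy estimate with a damping factor
    shows that it converges to the continuation.

    In the mean square over [n <= N], the pairs of lattice points [p, q] on a common line through
    the origin contribute [O(log^2 N)] for each [n], because the character cancels along the line.
    For the other pairs the sum over [n] is a geometric sum with monotone weights, of size
    [1 / |Re (p conj q)| + 1 / |Im (p conj q)|]; the real part does not vanish, as it is prime to [7].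
    Summed over the [O(N)] lattice points of norm [O(N)], these bounds give [O(N log^2 N)]. *)

Require Import Defs.
From mathcomp Require Import all_boot all_order all_algebra.
From mathcomp Require Import all_classical all_reals all_analysis.
From mathcomp Require Import complex finmap.
From mathcomp Require Import ring lra zify.
From mathcomp Require summability.

Set Implicit Arguments.
Unset Strict Implicit.
Unset Printing Implicit Defensive.

Import Order.TTheory GRing.Theory Num.Theory.
Import numFieldNormedType.Exports.

Local Open Scope ring_scope.
Local Open Scope complex_scope.
Local Open Scope classical_set_scope.

(** * The complex exponential *)

Section ComplexBasics.
Variable R : realType.
Implicit Types (x y : R) (z w : R[i]).

(** The hypothesis gives an entire function that agrees with the Dirichlet series where this
    converges absolutely, and the route to the center must start from there. The place of a Mellin
    transform is taken by a differentiation: the derivative of the sum with cutoff at norms [a / d]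
    with respect to [log d] is a multiple of a theta series, whose functional equation makes a fixed
    combination of the sums at [d = D] and [d = 1 / D] constant in [D]. As [D] grows, the first sum
    tends to 0 and the second, being dominated blockwise, to twice the value of the continuation.

    The exponents [4 n - 3] matter in two ways. The root number is the same for all [n], so a bound
    of its modulus is enough. And for two lattice points with [g = p conj q] the ratio of the
    geometric sum is [(g / |g|) ^ 4], which is close to 1 both near the real and near the imaginary
    axis. Hence the two terms in the bound for a pair, each the reciprocal of an integral linear
    form in [q]; counting the solutions in a box costs one logarithm for the values of the form and
    one for the average over its coefficients. *)

Definition cn (z : R[i]) : R := Normc.normc z.

Lemma normr_cn z : `|z| = (cn z)%:C.
Proof. by []. Qed.

Lemma cn_sqr z : cn z ^+ 2 = complex.Re z ^+ 2 + complex.Im z ^+ 2.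
Proof. by case: z => a b; rewrite /cn /= sqr_sqrtr // addr_ge0 ?sqr_ge0. Qed.

Lemma cn_ge0 z : 0 <= cn z.
Proof. by case: z => a b; rewrite /cn /= sqrtr_ge0. Qed.

Lemma cn0 : cn 0 = 0. Proof. exact: Normc.normc0. Qed.
Lemma cn1 : cn 1 = 1. Proof. exact: Normc.normc1. Qed.
Lemma cnM z w : cn (z * w) = cn z * cn w. Proof. exact: Normc.normcM. Qed.
Lemma cnV z : cn z^-1 = (cn z)^-1. Proof. exact: Normc.normcV. Qed.
Lemma cnN z : cn (- z) = cn z. Proof. exact: normcN. Qed.
Lemma cnX z n : cn (z ^+ n) = cn z ^+ n.
Proof. by elim: n => [|n IH]; rewrite ?expr0 ?cn1 // !exprS cnM IH. Qed.
Lemma cnD z w : cn (z + w) <= cn z + cn w. Proof. exact: le_normcD. Qed.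
Lemma cnB z w : cn (z - w) <= cn z + cn w.
Proof. by rewrite -(cnN w) cnD. Qed.
Lemma cnBC z w : cn (z - w) = cn (w - z).
Proof. by rewrite -cnN opprB. Qed.
Lemma cn_eq0 z : (cn z == 0) = (z == 0).
Proof.
apply/eqP/eqP => [h|->]; last exact: cn0.
by apply: (Normc.eq0_normc h).
Qed.
Lemma cn_gt0 z : (0 < cn z) = (z != 0).
Proof. by rewrite lt_neqAle cn_ge0 andbT eq_sym cn_eq0. Qed.
Lemma cn_real x : cn x%:C = `|x|.
Proof. by rewrite /cn /= expr0n /= addr0 sqrtr_sqr. Qed.
Lemma cn_nat n : cn n%:R = n%:R.
Proof. by rewrite -(rmorph_nat (real_complex R)) cn_real normr_nat. Qed.
Lemma cn_sum (I : Type) (s : seq I) (P : pred I) (f : I -> R[i]) :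
  cn (\sum_(i <- s | P i) f i) <= \sum_(i <- s | P i) cn (f i).
Proof.
elim/big_ind2 : _ => [|a b c d h1 h2|//]; first by rewrite cn0.
by apply: le_trans (cnD _ _) _; rewrite lerD.
Qed.
Lemma Re_le_cn z : `|complex.Re z| <= cn z.
Proof.
by case: z => a b; rewrite /cn /= -sqrtr_sqr ler_wsqrtr // lerDl sqr_ge0.
Qed.
Lemma Im_le_cn z : `|complex.Im z| <= cn z.
Proof.
by case: z => a b; rewrite /cn /= -sqrtr_sqr ler_wsqrtr // lerDr sqr_ge0.
Qed.
Lemma cn_le_ReIm z : cn z <= `|complex.Re z| + `|complex.Im z|.
Proof.
rewrite -(@ler_pXn2r _ 2) ?nnegrE ?cn_ge0 ?addr_ge0 //.
rewrite cn_sqr sqrrD !real_normK ?num_real //.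
by rewrite lerD2r ler_wpDr // mulrn_wge0 // mulr_ge0.
Qed.

Lemma ReD z w : complex.Re (z + w) = complex.Re z + complex.Re w.
Proof. by case: z; case: w. Qed.
Lemma ImD z w : complex.Im (z + w) = complex.Im z + complex.Im w.
Proof. by case: z; case: w. Qed.
Lemma ReN z : complex.Re (- z) = - complex.Re z. Proof. by case: z. Qed.
Lemma ImN z : complex.Im (- z) = - complex.Im z. Proof. by case: z. Qed.
Lemma ReM z w : complex.Re (z * w) =
  complex.Re z * complex.Re w - complex.Im z * complex.Im w.
Proof. by case: z; case: w. Qed.
Lemma ImM z w : complex.Im (z * w) =
  complex.Re z * complex.Im w + complex.Im z * complex.Re w.
Proof. by case: z; case: w. Qed.
Lemma Re_sum (I : Type) (s : seq I) (P : pred I) (f : I -> R[i]) :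
  complex.Re (\sum_(i <- s | P i) f i) = \sum_(i <- s | P i) complex.Re (f i).
Proof. exact: (big_morph _ ReD). Qed.
Lemma ext_complex z w : complex.Re z = complex.Re w ->
  complex.Im z = complex.Im w -> z = w.
Proof. by case: z => a b; case: w => c d /= -> ->. Qed.

Lemma rC_M x y : (x * y)%:C = x%:C * y%:C :> R[i]. Proof. exact: rmorphM. Qed.
Lemma rC_D x y : (x + y)%:C = x%:C + y%:C :> R[i]. Proof. exact: rmorphD. Qed.
Lemma rC_N x : (- x)%:C = - x%:C :> R[i]. Proof. exact: rmorphN. Qed.
Lemma rC_V x : (x^-1)%:C = x%:C^-1 :> R[i]. Proof. exact: fmorphV. Qed.
Lemma rC_X x n : (x ^+ n)%:C = x%:C ^+ n :> R[i]. Proof. exact: rmorphXn. Qed.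
Lemma rC_nat n : (n%:R)%:C = n%:R :> R[i]. Proof. exact: rmorph_nat. Qed.
Lemma rC_int (m : int) : (m%:~R)%:C = m%:~R :> R[i]. Proof. exact: rmorph_int. Qed.
Definition rCE := (rC_nat, rC_int, rC_N, rC_V, rC_X, rC_M).

Lemma cexpD z w : cexp (z + w) = cexp z * cexp w.
Proof.
rewrite /cexp ReD ImD expRD cosD sinD.
by apply: ext_complex; rewrite !(ReM, ImM) /=; ring.
Qed.
Lemma cexp0 : cexp 0 = 1 :> R[i].
Proof.
by rewrite /cexp /= expR0 cos0 sin0; apply: ext_complex; rewrite !(ReM, ImM) /=; ring.
Qed.
Lemma cn_cexp z : cn (cexp z) = expR (complex.Re z).
Proof.
rewrite /cexp cnM cn_real ger0_norm ?expR_ge0 //.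
by rewrite /cn /= cos2Dsin2 sqrtr1 mulr1.
Qed.
Lemma cexp_neq0 z : cexp z != 0.
Proof. by rewrite -cn_gt0 cn_cexp expR_gt0. Qed.
Lemma cexpN z : cexp (- z) = (cexp z)^-1.
Proof.
apply: (mulfI (cexp_neq0 z)).
by rewrite -cexpD subrr cexp0 mulfV // cexp_neq0.
Qed.
Lemma cexpMn z n : cexp (z *+ n) = cexp z ^+ n.
Proof. by elim: n => [|n IH]; rewrite ?mulr0n ?cexp0 ?expr0 // mulrS exprS cexpD IH. Qed.
Lemma cexp_real x : cexp x%:C = (expR x)%:C.
Proof. by rewrite /cexp /= cos0 sin0; apply: ext_complex; rewrite !(ReM, ImM) /=; ring. Qed.
Lemma cn_cexp_le z : cn (cexp z) <= expR (cn z).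
Proof. by rewrite cn_cexp ler_expR (le_trans (ler_norm _)) ?Re_le_cn. Qed.

Definition cderiv (F : R -> R[i]) (D : R[i]) (t : R) :=
  is_derive t 1 (fun u => complex.Re (F u)) (complex.Re D) /\
  is_derive t 1 (fun u => complex.Im (F u)) (complex.Im D).

Lemma cderivD F G D E t : cderiv F D t -> cderiv G E t ->
  cderiv (fun u => F u + G u) (D + E) t.
Proof.
move=> [h1 h2] [h3 h4]; split.
  rewrite ReD (_ : (fun u => _) = (fun u => complex.Re (F u)) + (fun u => complex.Re (G u))).
    exact: is_deriveD.
  by apply/funext => u; rewrite ReD.
rewrite ImD (_ : (fun u => _) = (fun u => complex.Im (F u)) + (fun u => complex.Im (G u))).
  exact: is_deriveD.
by apply/funext => u; rewrite ImD.
Qed.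

Lemma cderivM_cst (f : R -> R) (d : R) z (t : R) : is_derive t 1 f d ->
  cderiv (fun u => (f u)%:C * z) (d%:C * z) t.
Proof.
move=> h; split.
  rewrite (_ : (fun u => _) = (complex.Re z) \*: f); last first.
    by apply/funext => u; rewrite ReM /= mul0r subr0 mulrC.
  apply: is_derive_eq; rewrite ReM /= mul0r subr0 mulrC; reflexivity.
rewrite (_ : (fun u => _) = (complex.Im z) \*: f); last first.
  by apply/funext => u; rewrite ImM /= mul0r addr0 mulrC.
apply: is_derive_eq; rewrite ImM /= mul0r addr0 mulrC; reflexivity.
Qed.

Lemma cderivZ F D z t : cderiv F D t -> cderiv (fun u => z * F u) (z * D) t.
Proof.
move=> [h1 h2]; split.
  rewrite (_ : (fun u => _) = (complex.Re z) \*: (fun u => complex.Re (F u)) -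
     (complex.Im z) \*: (fun u => complex.Im (F u))); last first.
    by apply/funext => u; rewrite ReM.
  by apply: is_derive_eq; rewrite ReM.
rewrite (_ : (fun u => _) = (complex.Re z) \*: (fun u => complex.Im (F u)) +
   (complex.Im z) \*: (fun u => complex.Re (F u))); last first.
  by apply/funext => u; rewrite ImM.
by apply: is_derive_eq; rewrite ImM.
Qed.

Lemma cderiv_cst z t : cderiv (fun _ => z) 0 t.
Proof. by split; apply: is_derive_cst. Qed.

Lemma cderiv_ext F G D t : F =1 G -> cderiv F D t -> cderiv G D t.
Proof. by move/funext ->. Qed.

Lemma cderiv_sum (n : nat) (F : nat -> R -> R[i]) (D : nat -> R[i]) t :
  (forall i, (i < n)%N -> cderiv (F i) (D i) t) ->
  cderiv (fun u => \sum_(i < n) F i u) (\sum_(i < n) D i) t.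
Proof.
elim: n => [|n IH] h.
  rewrite big_ord0; apply: (cderiv_ext _ (cderiv_cst 0 t)) => u.
  by rewrite big_ord0.
rewrite big_ord_recr /=.
apply: (@cderiv_ext (fun u => \sum_(i < n) F i u + F n u)).
  by move=> u; rewrite big_ord_recr.
by apply: cderivD; [apply: IH => i hi; apply: h; exact: ltnW|exact: h].
Qed.

Lemma cderiv_cexp z t : cderiv (fun u => cexp (u%:C * z)) (z * cexp (t%:C * z)) t.
Proof.
case: z => a b.
have hR u : complex.Re (u%:C * (a +i* b)) = u * a by rewrite ReM /= mul0r subr0.
have hI u : complex.Im (u%:C * (a +i* b)) = u * b by rewrite ImM /= mul0r addr0.
split; rewrite /cexp.
  rewrite (_ : (fun u => _) = (fun u : R => expR (u * a) * cos (u * b))); last first.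
    by apply/funext => u; rewrite ReM hR hI /= mul0r subr0.
  apply: is_derive_eq.
  rewrite hR hI !(ReM, ImM) /= !scaler0 !add0r.
  rewrite (_ : a%:A = a); last exact: mulr1.
  rewrite (_ : b%:A = b); last exact: mulr1.
  by rewrite /GRing.scale /=; ring.
rewrite (_ : (fun u => _) = (fun u : R => expR (u * a) * sin (u * b))); last first.
  by apply/funext => u; rewrite ImM hR hI /= mul0r addr0.
apply: is_derive_eq.
rewrite hR hI !(ReM, ImM) /= !scaler0 !add0r.
  rewrite (_ : a%:A = a); last exact: mulr1.
  rewrite (_ : b%:A = b); last exact: mulr1.
  by rewrite /GRing.scale /=; ring.
Qed.

(** The real mean value theorem for [Re (conj w * F)], where [w] is the increment of [F]: its
    increment is [|w| ^ 2], and dividing by [|w|] loses no constant, as separate bounds for the real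
    and the imaginary part would. *)
Lemma cn_mvt F D (M : R) (a b : R) : a <= b ->
  (forall t, a <= t <= b -> cderiv F (D t) t) ->
  (forall t, a <= t <= b -> cn (D t) <= M) ->
  cn (F b - F a) <= M * (b - a).
Proof.
move=> ab hD hM.
set w := F b - F a.
have [w0|w0] := eqVneq w 0.
  rewrite w0 cn0 mulr_ge0 ?subr_ge0 //.
  by apply: le_trans (hM a _); rewrite ?cn_ge0 ?lexx.
set wb := (complex.Re w) +i* (- complex.Im w).
have cnwb : cn wb = cn w by rewrite /wb /cn; case: (w) => p q /=; rewrite sqrrN.
have hd t : a <= t <= b -> cderiv (fun u => wb * F u) (wb * D t) t.
  by move=> ht; apply: cderivZ; exact: hD.
have [c cab] : exists2 c, c \in `[a, b]%R &
   complex.Re (wb * F b) - complex.Re (wb * F a) = complex.Re (wb * D c) * (b - a).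
  apply: (@MVT_segment _ (fun u => complex.Re (wb * F u)) (fun t => complex.Re (wb * D t))) => //.
    move=> x; rewrite in_itv /= => /andP[h1 h2].
    by have [] := hd x; rewrite ?(ltW h1) ?(ltW h2).
  apply: derivable_within_continuous => x; rewrite in_itv /= => hx.
  by have [[h _] _] := hd x hx.
rewrite -ReN -ReD -mulrBr -/w => e.
have e2 : complex.Re (wb * w) = cn w ^+ 2.
  by rewrite ReM /wb cn_sqr /=; ring.
rewrite e2 in e.
have cw : 0 < cn w by rewrite cn_gt0.
rewrite -(ler_pM2l cw) -expr2 e mulrA ler_wpM2r ?subr_ge0 //.
apply: le_trans (ler_norm _) _; apply: le_trans (Re_le_cn _) _.
rewrite cnM cnwb ler_wpM2l ?cn_ge0 //.
by apply: hM; rewrite in_itv /= in cab.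
Qed.

Definition exp_poly (n : nat) (z : R[i]) : R[i] := \sum_(j < n) z ^+ j / (j`!)%:R.

(** Induction on [n]: along the segment [u z] the derivative of the remainder of order [n + 1] is
    [z] times the remainder of order [n]. *)
Lemma cexp_taylor n z : cn (cexp z - exp_poly n z) <= cn z ^+ n * expR (cn z).
Proof.
elim: n z => [|n IH] z.
  by rewrite /exp_poly big_ord0 subr0 expr0 mul1r cn_cexp_le.
have := @cn_mvt (fun u => cexp (u%:C * z) - exp_poly n.+1 (u%:C * z))
  (fun u => z * (cexp (u%:C * z) - exp_poly n (u%:C * z)))
  (cn z ^+ n.+1 * expR (cn z)) 0 1 ler01.
rewrite subr0 mulr1 !mul1r mul0r.
have -> : exp_poly n.+1 0 = 1.
  rewrite /exp_poly big_ord_recl /= expr0 fact0 divr1 big1 ?addr0 // => i _.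
  by rewrite /bump /= add1n expr0n mul0r.
rewrite cexp0 subrr subr0; apply => t /andP[t0 t1].
  rewrite mulrBr; apply: cderivD; first exact: cderiv_cexp.
  rewrite -mulN1r.
  apply: (@cderiv_ext (fun u => -1 * exp_poly n.+1 (u%:C * z))).
    by move=> u; rewrite mulN1r.
  apply: cderivZ.
  apply: (@cderiv_ext (fun u => 1 + \sum_(i < n) (u ^+ i.+1)%:C * (z ^+ i.+1 / (i.+1`!)%:R))).
    move=> u; rewrite /exp_poly big_ord_recl /= expr0 fact0 divr1; congr (_ + _).
    by apply: eq_bigr => i _; rewrite /bump /= add1n exprMn rmorphXn /= mulrA.
  rewrite -[z * _]add0r; apply: cderivD; first exact: cderiv_cst.
  rewrite /exp_poly mulr_sumr.
  rewrite (_ : \sum_(i < n) _ = \sum_(i < n) ((i.+1%:R * t ^+ i)%:C * (z ^+ i.+1 / (i.+1`!)%:R))); last first.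
    apply: eq_bigr => i _.
    rewrite rmorphM rmorphXn rmorph_nat exprMn factS natrM exprS /=.
    have h1 : (i.+1%:R : R[i]) != 0 by rewrite pnatr_eq0.
    have h2 : ((i`!)%:R : R[i]) != 0 by rewrite pnatr_eq0 -lt0n fact_gt0.
    by field; rewrite h2 -[1 + _]/(1 + i%:R) nat1r h1.
  apply: (cderiv_sum (F := fun i u => (u ^+ i.+1)%:C * (z ^+ i.+1 / (i.+1`!)%:R)) (D := fun i => (i.+1%:R * t ^+ i)%:C * (z ^+ i.+1 / (i.+1`!)%:R))).
  move=> i _; apply: cderivM_cst.
  have h := @is_deriveX R R id i.+1 t 1 1 (is_derive_id _ _).
  rewrite (_ : (fun _ => _) = (id : R -> R) ^+ i.+1); last by apply/funext => u; rewrite exprfctE.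
  by apply: (is_derive_eq h); rewrite /= -[LHS]/(_ * _) mulr1.
rewrite cnM exprS -mulrA ler_wpM2l ?cn_ge0 //.
apply: le_trans (IH _) _.
have htz : cn (t%:C * z) <= cn z.
  by rewrite cnM cn_real ger0_norm // ler_piMl ?cn_ge0.
by rewrite ler_pM ?exprn_ge0 ?expR_ge0 ?ler_expR ?cn_ge0 // lerXn2r // nnegrE cn_ge0.
Qed.

Lemma cexp_lin z : cn (cexp z - 1 - z) <= cn z ^+ 2 * expR (cn z).
Proof.
have := cexp_taylor 2 z.
by rewrite /exp_poly !big_ord_recl big_ord0 /= expr0 /= fact0 /bump /= !divr1 addr0 expr1 opprD addrA.
Qed.

Lemma cexp_sub1 z : cn (cexp z - 1) <= cn z * expR (cn z).
Proof.
have := cexp_taylor 1 z.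
by rewrite /exp_poly big_ord1 expr0 fact0 divr1 expr1.
Qed.

End ComplexBasics.

#[global] Arguments cn : simpl never.
#[global] Arguments cexp : simpl never.

(** * Unordered sums *)

Section UnorderedSums.
Variable R : realType.

(** Convergence of complex values through the real modulus, so that squeezing and the arithmetic of
    real limits apply along any filter. *)
Definition ccvg (T : Type) (F : set_system T) (f : T -> R[i]) (l : R[i]) :=
  (fun p => cn (f p - l)) @ F --> (0 : R).

Lemma ccvgP (T : Type) (F : set_system T) {FF : Filter F} (f : T -> R[i]) l :
  ccvg F f l <-> forall e : R, 0 < e -> \forall p \near F, cn (f p - l) <= e.
Proof.
split=> [h e e0|h].
  move/cvgrPdist_le : h => /(_ e e0); apply: filterS => p.
  by rewrite sub0r normrN ger0_norm ?cn_ge0.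
apply/cvgrPdist_le => e e0; have := h e e0; apply: filterS => p.
by rewrite sub0r normrN ger0_norm ?cn_ge0.
Qed.

Lemma ccvg_cst (T : Type) (F : set_system T) {FF : Filter F} l :
  ccvg F (fun _ => l) l.
Proof. by apply/ccvgP => e e0; apply: nearW => p; rewrite subrr cn0 ltW. Qed.

Lemma ccvgD (T : Type) (F : set_system T) {FF : Filter F} f g l m :
  ccvg F f l -> ccvg F g m -> ccvg F (fun p => f p + g p) (l + m).
Proof.
move=> /ccvgP hf /ccvgP hg; apply/ccvgP => e e0.
have e20 : 0 < e / 2 by rewrite divr_gt0.
near=> p.
rewrite opprD addrACA; apply: le_trans (cnD _ _) _.
rewrite (splitr e) lerD //; near: p; [exact: hf|exact: hg].
Unshelve. all: by end_near. Qed.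

Lemma ccvgM (T : Type) (F : set_system T) {FF : Filter F} f g l m :
  ccvg F f l -> ccvg F g m -> ccvg F (fun p => f p * g p) (l * m).
Proof.
move=> hf hg.
have h : (fun p => cn (f p - l) * cn (g p - m) + cn l * cn (g p - m) + cn m * cn (f p - l)) @ F
   --> (0 * 0 + cn l * 0 + cn m * 0 : R).
  apply: cvgD; [apply: cvgD; [exact: cvgM|]|]; by apply: cvgM => //; exact: cvg_cst.
rewrite !mulr0 !addr0 in h.
apply: (squeeze_cvgr _ (cvg_cst 0) h).
apply: nearW => p; rewrite cn_ge0 /=.
have -> : f p * g p - l * m = (f p - l) * (g p - m) + l * (g p - m) + m * (f p - l) by ring.
apply: le_trans (cnD _ _) _; rewrite cnM lerD2r.
by apply: le_trans (cnD _ _) _; rewrite !cnM.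
Qed.

Lemma ccvg_sum (T : Type) (F : set_system T) {FF : Filter F} (I : Type) (s : seq I)
  (f : I -> T -> R[i]) (l : I -> R[i]) :
  (forall i, ccvg F (f i) (l i)) ->
  ccvg F (fun p => \sum_(i <- s) f i p) (\sum_(i <- s) l i).
Proof.
move=> h; elim: s => [|i s IH].
  by rewrite big_nil; under eq_fun do rewrite big_nil; exact: ccvg_cst.
by rewrite big_cons; under eq_fun do rewrite big_cons; exact: ccvgD.
Qed.

Lemma ccvg_unique (T : Type) (F : set_system T) {FF : ProperFilter F} f l m :
  ccvg F f l -> ccvg F f m -> l = m.
Proof.
move=> /ccvgP hf /ccvgP hg.
apply/eqP; rewrite -subr_eq0 -cn_eq0; apply/negPn/negP => h.
have h0 : 0 < cn (l - m) by rewrite lt_neqAle eq_sym h cn_ge0.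
have e0 : 0 < cn (l - m) / 4 by rewrite divr_gt0.
have [p [h1 h2]] : exists p, cn (f p - l) <= cn (l - m) / 4 /\ cn (f p - m) <= cn (l - m) / 4.
  by apply: (@filter_ex _ F); near=> p; split; near: p; [exact: hf|exact: hg].
have : cn (l - m) <= cn (f p - m) + cn (f p - l).
  have -> : l - m = (f p - m) - (f p - l) by ring.
  exact: cnB.
lra.
Unshelve. all: by end_near. Qed.

Lemma ccvg_ext (T : Type) (F : set_system T) {FF : Filter F} f g l :
  (\forall p \near F, f p = g p) -> ccvg F f l -> ccvg F g l.
Proof.
move=> h /ccvgP hf; apply/ccvgP => e e0.
by near=> p; rewrite -(_ : f p = g p); near: p => //; exact: hf.
Unshelve. all: by end_near. Qed.

(** Unordered summability, with duplicate-free lists as finite sets, over any type with decidable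
    equality; [hasSum_sum_eq] links it to [summability.sum]. *)
Definition hasSum (T : eqType) (f : T -> R[i]) (l : R[i]) :=
  forall e : R, 0 < e -> exists A0 : seq T, forall A, uniq A -> {subset A0 <= A} ->
    cn (\sum_(t <- A) f t - l) <= e.

(** A summable majorant. Domination by such a weight gives existence of a sum ([hasSum_exists]),
    small tails ([wsum_tail]) and passage to the limit ([tannery]). *)
Definition wsum (T : eqType) (W : T -> R) :=
  (forall t, 0 <= W t) /\ exists C, forall A, uniq A -> \sum_(t <- A) W t <= C.

Lemma sum_subset (V : zmodType) (T : eqType) (f : T -> V) (A0 A : seq T) :
  uniq A0 -> uniq A -> {subset A0 <= A} ->
  \sum_(t <- A) f t = \sum_(t <- A0) f t + \sum_(t <- A | t \notin A0) f t.
Proof.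
move=> u0 u h; rewrite (bigID (mem A0)) /=; congr (_ + _).
rewrite -big_filter; apply: perm_big; apply: uniq_perm => //.
  exact: filter_uniq.
move=> x; rewrite mem_filter /=; apply/andP/idP => [[]//|hx]; split => //; exact: h.
Qed.

Lemma hasSum_ext (T : eqType) (f g : T -> R[i]) l : f =1 g -> hasSum f l -> hasSum g l.
Proof. by move=> /funext ->. Qed.

Lemma hasSum_unique (T : eqType) (f : T -> R[i]) l m : hasSum f l -> hasSum f m -> l = m.
Proof.
move=> hf hg.
apply/eqP; rewrite -subr_eq0 -cn_eq0; apply/negPn/negP => h.
have h0 : 0 < cn (l - m) by rewrite lt_neqAle eq_sym h cn_ge0.
have e0 : 0 < cn (l - m) / 4 by rewrite divr_gt0.
have [A hA] := hf _ e0; have [B hB] := hg _ e0.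
have u : uniq (undup (A ++ B)) by exact: undup_uniq.
have := hA _ u; have := hB _ u; set s := \sum_(_ <- _) _.
move=> h2 h1.
have {}h1 : cn (s - l) <= cn (l - m) / 4.
  by apply: h1 => x xA; rewrite mem_undup mem_cat xA.
have {}h2 : cn (s - m) <= cn (l - m) / 4.
  by apply: h2 => x xA; rewrite mem_undup mem_cat xA orbT.
have : cn (l - m) <= cn (s - m) + cn (s - l).
  have -> : l - m = (s - m) - (s - l) by ring.
  exact: cnB.
lra.
Qed.

Lemma hasSumD (T : eqType) (f g : T -> R[i]) l m : hasSum f l -> hasSum g m ->
  hasSum (fun t => f t + g t) (l + m).
Proof.
move=> hf hg e e0; have e20 : 0 < e / 2 by rewrite divr_gt0.
have [A hA] := hf _ e20; have [B hB] := hg _ e20.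
exists (A ++ B) => C uC sC; rewrite big_split /= opprD addrACA.
apply: le_trans (cnD _ _) _; rewrite (splitr e) lerD //.
  by apply: hA => // x xA; apply: sC; rewrite mem_cat xA.
by apply: hB => // x xA; apply: sC; rewrite mem_cat xA orbT.
Qed.

Lemma hasSumZ (T : eqType) (f : T -> R[i]) l c : hasSum f l ->
  hasSum (fun t => c * f t) (c * l).
Proof.
move=> hf e e0; have c0 : 0 < cn c + 1 by rewrite ltr_wpDl ?cn_ge0.
have [A hA] := hf _ (divr_gt0 e0 c0).
exists A => C uC sC; rewrite -mulr_sumr -mulrBr cnM.
apply: le_trans (_ : (cn c + 1) * (e / (cn c + 1)) <= _); last first.
  by rewrite mulrC divfK // gt_eqF.
by rewrite ler_pM ?cn_ge0 ?lerDl ?hA.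
Qed.

Lemma hasSum0 (T : eqType) : hasSum (fun _ : T => 0) 0.
Proof. by move=> e e0; exists [::] => A _ _; rewrite big1 // subr0 cn0 ltW. Qed.

Lemma hasSum_sum (T : eqType) (I : Type) (s : seq I) (f : I -> T -> R[i]) (l : I -> R[i]) :
  (forall i, hasSum (f i) (l i)) ->
  hasSum (fun t => \sum_(i <- s) f i t) (\sum_(i <- s) l i).
Proof.
move=> h; elim: s => [|i s IH].
  by rewrite big_nil; under eq_fun do rewrite big_nil; exact: hasSum0.
by rewrite big_cons; under eq_fun do rewrite big_cons; exact: hasSumD.
Qed.

Lemma hasSum_fin (T : eqType) (A : seq T) (f : T -> R[i]) : uniq A ->
  (forall t, t \notin A -> f t = 0) -> hasSum f (\sum_(t <- A) f t).
Proof.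
move=> uA h e e0; exists A => B uB sB.
by rewrite (sum_subset f uA uB sB) addrAC subrr add0r big1 // cn0 ltW.
Qed.

Lemma nneg_sum_exists (T : eqType) (g : T -> R) C : (forall t, 0 <= g t) ->
  (forall A, uniq A -> \sum_(t <- A) g t <= C) ->
  exists l, forall e, 0 < e -> exists2 A0 : seq T, uniq A0 & forall A, uniq A -> {subset A0 <= A} ->
    `|\sum_(t <- A) g t - l| <= e.
Proof.
move=> g0 hC.
pose E := [set x | exists2 A : seq T, uniq A & x = \sum_(t <- A) g t].
have hE : has_sup E.
  split; first by exists 0; exists [::] => //; rewrite big_nil.
  by exists C => x [A uA ->]; exact: hC.
exists (sup E) => e e0.
have [x [A0 uA0 ->] hx] := sup_adherent e0 hE.
exists A0 => // A uA sA.
have h1 : \sum_(t <- A) g t <= sup E by apply: ub_le_sup; [case: hE|exists A].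
have h2 : \sum_(t <- A0) g t <= \sum_(t <- A) g t.
  by rewrite (sum_subset g uA0 uA sA) lerDl sumr_ge0.
by rewrite ler_distl; apply/andP; split; lra.
Qed.

Lemma wsum_tail (T : eqType) (W : T -> R) e : wsum W -> 0 < e ->
  exists2 A0 : seq T, uniq A0 & forall A, uniq A -> \sum_(t <- A | t \notin A0) W t <= e.
Proof.
move=> [W0 [C hC]] e0.
have [l hl] := nneg_sum_exists W0 hC.
have [A0 uA0 hA0] := hl _ (divr_gt0 e0 (ltr0n R 2)).
exists A0 => // A uA.
have uB : uniq (A0 ++ [seq t <- A | t \notin A0]).
  rewrite cat_uniq uA0 filter_uniq //= andbT.
  by apply/hasPn => x; rewrite mem_filter => /andP[].
have := hA0 _ uB; have := hA0 _ uA0 (fun x h => h).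
rewrite big_cat big_filter /=.
move=> h1 h2; have {}h2 := h2 _.
have : {subset A0 <= A0 ++ [seq t <- A | t \notin A0]} by move=> x xA; rewrite mem_cat xA.
move=> /h2; move: h1; rewrite !ler_distl => /andP[a1 a2] /andP[b1 b2]; lra.
Qed.

Lemma hasSum_exists (T : eqType) (W : T -> R) (f : T -> R[i]) : wsum W ->
  (forall t, cn (f t) <= W t) -> exists l, hasSum f l.
Proof.
move=> hW hf; have [W0 [C hC]] := hW.
have hr (h : T -> R) : (forall t, `|h t| <= W t) -> exists l, hasSum (fun t => (h t)%:C) l.
  move=> hh.
  (* A signed real family is the difference of the nonnegative families [h + W] and [W]. *)
  have [l hl] := @nneg_sum_exists _ (fun t => h t + W t) (C + C)
    (fun t => ltac:(by have := hh t; rewrite ler_norml => /andP[]; lra))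
    (fun A uA => ltac:(by rewrite big_split /= lerD ?hC //; apply: le_trans (hC A uA);
       apply: ler_sum => t _; exact: le_trans (ler_norm _) (hh t))).
  have [m hm] := nneg_sum_exists W0 hC.
  exists ((l - m)%:C) => e e0; have e20 : 0 < e / 2 by rewrite divr_gt0.
  have [A _ hA] := hl _ e20; have [B _ hB] := hm _ e20.
  exists (A ++ B) => D uD sD.
  rewrite -rmorph_sum -rmorphB cn_real.
  have hA' : {subset A <= D} by move=> x xA; apply: sD; rewrite mem_cat xA.
  have hB' : {subset B <= D} by move=> x xA; apply: sD; rewrite mem_cat xA orbT.
  have := hA _ uD hA'; have := hB _ uD hB'; rewrite big_split /= => h1 h2.
  apply: le_trans (_ : _ <= `|\sum_(i <- D) h i + \sum_(i <- D) W i - l| + `|\sum_(t <- D) W t - m|) _.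
    apply: le_trans (ler_normB _ _); rewrite le_eqVlt; apply/orP; left; apply/eqP; congr (`|_|); ring.
  by rewrite (splitr e) lerD.
have [l hl] := hr (fun t => complex.Re (f t)) (fun t => le_trans (Re_le_cn _) (hf t)).
have [m hm] := hr (fun t => complex.Im (f t)) (fun t => le_trans (Im_le_cn _) (hf t)).
exists (l + 'i%C * m).
apply: (@hasSum_ext _ (fun t => (complex.Re (f t))%:C + 'i%C * (complex.Im (f t))%:C)).
  by move=> t; rewrite -complexE.
by apply: hasSumD => //; exact: hasSumZ.
Qed.

Lemma hasSum_tail (T : eqType) (W : T -> R) (f : T -> R[i]) l e A0 : hasSum f l ->
  (forall t, cn (f t) <= W t) -> uniq A0 ->
  (forall A, uniq A -> \sum_(t <- A | t \notin A0) W t <= e) ->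
  cn (\sum_(t <- A0) f t - l) <= e.
Proof.
move=> hf hW u0 h; apply/ler_addgt0Pr => d d0.
have [A hA] := hf _ d0.
have u : uniq (undup (A0 ++ A)) by exact: undup_uniq.
have s0 : {subset A0 <= undup (A0 ++ A)} by move=> x xA; rewrite mem_undup mem_cat xA.
have s1 : {subset A <= undup (A0 ++ A)} by move=> x xA; rewrite mem_undup mem_cat xA orbT.
have := hA _ u s1; rewrite (sum_subset _ u0 u s0); set S := \sum_(_ <- A0) _; set S' := \sum_(_ <- _ | _) _ => h1.
have -> : S - l = (S + S' - l) - S' by ring.
apply: le_trans (cnB _ _) _; rewrite addrC lerD //.
apply: le_trans (cn_sum _ _ _) _; apply: le_trans (h _ u); exact: ler_sum.
Qed.

Lemma hasSum_le (T : eqType) (W : T -> R) (f : T -> R[i]) l C : hasSum f l ->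
  (forall t, cn (f t) <= W t) -> (forall A, uniq A -> \sum_(t <- A) W t <= C) -> cn l <= C.
Proof.
move=> hf hW hC.
have := @hasSum_tail _ W f l C [::] hf hW isT.
by rewrite big_nil sub0r cnN; apply => A uA; rewrite (eq_bigl xpredT) ?hC.
Qed.

(** Dominated convergence for sums. Outside a finite list each of the two sums contributes at most
    [e / 3]; on the list the convergence is termwise. *)
Lemma tannery (T : eqType) (P : Type) (F : set_system P) {FF : ProperFilter F}
  (f : P -> T -> R[i]) (g : T -> R[i]) (W : T -> R) (l : P -> R[i]) l0 :
  wsum W ->
  (\forall p \near F, forall t, cn (f p t) <= W t) ->
  (forall t, ccvg F (f^~ t) (g t)) ->
  (\forall p \near F, hasSum (f p) (l p)) -> hasSum g l0 -> ccvg F l l0.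
Proof.
move=> hW hfW hfg hl hg.
have hgW t : cn (g t) <= W t.
  apply/ler_addgt0Pr => d d0.
  have [p [h1 h2]] : exists p, cn (f p t - g t) <= d /\ cn (f p t) <= W t.
    apply: (@filter_ex _ F); near=> p; split; near: p.
      by have /ccvgP := hfg t; exact.
    by apply: filterS hfW => p; apply.
  have -> : g t = f p t - (f p t - g t) by ring.
  by apply: le_trans (cnB _ _) _; rewrite lerD.
apply/ccvgP => e e0; have e30 : 0 < e / 3 by rewrite divr_gt0.
have [A0 u0 hA0] := wsum_tail hW e30.
have hs : ccvg F (fun p => \sum_(t <- A0) f p t) (\sum_(t <- A0) g t) by exact: ccvg_sum.
near=> p.
have -> : l p - l0 = - (\sum_(t <- A0) f p t - l p) + (\sum_(t <- A0) f p t - \sum_(t <- A0) g t)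
   + (\sum_(t <- A0) g t - l0) by ring.
have -> : e = e / 3 + e / 3 + e / 3 by field.
apply: le_trans (cnD _ _) _; rewrite lerD //; last exact: (hasSum_tail hg hgW u0 hA0).
apply: le_trans (cnD _ _) _; rewrite lerD //; last first.
  by near: p; move/ccvgP : hs; exact.
rewrite cnN; apply: (@hasSum_tail _ W (f p)) => //; last first.
  by near: p.
by near: p.
Unshelve. all: by end_near. Qed.

Lemma pinv_exists (T U : eqType) (phi : T -> U) : injective phi ->
  exists psi : U -> option T, pcancel phi psi /\ (forall u t, psi u = Some t -> phi t = u).
Proof.
move=> inj.
exists (fun u => match pselect (exists t, phi t = u) with
  | left h => Some (projT1 (cid h)) | right _ => None end); split => [t|u t].
  case: pselect => [h|]; last by case; exists t.
  by congr Some; apply: inj; case: cid.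
by case: pselect => // h [<-]; case: cid.
Qed.

Lemma pmap_uniq_pinv (T U : eqType) (phi : T -> U) (psi : U -> option T) (A : seq U) :
  (forall u t, psi u = Some t -> phi t = u) -> uniq A -> uniq (pmap psi A).
Proof.
move=> h; elim: A => //= u A IH /andP[uA uu].
case E : (psi u) => [t|] /=; last exact: IH.
rewrite IH // andbT; apply: contra uA; rewrite mem_pmap => /mapP[v vA hv].
by rewrite -(h _ _ E) (h v t).
Qed.

Lemma sum_pmap (V : zmodType) (T U : eqType) (phi : T -> U) (psi : U -> option T) (A : seq U)
  (f : U -> V) :
  (forall u t, psi u = Some t -> phi t = u) -> (forall u, psi u = None -> f u = 0) ->
  \sum_(u <- A) f u = \sum_(t <- pmap psi A) f (phi t).
Proof.
move=> h h0; elim: A => [|u A IH] /=; first by rewrite !big_nil.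
rewrite big_cons IH; case E : (psi u) => [t|] /=; first by rewrite big_cons (h _ _ E).
by rewrite h0 // add0r.
Qed.

Lemma hasSum_inj (T U : eqType) (phi : T -> U) (f : U -> R[i]) l : injective phi ->
  (forall u, (forall t, phi t <> u) -> f u = 0) ->
  hasSum (f \o phi) l <-> hasSum f l.
Proof.
move=> inj h0; have [psi [hp hq]] := pinv_exists inj.
have f0 u : psi u = None -> f u = 0.
  by move=> hu; apply: h0 => t htu; rewrite -htu hp in hu.
split=> hs e e0; have [A0 hA0] := hs _ e0.
  exists (map phi A0) => A uA sA; rewrite (sum_pmap _ hq f0).
  apply: hA0; first exact: (pmap_uniq_pinv hq uA).
  move=> t tA; rewrite mem_pmap; apply/mapP; exists (phi t); last by rewrite hp.
  by apply: sA; exact: map_f.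
exists (pmap psi A0) => A uA sA.
pose B := [seq u <- undup A0 | u \notin map phi A].
have uB : uniq (map phi A ++ B).
  rewrite cat_uniq map_inj_uniq // uA filter_uniq ?undup_uniq //= andbT.
  by apply/hasPn => x; rewrite mem_filter => /andP[].
have := hA0 _ uB; rewrite big_cat /= big_map (_ : \sum_(i <- B) f i = 0) ?addr0.
  apply => u uA0; rewrite mem_cat mem_filter mem_undup uA0 andbT; exact: orbN.
rewrite big_seq big1 // => u; rewrite mem_filter mem_undup => /andP[h1 h2].
case E : (psi u) => [t|]; last exact: f0.
case/negP: h1; apply/mapP; exists t; last by rewrite (hq _ _ E).
by apply: sA; rewrite mem_pmap; apply/mapP; exists u.
Qed.

Lemma wsum_le (T : eqType) (V W : T -> R) c : wsum W -> 0 <= c -> (forall t, 0 <= V t <= c * W t) -> wsum V.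
Proof.
move=> [W0 [C hC]] c0 h; split=> [t|]; first by have /andP[] := h t.
exists (c * C) => A uA; apply: le_trans (_ : _ <= c * \sum_(t <- A) W t) _.
  by rewrite mulr_sumr; apply: ler_sum => t _; have /andP[] := h t.
by rewrite ler_wpM2l ?hC.
Qed.

Lemma wsumZ (T : eqType) (W : T -> R) c : wsum W -> 0 <= c -> wsum (fun t => c * W t).
Proof.
by move=> hW c0; apply: (wsum_le hW c0) => t; rewrite lexx mulr_ge0 //; case: hW.
Qed.

Lemma wsum_prod (T U : eqType) (V : T -> R) (W : U -> R) : wsum V -> wsum W ->
  wsum (fun p : T * U => V p.1 * W p.2).
Proof.
move=> [V0 [C hC]] [W0 [D hD]]; split=> [p|]; first by rewrite mulr_ge0.
exists (C * D) => A uA.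
pose A1 := undup (map fst A); pose A2 := undup (map snd A).
have uP : uniq [seq (x, y) | x <- A1, y <- A2].
  by apply: allpairs_uniq; rewrite ?undup_uniq // => -[a b] [c d] _ _ [-> ->].
have sP : {subset A <= [seq (x, y) | x <- A1, y <- A2]}.
  move=> [x y] h; apply/allpairsP; exists (x, y) => /=.
  by split=> //; rewrite mem_undup; apply/mapP; exists (x, y).
apply: le_trans (_ : _ <= \sum_(p <- [seq (x, y) | x <- A1, y <- A2]) V p.1 * W p.2) _.
  by rewrite (sum_subset (fun p : T * U => V p.1 * W p.2) uA uP sP) lerDl sumr_ge0 // => p _; rewrite mulr_ge0.
rewrite big_allpairs /=.
under eq_bigr do rewrite -mulr_sumr.
rewrite -mulr_suml ler_pM ?hC ?hD ?undup_uniq ?sumr_ge0 //.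
Qed.

(** The product family has some sum [L] by domination; it is [l m] because partial sums over
    rectangles of lists factor. The choice of [e] makes the error [e (1 + |l| + |m|)] of a product
    of approximations at most a quarter of the presumed distance between [L] and [l m]. *)
Lemma hasSum_prod (T U : eqType) (V : T -> R) (W : U -> R) (f : T -> R[i]) (g : U -> R[i]) l m :
  wsum V -> wsum W -> (forall t, cn (f t) <= V t) -> (forall u, cn (g u) <= W u) ->
  hasSum f l -> hasSum g m -> hasSum (fun p : T * U => f p.1 * g p.2) (l * m).
Proof.
move=> hV hW hfV hgW hf hg.
have [L hL] := @hasSum_exists _ _ (fun p : T * U => f p.1 * g p.2) (wsum_prod hV hW)
  (fun p => ltac:(by rewrite cnM ler_pM ?cn_ge0)).
suff -> : l * m = L by [].
apply/eqP; rewrite -subr_eq0 -cn_eq0; apply/negPn/negP => h.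
have h0 : 0 < cn (l * m - L) by rewrite lt_neqAle eq_sym h cn_ge0.
set d := cn (l * m - L) in h0.
pose e := Num.min 1 (d / (4 * (1 + cn l + cn m))).
have q0 : 0 < 1 + cn l + cn m by rewrite -addrA ltr_wpDr ?addr_ge0 ?cn_ge0.
have e0 : 0 < e by rewrite /e lt_min ltr01 /= divr_gt0 // mulr_gt0.
have e1 : e <= 1 by rewrite /e ge_min lexx.
have e2 : e * (1 + cn l + cn m) <= d / 4.
  apply: le_trans (_ : d / (4 * (1 + cn l + cn m)) * (1 + cn l + cn m) <= _).
    by rewrite ler_wpM2r ?ge_min ?lexx ?orbT // ltW.
  by rewrite invfM mulrA divfK // gt_eqF.
have [A hA] := hf _ e0; have [B hB] := hg _ e0.
have [C hC] := hL _ (divr_gt0 h0 (ltr0n R 4)).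
pose A1 := undup (A ++ map fst C); pose A2 := undup (B ++ map snd C).
have uP : uniq [seq (x, y) | x <- A1, y <- A2].
  by apply: allpairs_uniq; rewrite ?undup_uniq // => -[a b] [c d'] _ _ [-> ->].
have sP : {subset C <= [seq (x, y) | x <- A1, y <- A2]}.
  move=> [x y] hxy; apply/allpairsP; exists (x, y) => /=.
  by split=> //; rewrite mem_undup mem_cat; apply/orP; right; apply/mapP; exists (x, y).
have := hC _ uP sP; rewrite big_allpairs /=.
under eq_bigr do rewrite -mulr_sumr.
rewrite -mulr_suml.
have := hA A1 (undup_uniq _) (fun x h => ltac:(by rewrite mem_undup mem_cat h)).
have := hB A2 (undup_uniq _) (fun x h => ltac:(by rewrite mem_undup mem_cat h)).
set F := \sum_(_ <- A1) _; set G := \sum_(_ <- A2) _ => hG hF hFG.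
have hd : d <= cn (F * G - L) + cn ((F - l) * (G - m) + l * (G - m) + m * (F - l)).
  rewrite /d; have -> : l * m - L = (F * G - L) - ((F - l) * (G - m) + l * (G - m) + m * (F - l)) by ring.
  exact: cnB.
have h3 : cn ((F - l) * (G - m) + l * (G - m) + m * (F - l)) <= e * (1 + cn l + cn m).
  apply: le_trans (cnD _ _) _; rewrite (mulrDr e).
  apply: lerD; last by rewrite cnM mulrC ler_wpM2r ?cn_ge0.
  apply: le_trans (cnD _ _) _; rewrite (mulrDr e).
  apply: lerD; last by rewrite cnM mulrC ler_wpM2r ?cn_ge0.
  by rewrite cnM ler_pM ?cn_ge0 // (le_trans hG).
lra.
Qed.

End UnorderedSums.

(** * Summable weights on the integers and on pairs of integers *)

Section IntWeight.
Variable R : realType.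

Definition qroot (x : R) : R := (Num.sqrt (Num.sqrt x))^-1.

Lemma qroot_ge0 x : 0 <= qroot x.
Proof. by rewrite invr_ge0 sqrtr_ge0. Qed.

Lemma qroot4 x : 0 <= x -> qroot x ^+ 4 = x^-1.
Proof.
move=> x0; rewrite /qroot exprVn; congr (_^-1).
by rewrite (exprM _ 2 2) !sqr_sqrtr ?sqrtr_ge0.
Qed.

Lemma qroot_le x y : 0 < x -> x <= y -> qroot y <= qroot x.
Proof.
move=> x0 xy; have y0 := lt_le_trans x0 xy.
by rewrite lef_pV2 ?posrE ?sqrtr_gt0 // !ler_wsqrtr.
Qed.

Lemma qrootM x y : 0 <= x -> qroot (x * y) = qroot x * qroot y.
Proof. by move=> x0; rewrite /qroot sqrtrM // sqrtrM ?sqrtr_ge0 // invfM. Qed.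

(** The weight [(n + 1) ^ (-5/4)]. The exponent is that of the blocks of the Dirichlet series:
    second order cancellation saves [nm ^ (-1)], and [Re s >= 1/4] gives [nm ^ (-1/4)]. A norm that
    is at least 1 dominates [(|x| + 1) (|y| + 1)] up to a constant, so the product of two such
    weights majorizes the blocks. *)
Definition wt (n : nat) : R := qroot n.+1%:R ^+ 5.

Lemma wt_ge0 n : 0 <= wt n. Proof. by rewrite exprn_ge0 ?qroot_ge0. Qed.

(** With [u ^ 4 = 1 / (n + 1)] and [v ^ 4 = 1 / (n + 2)] one has [u ^ 4 - v ^ 4 = u ^ 4 v ^ 4];
    factoring out [u - v] gives [u v ^ 4 <= 4 (u - v)], which telescopes. *)
Lemma wt_step n : wt n.+1 <= 4 * (qroot n.+1%:R - qroot n.+2%:R).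
Proof.
rewrite /wt; set u := qroot n.+1%:R; set v := qroot n.+2%:R.
have v0 : 0 <= v by exact: qroot_ge0.
have vu : v <= u by apply: qroot_le; rewrite ?ltr0n ?ler_nat.
have u0 : 0 < u by rewrite /u /qroot invr_gt0 !sqrtr_gt0 ltr0n.
have e : u ^+ 4 - v ^+ 4 = u ^+ 4 * v ^+ 4.
  rewrite !qroot4 ?ler0n // -[n.+2]addn1 natrD.
  have h1 : (n.+1%:R : R) != 0 by rewrite pnatr_eq0.
  have h2 : (n.+1%:R + 1 : R) != 0 by rewrite natr1 pnatr_eq0.
  by move: (n.+1%:R : R) h1 h2 => p h1 h2; field; rewrite h1 h2.
have h : (u - v) * (4 * u ^+ 3) >= u ^+ 4 * v ^+ 4.
  rewrite -e (_ : u ^+ 4 - v ^+ 4 = (u - v) * (u ^+ 3 + u ^+ 2 * v + u * v ^+ 2 + v ^+ 3)); last by ring.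
  rewrite ler_wpM2l ?subr_ge0 //.
  have h1 : u ^+ 2 * v <= u ^+ 3 by rewrite (exprSr u 2) ler_wpM2l ?exprn_ge0 ?(ltW u0).
  have h2 : u * v ^+ 2 <= u ^+ 3.
    by rewrite (exprS u 2) ler_wpM2l ?(ltW u0) // lerXn2r ?nnegrE ?(ltW u0).
  have h3 : v ^+ 3 <= u ^+ 3 by rewrite lerXn2r ?nnegrE ?(ltW u0).
  lra.
have h4 : u * v ^+ 4 <= 4 * (u - v).
  rewrite -(@ler_pM2l _ (u ^+ 3)) ?exprn_gt0 //.
  by rewrite mulrA -exprSr (le_trans h) // le_eqVlt; apply/orP; left; apply/eqP; ring.
apply: le_trans h4; rewrite exprS; apply: ler_wpM2r => //; exact: exprn_ge0.
Qed.

Lemma sum_wt N : \sum_(n < N) wt n <= 5.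
Proof.
case: N => [|N]; first by rewrite big_ord0.
suff h : \sum_(n < N.+1) wt n <= 1 + 4 * (1 - qroot N.+1%:R).
  by apply: le_trans h _; have := qroot_ge0 N.+1%:R; lra.
elim: N => [|N IH].
  by rewrite big_ord1 /wt /qroot !sqrtr1 invr1 expr1n; lra.
rewrite big_ord_recr /=; have := wt_step N; lra.
Qed.

Definition wi (i : int) : R := wt `|i|%N.

Lemma wsum_wi : wsum wi.
Proof.
split=> [i|]; first exact: wt_ge0.
exists 10 => A uA.
have hn (B : seq nat) : uniq B -> \sum_(n <- B) wt n <= 5.
  move=> uB; pose M := (\max_(n <- B) n).+1.
  have sB : {subset B <= iota 0 M}.
    by move=> x xB; rewrite mem_iota /= add0n ltnS; apply: (@leq_bigmax_seq _ B xpredT id).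
  apply: le_trans (sum_wt M); rewrite -(big_mkord xpredT) /index_iota subn0.
  rewrite (sum_subset wt uB (iota_uniq 0 M) sB) lerDl sumr_ge0 // => *; exact: wt_ge0.
rewrite (bigID (fun i : int => 0 <= i)) /=.
have -> : (10 : R) = 5 + 5 by lra.
rewrite lerD // -big_filter.
  apply: le_trans (hn (map (fun i : int => `|i|%N) [seq i <- A | 0 <= i]) _); first by rewrite big_map.
  rewrite map_inj_in_uniq ?filter_uniq // => x y; rewrite !mem_filter => /andP[x0 _] /andP[y0 _]; lia.
apply: le_trans (hn (map (fun i : int => `|i|%N) [seq i <- A | ~~ (0 <= i)]) _); first by rewrite big_map.
rewrite map_inj_in_uniq ?filter_uniq // => x y; rewrite !mem_filter => /andP[x0 _] /andP[y0 _]; lia.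
Qed.

Definition wi2 (p : int * int) : R := wi p.1 * wi p.2.

Lemma wsum_wi2 : wsum wi2.
Proof. exact: wsum_prod wsum_wi wsum_wi. Qed.

End IntWeight.

(** * Cauchy's theorem on rectangles *)

Section RealIntegral.
Variable R : realType.
Implicit Types (f g : R -> R) (a b c : R).
Notation mu := (@lebesgue_measure R).

Definition rint (a b : R) (f : R -> R) : R := \int[mu]_(x in `[a, b]) f x.

Lemma cont_integrable f a b : continuous f -> mu.-integrable `[a, b] (EFin \o f).
Proof.
move=> cf; apply: continuous_compact_integrable; first exact: segment_compact.
exact: continuous_subspaceT.
Qed.

Lemma rintD f g a b : continuous f -> continuous g ->
  rint a b (fun x => f x + g x) = rint a b f + rint a b g.
Proof. by move=> cf cg; apply: RintegralD => //; exact: cont_integrable. Qed.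

Lemma rintZ f r a b : continuous f -> rint a b (fun x => r * f x) = r * rint a b f.
Proof. by move=> cf; apply: RintegralZl => //; exact: cont_integrable. Qed.

Lemma rint_cst r a b : a <= b -> rint a b (fun=> r) = r * (b - a).
Proof.
move=> ab; rewrite /rint Rintegral_cst //= lebesgue_measure_itv /= lte_fin.
by case: ltrgtP ab => //= -> _; rewrite subrr.
Qed.

Lemma rint_split f a b c : continuous f -> a <= c <= b ->
  rint a b f = rint a c f + rint c b f.
Proof.
move=> cf /andP[ac cb]; apply/eqP; rewrite addrC -subr_eq; apply/eqP.
rewrite /rint Rintegral_itvB //=; last exact: cont_integrable.
apply: Rintegral_itv_obnd_cbnd.
apply: integrableS (cont_integrable c b cf) => //.
by apply: subset_itvr; rewrite bnd_simp.
Qed.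

Lemma rint_le f g a b : continuous f -> continuous g ->
  (forall x, a <= x <= b -> f x <= g x) -> rint a b f <= rint a b g.
Proof.
move=> cf cg h; apply: le_Rintegral => //; try exact: cont_integrable.
Qed.

Lemma rint_bound f M a b : a <= b -> continuous f ->
  (forall x, a <= x <= b -> `|f x| <= M) -> `|rint a b f| <= M * (b - a).
Proof.
move=> ab cf h; rewrite ler_norml -mulNr -!rint_cst //.
apply/andP; split; apply: rint_le => //; try exact: cst_continuous.
  by move=> x /h; rewrite ler_norml => /andP[].
by move=> x /h; rewrite ler_norml => /andP[].
Qed.

Lemma rint_id a b : a <= b -> rint a b id = (b ^+ 2 - a ^+ 2) / 2.
Proof.
rewrite le_eqVlt => /predU1P[<-|ab].
  by rewrite subrr mul0r /rint set_itv1 Rintegral_set1.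
rewrite /rint /Rintegral.
rewrite (@continuous_FTC2 _ (id : R -> R) (fun x : R => 2^-1 * (x * x)) a b ab) //.
- by rewrite -EFinB /= -mulrBr !expr2 mulrC.
- by apply: continuous_subspaceT => x; exact: cvg_id.
- split=> //.
  + by apply: cvg_at_right_filter; apply: cvgM; [exact: cvg_cst|apply: cvgM; exact: cvg_id].
  + by apply: cvg_at_left_filter; apply: cvgM; [exact: cvg_cst|apply: cvgM; exact: cvg_id].
- move=> x _; rewrite derive1E.
  have h : is_derive x 1 (fun x : R => 2^-1 * (x * x)) x.
    apply: is_derive_eq; rewrite /GRing.scale /=; by field.
  exact: derive_val.
Qed.

End RealIntegral.

(** * Complex differentiability, Goursat's theorem and Cauchy's estimate *)

Section Goursat.
Variable R : realType.
Implicit Types (h g : R[i] -> R[i]) (a b c x y : R) (s z w : R[i]).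

Definition ccat h s := forall e : R, 0 < e -> exists2 d : R, 0 < d &
  forall z, cn (z - s) <= d -> cn (h z - h s) <= e.

(** The form without a quotient, in which [z = s] needs no exception. *)
Definition cdiff h D s := forall e : R, 0 < e -> exists2 d : R, 0 < d &
  forall z, cn (z - s) <= d -> cn (h z - h s - D * (z - s)) <= e * cn (z - s).

Definition rcont (phi : R -> R[i]) :=
  continuous (fun t => complex.Re (phi t)) /\ continuous (fun t => complex.Im (phi t)).

Lemma cdiff_ccat h D s : cdiff h D s -> ccat h s.
Proof.
move=> hd e e0; have [d d0 H] := hd 1 ltr01.
have q0 : 0 < 1 + cn D by rewrite ltr_pwDl ?cn_ge0.
exists (Num.min d (e / (1 + cn D))); first by rewrite lt_min d0 divr_gt0.
move=> z; rewrite le_min => /andP[zd ze].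
have := H z zd; rewrite mul1r => h1.
have -> : h z - h s = (h z - h s - D * (z - s)) + D * (z - s) by ring.
apply: le_trans (cnD _ _) _; rewrite cnM.
apply: le_trans (_ : _ <= (1 + cn D) * (e / (1 + cn D))) _; last by rewrite mulrC divfK // gt_eqF.
apply: le_trans (_ : _ <= (1 + cn D) * cn (z - s)) _; first by rewrite mulrDl mul1r lerD2r.
by rewrite ler_wpM2l // ltW.
Qed.

Lemma cdiff_local h g D s r : 0 < r -> (forall z, cn (z - s) <= r -> h z = g z) ->
  cdiff h D s -> cdiff g D s.
Proof.
move=> r0 hg hd e e0; have [d d0 H] := hd e e0.
exists (Num.min d r); first by rewrite lt_min d0.
move=> z; rewrite le_min => /andP[zd zr]; rewrite -!hg ?subrr ?cn0 ?(ltW r0) //; exact: H.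
Qed.

Lemma cdiff_cst (c : R[i]) s : cdiff (fun _ => c) 0 s.
Proof. by move=> e e0; exists 1 => // z _; rewrite subrr mul0r subrr cn0 mulr_ge0 ?cn_ge0 ?ltW. Qed.

Lemma cdiff_id s : cdiff id 1 s.
Proof. by move=> e e0; exists 1 => // z _; rewrite mul1r subrr cn0 mulr_ge0 ?cn_ge0 ?ltW. Qed.

Lemma cdiffD h g D E s : cdiff h D s -> cdiff g E s ->
  cdiff (fun z => h z + g z) (D + E) s.
Proof.
move=> hh hg e e0; have e20 : 0 < e / 2 by rewrite divr_gt0.
have [d d0 H] := hh _ e20; have [d' d0' H'] := hg _ e20.
exists (Num.min d d'); first by rewrite lt_min d0.
move=> z; rewrite le_min => /andP[zd ze].
have -> : h z + g z - (h s + g s) - (D + E) * (z - s) =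
  (h z - h s - D * (z - s)) + (g z - g s - E * (z - s)) by ring.
apply: le_trans (cnD _ _) _.
rewrite (_ : e * _ = e / 2 * cn (z - s) + e / 2 * cn (z - s)); last by field.
by apply: lerD; [exact: H|exact: H'].
Qed.

Lemma cdiffM h g D E s : cdiff h D s -> cdiff g E s ->
  cdiff (fun z => h z * g z) (D * g s + h s * E) s.
Proof.
move=> hh hg e e0.
pose K := 1 + cn (g s) + cn (h s) + cn D.
have K0 : 0 < K by rewrite /K -!addrA ltr_pwDl ?addr_ge0 ?cn_ge0.
have eK : 0 < e / K / 2 by rewrite !divr_gt0.
have cg := cdiff_ccat hg.
have [d d0 H] := hh _ eK; have [d' d0' H'] := hg _ eK.
have [d2 d20 H2] := cg (Num.min 1 (e / K / 2)) ltac:(by rewrite lt_min ltr01).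
exists (Num.min d (Num.min d' d2)); first by rewrite !lt_min d0 d0'.
move=> z; rewrite !le_min => /and3P[zd ze zf].
have -> : h z * g z - h s * g s - (D * g s + h s * E) * (z - s) =
  (h z - h s - D * (z - s)) * g z + h s * (g z - g s - E * (z - s))
  + D * (z - s) * (g z - g s) by ring.
have gz : cn (g z) <= cn (g s) + 1.
  have -> : g z = g s + (g z - g s) by ring.
  apply: le_trans (cnD _ _) _; rewrite lerD2l.
  by apply: le_trans (H2 z zf) _; rewrite ge_min lexx.
have gz2 : cn (g z - g s) <= e / K / 2 by apply: le_trans (H2 z zf) _; rewrite ge_min lexx orbT.
have hz0 := cn_ge0 (z - s).
apply: le_trans (_ : _ <= e / K / 2 * cn (z - s) * (cn (g s) + 1) +
   cn (h s) * (e / K / 2 * cn (z - s)) + cn D * cn (z - s) * (e / K / 2)) _.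
  apply: le_trans (cnD _ _) _; apply: lerD; last by rewrite !cnM ler_wpM2l ?mulr_ge0 ?cn_ge0.
  apply: le_trans (cnD _ _) _; apply: lerD; first by rewrite cnM ler_pM ?cn_ge0 ?H.
  by rewrite cnM ler_wpM2l ?cn_ge0 ?H'.
have -> : e / K / 2 * cn (z - s) * (cn (g s) + 1) +
   cn (h s) * (e / K / 2 * cn (z - s)) + cn D * cn (z - s) * (e / K / 2)
   = e / 2 * cn (z - s) * (K / K) by rewrite /K; field; rewrite -/K gt_eqF.
rewrite divff ?gt_eqF // mulr1 ler_wpM2r //; lra.
Qed.

Lemma cdiffV w s : s != w -> cdiff (fun z => (z - w)^-1) (- (s - w) ^- 2) s.
Proof.
move=> sw e e0.
have q0 : 0 < cn (s - w) by rewrite cn_gt0 subr_eq0.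
set q := cn (s - w) in q0.
exists (Num.min (q / 2) (e * q ^+ 3 / 2)); first by rewrite lt_min !divr_gt0 // mulr_gt0 // exprn_gt0.
move=> z; rewrite le_min => /andP[z1 z2].
have hz : q / 2 <= cn (z - w).
  have : q <= cn (z - w) + cn (z - s).
    by rewrite /q (_ : s - w = (z - w) - (z - s)); [exact: cnB|ring].
  lra.
have zw : z - w != 0 by rewrite -cn_gt0; apply: lt_le_trans hz; rewrite divr_gt0.
have sw0 : s - w != 0 by rewrite subr_eq0.
have -> : (z - w)^-1 - (s - w)^-1 - - (s - w) ^- 2 * (z - s) =
  (z - s) ^+ 2 * ((s - w) ^+ 2 * (z - w))^-1 by field; rewrite zw sw0.
rewrite cnM cnX cnV cnM cnX -/q expr2 -mulrA mulrC.
apply: ler_wpM2r; first exact: cn_ge0.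
have -> : e = (e * q ^+ 3 / 2) * (q ^+ 2 * (q / 2))^-1 by field; rewrite gt_eqF.
apply: ler_pM; rewrite ?cn_ge0 ?invr_ge0 ?mulr_ge0 ?cn_ge0 ?sqr_ge0 ?(ltW q0) //.
rewrite lef_pV2 ?posrE ?mulr_gt0 ?exprn_gt0 ?divr_gt0 //; last by rewrite cn_gt0.
by rewrite ler_wpM2l ?sqr_ge0.
Qed.

Lemma cdiffX h D s n : cdiff h D s -> exists D', cdiff (fun z => h z ^+ n) D' s.
Proof.
move=> hd; elim: n => [|n [D' IH]].
  by exists 0; move: (cdiff_cst 1 s).
exists (D * h s ^+ n + h s * D').
by apply: (cdiff_local ltr01 _ (cdiffM hd IH)) => z _; rewrite exprS.
Qed.

Definition hline y (t : R) : R[i] := t +i* y.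
Definition vline x (t : R) : R[i] := x +i* t.

Lemma ccat_rcont h (p : R -> R[i]) :
  (forall t u, cn (p t - p u) = `|t - u|) -> (forall t, ccat h (p t)) -> rcont (h \o p).
Proof.
move=> hp hc; split=> t; apply/cvgrPdist_le => e e0; have [d d0 H] := hc t e e0.
  near=> u; rewrite /= distrC -ReN -ReD; apply: le_trans (Re_le_cn _) _; apply: H.
  by rewrite hp; near: u; apply: cvgr_distC_le d0; exact: cvg_id.
near=> u; rewrite /= distrC -ImN -ImD; apply: le_trans (Im_le_cn _) _; apply: H.
by rewrite hp; near: u; apply: cvgr_distC_le d0; exact: cvg_id.
Unshelve. all: by end_near. Qed.

Lemma cn_hline y t u : cn (hline y t - hline y u) = `|t - u|.
Proof. by rewrite /hline /cn /= subrr expr0n addr0 sqrtr_sqr. Qed.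
Lemma cn_vline y t u : cn (vline y t - vline y u) = `|t - u|.
Proof. by rewrite /vline /cn /= subrr expr0n add0r sqrtr_sqr. Qed.

Definition cint a b (phi : R -> R[i]) : R[i] :=
  rint a b (fun t => complex.Re (phi t)) +i* rint a b (fun t => complex.Im (phi t)).

Lemma cint_ext a b phi psi : (forall t, a <= t <= b -> phi t = psi t) ->
  cint a b phi = cint a b psi.
Proof.
by move=> h; rewrite /cint /rint; congr (_ +i* _); apply: eq_Rintegral => t
  /set_mem /=; rewrite in_itv /= => /h ->.
Qed.

Lemma cintB a b phi psi : rcont phi -> rcont psi ->
  cint a b (fun t => phi t - psi t) = cint a b phi - cint a b psi.
Proof.
move=> [h1 h2] [h3 h4]; rewrite /cint; apply: ext_complex; rewrite !(ReD, ImD, ReN, ImN) /=.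
  under eq_fun do rewrite ReD ReN -mulN1r.
  rewrite rintD ?rintZ ?mulN1r // => t; apply: cvgM; [exact: cvg_cst|exact: h3].
under eq_fun do rewrite ImD ImN -mulN1r.
rewrite rintD ?rintZ ?mulN1r // => t; apply: cvgM; [exact: cvg_cst|exact: h4].
Qed.

Lemma rcontZ phi z : rcont phi -> rcont (fun t => z * phi t).
Proof.
move=> [h1 h2]; split=> t.
  under eq_fun do rewrite ReM.
  by apply: cvgB; (apply: cvgM; [exact: cvg_cst|]); [exact: h1|exact: h2].
under eq_fun do rewrite ImM.
by apply: cvgD; (apply: cvgM; [exact: cvg_cst|]); [exact: h2|exact: h1].
Qed.

Lemma cintZ a b phi z : rcont phi -> cint a b (fun t => z * phi t) = z * cint a b phi.
Proof.
move=> [h1 h2]; rewrite /cint; apply: ext_complex; rewrite !(ReM, ImM) /=.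
  under eq_fun do rewrite ReM -mulNr.
  by rewrite rintD ?rintZ ?mulNr // => t; (apply: cvgM; [exact: cvg_cst|]); [exact: h1|exact: h2].
under eq_fun do rewrite ImM.
by rewrite rintD ?rintZ // => t; (apply: cvgM; [exact: cvg_cst|]); [exact: h2|exact: h1].
Qed.

Lemma cint_split a b c phi : rcont phi -> a <= c <= b ->
  cint a b phi = cint a c phi + cint c b phi.
Proof.
by move=> [h1 h2] acb; rewrite /cint (rint_split h1 acb) (rint_split h2 acb).
Qed.

Lemma cint_bound a b phi M : a <= b -> rcont phi ->
  (forall t, a <= t <= b -> cn (phi t) <= M) -> cn (cint a b phi) <= 2 * M * (b - a).
Proof.
move=> ab [h1 h2] h; apply: le_trans (cn_le_ReIm _) _ => /=.
rewrite -mulrA mulr_natl mulr2n lerD //; apply: rint_bound => // t /h.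
  exact: le_trans (Re_le_cn _).
exact: le_trans (Im_le_cn _).
Qed.

(** The integral of [h (z) dz] around the rectangle, counterclockwise: [dz] is [dt] on the
    horizontal sides and [i dt] on the vertical ones. *)
Definition rect h x1 x2 y1 y2 : R[i] :=
  cint x1 x2 (h \o hline y1) - cint x1 x2 (h \o hline y2)
  + 'i%C * (cint y1 y2 (h \o vline x2) - cint y1 y2 (h \o vline x1)).

Lemma rect_splitH h x1 x2 y1 y2 c : (forall s, ccat h s) -> x1 <= c <= x2 ->
  rect h x1 x2 y1 y2 = rect h x1 c y1 y2 + rect h c x2 y1 y2.
Proof.
move=> hc hx; rewrite /rect.
have H y := ccat_rcont (cn_hline y) (fun t => hc (hline y t)).
by rewrite (cint_split (H y1) hx) (cint_split (H y2) hx); ring.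
Qed.

Lemma rect_splitV h x1 x2 y1 y2 c : (forall s, ccat h s) -> y1 <= c <= y2 ->
  rect h x1 x2 y1 y2 = rect h x1 x2 y1 c + rect h x1 x2 c y2.
Proof.
move=> hc hx; rewrite /rect.
have H y := ccat_rcont (cn_vline y) (fun t => hc (vline y t)).
by rewrite (cint_split (H x1) hx) (cint_split (H x2) hx); ring.
Qed.

Lemma rect_bound h x1 x2 y1 y2 M : (forall s, ccat h s) -> x1 <= x2 -> y1 <= y2 ->
  (forall s, x1 <= complex.Re s <= x2 -> y1 <= complex.Im s <= y2 -> cn (h s) <= M) ->
  cn (rect h x1 x2 y1 y2) <= 4 * M * (x2 - x1 + (y2 - y1)).
Proof.
move=> hc hx hy hM.
have H y := ccat_rcont (cn_hline y) (fun t => hc (hline y t)).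
have V x := ccat_rcont (cn_vline x) (fun t => hc (vline x t)).
have b1 : cn (cint x1 x2 (h \o hline y1)) <= 2 * M * (x2 - x1).
  by apply: cint_bound => // t ht; apply: hM => //=; rewrite lexx.
have b2 : cn (cint x1 x2 (h \o hline y2)) <= 2 * M * (x2 - x1).
  by apply: cint_bound => // t ht; apply: hM => //=; rewrite lexx andbT.
have b3 : cn (cint y1 y2 (h \o vline x2)) <= 2 * M * (y2 - y1).
  by apply: cint_bound => // t ht; apply: hM => //=; rewrite lexx andbT.
have b4 : cn (cint y1 y2 (h \o vline x1)) <= 2 * M * (y2 - y1).
  by apply: cint_bound => // t ht; apply: hM => //=; rewrite lexx.
have ci : cn ('i%C : R[i]) = 1 by rewrite /cn /= expr0n add0r expr1n sqrtr1.
rewrite /rect; apply: le_trans (cnD _ _) _; rewrite cnM ci mul1r.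
have := cnB (cint x1 x2 (h \o hline y1)) (cint x1 x2 (h \o hline y2)).
have := cnB (cint y1 y2 (h \o vline x2)) (cint y1 y2 (h \o vline x1)).
rewrite mulrDr; lra.
Qed.

Lemma ccat_affine A B s : ccat (fun z => A + B * z) s.
Proof.
apply: (@cdiff_ccat _ (0 + (0 * s + B * 1))).
by apply: cdiffD; [exact: cdiff_cst|exact: (cdiffM (cdiff_cst B s) (cdiff_id s))].
Qed.

Lemma rect_affine A B x1 x2 y1 y2 : x1 <= x2 -> y1 <= y2 ->
  rect (fun z => A + B * z) x1 x2 y1 y2 = 0.
Proof.
move=> hx hy.
have ci (a b c d p q : R) : a <= b -> rint a b (fun t => p + q * t) = p * (b - a) + q * ((b ^+ 2 - a ^+ 2) / 2).
  move=> ab; rewrite rintD ?rintZ ?rint_cst ?rint_id //.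
  - by move=> t; exact: cvg_id.
  - exact: cst_continuous.
  - by move=> t; apply: cvgM; [exact: cvg_cst|exact: cvg_id].
case: A => a1 a2; case: B => b1 b2.
rewrite /rect /cint.
have E1 y : (fun t => complex.Re (((fun z => a1 +i* a2 + (b1 +i* b2) * z) \o hline y) t)) =
   (fun t => (a1 - b2 * y) + b1 * t).
  by apply/funext => t; rewrite /= ; ring.
have E2 y : (fun t => complex.Im (((fun z => a1 +i* a2 + (b1 +i* b2) * z) \o hline y) t)) =
   (fun t => (a2 + b1 * y) + b2 * t).
  by apply/funext => t; rewrite /= ; ring.
have E3 y : (fun t => complex.Re (((fun z => a1 +i* a2 + (b1 +i* b2) * z) \o vline y) t)) =
   (fun t => (a1 + b1 * y) + (- b2) * t).
  by apply/funext => t; rewrite /= ; ring.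
have E4 y : (fun t => complex.Im (((fun z => a1 +i* a2 + (b1 +i* b2) * z) \o vline y) t)) =
   (fun t => (a2 + b2 * y) + b1 * t).
  by apply/funext => t; rewrite /= ; ring.
rewrite !E1 !E2 !E3 !E4 !ci //.
by apply: ext_complex => /=; field.
Qed.

Lemma rectB h g x1 x2 y1 y2 : (forall s, ccat h s) -> (forall s, ccat g s) ->
  rect (fun z => h z - g z) x1 x2 y1 y2 = rect h x1 x2 y1 y2 - rect g x1 x2 y1 y2.
Proof.
move=> hc gc; rewrite /rect.
have H y := ccat_rcont (cn_hline y) (fun t => hc (hline y t)).
have V x := ccat_rcont (cn_vline x) (fun t => hc (vline x t)).
have H' y := ccat_rcont (cn_hline y) (fun t => gc (hline y t)).
have V' x := ccat_rcont (cn_vline x) (fun t => gc (vline x t)).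
have E y1' := cintB x1 x2 (H y1') (H' y1').
have E' x1' := cintB y1 y2 (V x1') (V' x1').
rewrite /= in E E' *.
rewrite (_ : (fun z => h z - g z) \o hline y1 = fun t => (h \o hline y1) t - (g \o hline y1) t) //.
rewrite (_ : (fun z => h z - g z) \o hline y2 = fun t => (h \o hline y2) t - (g \o hline y2) t) //.
rewrite (_ : (fun z => h z - g z) \o vline x1 = fun t => (h \o vline x1) t - (g \o vline x1) t) //.
rewrite (_ : (fun z => h z - g z) \o vline x2 = fun t => (h \o vline x2) t - (g \o vline x2) t) //.
by rewrite !E !E'; ring.
Qed.

Lemma quadrant_choice h x1 x2 y1 y2 : (forall s, ccat h s) -> x1 <= x2 -> y1 <= y2 ->
  let c := (x1 + x2) / 2 in let d := (y1 + y2) / 2 in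
  exists Q : R * R * R * R, let: (a1, a2, b1, b2) := Q in
    [/\ x1 <= a1 /\ a2 <= x2, y1 <= b1 /\ b2 <= y2, a2 - a1 = (x2 - x1) / 2, b2 - b1 = (y2 - y1) / 2
    & cn (rect h x1 x2 y1 y2) <= 4 * cn (rect h a1 a2 b1 b2)].
Proof.
move=> hc hx hy c d.
have hcc : x1 <= c <= x2 by rewrite /c; lra.
have hdd : y1 <= d <= y2 by rewrite /d; lra.
have E : rect h x1 x2 y1 y2 = (rect h x1 c y1 d + rect h x1 c d y2) + (rect h c x2 y1 d + rect h c x2 d y2).
  by rewrite (rect_splitH _ _ hc hcc) (rect_splitV x1 c hc hdd) (rect_splitV c x2 hc hdd).
have E2 : cn (rect h x1 x2 y1 y2) <= cn (rect h x1 c y1 d) + cn (rect h x1 c d y2) + (cn (rect h c x2 y1 d) + cn (rect h c x2 d y2)).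
  rewrite E; apply: le_trans (cnD _ _) _; apply: lerD; exact: cnD.
have e1 : c - x1 = (x2 - x1) / 2 by rewrite /c; field.
have e2 : x2 - c = (x2 - x1) / 2 by rewrite /c; field.
have e3 : d - y1 = (y2 - y1) / 2 by rewrite /d; field.
have e4 : y2 - d = (y2 - y1) / 2 by rewrite /d; field.
have /andP[c1 c2] := hcc; have /andP[d1 d2] := hdd.
case: (leP (cn (rect h x1 x2 y1 y2)) (4 * cn (rect h x1 c y1 d))) => h1.
  by exists (x1, c, y1, d); split.
case: (leP (cn (rect h x1 x2 y1 y2)) (4 * cn (rect h x1 c d y2))) => h2.
  by exists (x1, c, d, y2); split.
case: (leP (cn (rect h x1 x2 y1 y2)) (4 * cn (rect h c x2 y1 d))) => h3.
  by exists (c, x2, y1, d); split.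
exists (c, x2, d, y2); split => //.
have arith (t u v w z : R) : t <= u + v + (w + z) -> 4 * u < t -> 4 * v < t -> 4 * w < t -> t <= 4 * z.
  by clear; lra.
exact: arith E2 h1 h2 h3.
Qed.

Lemma nested_itv (u v : nat -> R) : (forall n, u n <= u n.+1) -> (forall n, v n.+1 <= v n) ->
  (forall n, u n <= v n) -> exists x, forall n, u n <= x <= v n.
Proof.
move=> hu hv huv.
have mu m n : (m <= n)%N -> u m <= u n.
  by move=> /subnK <-; elim: (n - m)%N => // k IH; rewrite addSn (le_trans IH).
have mv m n : (m <= n)%N -> v n <= v m.
  by move=> /subnK <-; elim: (n - m)%N => // k IH; rewrite addSn (le_trans _ IH).
have huv2 m n : u m <= v n.
  by apply: le_trans (mu _ _ (leq_maxl m n)) _; apply: le_trans (huv _) _; apply: mv; exact: leq_maxr.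
exists (sup (range u)) => n; apply/andP; split.
  by apply: ub_le_sup; [exists (v 0%N) => _ [m _ <-]|exists n].
by apply: ge_sup; [exists (u 0%N), 0%N|move=> _ [m _ <-]].
Qed.

(** Repeated bisection towards a point [p]. There [h] is affine up to [e' |z - p|], affine functions
    integrate to 0, and the error on a rectangle of size [S / 2 ^ n] is of order [e' S ^ 2 / 4 ^ n],
    against the factor [4 ^ n] lost by keeping one quarter each time. *)
Theorem goursat h (D : R[i] -> R[i]) x1 x2 y1 y2 : (forall s, ccat h s) -> x1 <= x2 -> y1 <= y2 ->
  (forall s, x1 <= complex.Re s <= x2 -> y1 <= complex.Im s <= y2 -> cdiff h (D s) s) ->
  rect h x1 x2 y1 y2 = 0.
Proof.
move=> hc hx hy hD.
pose ok (Q : R * R * R * R) := let: (a1, a2, b1, b2) := Q in a1 <= a2 /\ b1 <= b2.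
pose nx (Q Q' : R * R * R * R) := let: (x1, x2, y1, y2) := Q in let: (a1, a2, b1, b2) := Q' in
  [/\ x1 <= a1 /\ a2 <= x2, y1 <= b1 /\ b2 <= y2, a2 - a1 = (x2 - x1) / 2, b2 - b1 = (y2 - y1) / 2
    & cn (rect h x1 x2 y1 y2) <= 4 * cn (rect h a1 a2 b1 b2)].
have ex Q : exists Q', ok Q -> ok Q' /\ nx Q Q'.
  case: Q => [[[p1 p2] q1] q2].
  have [[hp hq]|nok] := pselect (ok (p1, p2, q1, q2)); last by exists (p1, p2, q1, q2).
  have [[[[a1 a2] b1] b2] [H1 H2 H3 H4 H5]] := quadrant_choice hc hp hq.
  exists (a1, a2, b1, b2) => _; split; last by split.
  by split; lra.
have [f hf] := choice ex.
pose Q n := iter n f (x1, x2, y1, y2).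
have okQ n : ok (Q n) by elim: n => [|n IH] //=; have [] := hf _ IH.
have nxQ n : nx (Q n) (Q n.+1) by have [] := hf _ (okQ n).
pose X1 n := (Q n).1.1.1; pose X2 n := (Q n).1.1.2; pose Y1 n := (Q n).1.2; pose Y2 n := (Q n).2.
have hn n : [/\ X1 n <= X1 n.+1 /\ X2 n.+1 <= X2 n, Y1 n <= Y1 n.+1 /\ Y2 n.+1 <= Y2 n,
   X2 n.+1 - X1 n.+1 = (X2 n - X1 n) / 2, Y2 n.+1 - Y1 n.+1 = (Y2 n - Y1 n) / 2
   & cn (rect h (X1 n) (X2 n) (Y1 n) (Y2 n)) <= 4 * cn (rect h (X1 n.+1) (X2 n.+1) (Y1 n.+1) (Y2 n.+1))].
  by have := nxQ n; rewrite /nx /X1 /X2 /Y1 /Y2; case: (Q n) => [[[? ?] ?] ?]; case: (Q n.+1) => [[[? ?] ?] ?].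
have hok n : X1 n <= X2 n /\ Y1 n <= Y2 n.
  by have := okQ n; rewrite /ok /X1 /X2 /Y1 /Y2; case: (Q n) => [[[? ?] ?] ?].
have [px hpx] : exists x, forall n, X1 n <= x <= X2 n.
  by apply: nested_itv => n; [by have [[]] := hn n|by have [[]] := hn n|by have [] := hok n].
have [py hpy] : exists x, forall n, Y1 n <= x <= Y2 n.
  by apply: nested_itv => n; [by have [_ []] := hn n|by have [_ []] := hn n|by have [] := hok n].
pose S := (x2 - x1) + (y2 - y1).
have S0 : 0 <= S by rewrite /S; lra.
have hlen n : (X2 n - X1 n) + (Y2 n - Y1 n) = S / 2 ^+ n.
  elim: n => [|n IH]; first by rewrite expr0 divr1.
  have [_ _ -> -> _] := hn n; rewrite -mulrDl IH exprS; field; exact: expf_neq0.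
have hrect n : cn (rect h x1 x2 y1 y2) <= 4 ^+ n * cn (rect h (X1 n) (X2 n) (Y1 n) (Y2 n)).
  elim: n => [|n IH]; first by rewrite expr0 mul1r.
  apply: le_trans IH _; rewrite exprSr -mulrA ler_wpM2l ?exprn_ge0 //.
  by have [] := hn n.
apply/eqP; rewrite -cn_eq0; apply/eqP/le_anti; rewrite cn_ge0 andbT.
apply/ler_addgt0Pr => e e0; rewrite add0r.
pose p := px +i* py.
have hp : cdiff h (D p) p by apply: hD; [exact: (hpx 0%N)|exact: (hpy 0%N)].
pose e' := e / (4 * S ^+ 2 + 1).
have q0 : 0 < 4 * S ^+ 2 + 1 by rewrite ltr_wpDl // mulr_ge0 // sqr_ge0.
have e'0 : 0 < e' by rewrite divr_gt0.
have [d d0 H] := hp _ e'0.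
have [n hnd] : exists n, S / 2 ^+ n <= d.
  have [n hn'] : exists n : nat, S / d <= n%:R.
    exists (Num.bound (S / d)); apply: ltW; apply: archi_boundP; exact: divr_ge0 S0 (ltW d0).
  exists n; rewrite ler_pdivrMr ?exprn_gt0 // mulrC -ler_pdivrMr //.
  apply: le_trans hn' _; rewrite -natrX ler_nat; exact/ltnW/ltn_expl.
apply: le_trans (hrect n) _.
have [lx ly] := hok n.
pose A := h p - D p * p.
have EA : rect h (X1 n) (X2 n) (Y1 n) (Y2 n) =
   rect (fun z => h z - (A + D p * z)) (X1 n) (X2 n) (Y1 n) (Y2 n).
  rewrite rectB //; last by move=> s; exact: ccat_affine.
  by rewrite rect_affine // subr0.
rewrite EA.
have Bd : cn (rect (fun z => h z - (A + D p * z)) (X1 n) (X2 n) (Y1 n) (Y2 n)) <=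
   4 * (e' * (S / 2 ^+ n)) * (S / 2 ^+ n).
  rewrite -[X in _ <= _ * X]hlen; apply: rect_bound => //.
    move=> s.
    have H1 : forall e, 0 < e -> exists2 d : R, 0 < d & forall z, cn (z - s) <= d ->
       cn (h z - (A + D p * z) - (h s - (A + D p * s))) <= e.
      move=> e1 e10; have e12 : 0 < e1 / 2 by rewrite divr_gt0.
      have [d1 d10 K1] := hc s _ e12; have [d2 d20 K2] := @ccat_affine A (D p) s _ e12.
      exists (Num.min d1 d2); first by rewrite lt_min d10.
      move=> z; rewrite le_min => /andP[/K1 k1 /K2 k2].
      have -> : h z - (A + D p * z) - (h s - (A + D p * s)) = (h z - h s) - (A + D p * z - (A + D p * s)) by ring.
      by apply: le_trans (cnB _ _) _; lra.
    exact: H1.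
  move=> s hs1 hs2.
  have hsp : cn (s - p) <= S / 2 ^+ n.
    apply: le_trans (cn_le_ReIm _) _; rewrite ReD ImD ReN ImN -(hlen n).
    apply: lerD; rewrite /p /= ler_norml; [have := hpx n|have := hpy n]; lra.
  have -> : h s - (A + D p * s) = h s - h p - D p * (s - p) by rewrite /A; ring.
  apply: le_trans (H _ (le_trans hsp hnd)) _.
  by rewrite ler_wpM2l // ltW.
apply: le_trans (_ : _ <= 4 ^+ n * (4 * (e' * (S / 2 ^+ n)) * (S / 2 ^+ n))) _.
  by rewrite ler_wpM2l ?exprn_ge0.
have -> : 4 ^+ n * (4 * (e' * (S / 2 ^+ n)) * (S / 2 ^+ n)) = 4 * S ^+ 2 * e'.
  have e4 : (4 : R) = 2 ^+ 2 by rewrite -natrX.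
  rewrite {1}e4 -exprM mulnC exprM.
  field; exact: expf_neq0.
rewrite /e' mulrC -mulrA ler_piMr ?(ltW e0) // mulrC ler_pdivrMr // mul1r lerDl //.
Qed.

(* The singularity may be cut out, because the integral over the boundary of a small
   square around it is small. *)
Lemma goursat_punctured h (D : R[i] -> R[i]) a b x1 x2 y1 y2 : (forall s, ccat h s) ->
  x1 < a < x2 -> y1 < b < y2 -> (forall s, s != a +i* b -> cdiff h (D s) s) ->
  rect h x1 x2 y1 y2 = 0.
Proof.
move=> hc /andP[hx1 hx2] /andP[hy1 hy2] hD.
apply/eqP; rewrite -cn_eq0; apply/eqP/le_anti; rewrite cn_ge0 andbT.
apply/ler_addgt0Pr => e e0; rewrite add0r.
have [d d0 H] := hc (a +i* b) 1 ltr01.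
pose M := cn (h (a +i* b)) + 1.
have M0 : 0 < M by rewrite ltr_wpDl ?cn_ge0.
pose r := Num.min (Num.min (a - x1) (x2 - a)) (Num.min (Num.min (b - y1) (y2 - b)) (Num.min (d / 2) (e / (16 * M)))).
have r0 : 0 < r by rewrite !lt_min !subr_gt0 hx1 hx2 hy1 hy2 !divr_gt0 // mulr_gt0.
have : r <= r by []. rewrite {2}/r !le_min => /and3P[/andP[r1 r2] /andP[r3 r4] /andP[r5 r6]].
clearbody r.
have hX1 : x1 <= a - r <= x2 by apply/andP; split; lra.
have hX2 : a - r <= a + r <= x2 by apply/andP; split; lra.
have hY1 : y1 <= b - r <= y2 by apply/andP; split; lra.
have hY2 : b - r <= b + r <= y2 by apply/andP; split; lra.
have /andP[? _] := hX1; have /andP[? ?] := hX2.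
have /andP[? _] := hY1; have /andP[? ?] := hY2.
rewrite (rect_splitH _ _ hc hX1) (rect_splitH _ _ hc hX2).
rewrite (rect_splitV (a - r) (a + r) hc hY1) (rect_splitV (a - r) (a + r) hc hY2).
have Z u1 u2 v1 v2 : u1 <= u2 -> v1 <= v2 ->
   [|| u2 < a, a < u1, v2 < b | b < v1] -> rect h u1 u2 v1 v2 = 0.
  move=> hu hv hn; apply: (@goursat h D) => // s hs1 hs2; apply: hD.
  apply/eqP => es; move: hn hs1 hs2; rewrite es /= !ltNge => hn /andP[h1 h2] /andP[h3 h4].
  by rewrite h1 h2 h3 h4 in hn.
have y12 : y1 <= y2 by apply: ltW; apply: lt_trans hy2.
have -> : rect h x1 (a - r) y1 y2 = 0 by apply: Z => //; rewrite gtrBl r0.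
have -> : rect h (a + r) x2 y1 y2 = 0 by apply: Z => //; rewrite ltrDl r0 orbT.
have -> : rect h (a - r) (a + r) y1 (b - r) = 0 by apply: Z => //; rewrite [b - r < b]gtrBl r0 !orbT.
have -> : rect h (a - r) (a + r) (b + r) y2 = 0 by apply: Z => //; rewrite [b < b + r]ltrDl r0 !orbT.
rewrite !add0r !addr0.
apply: le_trans (_ : 4 * M * (a + r - (a - r) + (b + r - (b - r))) <= _).
  apply: rect_bound => // s hs1 hs2.
  have -> : h s = h (a +i* b) + (h s - h (a +i* b)) by ring.
  apply: le_trans (cnD _ _) _; rewrite lerD2l; apply: H.
  apply: le_trans (cn_le_ReIm _) _; rewrite ReD ImD ReN ImN /=.
  have : `|complex.Re s - a| <= r by rewrite ler_norml; lra.
  have : `|complex.Im s - b| <= r by rewrite ler_norml; lra.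
  lra.
have -> : 4 * M * (a + r - (a - r) + (b + r - (b - r))) = r * (16 * M) by ring.
by rewrite -ler_pdivlMr ?mulr_gt0.
Qed.

Lemma ccat_quot g D w s : (forall s, cdiff g (D s) s) ->
  ccat (fun z => if z == w then D w else (g z - g w) / (z - w)) s.
Proof.
move=> hD; have [->|sw] := eqVneq s w.
  move=> e e0; have [d d0 H] := hD w e e0; exists d => // z zd.
  rewrite eqxx; case: eqP => [_|/eqP zw]; first by rewrite subrr cn0 ltW.
  have zw0 : z - w != 0 by rewrite subr_eq0.
  have -> : (g z - g w) / (z - w) - D w = (g z - g w - D w * (z - w)) / (z - w) by field.
  by rewrite cnM cnV ler_pdivrMr ?cn_gt0 // H.
have q0 : 0 < cn (s - w) / 2 by rewrite divr_gt0 // cn_gt0 subr_eq0.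
apply: (@cdiff_ccat _ _ _).
apply: (@cdiff_local (fun z => (g z - g w) * (z - w)^-1) _ _ s (cn (s - w) / 2) q0).
  move=> z hz; case: eqP => // zw; move: hz; rewrite zw cnBC => hz; exfalso; lra.
apply: cdiffM; last exact: cdiffV.
by apply: cdiffD; [exact: hD|exact: cdiff_cst].
Qed.

(** The constant depends only on the rectangle. [goursat_punctured], applied to the difference
    quotient of [g] at [w], equates [g w] times the integral of [1 / (z - w)] with the integral of
    [g z / (z - w)]; it remains to bound the modulus of the former integral from below by some
    [c > 0]. *)
Theorem cauchy_bound a b x1 x2 y1 y2 : x1 < a < x2 -> y1 < b < y2 ->
  exists2 C : R, 0 < C & forall g (D : R[i] -> R[i]) M, (forall s, cdiff g (D s) s) ->
   (forall t, x1 <= t <= x2 -> cn (g (t +i* y1)) <= M /\ cn (g (t +i* y2)) <= M) ->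
   (forall t, y1 <= t <= y2 -> cn (g (x1 +i* t)) <= M /\ cn (g (x2 +i* t)) <= M) ->
   cn (g (a +i* b)) <= C * M.
Proof.
move=> /andP[hx1 hx2] /andP[hy1 hy2].
pose w := a +i* b; pose k z := (z - w)^-1.
have kh y : y != b -> rcont (k \o hline y).
  move=> yb; apply: ccat_rcont; first exact: cn_hline.
  move=> t; apply: cdiff_ccat; apply: cdiffV.
  by apply/negP => /eqP [] _ /eqP; apply/negP.
have kv x : x != a -> rcont (k \o vline x).
  move=> yb; apply: ccat_rcont; first exact: cn_vline.
  move=> t; apply: cdiff_ccat; apply: cdiffV.
  by apply/negP => /eqP [] /eqP; rewrite (negbTE yb).
have Ny1 : y1 != b by rewrite lt_eqF.
have Ny2 : y2 != b by rewrite gt_eqF.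
have Nx1 : x1 != a by rewrite lt_eqF.
have Nx2 : x2 != a by rewrite gt_eqF.
have kE (p q : R) : p +i* q != 0 -> (p +i* q)^-1 = p / (p ^+ 2 + q ^+ 2) +i* (- q / (p ^+ 2 + q ^+ 2)).
  move=> pq.
  have n0 : p ^+ 2 + q ^+ 2 != 0.
    have -> : p ^+ 2 + q ^+ 2 = cn (p +i* q) ^+ 2 by rewrite cn_sqr.
    by rewrite sqrf_eq0 cn_eq0.
  apply: (mulfI pq); rewrite mulfV //.
  apply: ext_complex => /=; by field.
pose S := (x2 - x1) ^+ 2 + (y2 - y1) ^+ 2.
have S0 : 0 < S by rewrite /S addr_gt0 // exprn_gt0 // subr_gt0 (lt_trans hx1, lt_trans hy1).
have Imk (t y : R) : y != b -> complex.Im (k (t +i* y)) = (b - y) / ((t - a) ^+ 2 + (y - b) ^+ 2).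
  move=> yb; rewrite /k /w (_ : t +i* y - a +i* b = (t - a) +i* (y - b)) // kE /= ?opprB //.
  by apply/negP => /eqP [] _ /eqP; rewrite subr_eq0 (negbTE yb).
have Rek (t x : R) : x != a -> complex.Re (k (x +i* t)) = (x - a) / ((x - a) ^+ 2 + (t - b) ^+ 2).
  move=> yb; rewrite /k /w (_ : x +i* t - a +i* b = (x - a) +i* (t - b)) // kE //.
pose c := (b - y1) / S * (x2 - x1).
have c0 : 0 < c by rewrite /c !mulr_gt0 ?invr_gt0 // subr_gt0 // (lt_trans hx1).
have sq0 (p q : R) : 0 <= (p ^+ 2 + q ^+ 2)^-1 by rewrite invr_ge0 addr_ge0 ?sqr_ge0.
(* All four sides contribute to the imaginary part with the same sign, and [c] is a lower bound for
   the share of the bottom side, where the squared distance from [w] is at most [S]. *)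
have Ik : c <= cn (rect k x1 x2 y1 y2).
  apply: le_trans (Im_le_cn _); apply: le_trans (ler_norm _).
  rewrite /rect !(ImD, ImM, ImN, ReD, ReN) /= mul0r add0r mul1r.
  have I1 : c <= rint x1 x2 (fun t => complex.Im (k (hline y1 t))).
    rewrite /c -rint_cst ?(ltW (lt_trans hx1 hx2)) //.
    apply: rint_le; [exact: cst_continuous|by have [] := kh y1 Ny1|].
    move=> x /andP[ht1 ht2]; rewrite Imk //; apply: ler_wpM2l; first by rewrite subr_ge0 ltW.
    rewrite lef_pV2 ?posrE //; last by rewrite ltr_wpDl ?sqr_ge0 // exprn_even_gt0 //= subr_eq0.
    by apply: lerD; rewrite -subr_ge0 subr_sqr mulr_ge0 //; lra.
  have I2 : rint x1 x2 (fun t => complex.Im (k (hline y2 t))) <= 0.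
    rewrite -[leRHS](mul0r (x2 - x1)) -rint_cst ?(ltW (lt_trans hx1 hx2)) //.
    apply: rint_le; [by have [] := kh y2 Ny2|exact: cst_continuous|].
    move=> x hx; rewrite Imk // mulr_le0_ge0 // subr_le0 ltW //.
  have I3 : 0 <= rint y1 y2 (fun t => complex.Re (k (vline x2 t))).
    rewrite -[leLHS](mul0r (y2 - y1)) -rint_cst ?(ltW (lt_trans hy1 hy2)) //.
    apply: rint_le; [exact: cst_continuous|by have [] := kv x2 Nx2|].
    move=> x hx; rewrite Rek // mulr_ge0 // subr_ge0 ltW //.
  have I4 : rint y1 y2 (fun t => complex.Re (k (vline x1 t))) <= 0.
    rewrite -[leRHS](mul0r (y2 - y1)) -rint_cst ?(ltW (lt_trans hy1 hy2)) //.
    apply: rint_le; [by have [] := kv x1 Nx1|exact: cst_continuous|].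
    move=> x hx; rewrite Rek // mulr_le0_ge0 // subr_le0 ltW //.
  move: I1 I2 I3 I4; rewrite /=.
  move: (rint _ _ _) (rint _ _ _) (rint _ _ _) (rint _ _ _) => i1 i2 i3 i4; clear; lra.
pose dl := Num.min (Num.min (a - x1) (x2 - a)) (Num.min (b - y1) (y2 - b)).
have dl0 : 0 < dl by rewrite !lt_min !subr_gt0 hx1 hx2 hy1.
have : dl <= dl by []. rewrite {2}/dl !le_min => /andP[/andP[dl1 dl2] /andP[dl3 dl4]].
have ci : cn ('i%C : R[i]) = 1 by rewrite /cn /= expr0n add0r expr1n sqrtr1.
exists (4 * (x2 - x1 + (y2 - y1)) / dl / c).
  rewrite !divr_gt0 // mulr_gt0 // addr_gt0 // subr_gt0 ?(lt_trans hx1) ?(lt_trans hy1) //.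
move=> g D M hD hM1 hM2.
pose h z := if z == w then D w else (g z - g w) / (z - w).
have hc s : ccat h s by exact: ccat_quot.
have I0 : rect h x1 x2 y1 y2 = 0.
  apply: (@goursat_punctured h (fun s => (D s + 0) * (s - w)^-1 + (g s - g w) * (- (s - w) ^- 2)) a b) => //.
  - by rewrite hx1.
  - by rewrite hy1.
  - move=> s sw.
    have q0 : 0 < cn (s - w) / 2 by rewrite divr_gt0 // cn_gt0 subr_eq0.
    apply: (@cdiff_local (fun z => (g z - g w) * (z - w)^-1) _ _ s (cn (s - w) / 2) q0).
      move=> z hz; rewrite /h; case: eqP => // zw; move: hz; rewrite zw cnBC => hz; exfalso; lra.
    apply: cdiffM; last exact: cdiffV.
    by apply: cdiffD; [exact: hD|exact: cdiff_cst].
have gh y : y != b -> rcont (fun t => g (hline y t) * k (hline y t)).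
  move=> yb; apply: (@ccat_rcont (fun z => g z * k z) (hline y)); first exact: cn_hline.
  move=> t; apply: cdiff_ccat; apply: cdiffM; first exact: hD.
  by apply: cdiffV; apply/negP => /eqP [] _ /eqP; apply/negP.
have gv x : x != a -> rcont (fun t => g (vline x t) * k (vline x t)).
  move=> yb; apply: (@ccat_rcont (fun z => g z * k z) (vline x)); first exact: cn_vline.
  move=> t; apply: cdiff_ccat; apply: cdiffM; first exact: hD.
  by apply: cdiffV; apply/negP => /eqP [] /eqP; rewrite (negbTE yb).
have ch y : y != b -> cint x1 x2 (h \o hline y) =
   cint x1 x2 (fun t => g (hline y t) * k (hline y t)) - g w * cint x1 x2 (k \o hline y).
  move=> yb; rewrite -(cintZ _ _ _ (kh _ yb)) -(cintB _ _ (gh _ yb) (rcontZ _ (kh _ yb))).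
  apply: cint_ext => t _; rewrite /h /=; case: eqP => [[] _ yb'|_].
    by rewrite yb' eqxx in yb.
  by rewrite mulrBl.
have cv x : x != a -> cint y1 y2 (h \o vline x) =
   cint y1 y2 (fun t => g (vline x t) * k (vline x t)) - g w * cint y1 y2 (k \o vline x).
  move=> yb; rewrite -(cintZ _ _ _ (kv _ yb)) -(cintB _ _ (gv _ yb) (rcontZ _ (kv _ yb))).
  apply: cint_ext => t _; rewrite /h /=; case: eqP => [[] yb' _|_].
    by rewrite yb' eqxx in yb.
  by rewrite mulrBl.
have E : g w * rect k x1 x2 y1 y2 =
   cint x1 x2 (fun t => g (hline y1 t) * k (hline y1 t)) - cint x1 x2 (fun t => g (hline y2 t) * k (hline y2 t))
   + 'i%C * (cint y1 y2 (fun t => g (vline x2 t) * k (vline x2 t)) - cint y1 y2 (fun t => g (vline x1 t) * k (vline x1 t))).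
  move: I0; rewrite {1}/rect (ch _ Ny1) (ch _ Ny2) (cv _ Nx1) (cv _ Nx2) => I0.
  apply/esym/eqP; rewrite -subr_eq0; apply/eqP; rewrite -[RHS]I0 /rect; ring.
have kb s : dl <= `|complex.Re (s - w)| \/ dl <= `|complex.Im (s - w)| -> cn (k s) <= dl^-1.
  move=> hs; rewrite /k cnV lef_pV2 ?posrE //.
    by case: hs => hs; apply: le_trans hs _; [exact: Re_le_cn|exact: Im_le_cn].
  case: hs => hs; apply: lt_le_trans dl0 (le_trans hs _); [exact: Re_le_cn|exact: Im_le_cn].
have M0 : 0 <= M by have [] := hM1 x1 ltac:(by rewrite lexx ltW // (lt_trans hx1)); move=> q _; apply: le_trans q; exact: cn_ge0.
have lx : x1 <= x2 by rewrite ltW // (lt_trans hx1).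
have ly : y1 <= y2 by rewrite ltW // (lt_trans hy1).
have bd (u v : R) (phi : R -> R[i]) : u <= v -> rcont phi -> (forall t, u <= t <= v -> cn (phi t) <= M / dl) ->
   cn (cint u v phi) <= 2 * (M / dl) * (v - u) by move=> *; exact: cint_bound.
have B1 := bd _ _ _ lx (gh _ Ny1) (fun t ht => ltac:(rewrite cnM; apply: ler_pM; rewrite ?cn_ge0 //;
   [by have [] := hM1 t ht | apply: kb; right; rewrite /= ler_normr; apply/orP; right; lra])).
have B2 := bd _ _ _ lx (gh _ Ny2) (fun t ht => ltac:(rewrite cnM; apply: ler_pM; rewrite ?cn_ge0 //;
   [by have [] := hM1 t ht | apply: kb; right; rewrite /= ler_normr; apply/orP; left; lra])).
have B3 := bd _ _ _ ly (gv _ Nx1) (fun t ht => ltac:(rewrite cnM; apply: ler_pM; rewrite ?cn_ge0 //;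
   [by have [] := hM2 t ht | apply: kb; left; rewrite /= ler_normr; apply/orP; right; lra])).
have B4 := bd _ _ _ ly (gv _ Nx2) (fun t ht => ltac:(rewrite cnM; apply: ler_pM; rewrite ?cn_ge0 //;
   [by have [] := hM2 t ht | apply: kb; left; rewrite /= ler_normr; apply/orP; left; lra])).
have E2 : cn (g w) * cn (rect k x1 x2 y1 y2) <= 4 * (x2 - x1 + (y2 - y1)) * (M / dl).
  rewrite -cnM E; apply: le_trans (cnD _ _) _; rewrite cnM ci mul1r.
  apply: le_trans (lerD (cnB _ _) (cnB _ _)) _.
  move: B1 B2 B3 B4; do 4 move: (cn (cint _ _ _)) => ?.
  by move: (M / dl) => q; clear; move=> *; nra.
have -> : 4 * (x2 - x1 + (y2 - y1)) / dl / c * M = 4 * (x2 - x1 + (y2 - y1)) * (M / dl) / c.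
  by field; rewrite ?gt_eqF.
rewrite ler_pdivlMr //; apply: le_trans E2; rewrite ler_wpM2l ?cn_ge0 //.
Qed.

End Goursat.

(** * Poisson summation for Gaussians *)

Section RealBounds.
Variable R : realType.
Implicit Types x y : R.

Lemma ge0_of_deriv (f f' : R -> R) : f 0 = 0 -> (forall x, is_derive x 1 f (f' x)) ->
  (forall x, 0 <= x -> 0 <= f' x) -> forall x, 0 <= x -> 0 <= f x.
Proof.
move=> f0 hd hf x; rewrite le_eqVlt => /predU1P[<-|x0]; first by rewrite f0.
have [c hc E] := @MVT _ f f' 0 x x0 (fun y _ => hd y)
  (derivable_within_continuous (fun y _ => @ex_derive _ _ _ _ _ _ _ (hd y))).
move: hc E; rewrite in_itv /= f0 !subr0 => /andP[c0 _] ->.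
by apply: mulr_ge0; [apply: hf; exact: ltW|exact: ltW].
Qed.

Lemma sin_le x : 0 <= x -> sin x <= x.
Proof.
move=> x0; rewrite -subr_ge0.
have h0 : (0 : R) - sin 0 = 0 by rewrite sin0 subr0.
have h1 (y : R) : is_derive y 1 (fun x : R => x - sin x) (1 - cos y) by apply: is_derive_eq.
have h2 (y : R) : 0 <= y -> 0 <= 1 - cos y by rewrite subr_ge0 cos_le1.
exact: (ge0_of_deriv h0 h1 h2 x0).
Qed.

Lemma cos_ge x : 0 <= x -> 1 - x ^+ 2 / 2 <= cos x.
Proof.
move=> x0; rewrite -subr_ge0.
apply: (@ge0_of_deriv (fun x => cos x - (1 - x ^+ 2 / 2)) (fun x => x - sin x)) => //.
- by rewrite cos0; field.
- move=> y; have h : is_derive y 1 (fun x : R => x * x) (y + y).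
    by apply: is_derive_eq; rewrite /GRing.scale /= !mulr1.
  rewrite (_ : (fun _ => _) = (fun x => cos x - (1 - 2^-1 * (x * x)))); last first.
    by apply/funext => z; ring.
  by apply: is_derive_eq; rewrite /GRing.scale /=; field.
- by move=> y y0; rewrite subr_ge0 sin_le.
Qed.

Lemma sin_ge x : 0 <= x -> x - x ^+ 3 / 6 <= sin x.
Proof.
move=> x0; rewrite -subr_ge0.
apply: (@ge0_of_deriv (fun x => sin x - (x - x ^+ 3 / 6)) (fun x => cos x - (1 - x ^+ 2 / 2))) => //.
- by rewrite sin0; field.
- move=> y; have h : is_derive y 1 (fun x : R => x * x) (y + y).
    by apply: is_derive_eq; rewrite /GRing.scale /= !mulr1.
  rewrite (_ : (fun _ => _) = (fun x => sin x - (x - 6^-1 * (x * (x * x))))); last first.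
    by apply/funext => z; ring.
  by apply: is_derive_eq; rewrite /GRing.scale /=; field.
- by move=> y y0; rewrite subr_ge0 cos_ge.
Qed.

(** The range exceeds [pi / 2], which leaves room in [cosc_dom] for a fixed shift of the argument;
    for [0 <= x <= 2] the cubic bound gives [sin x >= x (1 - 4 / 6)]. *)
Lemma sin2_ge x : `|x| <= 2 -> x ^+ 2 / 9 <= sin x ^+ 2.
Proof.
have H y : 0 <= y <= 2 -> y ^+ 2 / 9 <= sin y ^+ 2.
  move=> /andP[y0 y2].
  have h := sin_ge y0.
  have h2 : y ^+ 2 <= 4 by nra.
  have h1 : y / 3 <= sin y.
    apply: le_trans h.
    have -> : y - y ^+ 3 / 6 = y * (1 - y ^+ 2 / 6) by ring.
    by rewrite ler_wpM2l //; lra.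
  have -> : y ^+ 2 / 9 = (y / 3) ^+ 2 by field.
  by rewrite lerXn2r ?nnegrE // ?divr_ge0 // (le_trans _ h1) // divr_ge0.
move=> hx; have [x0|x0] := lerP 0 x; first by apply: H; rewrite ger0_norm in hx; rewrite // x0.
rewrite -sqrrN -[in leRHS]sqrrN -sinN; apply: H.
by rewrite ltr0_norm // in hx; rewrite hx andbT oppr_ge0 ltW.
Qed.

Lemma sqr_le_expR x : 0 <= x -> (1 + x) ^+ 2 <= expR (2 * x).
Proof.
move=> x0; rewrite mulr_natl mulr2n expRD -expr2 lerXn2r ?nnegrE ?expR_ge0 ?addr_ge0 //.
exact: expR_ge1Dx.
Qed.

Lemma wi_ge (j : int) : (1 + `|j|%N%:R) ^- 2 <= wi R j.
Proof.
rewrite /wi /wt nat1r; set x : R := _.+1%:R.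
have x1 : 1 <= x by rewrite /x ler1n.
have x0 : 0 <= x by apply: le_trans x1.
have q1 : qroot x <= 1.
  have := @qroot_le R 1 x ltr01 x1; by rewrite /qroot !sqrtr1 invr1.
rewrite -exprVn -qroot4 // -exprM.
by rewrite ler_wiXn2l ?qroot_ge0.
Qed.

(** The weight is at least [(1 + x) ^ (-2) >= exp (- 2 x)], so [b + 2] replaces [b], and the
    constant is the maximum of the resulting Gaussian. *)
Lemma gauss_wi (a b : R) : 0 < a -> exists2 C, 0 < C &
  forall j : int, expR (- a * `|j|%N%:R ^+ 2 + b * `|j|%N%:R) <= C * wi R j.
Proof.
move=> a0; exists (expR ((b + 2) ^+ 2 / (4 * a))) => [|j]; first exact: expR_gt0.
set x : R := `|j|%N%:R; have x0 : 0 <= x by rewrite ler0n.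
have := wi_ge j; rewrite -/x => hw.
apply: le_trans (_ : expR ((b + 2) ^+ 2 / (4 * a)) * (1 + x) ^- 2 <= _); last by rewrite ler_wpM2l ?expR_ge0.
rewrite ler_pdivlMr ?exprn_gt0 ?ltr_pwDl //.
apply: le_trans (_ : expR (- a * x ^+ 2 + b * x) * expR (2 * x) <= _).
  by rewrite ler_wpM2l ?expR_ge0 ?sqr_le_expR.
rewrite -expRD ler_expR -subr_ge0.
have -> : (b + 2) ^+ 2 / (4 * a) - (- a * x ^+ 2 + b * x + 2 * x) = a * (x - (b + 2) / (2 * a)) ^+ 2.
  by field; rewrite gt_eqF.
by rewrite mulr_ge0 ?sqr_ge0 // ltW.
Qed.

End RealBounds.

(** * Characters of a finite cyclic group *)

Section Circle.
Variable R : realType.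
Implicit Types (x y : R) (z w : R[i]).

Definition cis x : R[i] := cexp (0 +i* x).

Lemma cisD x y : cis (x + y) = cis x * cis y.
Proof. by rewrite /cis -cexpD; congr cexp; apply: ext_complex; rewrite /= ?addr0. Qed.
Lemma cis0 : cis 0 = 1. Proof. exact: cexp0. Qed.
Lemma cisMn x n : cis (x *+ n) = cis x ^+ n.
Proof. by elim: n => [|n IH]; rewrite ?mulr0n ?cis0 ?expr0 // mulrS exprS cisD IH. Qed.
Lemma cn_cis x : cn (cis x) = 1.
Proof. by rewrite /cis cn_cexp /= expR0. Qed.
Lemma cis_2pi : cis (2 * pi) = 1.
Proof.
rewrite /cis /cexp /= expR0 mul1r mulr_natl.
by rewrite cos2pi sin2pi.
Qed.
Lemma cis_int (k : int) : cis (2 * pi * k%:~R) = 1.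
Proof.
have hn (n : nat) : cis (2 * pi * n%:R) = 1 by rewrite mulr_natr cisMn cis_2pi expr1n.
case: k => n; first exact: hn.
have E : cis (2 * pi * (Negz n)%:~R) * cis (2 * pi * n.+1%:R) = 1.
  by rewrite -cisD -mulrDr NegzE mulrNz addNr mulr0 cis0.
by rewrite hn mulr1 in E.
Qed.

(** After reduction of [n] modulo [r], half of the angle lies in [[0, pi)], where [cos (2 x) = 1]
    forces [sin x = 0]. *)
Lemma cis_frac_eq1 (n : int) (r : nat) : (0 < r)%N -> cis (2 * pi * (n%:~R / r%:R)) = 1 ->
  (r%:Z %| n)%Z.
Proof.
move=> r0 h.
have r0' : (r%:R : R) != 0 by rewrite pnatr_eq0 -lt0n.
pose k := (n %/ r%:Z)%Z; pose d := (n %% r%:Z)%Z.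
have en : n = k * r%:Z + d by exact: divz_eq.
have d0 : 0 <= d by apply: modz_ge0; rewrite -lt0n.
have dr : d < r%:Z by apply: ltz_pmod.
have h2 : cis (2 * pi * (d%:~R / r%:R)) = 1.
  have E : n%:~R / r%:R = k%:~R + d%:~R / r%:R :> R.
    by rewrite {1}en intrD intrM -[(Posz r)%:~R]pmulrn; field.
  by move: h; rewrite E mulrDr cisD cis_int mul1r.
apply/dvdz_mod0P; rewrite -/d; have [//|dn0] := eqVneq d 0.
exfalso.
pose x : R := pi * (d%:~R / r%:R).
have x0 : 0 < x by rewrite mulr_gt0 ?pi_gt0 // divr_gt0 ?ltr0n // ltr0z lt_neqAle eq_sym dn0.
have xpi : x < pi.
  rewrite -[ltRHS]mulr1 ltr_pM2l ?pi_gt0 // ltr_pdivrMr ?ltr0n // mul1r.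
  by rewrite -[r%:R]/((r%:Z)%:~R) ltr_int.
have sx : 0 < sin x by apply: sin_gt0_pi; rewrite x0.
have E : sin (x *+ 2) = 0 /\ cos (x *+ 2) = 1.
  move: h2; rewrite -mulrA -/x mulr_natl /cis /cexp /= expR0 mul1r => /eqP.
  by rewrite eq_complex /= => /andP[/eqP -> /eqP ->].
have [_] := E; rewrite cosD -!expr2 => e1.
have e2 := cos2Dsin2 x.
have : sin x ^+ 2 = 0 by lra.
by move/eqP; rewrite sqrf_eq0 gt_eqF.
Qed.

Lemma sum_cis (n : int) (q : nat) :
  \sum_(i < (2 * q).+1) cis (2 * pi * ((n * (i%:Z - q%:Z))%:~R / (2 * q).+1%:R)) =
  if ((2 * q).+1%:Z %| n)%Z then (2 * q).+1%:R else 0.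
Proof.
set r := (2 * q).+1.
have r0' : (r%:R : R) != 0 by rewrite pnatr_eq0.
case: ifPn => hr.
  case/dvdzP: hr => k ->.
  rewrite (eq_bigr (fun=> 1)); first by rewrite sumr_const card_ord.
  move=> i _; rewrite -[RHS](cis_int (k * (i%:Z - q%:Z))); congr cis.
  by rewrite !intrM -[(Posz r)%:~R]pmulrn; congr (_ * _); field.
pose om := cis (2 * pi * (n%:~R / r%:R)).
have om1 : om != 1 by apply: contra hr => /eqP h; apply: cis_frac_eq1.
have omr : om ^+ r = 1.
  rewrite /om -cisMn -mulr_natr -[RHS](cis_int n); congr cis; by field.
have E : \sum_(i < r) om ^+ i = 0.
  apply/eqP; have : (om - 1) * \sum_(i < r) om ^+ i = 0.
    have := subrXX om 1 r; rewrite omr expr1n subrr => /esym h0.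
    rewrite -[RHS]h0; congr (_ * _).
    rewrite (reindex_inj rev_ord_inj) /=; apply: eq_bigr => i _.
    by rewrite expr1n mulr1.
  by move/eqP; rewrite mulf_eq0 subr_eq0 (negbTE om1).
transitivity (cis (2 * pi * (- (n * q%:Z)%:~R / r%:R)) * \sum_(i < r) om ^+ i); last by rewrite E mulr0.
rewrite mulr_sumr.
apply: eq_bigr => i _; rewrite /om -cisMn -cisD; congr cis.
rewrite -[_ *+ i]mulr_natr !(intrM, intrB) -[(Posz i)%:~R]/(i%:R) -[(Posz q)%:~R]/(q%:R).
by move: (r%:R : R) r0' => p p0; field.
Qed.

End Circle.

(** * Poisson summation for binomial coefficients *)

Section Polya.
Variable R : realType.
Implicit Types (z u v : R[i]) (m q r i : nat).

(** The complex hyperbolic cosine; its even powers generate the binomial distribution. *)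
Definition cosc z : R[i] := (cexp z + cexp (- z)) / 2.

Lemma cosc_binomial z m :
  (2 * cosc z) ^+ (2 * m) = \sum_(i < (2 * m).+1) ('C(2 * m, i))%:R * cexp ((i%:Z - m%:Z)%:~R * (2 * z)).
Proof.
have -> : 2 * cosc z = cexp (- z) + cexp z by rewrite /cosc addrC; field.
rewrite exprDn; apply: eq_bigr => i _; rewrite -mulr_natl; congr (_ * _).
rewrite -!cexpMn -cexpD; congr cexp.
have hi : (i <= 2 * m)%N by rewrite -ltnS.
rewrite -[z *+ i]mulr_natr -[_ *+ (2 * m - i)]mulr_natr natrB // intrB natrM.
rewrite -[(i%:Z)%:~R]/(i%:R) -[(m%:Z)%:~R]/(m%:R); ring.
Qed.

Definition cint_range (m : nat) : seq int := [seq (i%:Z - m%:Z) | i <- iota 0 (2 * m).+1].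

Lemma cint_range_uniq m : uniq (cint_range m).
Proof. by rewrite map_inj_uniq ?iota_uniq // => a b /eqP; rewrite subr_eq subrK => /eqP []. Qed.

Lemma mem_cint_range m (j : int) : (j \in cint_range m) = (`|j| <= m)%N.
Proof.
apply/mapP/idP => [[k]|h].
  by rewrite mem_iota add0n => /andP[_ h] ->; lia.
exists (absz (j + m%:Z)); first by rewrite mem_iota; lia.
lia.
Qed.

Lemma sum_cint_range m (f : int -> R[i]) :
  \sum_(j <- cint_range m) f j = \sum_(i < (2 * m).+1) f (i%:Z - m%:Z).
Proof.
by rewrite big_map -[iota _ _]/(index_iota 0 (2 * m).+1) big_mkord.
Qed.

(** A discrete Gaussian, close to [exp (- j ^ 2 / m)] and normalized to 1 at the center. *)
Definition binr m (j : int) : R :=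
  if (`|j| <= m)%N then ('C(2 * m, m + `|j|))%:R / ('C(2 * m, m))%:R else 0.

Lemma binr_shift m i : (i < (2 * m).+1)%N ->
  binr m (i%:Z - m%:Z) = ('C(2 * m, i))%:R / ('C(2 * m, m))%:R.
Proof.
move=> hi; rewrite /binr ifT; last by lia.
congr (_%:R / _).
have [h|h] := leqP m i.
  by rewrite (_ : (m + `|i%:Z - m%:Z|)%N = i) //; lia.
by rewrite -(bin_sub (n := 2 * m) (m := i)); [congr 'C(_, _); lia|lia].
Qed.

(* Poisson summation on a finite cyclic group, applied to the binomial distribution. *)
Lemma finite_poisson u m q :
  \sum_(n <- cint_range m) (if ((2 * q).+1%:Z %| n)%Z then
     (binr m n)%:C * cexp (n%:~R * (2 * pi%:C * u / (2 * q).+1%:R)) else 0) =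
  (4 ^+ m / ((2 * q).+1%:R * ('C(2 * m, m))%:R))%:C *
  \sum_(l <- cint_range q) cosc (pi%:C * (u + 'i%C * l%:~R) / (2 * q).+1%:R) ^+ (2 * m).
Proof.
set r := (2 * q).+1.
have r0' : (r%:R : R[i]) != 0 by rewrite pnatr_eq0.
have b0 : (('C(2 * m, m))%:R : R[i]) != 0 by rewrite pnatr_eq0 -lt0n bin_gt0; lia.
have E1 (l : int) : cosc (pi%:C * (u + 'i%C * l%:~R) / r%:R) ^+ (2 * m) =
   (4 ^+ m)^-1 * \sum_(i < (2 * m).+1) ('C(2 * m, i))%:R * (cexp ((i%:Z - m%:Z)%:~R * (2 * pi%:C * u / r%:R)) *
     cis (2 * pi * (((i%:Z - m%:Z) * l)%:~R / r%:R))).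
  have f4 : (4 : R[i]) ^+ m = 2 ^+ (2 * m) by rewrite exprM; congr (_ ^+ _); rewrite -natrX.
  have f0 : (2 : R[i]) ^+ (2 * m) != 0 by rewrite expf_neq0 // pnatr_eq0.
  rewrite -[LHS](mulKf f0) -exprMn f4; congr (_ * _).
  rewrite cosc_binomial; apply: eq_bigr => i _; congr (_ * _).
  rewrite /cis -cexpD; congr cexp.
  rewrite (_ : 0 +i* (2 * pi * (((i%:Z - m%:Z) * l)%:~R / r%:R)) = 'i%C * (2 * pi * (((i%:Z - m%:Z) * l)%:~R / r%:R))%:C); last first.
    by apply: ext_complex; rewrite !(ReM, ImM) /= ; ring.
  rewrite intrM !rmorphM fmorphV !rmorph_nat !rmorph_int /=.
  by field.
rewrite [in RHS](eq_bigr _ (fun l _ => E1 l)) -mulr_sumr exchange_big /=.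
rewrite (sum_cint_range m (fun n => if (r%:Z %| n)%Z then (binr m n)%:C * cexp (n%:~R * (2 * pi%:C * u / r%:R)) else 0)).
rewrite mulrA mulr_sumr; apply: eq_bigr => i _.
rewrite -mulr_sumr -mulr_sumr (sum_cint_range q (fun l => cis (2 * pi * (((i%:Z - m%:Z) * l)%:~R / r%:R)))).
rewrite sum_cis -/r; case: ifP => _; last by rewrite !mulr0.
rewrite binr_shift //.
rewrite !(rmorphM, fmorphV, rmorph_nat, rmorphXn) /=.
have f0 : (4 : R[i]) ^+ m != 0 by rewrite expf_neq0 // pnatr_eq0.
by field; rewrite f0 b0 r0'.
Qed.

Lemma binr_step m i : (i < m)%N -> binr m i.+1%:Z = binr m i%:Z * ((m - i)%N%:R / (m + i).+1%:R).
Proof.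
move=> im; rewrite /binr !absz_nat im (ltnW im).
have h1 : ((m + i).+1%:R : R) != 0 by rewrite pnatr_eq0.
have := mul_bin_left (2 * m) (m + i).
have -> : (2 * m - (m + i))%N = (m - i)%N by lia.
move=> /(congr1 (fun x => x%:R : R)); rewrite !natrM addnS => E.
have b0 : (('C(2 * m, m))%:R : R) != 0 by rewrite pnatr_eq0 -lt0n bin_gt0; lia.
rewrite -[X in X / _ = _](mulKf h1) E; move: ((m + i).+1%:R : R) h1 {E} => M h1.
by field; rewrite b0 h1.
Qed.

Lemma binr0 m : binr m 0 = 1.
Proof. by rewrite /binr /= addn0 divff // pnatr_eq0 -lt0n bin_gt0; lia. Qed.

Lemma binr_ge0 m j : 0 <= binr m j.
Proof. by rewrite /binr; case: ifP => // _; rewrite divr_ge0. Qed.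

(** Consecutive values have the ratio [1 - (2 i + 1) / (m + i + 1)], at most
    [exp (- (2 i + 1) / (m + I))], and the odd numbers add up to squares. In [binr_lower] the
    inverse ratio [1 + (2 i + 1) / (m - i)] is bounded in the same way. *)
Lemma binr_upper m (i I : nat) : (i <= I)%N -> (I <= m)%N ->
  binr m i%:Z <= expR (- (i%:R ^+ 2 / (m + I)%:R)).
Proof.
move=> iI Im; elim: i iI => [|i IH] iI.
  by rewrite binr0 expr0n /= mul0r oppr0 expR0.
rewrite binr_step; last exact: leq_trans iI Im.
have mI : (0 : R) < (m + I)%:R by rewrite ltr0n; lia.
have mi : (0 : R) < (m + i).+1%:R by rewrite ltr0n.
have -> : - ((i.+1%:R : R) ^+ 2 / (m + I)%:R) = - (i%:R ^+ 2 / (m + I)%:R) + - ((2 * i + 1)%:R / (m + I)%:R).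
  have m0 := lt0r_neq0 mI; move: m0; move: ((m + I)%:R : R) => M m0.
  by rewrite -[i.+1]addn1 !(natrM, natrD); field.
rewrite expRD; apply: ler_pM; rewrite ?binr_ge0 ?divr_ge0 ?IH 1?ltnW //.
apply: le_trans (expR_ge1Dx _).
have -> : (m - i)%N%:R / (m + i).+1%:R = 1 - (2 * i + 1)%:R / (m + i).+1%:R :> R.
  rewrite natrB; last by lia.
  have m0 := lt0r_neq0 mi; move: m0; rewrite -[(m + i).+1]addn1 !(natrM, natrD) => m0; by field.
rewrite lerD2l lerN2 ler_wpM2l // lef_pV2 ?posrE // ler_nat; lia.
Qed.

Lemma binr_lower m (i I : nat) : (i <= I)%N -> (I < m)%N ->
  expR (- (i%:R ^+ 2 / (m - I)%:R)) <= binr m i%:Z.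
Proof.
move=> iI Im; elim: i iI => [|i IH] iI.
  by rewrite binr0 expr0n /= mul0r oppr0 expR0.
rewrite binr_step; last exact: leq_trans iI (ltnW Im).
have mI : (0 : R) < (m - I)%:R by rewrite ltr0n; lia.
have mi : (0 : R) < (m + i).+1%:R by rewrite ltr0n.
have mi2 : (0 : R) < (m - i)%:R by rewrite ltr0n; lia.
have -> : - ((i.+1%:R : R) ^+ 2 / (m - I)%:R) = - (i%:R ^+ 2 / (m - I)%:R) + - ((2 * i + 1)%:R / (m - I)%:R).
  have m0 := lt0r_neq0 mI; move: m0; move: ((m - I)%:R : R) => M m0.
  by rewrite -[i.+1]addn1 !(natrM, natrD); field.
rewrite expRD; apply: ler_pM; rewrite ?expR_ge0 ?IH 1?ltnW //.
rewrite expRN -[leRHS]invrK lef_pV2 ?posrE ?expR_gt0 ?invr_gt0 ?divr_gt0 //.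
rewrite invf_div; apply: le_trans (expR_ge1Dx _).
have -> : (m + i).+1%:R / (m - i)%N%:R = 1 + (2 * i + 1)%:R / (m - i)%:R :> R.
  have -> : (m + i).+1 = (m - i + (2 * i + 1))%N by lia.
  by rewrite natrD mulrDl divff // gt_eqF.
rewrite lerD2l ler_wpM2l // lef_pV2 ?posrE // ler_nat; lia.
Qed.

Lemma binr_abs m j : binr m j = binr m `|j|%N%:Z.
Proof. by rewrite /binr absz_nat. Qed.

Lemma central_step m : ('C(2 * m.+1, m.+1) * m.+1 = 'C(2 * m, m) * (2 * (2 * m).+1))%N.
Proof.
have h1 := mul_bin_diag (2 * m).+1 m.
have h2 := mul_bin_left (2 * m).+1 m.
have e1 : (2 * m.+1 = (2 * m).+2)%N by lia.
have e2 : ((2 * m).+1 - m = m.+1)%N by lia.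
rewrite e2 in h2; rewrite e1 binS; rewrite [_.-1]/= in h1.
move: ('C((2 * m).+1, m.+1)) ('C((2 * m).+1, m)) ('C(2 * m, m)) h1 h2 => X Y Z; lia.
Qed.

(** Wallis's quotient. It decreases, hence converges; the limit is carried as [K] until
    [jacobi_theta] determines it from a self-dual case. *)
Definition walr (m : nat) : R := 16 ^+ m / (('C(2 * m, m))%:R ^+ 2 * m%:R).

Lemma walr_step m : (0 < m)%N -> walr m.+1 <= walr m.
Proof.
move=> m0; rewrite /walr.
have := congr1 (fun x => x%:R : R) (central_step m); rewrite !natrM.
set a : R := ('C(2 * m.+1, m.+1))%:R; set b : R := ('C(2 * m, m))%:R => E.
have a0 : 0 < a by rewrite ltr0n bin_gt0; lia.
have b0 : 0 < b by rewrite ltr0n bin_gt0; lia.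
have x0 : 0 < (m%:R : R) by rewrite ltr0n.
have {}E : a = b * (2 * (2 * m%:R + 1)) / (m%:R + 1).
  rewrite -[LHS](mulfK (_ : (m%:R + 1 : R) != 0)) ?natr1 ?pnatr_eq0 // E.
  by rewrite -[(2 * m).+1]addn1 !(natrM, natrD).
rewrite E -[in m.+1%:R]addn1 natrD exprS; move: (m%:R : R) x0 => x x0.
have p0 : 0 < (16 : R) ^+ m by rewrite exprn_gt0.
have h1 : 0 < 2 * x + 1 by lra.
have h2 : 0 < x + 1 by lra.
have -> : 16 * 16 ^+ m / ((b * (2 * (2 * x + 1)) / (x + 1)) ^+ 2 * (x + 1)) =
  (16 ^+ m / (b ^+ 2 * x)) * (4 * x * (x + 1) / (2 * x + 1) ^+ 2).
  by field; rewrite ?gt_eqF // ?addr_gt0 //; lra.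
rewrite ler_piMr ?divr_ge0 ?mulr_ge0 ?sqr_ge0 ?(ltW p0) ?(ltW x0) //.
rewrite ler_pdivrMr ?exprn_gt0 // mul1r; nra.
Qed.

Lemma walr_cvg : exists K : R, walr m @[m --> \oo] --> K.
Proof.
have h : cvgn (fun m => walr m.+1).
  apply: (@nonincreasing_is_cvgn _ (fun m => walr m.+1)).
    apply/nonincreasing_seqP => m; exact: walr_step.
  exists 0 => _ [m _ <-]; rewrite /walr divr_ge0 ?exprn_ge0 ?mulr_ge0 ?sqr_ge0 //.
by exists (limn (fun m => walr m.+1)); rewrite -cvg_shiftS.
Qed.

End Polya.

(** * The limit: Jacobi's identity for theta series *)

Section PolyaLimit.
Variable R : realType.
Implicit Types (z u v : R[i]).

Lemma cn_expB (a b : R[i]) (P : R) M : 1 <= P -> cn a <= P -> cn b <= P ->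
  cn (a ^+ M - b ^+ M) <= M%:R * cn (a - b) * P ^+ M.
Proof.
move=> P1 aP bP; have P0 : 0 <= P by apply: le_trans P1.
elim: M => [|M IH]; first by rewrite !expr0 subrr cn0 !mul0r.
have -> : a ^+ M.+1 - b ^+ M.+1 = a * (a ^+ M - b ^+ M) + (a - b) * b ^+ M by rewrite !exprS; ring.
apply: le_trans (cnD _ _) _; rewrite !cnM cnX.
apply: le_trans (_ : _ <= P * (M%:R * cn (a - b) * P ^+ M) + cn (a - b) * P ^+ M) _.
  by apply: lerD; [rewrite ler_pM ?cn_ge0|rewrite ler_wpM2l ?cn_ge0 // lerXn2r ?nnegrE ?cn_ge0].
have h : cn (a - b) * P ^+ M <= cn (a - b) * P ^+ M.+1.
  by rewrite ler_wpM2l ?cn_ge0 // exprS ler_peMl ?exprn_ge0.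
rewrite -[M.+1]addn1 natrD addn1 (exprS P M) in h *.
move: h; set X := P ^+ M; set d := cn (a - b) => h.
have -> : (M%:R + 1) * d * (P * X) = P * (M%:R * d * X) + d * (P * X) by ring.
by rewrite lerD2l.
Qed.

(** An error of third order is small enough: [cosc_pow_cvg] takes powers of order [r ^ 2] at
    arguments of size [1 / r]. *)
Lemma cosc_near z : cn (cosc z - cexp (z ^+ 2 / 2)) <= cn z ^+ 3 * (expR (cn z) + cn z * expR (cn z ^+ 2)).
Proof.
have p3 w : exp_poly 3 w = 1 + w + w ^+ 2 / 2 :> R[i].
  rewrite /exp_poly !big_ord_recl big_ord0 /= /bump /= !add1n expr0 expr1 addr0.
  by rewrite -[0`!]/1%N -[1`!]/1%N -[2`!]/2%N !divr1 addrA.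
have h1 := cexp_taylor 3 z; have h2 := cexp_taylor 3 (- z); rewrite !p3 cnN in h1 h2.
have h3 := cexp_lin (z ^+ 2 / 2).
have e : cn (z ^+ 2 / 2) = cn z ^+ 2 / 2 by rewrite cnM cnX cnV cn_nat.
rewrite e in h3.
have -> : cosc z - cexp (z ^+ 2 / 2) = 2^-1 * ((cexp z - (1 + z + z ^+ 2 / 2)) + (cexp (- z) - (1 + - z + (- z) ^+ 2 / 2)))
   - (cexp (z ^+ 2 / 2) - 1 - z ^+ 2 / 2) by rewrite /cosc; field.
apply: le_trans (cnB _ _) _; rewrite (mulrDr (cn z ^+ 3)); apply: lerD.
  rewrite cnM cnV cn_nat; apply: le_trans (_ : 2^-1 * (cn z ^+ 3 * expR (cn z) + cn z ^+ 3 * expR (cn z)) <= _).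
    by rewrite ler_wpM2l // (le_trans (cnD _ _)) // lerD.
  lra.
apply: le_trans h3 _; rewrite mulrA -exprSr; apply: ler_pM; rewrite ?expR_ge0 ?sqr_ge0 //.
  rewrite expr_div_n -exprM ler_pdivrMr; last by rewrite exprn_gt0.
  by rewrite ler_peMr ?exprn_ge0 ?cn_ge0 // -natrX ler1n.
rewrite ler_expR ler_piMr ?sqr_ge0 //; lra.
Qed.

Lemma cexp_cvg (T : Type) (F : set_system T) {FF : Filter F} (f : T -> R[i]) l :
  ccvg F f l -> ccvg F (fun p => cexp (f p)) (cexp l).
Proof.
move=> h.
have hh : (fun p => cn (cexp l) * (cn (f p - l) * expR (cn (f p - l)))) @ F --> cn (cexp l) * (0 * expR 0).
  apply: cvgM; first exact: cvg_cst.
  apply: cvgM; first exact: h.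
  by apply: continuous_cvg h; exact: continuous_expR.
rewrite mul0r mulr0 in hh.
apply: (squeeze_cvgr _ (cvg_cst 0) hh).
apply: nearW => p; rewrite cn_ge0 /=.
have -> : cexp (f p) - cexp l = cexp l * (cexp (f p - l) - 1).
  by rewrite mulrBr mulr1 -cexpD; congr (cexp _ - _); ring.
by rewrite cnM ler_wpM2l ?cn_ge0 // cexp_sub1.
Qed.

Lemma ccvg_real (T : Type) (F : set_system T) {FF : Filter F} (f : T -> R) (l : R) :
  f @ F --> l <-> ccvg F (fun p => (f p)%:C) l%:C.
Proof.
split=> [h|/ccvgP h].
  apply/ccvgP => e e0; move/cvgrPdist_le : h => /(_ e e0); apply: filterS => p.
  by rewrite -rmorphB cn_real distrC.
apply/cvgrPdist_le => e e0; have := h e e0; apply: filterS => p.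
by rewrite -rmorphB cn_real distrC.
Qed.

Lemma cosc_pow_cvg v (r : nat -> R) (m : nat -> nat) (c : R) :
  (forall q, 1 <= r q) -> (r q)^-1 @[q --> \oo] --> (0 : R) ->
  (m q)%:R / r q ^+ 2 @[q --> \oo] --> c ->
  ccvg \oo (fun q => cosc (v / (r q)%:C) ^+ (2 * m q)) (cexp (v ^+ 2 * c%:C)).
Proof.
move=> r1 hr hm.
have r0 q : 0 < r q by apply: lt_le_trans (r1 q).
pose V := cn v; have V0 : 0 <= V := cn_ge0 v.
(* [C1] bounds the factor of the cubic error in [cosc_near], and [C2] is such that both bases are at
   most [exp (C2 (V / r) ^ 2)]; their powers with exponent [2 m] then stay bounded. *)
pose C1 := 1 + expR V + V * expR (V ^+ 2).
pose C2 := 1 + V * C1.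
have C10 : 0 <= C1 by rewrite /C1 !addr_ge0 ?mulr_ge0 ?expR_ge0.
have C20 : 0 <= C2 by rewrite /C2 addr_ge0 ?mulr_ge0.
have zq q : cn (v / (r q)%:C) = V / r q by rewrite cnM cnV cn_real gtr0_norm.
have zV q : V / r q <= V by rewrite ler_piMr // invf_le1.
pose b q := cexp ((v / (r q)%:C) ^+ 2 / 2).
have hab q : cn (cosc (v / (r q)%:C) - b q) <= (V / r q) ^+ 3 * C1.
  apply: le_trans (cosc_near _) _; rewrite zq ler_wpM2l ?exprn_ge0 ?divr_ge0 ?(ltW (r0 q)) //.
  have x0 : 0 <= V / r q by rewrite divr_ge0 // ltW.
  rewrite /C1 -addrA ler_wpDl //; apply: lerD; first by rewrite ler_expR.
  by apply: ler_pM; rewrite ?expR_ge0 // ler_expR lerXn2r ?nnegrE.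
have hb q : cn (b q) <= expR (C2 * (V / r q) ^+ 2).
  rewrite /b; apply: le_trans (cn_cexp_le _) _; rewrite ler_expR cnM cnX cnV cn_nat zq mulrC.
  rewrite ler_wpM2r ?sqr_ge0 // /C2; apply: le_trans (_ : 1 <= _); first by lra.
  by rewrite lerDl mulr_ge0.
have ha q : cn (cosc (v / (r q)%:C)) <= expR (C2 * (V / r q) ^+ 2).
  have x0 : 0 <= V / r q by rewrite divr_ge0 // ltW.
  set x := V / r q in x0 *.
  have -> : cosc (v / (r q)%:C) = (cosc (v / (r q)%:C) - (1 + (v / (r q)%:C) ^+ 2 / 2)) + (1 + (v / (r q)%:C) ^+ 2 / 2) by ring.
  have p3 w : exp_poly 3 w = 1 + w + w ^+ 2 / 2 :> R[i].
    rewrite /exp_poly !big_ord_recl big_ord0 /= /bump /= !add1n expr0 expr1 addr0.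
    by rewrite -[0`!]/1%N -[1`!]/1%N -[2`!]/2%N !divr1 addrA.
  set z := v / (r q)%:C.
  have h1 := cexp_taylor 3 z; have h2 := cexp_taylor 3 (- z); rewrite !p3 cnN zq -/x in h1 h2.
  apply: le_trans (cnD _ _) _.
  apply: le_trans (_ : x ^+ 3 * expR x + (1 + x ^+ 2) <= _).
    apply: lerD.
      have -> : cosc z - (1 + z ^+ 2 / 2) = 2^-1 * ((cexp z - (1 + z + z ^+ 2 / 2)) + (cexp (- z) - (1 + - z + (- z) ^+ 2 / 2))).
        by rewrite /cosc; field.
      rewrite cnM cnV cn_nat.
      have := cnD (cexp z - (1 + z + z ^+ 2 / 2)) (cexp (- z) - (1 + - z + (- z) ^+ 2 / 2)); lra.
    apply: le_trans (cnD _ _) _; rewrite cn1 lerD2l cnM cnX cnV cn_nat zq -/x.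
    by rewrite ler_piMr ?sqr_ge0 //; lra.
  apply: le_trans (expR_ge1Dx _); rewrite addrC -addrA lerD2l /C2 mulrDl mul1r lerD2l.
  rewrite exprSr -mulrA [leLHS]mulrC; apply: ler_wpM2r; first exact: sqr_ge0.
  apply: ler_pM; rewrite ?expR_ge0 ?zV //.
  rewrite /C1; apply: le_trans (_ : expR V <= _); first by rewrite ler_expR zV.
  by rewrite addrAC lerDr addr_ge0 // mulr_ge0 ?expR_ge0.
have hdiff : ccvg \oo (fun q => cosc (v / (r q)%:C) ^+ (2 * m q) - b q ^+ (2 * m q)) 0.
  have h : (fun q => 2 * ((m q)%:R / r q ^+ 2) * (V ^+ 3 * C1 * (r q)^-1) * expR (2 * C2 * V ^+ 2 * ((m q)%:R / r q ^+ 2))) @ \oo -->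
    2 * c * (V ^+ 3 * C1 * 0) * expR (2 * C2 * V ^+ 2 * c).
    apply: cvgM; first apply: cvgM.
    - by apply: cvgM => //; exact: cvg_cst.
    - by apply: cvgM => //; exact: cvg_cst.
    apply: continuous_cvg; first exact: continuous_expR.
    by apply: cvgM => //; exact: cvg_cst.
  rewrite mulr0 mulr0 mul0r in h.
  apply: (squeeze_cvgr _ (cvg_cst 0) h).
  apply: nearW => q; rewrite cn_ge0 /= subr0.
  apply: le_trans (cn_expB (2 * m q) _ (ha q) (hb q)) _.
    by rewrite -expR0 ler_expR mulr_ge0 ?sqr_ge0.
  rewrite -expRM_natl natrM.
  apply: le_trans (_ : 2 * (m q)%:R * ((V / r q) ^+ 3 * C1) * expR (2 * (m q)%:R * (C2 * (V / r q) ^+ 2)) <= _).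
    by rewrite ler_wpM2r ?expR_ge0 // ler_wpM2l // mulr_ge0.
  rewrite le_eqVlt; apply/orP; left; apply/eqP; congr (_ * expR _); field; exact: lt0r_neq0.
have hbm : ccvg \oo (fun q => b q ^+ (2 * m q)) (cexp (v ^+ 2 * c%:C)).
  apply: (@ccvg_ext _ _ \oo _ (fun q => cexp (v ^+ 2 * ((m q)%:R / r q ^+ 2)%:C))).
    apply: nearW => q; rewrite /b -cexpMn; congr cexp.
    rewrite -[_ *+ (2 * m q)]mulr_natr natrM rmorphM fmorphV rmorphXn rmorph_nat /=.
    have rq : (r q)%:C != 0 :> R[i] by rewrite -cn_gt0 cn_real gtr0_norm.
    by field.
  apply: cexp_cvg; apply: ccvgM; first exact: ccvg_cst.
  have [h _] := @ccvg_real _ \oo _ (fun q => (m q)%:R / r q ^+ 2) c; exact: h hm.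
rewrite -[X in ccvg _ _ X]add0r.
by apply: (ccvg_ext _ (ccvgD hdiff hbm)); apply: nearW => q; rewrite subrK.
Qed.

(** This is [sinh ^ 2 + cos ^ 2], arranged as 1 plus a growth in the real part minus a decay in the
    imaginary part. *)
Lemma cn_cosc2 z : cn (cosc z) ^+ 2 =
  (expR (2 * complex.Re z) + expR (- (2 * complex.Re z)) - 2) / 4 + 1 - sin (complex.Im z) ^+ 2.
Proof.
case: z => A B /=.
have E : cn (cosc (A +i* B)) ^+ 2 = ((expR A + expR (- A)) / 2 * cos B) ^+ 2 + ((expR A - expR (- A)) / 2 * sin B) ^+ 2.
  rewrite cn_sqr /cosc.
  have -> : (2 : R[i])^-1 = (2^-1)%:C by rewrite fmorphV rmorph_nat.
  rewrite /cexp /= cosN sinN.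
  by congr (_ ^+ 2 + _ ^+ 2); field.
rewrite E (mulr_natl A 2) mulr2n opprD !expRD expRN.
have := cos2Dsin2 B; have e0 := expR_gt0 A; move: (expR A) e0 => x x0.
move: (cos B) (sin B) => c s h.
rewrite !exprMn (_ : c ^+ 2 = 1 - s ^+ 2); last by lra.
by field; exact: lt0r_neq0.
Qed.

Lemma expR_cosh (x : R) : `|x| <= 2 -> expR x + expR (- x) - 2 <= 2 * expR 2 * x ^+ 2.
Proof.
move=> hx.
have h1 := cexp_lin x%:C; have h2 := cexp_lin (- x)%:C.
rewrite cn_real cexp_real in h1; rewrite cn_real cexp_real in h2.
have e1 : (expR x)%:C - 1 - x%:C = (expR x - 1 - x)%:C :> R[i] by rewrite !rmorphB.
have e2 : (expR (- x))%:C - 1 - (- x)%:C = (expR (- x) - 1 + x)%:C :> R[i] by rewrite rmorphN opprK rmorphD rmorphB.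
rewrite e1 cn_real in h1; rewrite e2 cn_real normrN in h2.
have h3 : `|x| ^+ 2 * expR `|x| <= x ^+ 2 * expR 2.
  by rewrite real_normK ?num_real // ler_wpM2l ?sqr_ge0 // ler_expR.
have := ler_norm (expR x - 1 - x); have := ler_norm (expR (- x) - 1 + x).
lra.
Qed.

Definition odd_seq (q : nat) : R := (2 * q).+1%:R.
(** The size of the binomial distribution for which its value at [j r], about
    [exp (- (j r) ^ 2 / m)], tends to [exp (- pi t j ^ 2)]. *)
Definition poly_m (t : R) (q : nat) : nat := Num.truncn (odd_seq q ^+ 2 / (pi * t)).

Lemma odd_seq_ge1 q : 1 <= odd_seq q.
Proof. by rewrite /odd_seq ler1n. Qed.
Lemma odd_seq_gt0 q : 0 < odd_seq q.
Proof. exact: lt_le_trans (odd_seq_ge1 q). Qed.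

Lemma odd_seqV_cvg : (odd_seq q)^-1 @[q --> \oo] --> (0 : R).
Proof.
apply: (squeeze_cvgr (f := fun=> 0) (h := @harmonic R)); last exact: cvg_harmonic.
  apply: nearW => q; rewrite invr_ge0 (ltW (odd_seq_gt0 q)) /= /harmonic.
  by rewrite lef_pV2 ?posrE ?odd_seq_gt0 ?ltr0n // ler_nat; lia.
exact: cvg_cst.
Qed.

Lemma poly_m_le t q : 0 < t -> (poly_m t q)%:R / odd_seq q ^+ 2 <= (pi * t)^-1.
Proof.
move=> t0; have pt : 0 < pi * t by rewrite mulr_gt0 ?pi_gt0.
rewrite ler_pdivrMr ?exprn_gt0 ?odd_seq_gt0 // mulrC.
by have /andP[] := @truncn_itv R (odd_seq q ^+ 2 / (pi * t)) (divr_ge0 (sqr_ge0 _) (ltW pt)).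
Qed.

Lemma poly_m_ge t q : 0 < t -> (pi * t)^-1 - (odd_seq q)^-1 <= (poly_m t q)%:R / odd_seq q ^+ 2.
Proof.
move=> t0; have pt : 0 < pi * t by rewrite mulr_gt0 ?pi_gt0.
have o0 := odd_seq_gt0 q.
rewrite ler_pdivlMr ?exprn_gt0 // mulrBl.
have /andP[_ ] := @truncn_itv R (odd_seq q ^+ 2 / (pi * t)) (divr_ge0 (sqr_ge0 _) (ltW pt)).
rewrite -/(poly_m t q) -natr1 [_ / _]mulrC expr2 mulKf ?gt_eqF //.
have := odd_seq_ge1 q; lra.
Qed.

Lemma poly_m_cvg t : 0 < t -> (poly_m t q)%:R / odd_seq q ^+ 2 @[q --> \oo] --> (pi * t)^-1.
Proof.
move=> t0; apply: (squeeze_cvgr (f := fun q => (pi * t)^-1 - (odd_seq q)^-1) (h := fun=> (pi * t)^-1)).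
- by apply: nearW => q; rewrite poly_m_le // poly_m_ge.
- rewrite -[X in _ --> X]subr0; apply: cvgB; [exact: cvg_cst|exact: odd_seqV_cvg].
- exact: cvg_cst.
Qed.

Lemma poly_m_infty t : 0 < t -> (poly_m t @ \oo --> \oo)%classic.
Proof.
move=> t0; have pt : 0 < pi * t by rewrite mulr_gt0 ?pi_gt0.
apply/cvgnyPge => A.
near=> q.
rewrite -(ler_nat R).
have h := poly_m_ge q t0.
have o0 := odd_seq_gt0 q; have o1 := odd_seq_ge1 q.
rewrite ler_pdivlMr ?exprn_gt0 // mulrBl expr2 mulKf ?gt_eqF // in h.
apply: le_trans h.
have hq : (A%:R + 1) * (pi * t) <= odd_seq q - pi * t.
  have h1 : ((A%:R + 1) * (pi * t) + pi * t) <= q%:R by near: q; exact: nbhs_infty_ger.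
  have h2 : (q%:R : R) <= odd_seq q by rewrite /odd_seq ler_nat; lia.
  lra.
have -> : (pi * t)^-1 * (odd_seq q * odd_seq q) - odd_seq q = odd_seq q * ((odd_seq q - pi * t) / (pi * t)).
  by move: (pi * t : R) pt {hq} => p p0; field; exact: lt0r_neq0.
apply: le_trans (_ : 1 * (A%:R + 1) <= _); first by lra.
by apply: ler_pM; rewrite // ?addr_ge0 // ler_pdivlMr.
Unshelve. all: by end_near. Qed.

Lemma binr_cvg t (j : int) : 0 < t ->
  binr R (poly_m t q) (j * (2 * q).+1%:Z) @[q --> \oo] --> expR (- (pi * t * `|j|%N%:R ^+ 2)).
Proof.
move=> t0; have pt : 0 < pi * t by rewrite mulr_gt0 ?pi_gt0.
pose J : R := `|j|%N%:R.
have up : expR (- (J ^+ 2 / ((poly_m t q)%:R / odd_seq q ^+ 2 + J * (odd_seq q)^-1))) @[q --> \oo] -->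
   expR (- (J ^+ 2 / ((pi * t)^-1 + J * 0))).
  apply: continuous_cvg; first exact: continuous_expR.
  apply: cvgN; apply: cvgM; first exact: cvg_cst.
  apply: cvgV; first by rewrite mulr0 addr0 invr_eq0 gt_eqF.
  apply: cvgD; first exact: poly_m_cvg.
  by apply: cvgM; [exact: cvg_cst|exact: odd_seqV_cvg].
have lo : expR (- (J ^+ 2 / ((poly_m t q)%:R / odd_seq q ^+ 2 - J * (odd_seq q)^-1))) @[q --> \oo] -->
   expR (- (J ^+ 2 / ((pi * t)^-1 - J * 0))).
  apply: continuous_cvg; first exact: continuous_expR.
  apply: cvgN; apply: cvgM; first exact: cvg_cst.
  apply: cvgV; first by rewrite mulr0 subr0 invr_eq0 gt_eqF.
  apply: cvgB; first exact: poly_m_cvg.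
  by apply: cvgM; [exact: cvg_cst|exact: odd_seqV_cvg].
rewrite mulr0 addr0 invrK in up; rewrite mulr0 subr0 invrK in lo.
rewrite [pi * t * _]mulrC.
apply: squeeze_cvgr lo up.
near=> q.
have hI : (`|j| * (2 * q).+1 < poly_m t q)%N.
  rewrite -(ltr_nat R) natrM -/J -/(odd_seq q).
  have o0 := odd_seq_gt0 q.
  have h : J * (odd_seq q)^-1 < (poly_m t q)%:R / odd_seq q ^+ 2.
    near: q.
    have c1 : (fun q => (poly_m t q)%:R / odd_seq q ^+ 2 - J * (odd_seq q)^-1) @ \oo --> (pi * t)^-1 - J * 0.
      apply: cvgB; first exact: poly_m_cvg.
      by apply: cvgM; [exact: cvg_cst|exact: odd_seqV_cvg].
    rewrite mulr0 subr0 in c1.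
    move/cvgr_gt : c1 => /(_ 0); rewrite invr_gt0 => /(_ pt).
    by apply: filterS => q; rewrite subr_gt0.
  rewrite ltr_pdivlMr ?exprn_gt0 // in h.
  by rewrite expr2 mulrA divfK ?gt_eqF in h.
rewrite binr_abs abszM absz_nat.
have o0 := lt0r_neq0 (odd_seq_gt0 q).
have e1 : J ^+ 2 / ((poly_m t q)%:R / odd_seq q ^+ 2 + J * (odd_seq q)^-1) =
   (`|j| * (2 * q).+1)%N%:R ^+ 2 / (poly_m t q + `|j| * (2 * q).+1)%N%:R.
  rewrite natrD natrM -/J -/(odd_seq q).
  have -> : (poly_m t q)%:R / odd_seq q ^+ 2 + J / odd_seq q = ((poly_m t q)%:R + J * odd_seq q) / odd_seq q ^+ 2.
    by field.
  by rewrite invf_div exprMn mulrA.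
have e2 : J ^+ 2 / ((poly_m t q)%:R / odd_seq q ^+ 2 - J * (odd_seq q)^-1) =
   (`|j| * (2 * q).+1)%N%:R ^+ 2 / (poly_m t q - `|j| * (2 * q).+1)%N%:R.
  rewrite natrB ?(ltnW hI) // natrM -/J -/(odd_seq q).
  have -> : (poly_m t q)%:R / odd_seq q ^+ 2 - J / odd_seq q = ((poly_m t q)%:R - J * odd_seq q) / odd_seq q ^+ 2.
    by field.
  by rewrite invf_div exprMn mulrA.
by rewrite e1 e2 binr_upper ?binr_lower // ltnW.
Unshelve. all: by end_near. Qed.

(** Where the binomial coefficient does not vanish, the denominator in [binr_upper] is at most
    [2 m]; hence the halved exponent. *)
Lemma binr_dom t q (j : int) : 0 < t ->
  binr R (poly_m t q) (j * (2 * q).+1%:Z) <= expR (- (pi * t / 2) * `|j|%N%:R ^+ 2).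
Proof.
move=> t0; have pt : 0 < pi * t by rewrite mulr_gt0 ?pi_gt0.
have [hI|hI] := leqP (`|j| * (2 * q).+1) (poly_m t q); last first.
  by rewrite /binr abszM absz_nat leqNgt hI /= expR_ge0.
rewrite binr_abs abszM absz_nat; apply: le_trans (binr_upper R (leqnn _) hI) _.
rewrite ler_expR mulNr lerN2 natrD natrM -/(odd_seq q).
set m := poly_m t q in hI *; set J : R := `|j|%N%:R.
have o0 := odd_seq_gt0 q.
have hm := poly_m_le q t0; rewrite -/m ler_pdivrMr ?exprn_gt0 // in hm.
have hJ : J * odd_seq q <= m%:R by rewrite -natrM ler_nat.
have J0 : 0 <= J by rewrite ler0n.
have [m0|m0] := eqVneq m 0%N.
  have j0 : J = 0.
    apply/eqP; rewrite eq_le J0 andbT; rewrite m0 in hJ.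
    by rewrite -(ler_pM2r o0) mul0r.
  by rewrite j0 expr0n /= mulr0 mul0r expr0n /= mul0r.
have mp : 0 < m%:R :> R by rewrite ltr0n lt0n.
rewrite ler_pdivlMr; last by rewrite ltr_pwDl // mulr_ge0 // ltW.
apply: le_trans (_ : pi * t / 2 * J ^+ 2 * (m%:R + m%:R) <= _).
  by rewrite ler_wpM2l ?lerD2l // mulr_ge0 ?sqr_ge0 // divr_ge0 // ltW.
rewrite exprMn; have -> : pi * t / 2 * J ^+ 2 * (m%:R + m%:R) = J ^+ 2 * (pi * t * m%:R) by field.
rewrite ler_wpM2l ?sqr_ge0 //; rewrite mulrC in hm.
rewrite -ler_pdivlMl //; by rewrite mulrC.
Qed.

Lemma near_ge_odd (x : R) : \forall q \near \oo, x <= odd_seq q.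
Proof.
near=> q; apply: (@le_trans _ _ q%:R); first by near: q; exact: nbhs_infty_ger.
by rewrite /odd_seq ler_nat; lia.
Unshelve. all: by end_near. Qed.

Lemma shifted_sqr (b x : R) : x ^+ 2 / 2 - b ^+ 2 <= (b + x) ^+ 2.
Proof. by rewrite -subr_ge0 (_ : _ - _ = (x + 2 * b) ^+ 2 / 2) ?divr_ge0 ?sqr_ge0 //; field. Qed.

Lemma int_sqr (l : int) : (l%:~R : R) ^+ 2 = `|l|%N%:R ^+ 2.
Proof. by rewrite natr_absz intr_norm real_normK ?num_real. Qed.

Lemma cn_int (l : int) : cn (l%:~R : R[i]) = `|l|%N%:R.
Proof. by rewrite -(rmorph_int (real_complex R)) cn_real natr_absz intr_norm. Qed.

(** For [|l| <= q] the angle [pi l / r] is at most [pi / 2] in modulus, and for large [q] the shift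
    by [Im u] stays within [2 - pi / 2], so that [sin2_ge] applies; the real part costs a bounded
    factor. The exponent [pi / (36 t)] is [pi ^ 2 / 9], times [1 / 2] from [shifted_sqr], times
    [1 / (2 pi t)] from [m >= r ^ 2 / (2 pi t)]. *)
Lemma cosc_dom t u : 0 < t -> exists2 C : R, 0 < C & \forall q \near \oo,
  forall l : int, (`|l| <= q)%N ->
    cn (cosc (pi%:C * (u + 'i%C * l%:~R) / (odd_seq q)%:C) ^+ (2 * poly_m t q)) <= C * wi R l.
Proof.
move=> t0; have pt : 0 < pi * t by rewrite mulr_gt0 ?pi_gt0.
have p0 := pi_gt0 R.
have [C C0 hC] := @gauss_wi R (pi / (36 * t)) 0 ltac:(by rewrite divr_gt0 // mulr_gt0).
pose a := complex.Re u; pose b := complex.Im u.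
pose K := 2 * expR 2 * (pi * a ^+ 2 / t) + pi * b ^+ 2 / (18 * t).
exists (expR K * C); first by rewrite mulr_gt0 ?expR_gt0.
pose dl : R := 2 - pi / 2.
have dl0 : 0 < dl by rewrite subr_gt0; exact: pihalf_lt2.
near=> q.
have o0 := odd_seq_gt0 q.
have h1 : pi * `|a| <= odd_seq q by near: q; exact: near_ge_odd.
have h2 : pi * `|b| / dl <= odd_seq q by near: q; exact: near_ge_odd.
have h3 : (pi * t)^-1 / 2 <= (poly_m t q)%:R / odd_seq q ^+ 2.
  near: q.
  have c1 := poly_m_cvg t0.
  move/cvgr_ge : c1 => /(_ ((pi * t)^-1 / 2)); apply.
  by rewrite ltr_pdivrMr // ltr_pMr ?invr_gt0 //; lra.
move=> l hl; set r := odd_seq q in o0 h1 h2 h3 *.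
have h4 := poly_m_le q t0; rewrite -/r in h4.
set m := poly_m t q in h3 h4 *.
set z := _ / r%:C.
have zR : complex.Re z = pi * a / r.
  by rewrite /z -fmorphV /a; case: (u) => u1 u2; rewrite -[l%:~R]/(l%:~R : R[i]) -(rmorph_int (real_complex R)) /=; ring.
have zI : complex.Im z = pi * (b + l%:~R) / r.
  by rewrite /z -fmorphV /b; case: (u) => u1 u2; rewrite -[l%:~R]/(l%:~R : R[i]) -(rmorph_int (real_complex R)) /=; ring.
have hA : `|2 * (pi * a / r)| <= 2.
  rewrite !normrM normr_nat normfV (gtr0_norm p0) (gtr0_norm o0).
  by rewrite ler_piMr // ler_pdivrMr // mul1r.
have hB : `|pi * (b + l%:~R) / r| <= 2.
  rewrite !normrM normfV (gtr0_norm p0) (gtr0_norm o0) ler_pdivrMr //.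
  apply: le_trans (_ : pi * (`|b| + `|l|%N%:R) <= _).
    rewrite ler_wpM2l ?(ltW p0) // (le_trans (ler_normD _ _)) // lerD2l.
    by rewrite natr_absz intr_norm.
  have e1 : pi * `|b| <= r * dl by rewrite -ler_pdivrMr.
  have e2 : (`|l|%N%:R : R) <= r / 2.
    rewrite ler_pdivlMr // /r /odd_seq -natrM ler_nat; clear -hl; lia.
  have e3 : pi * `|l|%N%:R <= pi * (r / 2) by rewrite ler_wpM2l // ltW.
  by rewrite mulrDr; rewrite /dl in e1; lra.
have hz : cn (cosc z) ^+ 2 <= expR (2 * expR 2 * (pi * a / r) ^+ 2 - (pi * (b + l%:~R) / r) ^+ 2 / 9).
  rewrite cn_cosc2 zR zI.
  have k1 := expR_cosh hA; have k2 := sin2_ge hB.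
  apply: le_trans (expR_ge1Dx _).
  have e9 : (2 * (pi * a / r)) ^+ 2 = 4 * (pi * a / r) ^+ 2 by ring.
  rewrite e9 in k1.
  move: k1 k2; rewrite -!(mulrA 2) (mulrCA (expR 2)).
  move: (expR 2 * (pi * a / r) ^+ 2) (sin _ ^+ 2) ((pi * (b + l%:~R) / r) ^+ 2) (expR _ + _) => X Y Z W.
  clear; lra.
rewrite cnX exprM.
apply: le_trans (_ : expR (2 * expR 2 * (pi * a / r) ^+ 2 - (pi * (b + l%:~R) / r) ^+ 2 / 9) ^+ m <= _).
  by rewrite lerXn2r ?nnegrE ?sqr_ge0 ?expR_ge0.
rewrite -expRM_natl.
apply: le_trans (_ : expR K * expR (- (pi / (36 * t)) * `|l|%N%:R ^+ 2 + 0 * `|l|%N%:R) <= _); last first.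
  by rewrite -[leRHS]mulrA; apply: ler_wpM2l; [exact: expR_ge0|exact: hC].
rewrite -expRD ler_expR mul0r addr0 -int_sqr.
have -> : m%:R * (2 * expR 2 * (pi * a / r) ^+ 2 - (pi * (b + l%:~R) / r) ^+ 2 / 9) =
   2 * expR 2 * (pi ^+ 2 * a ^+ 2) * (m%:R / r ^+ 2) - (pi ^+ 2 / 9) * (b + l%:~R) ^+ 2 * (m%:R / r ^+ 2).
  by field; exact: lt0r_neq0.
have k1 : 2 * expR 2 * (pi ^+ 2 * a ^+ 2) * (m%:R / r ^+ 2) <= 2 * expR 2 * (pi ^+ 2 * a ^+ 2) * (pi * t)^-1.
  have Y0 : 0 <= 2 * expR 2 * (pi ^+ 2 * a ^+ 2).
    apply: mulr_ge0; first by apply: mulr_ge0; [exact: ler0n|exact: expR_ge0].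
    by apply: mulr_ge0; exact: sqr_ge0.
  exact: (ler_wpM2l Y0 h4).
have k2 : (pi ^+ 2 / 9) * (b + l%:~R) ^+ 2 * ((pi * t)^-1 / 2) <= (pi ^+ 2 / 9) * (b + l%:~R) ^+ 2 * (m%:R / r ^+ 2).
  by rewrite ler_wpM2l // mulr_ge0 ?sqr_ge0 // divr_ge0 ?sqr_ge0.
have k3 := @shifted_sqr b l%:~R.
have k4 : (pi ^+ 2 / 9) * (l%:~R ^+ 2 / 2 - b ^+ 2) * ((pi * t)^-1 / 2) <= (pi ^+ 2 / 9) * (b + l%:~R) ^+ 2 * ((pi * t)^-1 / 2).
  rewrite ler_wpM2r ?divr_ge0 ?invr_ge0 ?(ltW pt) // ler_wpM2l // divr_ge0 ?sqr_ge0 //.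
have e5 : 2 * expR 2 * (pi ^+ 2 * a ^+ 2) * (pi * t)^-1 = 2 * expR 2 * (pi * a ^+ 2 / t).
  by move: (pi : R) (lt0r_neq0 p0) (lt0r_neq0 t0) => P P0 T0; field; rewrite P0 T0.
have e6 : (pi ^+ 2 / 9) * (l%:~R ^+ 2 / 2 - b ^+ 2) * ((pi * t)^-1 / 2) =
   pi / (36 * t) * l%:~R ^+ 2 - pi * b ^+ 2 / (18 * t).
  by move: (pi : R) (lt0r_neq0 p0) (lt0r_neq0 t0) => P P0 T0; field; rewrite P0 T0.
apply: le_trans (lerB k1 (le_trans k4 k2)) _; rewrite e5 e6 /K mulNr.
by rewrite le_eqVlt; apply/orP; left; apply/eqP; ring.
Unshelve. all: by end_near. Qed.

(** The terms of the two sides of Jacobi's identity with a complex argument [u], which carries the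
    twists by roots of unity as imaginary shifts. *)
Definition gaussL t u (j : int) : R[i] := cexp ((- (pi * t * j%:~R ^+ 2))%:C + 2 * pi%:C * u * j%:~R).
Definition gaussR t u (l : int) : R[i] := cexp (pi%:C * (u + 'i%C * l%:~R) ^+ 2 / t%:C).

Lemma gaussL_dom t u : 0 < t -> exists2 C : R, 0 < C & forall j, cn (gaussL t u j) <= C * wi R j.
Proof.
move=> t0; have pt : 0 < pi * t by rewrite mulr_gt0 ?pi_gt0.
have [C C0 hC] := @gauss_wi R (pi * t) (2 * pi * cn u) pt.
exists C => // j; apply: le_trans (hC j); rewrite /gaussL cn_cexp ler_expR ReD /= int_sqr mulNr lerD2l.
apply: le_trans (ler_norm _) _; apply: le_trans (Re_le_cn _) _.
rewrite !cnM cn_nat cn_real (gtr0_norm (pi_gt0 R)) ler_wpM2l ?mulr_ge0 ?pi_ge0 ?cn_ge0 //.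
by rewrite cn_int.
Qed.

Lemma gaussR_dom t u : 0 < t -> exists2 C : R, 0 < C & forall j, cn (gaussR t u j) <= C * wi R j.
Proof.
move=> t0; have p0 := pi_gt0 R.
have [C C0 hC] := @gauss_wi R (pi / (2 * t)) 0 ltac:(by rewrite divr_gt0 // mulr_gt0).
pose a := complex.Re u; pose b := complex.Im u.
exists (expR (pi * (a ^+ 2 + b ^+ 2) / t) * C) => [|j]; first by rewrite mulr_gt0 ?expR_gt0.
apply: le_trans (_ : expR (pi * (a ^+ 2 + b ^+ 2) / t) * expR (- (pi / (2 * t)) * `|j|%N%:R ^+ 2 + 0 * `|j|%N%:R) <= _); last first.
  by rewrite -[leRHS]mulrA; apply: ler_wpM2l; [exact: expR_ge0|exact: hC].
rewrite -expRD cn_cexp ler_expR mul0r addr0 -int_sqr.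
have -> : complex.Re (pi%:C * (u + 'i%C * j%:~R) ^+ 2 / t%:C) = pi * (a ^+ 2 - (b + j%:~R) ^+ 2) / t.
  by rewrite -fmorphV /a /b; case: (u) => u1 u2; rewrite -(rmorph_int (real_complex R)) /=; ring.
have k := shifted_sqr b j%:~R.
have -> : pi * (a ^+ 2 + b ^+ 2) / t + - (pi / (2 * t)) * j%:~R ^+ 2 = pi / t * (a ^+ 2 - (j%:~R ^+ 2 / 2 - b ^+ 2)).
  by field; exact: lt0r_neq0.
rewrite -mulrA [_ / t]mulrC mulrA; apply: ler_wpM2l; first by rewrite divr_ge0 ?ltW.
by rewrite lerD2l lerN2.
Qed.

(** The limit of [finite_poisson] as the group grows: both sums converge by [tannery], and the
    square of the factor [kap q] is [walr] times [m / r ^ 2]. *)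
Lemma jacobi_const : exists K : R, forall t u S1 S2, 0 < t ->
  hasSum (gaussL t u) S1 -> hasSum (gaussR t u) S2 -> S1 = (Num.sqrt (K / (pi * t)))%:C * S2.
Proof.
have [K hK] := walr_cvg R; exists K => t u S1 S2 t0 hS1 hS2.
have pt : 0 < pi * t by rewrite mulr_gt0 ?pi_gt0.
pose m := poly_m t.
pose f q (n : int) : R[i] := if ((2 * q).+1%:Z %| n)%Z then
     (binr R (m q) n)%:C * cexp (n%:~R * (2 * pi%:C * u / (2 * q).+1%:R)) else 0.
pose F q (j : int) : R[i] := (binr R (m q) (j * (2 * q).+1%:Z))%:C * cexp (2 * pi%:C * u * j%:~R).
pose G q (l : int) : R[i] := if (`|l| <= q)%N then cosc (pi%:C * (u + 'i%C * l%:~R) / (odd_seq q)%:C) ^+ (2 * m q) else 0.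
pose A q := \sum_(n <- cint_range (m q)) f q n.
pose B q := \sum_(l <- cint_range q) G q l.
pose kap q : R := 4 ^+ m q / ((2 * q).+1%:R * ('C(2 * m q, m q))%:R).
have hA q : hasSum (F q) (A q).
  have hf : hasSum (f q) (A q).
    apply: hasSum_fin; first exact: cint_range_uniq.
    by move=> n; rewrite mem_cint_range /f /binr => /negbTE ->; rewrite mul0r if_same.
  have inj : injective (fun j : int => j * (2 * q).+1%:Z) by apply: mulIf.
  apply: (hasSum_ext _ ((hasSum_inj _ inj _).2 hf)).
    move=> j /=; rewrite /f dvdz_mull // /F; congr (_ * cexp _).
    rewrite intrM -[((2 * q).+1%:Z)%:~R]/((2 * q).+1%:R).
    have r0 : ((2 * q).+1%:R : R[i]) != 0 by rewrite pnatr_eq0.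
    by move: ((2 * q).+1%:R : R[i]) r0 => r r0; field.
  move=> n hn; rewrite /f; case: ifP => // /dvdzP [k nk]; by case: (hn k).
have hB q : hasSum (G q) (B q).
  apply: hasSum_fin; first exact: cint_range_uniq.
  by move=> n; rewrite mem_cint_range /G => /negbTE ->.
have hAB q : A q = (kap q)%:C * B q.
  rewrite /A finite_poisson; congr (_ * _); apply: eq_big_seq => l.
  rewrite mem_cint_range /G => ->; congr (cosc (_ / _) ^+ _).
  by rewrite /odd_seq rmorph_nat.
have cA : ccvg \oo A S1.
  have [C C0 hC] := @gauss_wi R (pi * t / 2) (2 * pi * cn u) ltac:(by rewrite divr_gt0).
  apply: (@tannery _ _ _ _ _ F _ (fun j => C * wi R j) _ _ _ _ _ _ hS1).
  - by apply: wsumZ (wsum_wi R) (ltW C0).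
  - apply: nearW => q j; apply: le_trans (hC j); rewrite /F cnM cn_real ger0_norm ?binr_ge0 //.
    rewrite expRD; apply: ler_pM; rewrite ?binr_ge0 ?cn_ge0 ?binr_dom //.
    rewrite cn_cexp ler_expR; apply: le_trans (ler_norm _) _; apply: le_trans (Re_le_cn _) _.
    rewrite !cnM cn_nat cn_real (gtr0_norm (pi_gt0 R)) ler_wpM2l ?mulr_ge0 ?pi_ge0 ?cn_ge0 //.
    by rewrite cn_int.
  - move=> j; rewrite /gaussL cexpD cexp_real; apply: ccvgM; last exact: ccvg_cst.
    have h := @binr_cvg t j t0; rewrite -int_sqr in h.
    have [k _] := @ccvg_real _ \oo _ (fun q => binr R (poly_m t q) (j * (2 * q).+1%:Z)) (expR (- (pi * t * j%:~R ^+ 2))).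
    exact: k h.
  - by apply: nearW => q; exact: hA.
have cB : ccvg \oo B S2.
  have [C C0 hC] := @cosc_dom t u t0.
  apply: (@tannery _ _ _ _ _ G _ (fun j => C * wi R j) _ _ _ _ _ _ hS2).
  - by apply: wsumZ (wsum_wi R) (ltW C0).
  - apply: filterS hC => q hq j; rewrite /G; case: ifP => hj; first exact: hq.
    by rewrite cn0 mulr_ge0 ?(ltW C0) // /wi wt_ge0.
  - move=> l; apply: (@ccvg_ext _ _ _ _ (fun q => cosc ((pi%:C * (u + 'i%C * l%:~R)) / (odd_seq q)%:C) ^+ (2 * m q))).
      by near=> q; rewrite /G ifT //; near: q; exact: nbhs_infty_ge.
    have := @cosc_pow_cvg (pi%:C * (u + 'i%C * l%:~R)) odd_seq m _ odd_seq_ge1 odd_seqV_cvg (poly_m_cvg t0).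
    rewrite /gaussR (_ : (pi%:C * (u + 'i%C * l%:~R)) ^+ 2 * ((pi * t)^-1)%:C = pi%:C * (u + 'i%C * l%:~R) ^+ 2 / t%:C) //.
    rewrite fmorphV rmorphM /=.
    have p0 : (pi%:C : R[i]) != 0 by rewrite -cn_gt0 cn_real gtr0_norm ?pi_gt0.
    have tt0 : (t%:C : R[i]) != 0 by rewrite -cn_gt0 cn_real gtr0_norm.
    by move: (pi%:C : R[i]) p0 (t%:C : R[i]) tt0 => p p0 x x0; field; rewrite p0 x0.
  - by apply: nearW => q; exact: hB.
have ck : kap q @[q --> \oo] --> Num.sqrt (K / (pi * t)).
  have h : (fun q => Num.sqrt (walr R (m q) * ((m q)%:R / odd_seq q ^+ 2))) @ \oo --> Num.sqrt (K / (pi * t)).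
    apply: continuous_cvg; first exact: sqrt_continuous.
    apply: cvgM; last exact: poly_m_cvg.
    exact: (cvg_comp _ _ (poly_m_infty t0) hK).
  apply: (cvg_trans _ h); apply: near_eq_cvg; near=> q.
  have m0 : (0 < m q)%N.
    near: q; have /cvgnyPgt := poly_m_infty t0; exact.
  have mp : (m q)%:R != 0 :> R by rewrite pnatr_eq0 -lt0n.
  have o0 := odd_seq_gt0 q.
  have b0 : (('C(2 * m q, m q))%:R : R) != 0 by rewrite pnatr_eq0 -lt0n bin_gt0; lia.
  have kp : 0 <= kap q by rewrite /kap divr_ge0 ?exprn_ge0 ?mulr_ge0.
  rewrite -[RHS](ger0_norm kp) -sqrtr_sqr; congr Num.sqrt.
  rewrite /walr /kap -/(odd_seq q).
  have -> : (16 : R) ^+ m q = (4 ^+ m q) ^+ 2 by rewrite -exprM mulnC exprM; congr (_ ^+ _); rewrite -natrX.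
  by field; rewrite mp b0 lt0r_neq0.
apply: (ccvg_unique cA).
apply: (@ccvg_ext _ _ \oo _ (fun q => (kap q)%:C * B q)); first by apply: nearW => q; rewrite hAB.
apply: ccvgM cB; exact: ((@ccvg_real _ \oo _ kap _).1 ck).
Unshelve. all: by end_near. Qed.

(** For [t = 1] and [u = 0] the two series coincide term by term and have a nonzero sum, which
    forces the constant [K] of [jacobi_const] to be [pi]. *)
Theorem jacobi_theta t u : 0 < t -> exists S,
  hasSum (gaussL t u) S /\ hasSum (gaussR t u) ((Num.sqrt t)%:C * S).
Proof.
move=> t0.
have ex (x : R) v : 0 < x -> exists S1 S2, hasSum (gaussL x v) S1 /\ hasSum (gaussR x v) S2.
  move=> x0.
  have [C C0 hC] := gaussL_dom v x0; have [D D0 hD] := gaussR_dom v x0.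
  have [S1 h1] := hasSum_exists (wsumZ (wsum_wi R) (ltW C0)) hC.
  have [S2 h2] := hasSum_exists (wsumZ (wsum_wi R) (ltW D0)) hD.
  by exists S1, S2.
have [K hK] := jacobi_const.
have K1 : Num.sqrt (K / pi) = 1.
  have [S1 [S2 [h1 h2]]] := ex 1 0 ltr01.
  have E : S1 = S2.
    apply: hasSum_unique h1 _; apply: hasSum_ext h2 => j; rewrite /gaussL /gaussR.
    congr cexp; rewrite add0r divr1 !mulr0 mul0r addr0 mulr1 exprMn sqr_i.
    by rewrite rmorphN rmorphM rmorphXn rmorph_int /=; ring.
  have := hK 1 0 S1 S2 ltr01 h1 h2; rewrite mulr1 -E => e.
  (* All terms are positive and the one at 0 is 1, so every partial sum that contains it is at least
     1. *)
  have S0 : S1 != 0.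
    rewrite -cn_gt0.
    have h : 1 <= complex.Re S1.
      rewrite leNgt; apply/negP => hlt.
      have e0 : 0 < (1 - complex.Re S1) / 2 by rewrite divr_gt0 // subr_gt0.
      have [A0 hA0] := h1 _ e0.
      have u0 : uniq (undup (0 :: A0)) := undup_uniq _.
      have s0 : {subset A0 <= undup (0 :: A0)} by move=> x xA; rewrite mem_undup inE xA orbT.
      have := hA0 _ u0 s0.
      have : 1 <= complex.Re (\sum_(t1 <- undup (0 :: A0)) gaussL 1 0 t1).
        rewrite Re_sum.
        have gr j : complex.Re (gaussL 1 0 j) = expR (- (pi * 1 * j%:~R ^+ 2)).
          by rewrite /gaussL mulr0 mul0r addr0 cexp_real.
        under eq_bigr do rewrite gr.
        have m0 : (0 : int) \in undup (0 :: A0) by rewrite mem_undup inE eqxx.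
        rewrite (bigD1_seq _ m0 u0) /=.
        by rewrite expr0n /= mulr0 oppr0 expR0 lerDl sumr_ge0 // => *; exact: expR_ge0.
      set s := \sum_(_ <- _) _ => k1 k2.
      have := Re_le_cn (s - S1); rewrite ReD ReN => k3.
      have := ler_norm (complex.Re s - complex.Re S1); lra.
    by apply: lt_le_trans (le_trans (ler_norm _) (Re_le_cn _)); lra.
  have : (Num.sqrt (K / pi))%:C = 1 :> R[i].
    by apply: (mulIf S0); rewrite mul1r -e.
  by move=> /(congr1 (@complex.Re R)).
have [S1 [S2 [h1 h2]]] := ex t u t0.
exists S1; split => //.
have -> : (Num.sqrt t)%:C * S1 = S2; last by [].
rewrite (hK t u S1 S2 t0 h1 h2) mulrA -rmorphM invfM mulrA.
rewrite [Num.sqrt (K / pi / t)]sqrtrM; last first.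
  by rewrite leNgt; apply/negP => h; move: K1; rewrite ler0_sqrtr ?ltW // => /eqP; rewrite eq_sym oner_eq0.
rewrite K1 mul1r -sqrtrM ?(ltW t0) // divff ?lt0r_neq0 // sqrtr1.
by rewrite mul1r.
Qed.

End PolyaLimit.

(** * The theta series of the Groessencharacter *)

Section Chi7.

(** The quadratic character modulo 7 ([legendre7]), as a table so that its identities are decided by
    cases on the residue. *)
Definition chi (x : int) : int := nth 0 [:: 0; 1; 1; -1; 1; -1; -1] (absz (x %% 7)%Z).

Lemma mod7_cases (x : int) : exists2 r : nat, (r < 7)%N & exists q : int, x = q * 7 + r%:Z.
Proof.
exists (absz (x %% 7)%Z).
  have h0 : (0 <= (x %% 7)%Z) by apply: modz_ge0.
  have h1 : ((x %% 7)%Z < 7) by apply: ltz_pmod.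
  by move: h0 h1; case: (x %% 7)%Z => // n _.
exists (x %/ 7)%Z; rewrite gez0_abs ?modz_ge0 //; exact: divz_eq.
Qed.

Lemma chi_small (q : int) (r : nat) : (r < 7)%N -> chi (q * 7 + r%:Z) = nth 0 [:: 0; 1; 1; -1; 1; -1; -1] r.
Proof. by move=> hr; rewrite /chi modzMDl modz_nat modn_small. Qed.

Lemma chi_mod (x q : int) : chi (q * 7 + x) = chi x.
Proof. by rewrite /chi modzMDl. Qed.

Lemma chiM x y : chi (x * y) = chi x * chi y.
Proof.
have [r hr [q ->]] := mod7_cases x; have [r' hr' [q' ->]] := mod7_cases y.
rewrite !chi_small //.
have -> : (q * 7 + r%:Z) * (q' * 7 + r'%:Z) = (q * q' * 7 + q * r'%:Z + r%:Z * q') * 7 + (r * r')%N%:Z.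
  by rewrite PoszM; ring.
rewrite /chi modzMDl modz_nat /=.
by do 7 (case: r hr => [|r] hr; first by do 7 (case: r' hr' => [|r'] hr' //)).
Qed.

Lemma chiN x : chi (- x) = - chi x.
Proof.
have [r hr [q ->]] := mod7_cases x; rewrite chi_small //.
have -> : - (q * 7 + r%:Z) = (- q - 1) * 7 + (7 - r)%N%:Z by lia.
rewrite /chi modzMDl modz_nat /=.
by do 7 (case: r hr => [|r] hr //).
Qed.

Lemma chi_norm x : (`|chi x| <= 1)%R.
Proof.
have [r hr [q ->]] := mod7_cases x; rewrite chi_small //.
by do 7 (case: r hr => [|r] hr //).
Qed.

Lemma chi_dvd x : (7 %| x)%Z -> chi x = 0.
Proof. by case/dvdzP => q ->; rewrite -[q * 7]addr0 chi_mod. Qed.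

Lemma chi2 x : chi (2 * x) = chi x.
Proof. by rewrite chiM (_ : chi 2 = 1) ?mul1r. Qed.

Lemma legendre7 x : legendre 7 x = chi x.
Proof.
have [r hr [q ->]] := mod7_cases x; rewrite chi_small // /legendre.
have E1 : ((7%:Z) %| q * 7 + r%:Z)%Z = (r == 0)%N by apply/idP/idP; lia.
rewrite E1; case: eqP => [-> //|/eqP r0].
have E2 : [exists x : 'I_7, (7%:Z %| (x : nat)%:Z ^+ 2 - (q * 7 + r%:Z))%Z] = (r \in [:: 1; 2; 4])%N.
  have K (y : nat) : ((7%:Z) %| y%:Z ^+ 2 - (q * 7 + r%:Z))%Z -> ((y * y) %% 7 = r)%N.
    rewrite expr2 -PoszM; lia.
  apply/existsP/idP => [[[y hy] /= /K]|].
    by do 7 (case: y hy => [|y] hy; first by move=> e; move: r0; rewrite -e).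
  rewrite !inE => /or3P[] /eqP ->.
  - by exists (Ordinal (isT : (1 < 7)%N)) => /=; lia.
  - by exists (Ordinal (isT : (3 < 7)%N)) => /=; lia.
  - by exists (Ordinal (isT : (2 < 7)%N)) => /=; lia.
rewrite E2; clear E1 E2; by do 7 (case: r hr r0 => [|r] hr r0 //).
Qed.

(** The cubic form is [(2 a + b) ^ 3] modulo 7, and a character with values 0, 1 and -1 equals its
    cube. *)
Lemma epsilon_chi a b : epsilon a b = chi (2 * a + b).
Proof.
rewrite /epsilon legendre7.
have -> : a ^+ 3 - 2 * a ^+ 2 * b - a * b ^+ 2 + b ^+ 3 =
  (- (a ^+ 3) - 2 * a ^+ 2 * b - a * b ^+ 2) * 7 + (2 * a + b) * ((2 * a + b) * (2 * a + b)) by ring.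
rewrite chi_mod !chiM.
have [r hr [q ->]] := mod7_cases (2 * a + b); rewrite chi_small //.
by do 7 (case: r hr => [|r] hr //).
Qed.

End Chi7.

(** * The Gauss sum modulo 7 *)

Section GaussSum.
Variable R : realType.

Lemma cn_chi (x : int) : cn ((chi x)%:~R : R[i]) <= 1.
Proof.
rewrite cn_int; have h1 : (absz (chi x) <= 1)%N by have := chi_norm x; lia.
by rewrite -(ler_nat R) in h1.
Qed.

Definition gauss7 : R[i] := \sum_(h < 7) (chi h%:Z)%:~R * cis (2 * pi * (h%:R / 7)).

Lemma cn_gauss7 : cn gauss7 <= 7.
Proof.
apply: le_trans (cn_sum _ _ _) _.
apply: le_trans (_ : \sum_(h < 7) (1 : R) <= _); last by rewrite sumr_const card_ord.
apply: ler_sum => h _; by rewrite cnM cn_cis mulr1 cn_chi.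
Qed.

(** For [x] prime to 7, multiplication by [x] permutes the residues; for [x] divisible by 7 both
    sides vanish, as the character has sum 0. Either case is an identity between powers of a seventh
    root of unity. *)
Lemma gauss7_twist (x : int) :
  \sum_(h < 7) (chi h%:Z)%:~R * cis (2 * pi * ((h%:Z * x)%:~R / 7)) = (chi x)%:~R * gauss7 :> R[i].
Proof.
pose z : R[i] := cis (2 * pi * (1 / 7)).
have z7 : z ^+ 7 = 1.
  by rewrite /z -cisMn -[RHS](cis_int R 1); congr cis; rewrite -mulr_natr; field.
have zE (n : nat) : cis (2 * pi * (n%:R / 7)) = z ^+ (n %% 7) :> R[i].
  rewrite (expr_mod _ z7) /z -cisMn; congr cis; rewrite -mulr_natr; by field.
have [r hr [q ->]] := mod7_cases x; rewrite chi_small //.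
have E (h : 'I_7) : cis (2 * pi * ((h%:Z * (q * 7 + r%:Z))%:~R / 7)) = z ^+ ((h * r) %% 7) :> R[i].
  rewrite -zE -[LHS]mul1r -(cis_int R (- (h%:Z * q))) -cisD; congr cis.
  rewrite intrN !intrM intrD intrM rmorph_nat natrM -[(Posz h)%:~R]/(h%:R) -[(Posz r)%:~R]/(r%:R).
  by field.
under eq_bigr do rewrite E.
rewrite /gauss7; under [in RHS]eq_bigr do rewrite zE.
rewrite !big_ord_recr !big_ord0 /=.
clear E.
do 7 (case: r hr => [|r] hr; first by rewrite /= /chi /= ?rmorphN1 ?rmorph0 ?rmorph1; ring).
by [].
Qed.

End GaussSum.

Section FiniteFamilies.
Variable R : realType.

Lemma hasSum_fin_prod (T : eqType) (n : nat) (F : 'I_n -> T -> R[i]) (l : 'I_n -> R[i]) :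
  (forall i, hasSum (F i) (l i)) ->
  hasSum (fun p : 'I_n * T => F p.1 p.2) (\sum_(i < n) l i).
Proof.
move=> h.
have hi (i : 'I_n) : hasSum (fun p : 'I_n * T => if p.1 == i then F p.1 p.2 else 0) (l i).
  have inj : injective (fun t : T => (i, t)) by move=> a b [].
  apply: (hasSum_inj _ inj _).1; last by apply: hasSum_ext (h i) => t /=; rewrite eqxx.
  move=> [j t] hj /=; case: eqP => // e; by case: (hj t); rewrite e.
apply: (hasSum_ext _ (hasSum_sum (index_enum 'I_n) hi)) => p.
by rewrite -big_mkcond /= (big_pred1 p.1) // => i; rewrite eq_sym.
Qed.

End FiniteFamilies.

(** * One-dimensional theta series with character and parity *)

Section ThetaFactors.
Variable R : realType.
Implicit Types (t : R) (u v tau : R[i]) (s x y : int).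

(** The sign [(-1) ^ (s x)]. The product of the signs of two coordinates, summed over [s], detects
    equal parity ([parity_sum]), while for fixed [s] the double series is a product of two
    series. *)
Definition sgn2 (s : bool) (x : int) : R[i] := if s && ~~ (2 %| x)%Z then -1 else 1.

Lemma sgn2_cis (s : bool) x : sgn2 s x = cis (2 * pi * ((s%:R : R) / 2 * x%:~R)).
Proof.
rewrite /sgn2; case: s => /=; last by rewrite mul0r mul0r mulr0 cis0.
case: ifPn => h.
  have -> : x = 2 * (x %/ 2)%Z + 1 by lia.
  rewrite -[LHS]mulr1 -(cis_int R (x %/ 2)%Z) intrD intrM rmorph_nat.
  have -> : 2 * pi * (1 / 2 * (2 * ((x %/ 2)%Z)%:~R + 1%:~R)) = 2 * pi * ((x %/ 2)%Z)%:~R + pi :> R by field.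
  rewrite cisD cis_int mulr1 mul1r /cis /cexp /= expR0 cospi sinpi.
  by apply: ext_complex; rewrite /= ; ring.
have -> : x = 2 * (x %/ 2)%Z by lia.
rewrite -(cis_int R (x %/ 2)%Z) intrM rmorph_nat; congr cis; by field.
Qed.

Lemma cn_sgn2 (s : bool) x : cn (sgn2 s x) = 1.
Proof. by rewrite sgn2_cis cn_cis. Qed.

Lemma sqrt_real_neq0 t : 0 < t -> (t%:C : R[i]) != 0.
Proof. by move=> t0; rewrite -cn_gt0 cn_real gtr0_norm. Qed.

Definition par (s : bool) (x : int) : bool := (2 %| x - (s : nat)%:Z)%Z.

Lemma par_neg (s : bool) x : par s x -> par (~~ s) x = false.
Proof. by rewrite /par; case: s => /=; lia. Qed.

(** The Gauss sum turns the character into a combination of shifts of the argument by [i h / 7], and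
    the sign is a shift by [i s / 2]. On the dual side [l + h / 7 + s / 2 = X / 14] with
    [X = 14 l + 2 h + 7 s], which runs through the integers of the parity of [s], and
    [chi X = chi (2 h) = chi h]. The scale [t / 14] comes from the share [p.1 ^ 2 / 4] of the first
    coordinate in [nm]. *)
Lemma theta_x t tau (s : bool) : 0 < t -> exists S,
  hasSum (fun x => gauss7 R * ((chi x)%:~R * sgn2 s x * gaussL (t / 14) (tau / (4 * pi)%:C) x)) S /\
  hasSum (fun X => if par s X then (chi X)%:~R * gaussR (t / 14) (tau / (4 * pi)%:C) 0 *
     cexp ((- (pi / (14 * t) * X%:~R ^+ 2))%:C + 'i%C * tau * X%:~R / (2 * t)%:C) else 0)
    ((Num.sqrt (t / 14))%:C * S).
Proof.
move=> t0; have t14 : 0 < t / 14 by rewrite divr_gt0.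
have p0 := pi_gt0 R.
pose u (h : 'I_7) : R[i] := tau / (4 * pi)%:C + 'i%C * (h%:R / 7 + (s : nat)%:R / 2).
have /choice [S hS] : forall h, exists S, hasSum (gaussL (t / 14) (u h)) S /\
   hasSum (gaussR (t / 14) (u h)) ((Num.sqrt (t / 14))%:C * S) by move=> h; exact: jacobi_theta.
exists (\sum_(h < 7) (chi h%:Z)%:~R * S h); split.
  have H : hasSum (fun x => \sum_(h < 7) (chi h%:Z)%:~R * gaussL (t / 14) (u h) x) (\sum_(h < 7) (chi h%:Z)%:~R * S h).
    by apply: hasSum_sum => h; apply: hasSumZ; case: (hS h).
  apply: hasSum_ext H => x.
  have E (h : 'I_7) : gaussL (t / 14) (u h) x = cis (2 * pi * ((h%:Z * x)%:~R / 7)) * sgn2 s x * gaussL (t / 14) (tau / (4 * pi)%:C) x.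
    rewrite sgn2_cis -cisD /cis /gaussL -cexpD; congr cexp.
    have -> (r : R) : 0 +i* r = 'i%C * r%:C by apply: ext_complex; rewrite /=; ring.
    rewrite /u intrM -[(Posz h)%:~R]/(h%:R) rC_D.
    move: (pi : R) (sqrt_real_neq0 p0) => P P0.
    rewrite !rCE.
    by ring.
  rewrite (eq_bigr (fun h : 'I_7 => ((chi h%:Z)%:~R * cis (2 * pi * ((h%:Z * x)%:~R / 7))) *
     (sgn2 s x * gaussL (t / 14) (tau / (4 * pi)%:C) x))); last by move=> h _; rewrite E !mulrA.
  rewrite -mulr_suml gauss7_twist.
  by move: (gaussL _ _ _) (gauss7 R) => G1 G2; ring.
have H : hasSum (fun p : 'I_7 * int => (chi p.1%:Z)%:~R * gaussR (t / 14) (u p.1) p.2)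
   ((Num.sqrt (t / 14))%:C * (\sum_(h < 7) (chi h%:Z)%:~R * S h)).
  rewrite mulr_sumr; under eq_bigr do rewrite mulrCA.
  by apply: (hasSum_fin_prod (F := fun h l => (chi h%:Z)%:~R * gaussR (t / 14) (u h) l)) => h; apply: hasSumZ; case: (hS h).
have inj : injective (fun p : 'I_7 * int => 14 * p.2 + 2 * p.1%:Z + 7 * (s : nat)%:Z).
  move=> [h l] [h' l'] /= e.
  have e1 : (h : nat) = h' by have := ltn_ord h; have := ltn_ord h'; lia.
  have e2 : l = l' by have := ltn_ord h; have := ltn_ord h'; lia.
  by rewrite e2; congr pair; apply: val_inj.
apply: (hasSum_inj _ inj _).1; last first.
  apply: hasSum_ext H => -[h l] /=.
  set X : int := 14 * l + 2 * h%:Z + 7 * (s : nat)%:Z.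
  have -> : par s X by rewrite /par /X; case: (s) => /=; lia.
  have -> : chi X = chi h%:Z.
    rewrite -(chi2 h%:Z) (_ : X = (2 * l + (s : nat)%:Z) * 7 + 2 * h%:Z) ?chi_mod // /X; ring.
  rewrite -mulrA; congr (_ * _); rewrite /gaussR -cexpD; congr cexp.
  have EX : 'i%C * (h%:R / 7 + (s : nat)%:R / 2) + 'i%C * l%:~R = 'i%C * (X%:~R / 14) :> R[i].
    rewrite /X 2!intrD 3!intrM 3!rmorph_nat -[(Posz h)%:~R]/(h%:R) -[(Posz (s : nat))%:~R]/((s : nat)%:R).
    by field.
  rewrite /u -addrA EX mulr0 addr0.
  have t0' := sqrt_real_neq0 t0; have p0' := sqrt_real_neq0 p0.
  clearbody X; move: (pi : R) p0' => P.
  rewrite !rCE.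
  move: (t%:C : R[i]) t0' (P%:C : R[i]) => T T0 Q P0.
  have i2 := sqr_i R.
  have -> : (tau / (4 * Q) + 'i%C * (X%:~R / 14)) ^+ 2 = (tau / (4 * Q)) ^+ 2 + 'i%C * tau * X%:~R / (28 * Q) + 'i%C ^+ 2 * (X%:~R / 14) ^+ 2.
    by field.
  by rewrite i2; field; rewrite T0 P0.
move=> X hX; case: ifP => // hp.
case: (boolP (7 %| X)%Z) => h7; first by rewrite chi_dvd // mul0r mul0r.
exfalso.
pose Y : int := (X : int) - 7 * (s : nat)%:Z.
pose h : int := ((Y %/ 2)%Z %% 7)%Z.
have h0 : 0 <= h by apply: modz_ge0.
have h7' : h < 7 by apply: ltz_pmod.
have hn : (absz h < 7)%N by lia.
apply: (hX (Ordinal hn, ((Y %/ 2)%Z %/ 7)%Z)) => /=.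
rewrite gez0_abs // /h /Y; move: hp; rewrite /par; case: (s) => /=; lia.
Qed.

Lemma theta_y t tau (s : bool) : 0 < t -> exists S,
  hasSum (fun y => sgn2 s y * gaussL (t / 2) (tau * (Num.sqrt 7)%:C * 'i%C / (4 * pi)%:C) y) S /\
  hasSum (fun Y => if par s Y then gaussR (t / 2) (tau * (Num.sqrt 7)%:C * 'i%C / (4 * pi)%:C) 0 *
     cexp ((- (pi / (2 * t) * Y%:~R ^+ 2))%:C - tau * (Num.sqrt 7)%:C * Y%:~R / (2 * t)%:C) else 0)
    ((Num.sqrt (t / 2))%:C * S).
Proof.
move=> t0; have t2 : 0 < t / 2 by rewrite divr_gt0.
have p0 := pi_gt0 R.
set v : R[i] := tau * (Num.sqrt 7)%:C * 'i%C / (4 * pi)%:C.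
pose u : R[i] := v + 'i%C * ((s : nat)%:R / 2).
have [S [h1 h2]] := jacobi_theta u t2.
exists S; split.
  apply: hasSum_ext h1 => y.
  rewrite sgn2_cis /cis /gaussL -cexpD; congr cexp.
  have -> (r : R) : 0 +i* r = 'i%C * r%:C by apply: ext_complex; rewrite /=; ring.
  rewrite /u /v; move: (pi : R) (sqrt_real_neq0 p0) => P P0.
  rewrite !rCE.
  by ring.
have inj : injective (fun l : int => 2 * l + (s : nat)%:Z) by move=> a b; lia.
apply: (hasSum_inj _ inj _).1; last first.
  apply: hasSum_ext h2 => l /=.
  set Y : int := 2 * l + (s : nat)%:Z.
  have -> : par s Y by rewrite /par /Y; case: (s) => /=; lia.
  rewrite /gaussR -cexpD; congr cexp.
  have EX : 'i%C * ((s : nat)%:R / 2) + 'i%C * l%:~R = 'i%C * (Y%:~R / 2) :> R[i].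
    rewrite /Y intrD intrM rmorph_nat -[(Posz (s : nat))%:~R]/((s : nat)%:R).
    by field.
  rewrite /u -addrA EX mulr0 addr0.
  have t0' := sqrt_real_neq0 t0; have p0' := sqrt_real_neq0 p0.
  clearbody Y; rewrite /v; move: (pi : R) p0' => P.
  rewrite !rCE.
  move: (t%:C : R[i]) t0' (P%:C : R[i]) ((Num.sqrt 7)%:C : R[i]) => T T0 Q r7 P0.
  have i2 := sqr_i R.
  have -> : (tau * r7 * 'i%C / (4 * Q) + 'i%C * (Y%:~R / 2)) ^+ 2 = (tau * r7 * 'i%C / (4 * Q)) ^+ 2 + 'i%C ^+ 2 * (tau * r7 * Y%:~R / (4 * Q) + (Y%:~R / 2) ^+ 2).
    by field.
  by rewrite i2; field; rewrite T0 P0.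
move=> Y hY; case: ifP => // hp; exfalso.
apply: (hY ((Y - (s : nat)%:Z) %/ 2)%Z); move: hp; rewrite /par; case: (s) => /=; lia.
Qed.

End ThetaFactors.

(** * The two-dimensional theta series and its inversion *)

Section ThetaFunction.
Variable R : realType.
Implicit Types (t : R) (tau : R[i]) (p : int * int).

(* The algebraic integer [a + b eta] is encoded by the pair [p = (2 a + b, b)], and [al p],
   [nm p], [ec p] are its value, its norm and its [epsilon]; a pair of integers of different
   parities encodes nothing, and has [ec p = 0]. *)
Definition al p : R[i] := (p.1%:~R / 2) +i* (p.2%:~R * Num.sqrt 7 / 2).
Definition nm p : R := (p.1%:~R ^+ 2 + 7 * p.2%:~R ^+ 2) / 4.
Definition ec p : R[i] := if (2 %| p.1 - p.2)%Z then (chi p.1)%:~R else 0.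

Lemma alE p : al p = (p.1%:~R + 'i%C * (Num.sqrt 7)%:C * p.2%:~R) / 2.
Proof.
have -> : (2 : R[i])^-1 = (2^-1)%:C by rewrite rC_V rC_nat.
rewrite -!(rC_int R); apply: ext_complex; rewrite /=; ring.
Qed.

Lemma cn_al2 p : cn (al p) ^+ 2 = nm p.
Proof. by rewrite cn_sqr /al /nm /= expr_div_n mulrAC !exprMn sqr_sqrtr //; field. Qed.

Lemma nm_ge0 p : 0 <= nm p.
Proof. by rewrite -cn_al2 sqr_ge0. Qed.

Lemma cn_ec p : cn (ec p) <= 1.
Proof.
by rewrite /ec; case: ifP => _; rewrite ?cn0 ?cn_chi.
Qed.

(* [tau] generates the powers of [al p]: the theta series with harmonic coefficient
   [al p ^ k] is the [k]-th Taylor coefficient of the sum of [Eterm t tau]. *)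
Definition Eterm t tau p : R[i] := ec p * cexp ((- (2 * pi / 7 * t * nm p))%:C + tau * al p).

Lemma parity_sum (x y : int) : sgn2 R false x * sgn2 R false y + sgn2 R true x * sgn2 R true y =
  if (2 %| x - y)%Z then 2 else 0.
Proof.
rewrite /sgn2 /= !mul1r; case: ifPn => h1; case: ifPn => h2; case: ifPn => h3; rewrite ?mulrN1 ?mulr1 ?opprK ?subrr //; exfalso; lia.
Qed.

Lemma par_split (x y : int) : (2 %| x - y)%Z = (par false x && par false y) || (par true x && par true y).
Proof. by rewrite /par /=; lia. Qed.

(** The parity condition becomes a sum over [s] of products of one-dimensional series. After
    inversion [s] reappears as the common parity of the two dual coordinates, so the dual series
    runs over the same lattice. *)
Theorem Eterm_inversion t tau : 0 < t -> exists S, hasSum (Eterm t tau) S /\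
  hasSum (Eterm t^-1 ('i%C * tau / t%:C)) (gauss7 R * t%:C / (Num.sqrt 7)%:C * S).
Proof.
move=> t0; have t14 : 0 < t / 14 by rewrite divr_gt0.
have t2 : 0 < t / 2 by rewrite divr_gt0.
have p0 := pi_gt0 R; have t0' := sqrt_real_neq0 t0; have p0' := sqrt_real_neq0 p0.
set vx := tau / (4 * pi)%:C; set vy := tau * (Num.sqrt 7)%:C * 'i%C / (4 * pi)%:C.
have [C C0 hC] := gaussL_dom vx t14; have [D D0 hD] := gaussL_dom vy t2.
have EE p : Eterm t tau p = ec p * (gaussL (t / 14) vx p.1 * gaussL (t / 2) vy p.2).
  rewrite /Eterm /gaussL -cexpD; congr (_ * cexp _).
  rewrite alE /vx /vy /nm !rCE [(p.1%:~R ^+ 2 + 7 * p.2%:~R ^+ 2)%:C]rC_D !rCE.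
  by move: (t%:C : R[i]) t0' (pi%:C : R[i]) p0' ((Num.sqrt 7)%:C : R[i]) => T T0 P P0 r7; field.
have Edom p : cn (Eterm t tau p) <= (C * wi R p.1) * (D * wi R p.2).
  rewrite EE cnM cnM -[leRHS]mul1r; apply: ler_pM; rewrite ?cn_ge0 ?mulr_ge0 ?cn_ge0 ?cn_ec //.
  by apply: ler_pM; rewrite ?cn_ge0.
have wC : wsum (fun x => C * wi R x) by apply: wsumZ (wsum_wi R) (ltW C0).
have wD : wsum (fun x => D * wi R x) by apply: wsumZ (wsum_wi R) (ltW D0).
have [S hS] := hasSum_exists (wsum_prod wC wD) Edom.
exists S; split => //.
have /choice [X hX] := fun s => theta_x tau s t0.
have /choice [Y hY] := fun s => theta_y tau s t0.
have hP s : hasSum (fun p => gauss7 R * ((chi p.1)%:~R * sgn2 R s p.1 * gaussL (t / 14) vx p.1) *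
    (sgn2 R s p.2 * gaussL (t / 2) vy p.2)) (X s * Y s).
  have [h1 _] := hX s; have [h2 _] := hY s.
  apply: (hasSum_prod (V := fun x => 7 * (C * wi R x)) (W := fun x => D * wi R x) _ _ _ _ h1 h2) => //.
  - exact: wsumZ.
  - move=> x; rewrite -/vx; move: (gaussL (t / 14) vx x) (hC x) => g hg.
    rewrite !cnM cn_sgn2 mulr1; apply: ler_pM; rewrite ?cn_ge0 ?mulr_ge0 ?cn_ge0 ?cn_gauss7 //.
    rewrite -[leRHS]mul1r; apply: ler_pM; rewrite ?cn_ge0 ?cn_chi //.
  - by move=> x; rewrite -/vy; move: (gaussL (t / 2) vy x) (hD x) => g hg; rewrite cnM cn_sgn2 mul1r.
have E1 : 2 * gauss7 R * S = X false * Y false + X true * Y true.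
  apply: (hasSum_unique (hasSumZ (2 * gauss7 R) hS)).
  apply: hasSum_ext (hasSumD (hP false) (hP true)) => p.
  rewrite EE /ec; have := parity_sum p.1 p.2.
  move: (gaussL _ _ _) (gaussL _ _ _) (gauss7 R) => g1 g2 G.
  case: ifP => _ hs.
    transitivity (G * (chi p.1)%:~R * g1 * g2 * (sgn2 R false p.1 * sgn2 R false p.2 + sgn2 R true p.1 * sgn2 R true p.2)); first by ring.
    by rewrite hs; ring.
  transitivity (G * (chi p.1)%:~R * g1 * g2 * (sgn2 R false p.1 * sgn2 R false p.2 + sgn2 R true p.1 * sgn2 R true p.2)); first by ring.
  by rewrite hs; ring.
have [CR CR0 hCR] := gaussR_dom vx t14; have [DR DR0 hDR] := gaussR_dom vy t2.
pose fx s (x : int) := if par s x then (chi x)%:~R * gaussR (t / 14) vx 0 *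
     cexp ((- (pi / (14 * t) * x%:~R ^+ 2))%:C + 'i%C * tau * x%:~R / (2 * t)%:C) else 0 : R[i].
pose fy s (y : int) := if par s y then gaussR (t / 2) vy 0 *
     cexp ((- (pi / (2 * t) * y%:~R ^+ 2))%:C - tau * (Num.sqrt 7)%:C * y%:~R / (2 * t)%:C) else 0 : R[i].
have t0i : 0 < t^-1 by rewrite invr_gt0.
have t14i : 0 < t^-1 / 14 by rewrite divr_gt0.
have t2i : 0 < t^-1 / 2 by rewrite divr_gt0.
have [C' C'0 hC'] := gaussL_dom ('i%C * tau / t%:C / (4 * pi)%:C) t14i.
have [D' D'0 hD'] := gaussL_dom (- (tau / t%:C * (Num.sqrt 7)%:C) / (4 * pi)%:C) t2i.
have ex x : cexp ((- (pi / (14 * t) * x%:~R ^+ 2))%:C + 'i%C * tau * x%:~R / (2 * t)%:C) =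
    gaussL (t^-1 / 14) ('i%C * tau / t%:C / (4 * pi)%:C) x.
  rewrite /gaussL; congr cexp; rewrite !rCE.
  by move: (t%:C : R[i]) t0' (pi%:C : R[i]) p0' => T T0 P P0; field; rewrite ?T0 ?P0.
have ey y : cexp ((- (pi / (2 * t) * y%:~R ^+ 2))%:C - tau * (Num.sqrt 7)%:C * y%:~R / (2 * t)%:C) =
    gaussL (t^-1 / 2) (- (tau / t%:C * (Num.sqrt 7)%:C) / (4 * pi)%:C) y.
  rewrite /gaussL; congr cexp; rewrite !rCE.
  by move: (t%:C : R[i]) t0' (pi%:C : R[i]) p0' => T T0 P P0; field; rewrite ?T0 ?P0.
have hQ s : hasSum (fun p => fx s p.1 * fy s p.2) ((Num.sqrt (t / 14))%:C * X s * ((Num.sqrt (t / 2))%:C * Y s)).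
  have [_ h1] := hX s; have [_ h2] := hY s.
  apply: (hasSum_prod (V := fun x => cn (gaussR (t / 14) vx 0) * (C' * wi R x)) (W := fun x => cn (gaussR (t / 2) vy 0) * (D' * wi R x)) _ _ _ _ h1 h2) => //.
  - by apply: wsumZ; [apply: wsumZ (wsum_wi R) (ltW C'0)|exact: cn_ge0].
  - by apply: wsumZ; [apply: wsumZ (wsum_wi R) (ltW D'0)|exact: cn_ge0].
  - move=> x; case: ifP => _; last by rewrite cn0; apply: mulr_ge0; [exact: cn_ge0|apply: mulr_ge0; [exact: ltW|exact: wt_ge0]].
    rewrite ex cnM cnM -/vx; apply: ler_pM; rewrite ?mulr_ge0 ?cn_ge0 //.
    by rewrite ler_piMl ?cn_ge0 ?cn_chi.
  - move=> x; case: ifP => _; last by rewrite cn0; apply: mulr_ge0; [exact: cn_ge0|apply: mulr_ge0; [exact: ltW|exact: wt_ge0]].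
    by rewrite ey cnM -/vy; apply: ler_pM; rewrite ?mulr_ge0 ?cn_ge0.
have sq : Num.sqrt (t / 14) * Num.sqrt (t / 2) = t / (2 * Num.sqrt 7).
  rewrite -sqrtrM ?(ltW t14) //.
  have s7 : 0 < Num.sqrt (7 : R) by rewrite sqrtr_gt0.
  have -> : t / 14 * (t / 2) = (t / (2 * Num.sqrt 7)) ^+ 2.
    by rewrite expr_div_n exprMn sqr_sqrtr //; field.
  by rewrite sqrtr_sqr ger0_norm // divr_ge0 ?(ltW t0) // mulr_ge0 // ltW.
have -> : gauss7 R * t%:C / (Num.sqrt 7)%:C * S = (Num.sqrt (t / 14))%:C * X false * ((Num.sqrt (t / 2))%:C * Y false)
   + (Num.sqrt (t / 14))%:C * X true * ((Num.sqrt (t / 2))%:C * Y true).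
  transitivity ((Num.sqrt (t / 14) * Num.sqrt (t / 2))%:C * (X false * Y false + X true * Y true)).
    rewrite -E1 sq !rCE.
    have : (Num.sqrt 7)%:C != 0 :> R[i] by apply: sqrt_real_neq0; rewrite sqrtr_gt0.
    by move: (gauss7 R) ((Num.sqrt 7)%:C : R[i]) => G r7 r70; field.
  by rewrite rC_M; ring.
apply: hasSum_ext (hasSumD (hQ false) (hQ true)) => p.
(* The factors quadratic in [tau] from the two coordinates cancel: this is the harmonicity of the
   powers of [al]. *)
have gg : gaussR (t / 14) vx 0 * gaussR (t / 2) vy 0 = 1.
  rewrite /gaussR -cexpD -cexp0; congr cexp.
  rewrite mulr0 !addr0 /vx /vy !rCE.
  have i2 := sqr_i R.
  have r72 : (Num.sqrt 7)%:C ^+ 2 = 7 :> R[i] by rewrite -rC_X sqr_sqrtr // rC_nat.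
  move: (t%:C : R[i]) t0' (pi%:C : R[i]) p0' ((Num.sqrt 7)%:C : R[i]) r72 => T T0 P P0 r7 r72.
  rewrite !exprMn r72 i2; by field; rewrite T0 P0.
have Eg : cexp ((- (pi / (14 * t) * p.1%:~R ^+ 2))%:C + 'i%C * tau * p.1%:~R / (2 * t)%:C) *
   cexp ((- (pi / (2 * t) * p.2%:~R ^+ 2))%:C - tau * (Num.sqrt 7)%:C * p.2%:~R / (2 * t)%:C) =
   cexp ((- (2 * pi / 7 * t^-1 * nm p))%:C + 'i%C * tau / t%:C * al p).
  rewrite -cexpD; congr cexp.
  rewrite alE /nm !rCE [(p.1%:~R ^+ 2 + 7 * p.2%:~R ^+ 2)%:C]rC_D !rCE.
  have i2 := sqr_i R.
  move: (t%:C : R[i]) t0' (pi%:C : R[i]) p0' ((Num.sqrt 7)%:C : R[i]) => T T0 P P0 r7.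
  have -> : 'i%C * tau / T * ((p.1%:~R + 'i%C * r7 * p.2%:~R) / 2) = 'i%C * tau / T * p.1%:~R / 2 + 'i%C ^+ 2 * tau / T * r7 * p.2%:~R / 2.
    by field.
  rewrite i2; by field.
rewrite /Eterm /ec par_split -Eg /fx /fy.
have n1 := @par_neg false p.1; have n2 := @par_neg true p.1.
case h1 : (par false p.1) => /=; case h2 : (par false p.2) => /=;
  case h3 : (par true p.1) => /=; case h4 : (par true p.2) => /=;
  rewrite ?mulr0 ?mul0r ?addr0 ?add0r //; try (by move: (n1 h1); rewrite /= h3);
  move: (cexp _) (cexp _) => c1 c2;
  rewrite -[RHS]mulr1 -gg; move: (gaussR _ _ _) (gaussR _ _ _) => g1 g2; ring.
Qed.

Lemma pow_le_exp (K : nat) : exists2 C : R, 0 < C & forall x : R, 0 <= x -> x ^+ K <= C * expR x.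
Proof.
exists (K.+1%:R ^+ K) => [|x x0]; first by rewrite exprn_gt0 // ltr0n.
case: K => [|K]; first by rewrite !expr0 mul1r -expR0 ler_expR.
have k0 : (0 : R) < K.+2%:R by rewrite ltr0n.
have h : x <= K.+2%:R * expR (x / K.+1%:R).
  have := expR_ge1Dx (x / K.+1%:R) => h.
  have k1 : (0 : R) < K.+1%:R by rewrite ltr0n.
  apply: le_trans (_ : K.+1%:R * expR (x / K.+1%:R) <= _).
    have e : x = K.+1%:R * (x / K.+1%:R) by rewrite mulrC divfK // gt_eqF.
    rewrite {1}e; move: h; move: (x / _) (expR _) => u v h.
    by apply: ler_wpM2l; [exact: ltW|lra].
  by rewrite ler_wpM2r ?expR_ge0 // ler_nat.
apply: le_trans (_ : (K.+2%:R * expR (x / K.+1%:R)) ^+ K.+1 <= _).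
  by rewrite lerXn2r ?nnegrE // mulr_ge0 ?expR_ge0.
rewrite exprMn -expRM_natl mulrC [K.+1%:R * _]mulrC divfK // ?pnatr_eq0 //.
by rewrite mulrC.
Qed.

Lemma cn_al_le p : cn (al p) <= `|p.1|%N%:R + 2 * `|p.2|%N%:R.
Proof.
apply: le_trans (cn_le_ReIm _) _; rewrite /al /=.
have s7 : Num.sqrt (7 : R) <= 4.
  rewrite -[leRHS]ger0_norm // -sqrtr_sqr ler_wsqrtr //; lra.
rewrite !normrM !normfV !natr_absz !intr_norm normr_nat (ger0_norm (sqrtr_ge0 _)).
have h1 : 0 <= `|p.1%:~R : R| by [].
have h2 : 0 <= `|p.2%:~R : R| by [].
have h3 : `|p.2%:~R : R| * Num.sqrt 7 <= `|p.2%:~R : R| * 4 by rewrite ler_wpM2l.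
lra.
Qed.

Lemma gauss2_wi (a b : R) (K : nat) : 0 < a -> exists2 C, 0 < C &
  forall p, cn (al p) ^+ K * expR (b * cn (al p) - a * nm p) <= C * wi2 R p.
Proof.
move=> a0; have [C0 C00 hC0] := pow_le_exp K.
pose b' := `|b| + 1.
have [C1 C10 hC1] := @gauss_wi R (a / 4) b' ltac:(by rewrite divr_gt0).
have [C2 C20 hC2] := @gauss_wi R (a * 7 / 4) (2 * b') ltac:(by rewrite divr_gt0 // mulr_gt0).
exists (C0 * C1 * C2) => [|p]; first by rewrite !mulr_gt0.
apply: le_trans (_ : C0 * expR (cn (al p)) * expR (b * cn (al p) - a * nm p) <= _).
  by rewrite ler_wpM2r ?expR_ge0 // hC0 // cn_ge0.
rewrite -mulrA -expRD.
have -> : C0 * C1 * C2 * wi2 R p = C0 * ((C1 * wi R p.1) * (C2 * wi R p.2)) by rewrite /wi2; ring.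
apply: ler_wpM2l; first exact: ltW.
apply: le_trans (ler_pM (expR_ge0 _) (expR_ge0 _) (hC1 p.1) (hC2 p.2)).
rewrite -expRD ler_expR /nm !int_sqr.
have h1 := cn_al_le p; have h0 := cn_ge0 (al p).
have h2 : b * cn (al p) + cn (al p) <= b' * cn (al p).
  by rewrite /b' mulrDl mul1r lerD2r ler_wpM2r // ler_norm.
have h3 : b' * cn (al p) <= b' * (`|p.1|%N%:R + 2 * `|p.2|%N%:R).
  by rewrite ler_wpM2l // addr_ge0.
have e : a * ((`|p.1|%N%:R ^+ 2 + 7 * `|p.2|%N%:R ^+ 2) / 4) = a / 4 * `|p.1|%N%:R ^+ 2 + a * 7 / 4 * `|p.2|%N%:R ^+ 2 by field.
rewrite e; apply: le_trans (_ : b' * (`|p.1|%N%:R + 2 * `|p.2|%N%:R) - (a / 4 * `|p.1|%N%:R ^+ 2 + a * 7 / 4 * `|p.2|%N%:R ^+ 2) <= _).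
  by rewrite addrA lerD2r (le_trans _ h3) // addrC.
by rewrite le_eqVlt; apply/orP; left; apply/eqP; ring.
Qed.

Definition Tk t (k : nat) p : R[i] := ec p * al p ^+ k * (expR (- (2 * pi / 7 * t * nm p)))%:C.

Lemma Tk_dom t k : 0 < t -> exists2 C : R, 0 < C & forall p, cn (Tk t k p) <= C * wi2 R p.
Proof.
move=> t0; have c0 : 0 < 2 * pi / 7 * t by rewrite mulr_gt0 // divr_gt0 // mulr_gt0 // pi_gt0.
have [C C0 hC] := gauss2_wi 0 k c0; exists C => // p.
apply: le_trans (hC p); rewrite mul0r add0r !cnM cnX cn_real ger0_norm ?expR_ge0 //.
by rewrite ler_wpM2r ?expR_ge0 // ler_piMl ?exprn_ge0 ?cn_ge0 ?cn_ec.
Qed.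

Lemma Tk_sum t k : 0 < t -> exists S, hasSum (Tk t k) S.
Proof.
move=> t0; have [C C0 hC] := Tk_dom k t0.
by apply: hasSum_exists hC; exact: (wsumZ (wsum_wi2 R) (ltW C0)).
Qed.

Lemma Eterm_expansion t (n : nat) (A : nat -> R[i]) : 0 < t -> (forall k, hasSum (Tk t k) (A k)) ->
  exists2 C : R, 0 < C & forall tau S, cn tau <= 1 -> hasSum (Eterm t tau) S ->
    cn (S - \sum_(j < n) tau ^+ j / (j`!)%:R * A j) <= C * cn tau ^+ n.
Proof.
move=> t0 hA; have c0 : 0 < 2 * pi / 7 * t by rewrite mulr_gt0 // divr_gt0 // mulr_gt0 // pi_gt0.
have [C C0 hC] := gauss2_wi 1 n c0.
have [_ [M hM]] := wsum_wi2 R.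
exists (C * (1 + M)).
  rewrite mulr_gt0 // ltr_pwDl //; have := hM [::] isT; by rewrite big_nil.
move=> tau S ht hS.
have h : hasSum (fun p => Eterm t tau p - \sum_(j < n) tau ^+ j / (j`!)%:R * Tk t j p)
   (S - \sum_(j < n) tau ^+ j / (j`!)%:R * A j).
  rewrite -[- (\sum_(j < n) _)]mulN1r.
  apply: (hasSum_ext _ (hasSumD hS (hasSumZ (-1) (hasSum_sum (f := fun (j : 'I_n) p => tau ^+ j / (j`!)%:R * Tk t j p) (index_enum _) (fun j => hasSumZ _ (hA j)))))) => p.
  by rewrite mulN1r.
apply: (hasSum_le (W := fun p => cn tau ^+ n * (C * wi2 R p)) h).
  move=> p.
  have -> : Eterm t tau p - \sum_(j < n) tau ^+ j / (j`!)%:R * Tk t j p =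
     ec p * (expR (- (2 * pi / 7 * t * nm p)))%:C * (cexp (tau * al p) - exp_poly n (tau * al p)).
    rewrite /Eterm cexpD cexp_real mulrBr mulrA; congr (_ - _).
    by rewrite /exp_poly mulr_sumr; apply: eq_bigr => j _; rewrite /Tk exprMn; ring.
  rewrite !cnM cn_real ger0_norm ?expR_ge0 //.
  apply: le_trans (_ : expR (- (2 * pi / 7 * t * nm p)) * (cn (tau * al p) ^+ n * expR (cn (tau * al p))) <= _).
    apply: ler_pM; rewrite ?mulr_ge0 ?cn_ge0 ?expR_ge0 ?cexp_taylor //.
    by rewrite ler_piMl ?expR_ge0 ?cn_ec.
  apply: le_trans (ler_wpM2l _ (hC p)); last by rewrite exprn_ge0 ?cn_ge0.
  rewrite cnM exprMn mulrCA mulrA [leRHS]mulrA mul1r expRD mulrAC -!mulrA.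
  do 2 (apply: ler_wpM2l; first by rewrite exprn_ge0 ?cn_ge0).
  by rewrite ler_wpM2r ?expR_ge0 // ler_expR ler_piMl ?cn_ge0.
move=> B uB; rewrite -mulr_sumr -mulr_sumr mulrC.
rewrite ler_wpM2r ?exprn_ge0 ?cn_ge0 // ler_wpM2l ?(ltW C0) //.
by apply: le_trans (hM B uB) _; rewrite lerDr.
Qed.

(** The limit at 0 yields the constant coefficient; then one divides by [x]. *)
Lemma small_poly_zero (n : nat) (c : nat -> R[i]) (C d : R) : 0 < d ->
  (forall x : R, 0 < x <= d -> cn (\sum_(j < n) c j * x%:C ^+ j) <= C * x ^+ n) ->
  forall j, (j < n)%N -> c j = 0.
Proof.
move=> d0; elim: n c => [//|n IH] c h.
have c0 : c 0%N = 0.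
  apply/eqP; rewrite -cn_eq0; apply/eqP/le_anti; rewrite cn_ge0 andbT.
  apply/ler_addgt0Pr => e e0; rewrite add0r.
  pose M := `|C| + \sum_(j < n) cn (c j.+1) + 1.
  have M0 : 0 < M by rewrite ltr_wpDl // addr_ge0 ?sumr_ge0 // => *; exact: cn_ge0.
  pose x := Num.min (Num.min d 1) (e / M).
  have x0 : 0 < x by rewrite !lt_min d0 ltr01 divr_gt0.
  have : x <= x by []. rewrite {2}/x !le_min => /andP[/andP[xd x1] xe].
  have := h x ltac:(by rewrite x0 xd).
  rewrite big_ord_recl expr0 mulr1 => hx.
  have hr : cn (\sum_(i < n) c (bump 0 i) * x%:C ^+ bump 0 i) <= (\sum_(j < n) cn (c j.+1)) * x.
    apply: le_trans (cn_sum _ _ _) _; rewrite mulr_suml; apply: ler_sum => i _.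
    rewrite cnM cnX cn_real gtr0_norm // ler_wpM2l ?cn_ge0 //.
    by rewrite /bump /= add1n exprS ler_piMr ?(ltW x0) // exprn_ile1 // ltW.
  set s := \sum_(i < n) _ in hx hr.
  have hC : C * x ^+ n.+1 <= `|C| * x.
    apply: le_trans (_ : `|C| * x ^+ n.+1 <= _); first by rewrite ler_wpM2r ?exprn_ge0 ?(ltW x0) // ler_norm.
    by rewrite ler_wpM2l // exprS ler_piMr ?(ltW x0) // exprn_ile1 // ltW.
  have -> : c 0%N = (c 0%N + s) - s by ring.
  apply: le_trans (cnB _ _) _.
  have hM : M * x <= e by rewrite mulrC -ler_pdivlMr.
  have hM2 : `|C| * x + (\sum_(j < n) cn (c j.+1)) * x <= M * x by rewrite /M !mulrDl mul1r lerDl ltW.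
  move: hx hr hC hM hM2; move: (_ * x) (_ * x) (M * x) (C * _) => *; lra.
move=> [//|j] hj; apply: (IH (fun j => c j.+1)) => // x hx.
have /andP[x0 _] := hx.
have := h x hx; rewrite big_ord_recl c0 mul0r add0r.
have -> : \sum_(i < n) c (lift ord0 i) * x%:C ^+ lift ord0 i = x%:C * \sum_(j0 < n) c j0.+1 * x%:C ^+ j0.
  by rewrite mulr_sumr; apply: eq_bigr => i _; rewrite /= /bump /= add1n exprS mulrCA.
by rewrite cnM cn_real gtr0_norm // exprS mulrCA ler_pM2l.
Qed.

(** The coefficients of [tau ^ k] on both sides of [Eterm_inversion] are compared along small
    positive [tau]; the argument [i tau / t] of the dual series produces the factor
    [(i / t) ^ k]. *)
Theorem theta_inversion t k S S' : 0 < t -> hasSum (Tk t k) S -> hasSum (Tk t^-1 k) S' ->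
  ('i%C / t%:C) ^+ k * S' = gauss7 R * t%:C / (Num.sqrt 7)%:C * S.
Proof.
move=> t0 hS hS'; have ti0 : 0 < t^-1 by rewrite invr_gt0.
have /choice [A hA] := fun k => Tk_sum k t0.
have /choice [B hB] := fun k => Tk_sum k ti0.
rewrite (hasSum_unique hS (hA k)) (hasSum_unique hS' (hB k)).
set G := gauss7 R * t%:C / (Num.sqrt 7)%:C.
have [C C0 hC] := Eterm_expansion k.+1 t0 hA.
have [D D0 hD] := Eterm_expansion k.+1 ti0 hB.
pose c j := (('i%C / t%:C) ^+ j * B j - G * A j) / (j`!)%:R.
have ci : cn ('i%C : R[i]) = 1 by rewrite /cn /= expr0n add0r expr1n sqrtr1.
(* The dual expansion is used at [i x / t], whose modulus must be at most 1 as well. *)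
pose d := Num.min 1 t.
have d0 : 0 < d by rewrite lt_min ltr01.
have ck : c k = 0.
  apply: (@small_poly_zero k.+1 c (D * t^-1 ^+ k.+1 + cn G * C) d d0 _ k (ltnSn k)) => x /andP[x0 xd].
  have [x1 xt] : x <= 1 /\ x <= t by move: xd; rewrite /d le_min => /andP[].
  have [E [hE1 hE2]] := Eterm_inversion x%:C t0; rewrite -/G in hE2.
  have b1 := hC x%:C E ltac:(by rewrite cn_real gtr0_norm) hE1.
  have cx : cn ('i%C * x%:C / t%:C) = x / t.
    by rewrite !cnM cnV !cn_real ci mul1r !gtr0_norm.
  have b2 := hD ('i%C * x%:C / t%:C) (G * E) ltac:(by rewrite cx ler_pdivrMr // mul1r) hE2.
  rewrite cx in b2; rewrite cn_real gtr0_norm // in b1.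
  have -> : \sum_(j < k.+1) c j * x%:C ^+ j =
     G * (E - \sum_(j < k.+1) x%:C ^+ j / (j`!)%:R * A j) - (G * E - \sum_(j < k.+1) ('i%C * x%:C / t%:C) ^+ j / (j`!)%:R * B j).
    rewrite (_ : forall a b c d : R[i], a * (b - c) - (a * b - d) = d - a * c); last by move=> *; ring.
    rewrite mulr_sumr -sumrB; apply: eq_bigr => j _.
    rewrite /c !exprMn; ring.
  apply: le_trans (cnB _ _) _; rewrite addrC mulrDl; apply: lerD.
    by apply: le_trans b2 _; rewrite exprMn -mulrA [t^-1 ^+ _ * _]mulrC.
  by rewrite cnM -mulrA ler_wpM2l ?cn_ge0.
move: ck; rewrite /c => /eqP; rewrite mulf_eq0 invr_eq0 pnatr_eq0 -[(k`! == 0)%N]negbK -lt0n fact_gt0 orbF subr_eq0.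
by move=> /eqP.
Qed.

End ThetaFunction.

(** * Convergence at the central point *)

Section SecondOrder.
Variable R : realType.
Implicit Types (rho M N : R) (phi psi : int -> R[i]) (r : int).

Lemma cn_le_mul (z w : R[i]) (x y : R) : cn z <= x -> cn w <= y -> cn (z * w) <= x * y.
Proof. by move=> h1 h2; rewrite cnM ler_pM ?cn_ge0. Qed.

Lemma cn_le_add (z w : R[i]) (x y : R) : cn z <= x -> cn w <= y -> cn (z + w) <= x + y.
Proof. by move=> h1 h2; apply: le_trans (cnD _ _) _; exact: lerD. Qed.

(* [phi r = A + B r + O(rho ^ 2)] for small [r], with [A = O(1)] and [B = O(rho)] *)
Definition lin2 rho M phi := exists A B : R[i], [/\ cn A <= M, cn B <= M * rho &
  forall r, (`|r| <= 3)%N -> cn (phi r - A - B * r%:~R) <= M * rho ^+ 2].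

Variable rho : R.
Hypothesis rho_ge0 : 0 <= rho.
Hypothesis rho_le : 16 * rho <= 1.

Lemma lin2_ext M phi psi : phi =1 psi -> lin2 rho M phi -> lin2 rho M psi.
Proof. by move=> e [A [B [h1 h2 h3]]]; exists A, B; split=> // r hr; rewrite -e h3. Qed.

Lemma lin2_ge0 M phi : lin2 rho M phi -> 0 <= M.
Proof. by move=> [A [B [h1 _ _]]]; exact: le_trans (cn_ge0 _) h1. Qed.

Lemma cn_int3 r : (`|r| <= 3)%N -> cn (r%:~R : R[i]) <= 3.
Proof. by rewrite cn_int -(ler_nat R). Qed.

Lemma lin2W M N phi : M <= N -> lin2 rho M phi -> lin2 rho N phi.
Proof.
move=> hMN [A [B [h1 h2 h3]]]; exists A, B; split=> [||r hr].
- exact: le_trans h1 hMN.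
- by apply: le_trans h2 _; rewrite ler_wpM2r.
- by apply: le_trans (h3 r hr) _; rewrite ler_wpM2r // exprn_ge0.
Qed.

Lemma lin2D M N phi psi : lin2 rho M phi -> lin2 rho N psi ->
  lin2 rho (M + N) (fun r => phi r + psi r).
Proof.
move=> [A [B [a1 a2 a3]]] [A' [B' [b1 b2 b3]]]; exists (A + A'), (B + B'); split=> [||r hr].
- exact: cn_le_add.
- by rewrite mulrDl; exact: cn_le_add.
rewrite (_ : _ - _ - _ = (phi r - A - B * r%:~R) + (psi r - A' - B' * r%:~R)); last by ring.
by rewrite mulrDl; apply: cn_le_add; [exact: a3|exact: b3].
Qed.

(** The factor 18 is [1 + 3 + 1 + 3 + 1 + 9], from the products that enter the second order error
    for [|r| <= 3] and [rho <= 1]. *)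
Lemma lin2M M N phi psi : lin2 rho M phi -> lin2 rho N psi ->
  lin2 rho (18 * M * N) (fun r => phi r * psi r).
Proof.
move=> h1 h2; have M0 := lin2_ge0 h1; have N0 := lin2_ge0 h2.
case: h1 => [A [B [a1 a2 a3]]]; case: h2 => [A' [B' [b1 b2 b3]]].
have MN : 0 <= M * N by rewrite mulr_ge0.
have r1 : rho <= 1 by apply: le_trans rho_le; rewrite ler_peMl ?ler1n.
exists (A * A'), (A * B' + B * A'); split=> [||r hr].
- by apply: le_trans (cn_le_mul a1 b1) _; rewrite -mulrA ler_peMl //; lra.
- apply: le_trans (cn_le_add (cn_le_mul a1 b2) (cn_le_mul a2 b1)) _.
  have e : M * (N * rho) + M * rho * N = 2 * (M * N * rho) by ring.
  have e2 : 18 * M * N * rho = 18 * (M * N * rho) by ring.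
  by rewrite e e2 ler_wpM2r ?mulr_ge0 //; lra.
have := a3 r hr; have := b3 r hr; have := cn_int3 hr.
set E := phi r - A - B * r%:~R; set E' := psi r - A' - B' * r%:~R => r3 hE' hE.
have -> : phi r * psi r - A * A' - (A * B' + B * A') * r%:~R =
   A * E' + B * r%:~R * E' + E * (A' + B' * r%:~R + E') + B * B' * (r%:~R * r%:~R).
  by rewrite /E /E'; ring.
apply: le_trans (cn_le_add (cn_le_add (cn_le_add (cn_le_mul a1 hE') (cn_le_mul (cn_le_mul a2 r3) hE'))
   (cn_le_mul hE (cn_le_add (cn_le_add b1 (cn_le_mul b2 r3)) hE'))) (cn_le_mul (cn_le_mul a2 b2) (cn_le_mul r3 r3))) _.
have -> : M * (N * rho ^+ 2) + M * rho * 3 * (N * rho ^+ 2) + M * rho ^+ 2 * (N + N * rho * 3 + N * rho ^+ 2) + M * rho * (N * rho) * (3 * 3)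
   = (M * N * rho ^+ 2) * (1 + 3 * rho + 1 + 3 * rho + rho ^+ 2 + 9) by ring.
have -> : 18 * M * N * rho ^+ 2 = (M * N * rho ^+ 2) * 18 by ring.
apply: ler_wpM2l; first by rewrite mulr_ge0 ?exprn_ge0.
have : rho ^+ 2 <= 1 by rewrite exprn_ile1.
lra.
Qed.

Lemma lin2Z M c phi : lin2 rho M phi -> lin2 rho (cn c * M) (fun r => c * phi r).
Proof.
move=> [A [B [a1 a2 a3]]]; exists (c * A), (c * B); split=> [||r hr].
- by apply: cn_le_mul.
- by rewrite -mulrA; apply: cn_le_mul.
rewrite -mulrA -!mulrBr -mulrA; apply: cn_le_mul => //; exact: a3.
Qed.

Lemma lin2_cst c : lin2 rho (cn c) (fun=> c).
Proof.
exists c, 0; split=> // [|r hr]; first by rewrite cn0 mulr_ge0 ?cn_ge0.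
by rewrite subrr mul0r subr0 cn0 mulr_ge0 ?cn_ge0 ?exprn_ge0.
Qed.

Lemma lin2X M n phi : lin2 rho M phi -> lin2 rho ((18 * (1 + M)) ^+ n) (fun r => phi r ^+ n).
Proof.
move=> h; have M0 := lin2_ge0 h; elim: n => [|n IH].
  by apply: lin2W (lin2_cst 1); rewrite expr0 cn1.
apply: (lin2W (M := 18 * M * (18 * (1 + M)) ^+ n)); last first.
  by apply: lin2_ext (lin2M h IH) => r; rewrite exprS.
rewrite exprS ler_wpM2r ?exprn_ge0 //; lra.
Qed.

Lemma lin2_sum M n (phi : nat -> int -> R[i]) : 0 <= M -> (forall j, (j < n)%N -> lin2 rho M (phi j)) ->
  lin2 rho (n%:R * M) (fun r => \sum_(j < n) phi j r).
Proof.
move=> M0; elim: n => [|n IH] h.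
  by apply: lin2W (lin2_ext _ (lin2_cst 0)) => [|r]; rewrite ?cn0 ?mul0r // big_ord0.
rewrite -natr1 mulrDl mul1r.
have hn : lin2 rho (n%:R * M) (fun r => \sum_(j < n) phi j r) by apply: IH => j hj; apply: h; rewrite ltnS ltnW.
by apply: lin2_ext (lin2D hn (h n (ltnSn n))) => r; rewrite big_ord_recr.
Qed.

(* [chi] is orthogonal on [-3 .. 3] to the constants and to the identity: [1 + 2 - 3 = 0]. *)
Lemma chi_lin2 M phi : lin2 rho M phi ->
  cn (\sum_(h < 7) (chi (h%:Z - 3))%:~R * phi (h%:Z - 3)) <= 7 * M * rho ^+ 2.
Proof.
move=> [A [B [a1 a2 a3]]].
have -> : \sum_(h < 7) (chi (h%:Z - 3))%:~R * phi (h%:Z - 3) =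
  \sum_(h < 7) (chi (h%:Z - 3))%:~R * (phi (h%:Z - 3) - A - B * (h%:Z - 3)%:~R).
  rewrite !big_ord_recr !big_ord0 /= /chi /=; ring.
apply: le_trans (cn_sum _ _ _) _.
apply: le_trans (_ : \sum_(h < 7) (M * rho ^+ 2) <= _); last first.
  by rewrite sumr_const card_ord -[leLHS]mulr_natl mulrA.
apply: ler_sum => h _; rewrite -[leRHS]mul1r.
by apply: cn_le_mul; [exact: cn_chi|apply: a3; have := ltn_ord h; lia].
Qed.

End SecondOrder.

(** * Second order expansions of the factors of a term *)

Section SecondOrderComponents.
Variable R : realType.
Variable lam : R[i].
Hypothesis lam_ge : 16 <= cn lam.
Let rho : R := (cn lam)^-1.

(** The relative change of the norm when [lam] is shifted by the integer [r] ([cn_shift2]). *)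
Definition vshift (r : int) : R := 2 * r%:~R * complex.Re lam^-1 + r%:~R ^+ 2 * rho ^+ 2.

Lemma rho0 : 0 <= rho. Proof. by rewrite invr_ge0 cn_ge0. Qed.

Lemma rho16 : 16 * rho <= 1.
Proof. by rewrite /rho ler_pdivrMr ?mul1r // (lt_le_trans _ lam_ge). Qed.

Lemma lam_neq0 : lam != 0.
Proof. by rewrite -cn_gt0 (lt_le_trans _ lam_ge). Qed.

Lemma cn_shift2 (r : int) : cn (1 + r%:~R / lam) ^+ 2 = 1 + vshift r.
Proof.
rewrite cn_sqr /vshift /rho -cnV cn_sqr -(rC_int R).
case: (lam^-1) => a b /=; ring.
Qed.

Lemma vshift_le (r : int) : (`|r| <= 3)%N -> `|vshift r| <= 7 * rho.
Proof.
move=> hr; have r0 := rho0; have r16 := rho16.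
have hR : `|complex.Re lam^-1| <= rho by rewrite /rho -cnV; exact: Re_le_cn.
have h3 : `|r%:~R : R| <= 3 by rewrite -cn_real rC_int cn_int3.
apply: le_trans (ler_normD _ _) _; rewrite !normrM normr_nat (ger0_norm r0) -!mulrA.
have e1 : `|r%:~R : R| * `|complex.Re lam^-1| <= 3 * rho by rewrite ler_pM.
have e2 : (`|r%:~R : R| * `|r%:~R : R|) * (rho * rho) <= 9 * (rho * rho).
  by rewrite ler_wpM2r ?mulr_ge0 // (_ : 9 = 3 * 3) ?ler_pM //; ring.
have e3 : rho * rho <= 16^-1 * rho.
  by rewrite ler_wpM2r // -[leRHS]mulr1 ler_pdivlMl.
rewrite [X in _ + X]mulrA.
apply: le_trans (_ : 2 * (3 * rho) + 9 * (16^-1 * rho) <= _).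
  by apply: lerD; rewrite ?ler_wpM2l //; apply: le_trans e2 _; rewrite ler_wpM2l.
by rewrite !mulrA -mulrDl ler_wpM2r //; lra.
Qed.

Lemma vshift_half (r : int) : (`|r| <= 3)%N -> `|vshift r| <= 2^-1.
Proof.
move=> hr; apply: le_trans (vshift_le hr) _; have := rho16; have := rho0; move: (rho) => x *; lra.
Qed.

Lemma lin2_base : lin2 rho 1 (fun r => 1 + r%:~R / lam).
Proof.
exists 1, lam^-1; split=> [||r hr]; first by rewrite cn1.
  by rewrite cnV mul1r.
rewrite (_ : _ - _ - _ = 0) ?cn0 ?mul1r ?exprn_ge0 ?rho0 //.
by ring.
Qed.

(** The constant 58 is [49 + 9]: the remainder of [f] is controlled by [v ^ 2 <= (7 rho) ^ 2], and
    the quadratic part of the shift itself is at most [(3 rho) ^ 2]. *)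
Lemma lin2_comp (f : R -> R[i]) (A B : R[i]) (K : R) : cn A <= K -> cn B <= K ->
  (forall v : R, `|v| <= 2^-1 -> cn (f v - A - B * v%:C) <= K * v ^+ 2) ->
  lin2 rho (58 * K) (fun r => f (vshift r)).
Proof.
move=> hA hB hf; have K0 : 0 <= K := le_trans (cn_ge0 _) hA.
have r0 := rho0.
have hR : `|complex.Re lam^-1| <= rho by rewrite /rho -cnV; exact: Re_le_cn.
exists A, (B * (2 * complex.Re lam^-1)%:C); split=> [||r hr].
- by apply: le_trans hA _; rewrite ler_peMl //; lra.
- apply: le_trans (cn_le_mul hB (lexx _)) _; rewrite cn_real normrM normr_nat [leRHS]mulrAC mulrC; apply: ler_wpM2r => //.
  by move: hR; move: `|_| (rho) r0 => x y *; lra.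
have -> : f (vshift r) - A - B * (2 * complex.Re lam^-1)%:C * r%:~R =
   (f (vshift r) - A - B * (vshift r)%:C) + B * (r%:~R ^+ 2 * rho ^+ 2)%:C.
  have -> : (vshift r)%:C = (2 * complex.Re lam^-1)%:C * r%:~R + (r%:~R ^+ 2 * rho ^+ 2)%:C.
    rewrite -(rC_int R) -rC_M -rC_D /vshift; congr (_%:C); ring.
  by move: (_%:C) (_%:C) => u w; ring.
have h3 : `|r%:~R : R| <= 3 by rewrite -cn_real rC_int cn_int3.
have hv : vshift r ^+ 2 <= 49 * rho ^+ 2.
  rewrite -[leLHS]ger0_norm ?sqr_ge0 // normrX (_ : 49 * rho ^+ 2 = (7 * rho) ^+ 2); last by ring.
  by rewrite lerXn2r ?nnegrE ?normr_ge0 ?mulr_ge0 ?vshift_le.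
have h9 : cn (r%:~R ^+ 2 * rho ^+ 2)%:C <= 9 * rho ^+ 2.
  rewrite cn_real normrM !normrX (ger0_norm r0) ler_wpM2r ?exprn_ge0 //.
  by rewrite (_ : 9 = 3 ^+ 2) ?lerXn2r ?nnegrE //; ring.
apply: le_trans (cn_le_add (hf _ (vshift_half hr)) (cn_le_mul hB h9)) _.
have : K * vshift r ^+ 2 <= K * (49 * rho ^+ 2) by rewrite ler_wpM2l.
by rewrite (_ : 58 * K * rho ^+ 2 = K * (49 * rho ^+ 2) + K * (9 * rho ^+ 2)) ?lerD2r //; ring.
Qed.

Lemma ln_quad (v : R) : `|v| <= 2^-1 -> `|ln (1 + v) - v| <= 2 * v ^+ 2.
Proof.
rewrite ler_norml => /andP[v1 v2].
have p1 : 0 < 1 + v by lra.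
have u1 : ln (1 + v) <= v by apply: le_ln1Dx; lra.
have u2 : v / (1 + v) <= ln (1 + v).
  have -> : ln (1 + v) = - ln (1 + - (v / (1 + v))).
    have -> : 1 + - (v / (1 + v)) = (1 + v)^-1 by field; rewrite gt_eqF.
    by rewrite lnV ?posrE // opprK.
  rewrite lerNr; apply: le_ln1Dx; rewrite ltrN2 ltr_pdivrMr //; lra.
have u3 : v - 2 * v ^+ 2 <= v / (1 + v).
  rewrite ler_pdivlMr // -subr_ge0 (_ : _ - _ = v ^+ 2 * (1 + 2 * v)); last by ring.
  by rewrite mulr_ge0 ?sqr_ge0 //; lra.
rewrite ler_norml; apply/andP; split; last first.
  by have := sqr_ge0 v; move: (v ^+ 2) => *; lra.
by move: u2 u3; move: (v / _) (v ^+ 2) (ln _) => *; lra.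
Qed.

Lemma lin2_cpow (w : R[i]) (W : R) : cn w <= W ->
  lin2 rho (58 * (1 + 2 * W + 4 * W ^+ 2 * expR W)) (fun r => cexp (- (w * (ln (1 + vshift r))%:C))).
Proof.
move=> hw; have W0 : 0 <= W := le_trans (cn_ge0 _) hw.
have X0 : 0 <= 4 * W ^+ 2 * expR W by rewrite !mulr_ge0 ?exprn_ge0 ?expR_ge0.
apply: (lin2_comp (f := fun v => cexp (- (w * (ln (1 + v))%:C))) (A := 1) (B := - w)).
- by rewrite cn1; move: (_ * expR _) X0 => *; lra.
- by rewrite cnN; move: (_ * expR _) X0 => *; lra.
move=> v hv; have hl := ln_quad hv.
have hl2 : `|ln (1 + v)| <= 2 * `|v|.
  rewrite -[ln (1 + v)](subrK v); apply: le_trans (ler_normD _ _) _.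
  have : v ^+ 2 <= 2^-1 * `|v|.
    by rewrite -[leLHS]ger0_norm ?sqr_ge0 // normrX expr2 ler_wpM2r.
  move: hl; move: `|_ - _| `|v| (v ^+ 2) => *; lra.
set l := ln (1 + v) in hl hl2 *.
have hz : cn (- (w * l%:C)) <= W * (2 * `|v|) by rewrite cnN; apply: cn_le_mul => //; rewrite cn_real.
have -> : cexp (- (w * l%:C)) - 1 - - w * v%:C = (cexp (- (w * l%:C)) - 1 - - (w * l%:C)) + (- w) * (l - v)%:C.
  by rewrite rC_D rC_N; move: (cexp _) => c; ring.
have b1 : cn (- w * (l - v)%:C) <= W * (2 * v ^+ 2).
  by apply: cn_le_mul; rewrite ?cnN // cn_real.
have b2 : cn (cexp (- (w * l%:C)) - 1 - - (w * l%:C)) <= (W * (2 * `|v|)) ^+ 2 * expR W.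
  apply: le_trans (cexp_lin _) _; apply: ler_pM; rewrite ?exprn_ge0 ?cn_ge0 ?expR_ge0 //.
    by rewrite lerXn2r ?nnegrE ?cn_ge0 // mulr_ge0 // mulr_ge0.
  rewrite ler_expR; apply: le_trans hz _; rewrite ler_piMr //; lra.
apply: le_trans (cn_le_add b2 b1) _.
rewrite !exprMn -normrX ger0_norm ?sqr_ge0 //.
rewrite (_ : (1 + 2 * W + 4 * W ^+ 2 * expR W) * v ^+ 2 = (W ^+ 2 * (2 ^+ 2 * v ^+ 2) * expR W + W * (2 * v ^+ 2)) + v ^+ 2); last by ring.
by rewrite lerDl sqr_ge0.
Qed.

Lemma lin2_pow1 j : lin2 rho ((18 * (1 + 58)) ^+ j) (fun r => (1 + vshift r)%:C ^+ j).
Proof.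
apply: lin2X; [exact: rho0|exact: rho16|].
have -> : (58 : R) = 58 * 1 by rewrite mulr1.
apply: (lin2_comp (f := fun v => (1 + v)%:C) (A := 1) (B := 1)); rewrite ?cn1 // => v _.
by rewrite rC_D (_ : _ - _ - _ = 0) ?cn0 ?mul1r ?sqr_ge0 //; ring.
Qed.

End SecondOrderComponents.

Section ExpComponent.
Variable R : realType.

Lemma rC_sum (I : Type) (s : seq I) (f : I -> R) :
  (\sum_(i <- s) f i)%:C = \sum_(i <- s) (f i)%:C :> R[i].
Proof. exact: rmorph_sum. Qed.

(** Uniformity in [X] is the point, as it makes the block estimates independent of the cutoff. Each
    order in [v] costs a power of [X], which the exponential absorbs; for [|v| <= 1 / 2] a factor
    [exp (- X / 2)] is left in the remainder. *)
Lemma lin2_exp (j : nat) : exists2 K : R, 0 < K & forall (lam : R[i]) (X : R), 16 <= cn lam -> 0 <= X ->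
  lin2 (cn lam)^-1 K (fun r => (X ^+ j * expR (- (X * (1 + vshift lam r))))%:C).
Proof.
have [C0 C00 h0] := pow_le_exp R j; have [C1 C10 h1] := pow_le_exp R j.+1.
have [C2 C20 h2] := pow_le_exp R j.+2.
pose K := C0 + C1 + 2 ^+ j.+2 * C2.
have K0 : 0 < K by rewrite !addr_gt0 // mulr_gt0 // exprn_gt0.
have K2 : 0 <= 2 ^+ j.+2 * C2 by rewrite mulr_ge0 // ?exprn_ge0 // ltW.
exists (58 * K) => [|lam X hlam X0]; first by rewrite mulr_gt0.
apply: (lin2_comp hlam (f := fun v => (X ^+ j * expR (- (X * (1 + v))))%:C)
  (A := (X ^+ j * expR (- X))%:C) (B := (- (X ^+ j.+1 * expR (- X)))%:C)).
- rewrite cn_real ger0_norm ?mulr_ge0 ?exprn_ge0 ?expR_ge0 // expRN ler_pdivrMr ?expR_gt0 //.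
  apply: le_trans (h0 X X0) _; rewrite ler_wpM2r ?expR_ge0 // /K; lra.
- rewrite cn_real normrN ger0_norm ?mulr_ge0 ?exprn_ge0 ?expR_ge0 // expRN ler_pdivrMr ?expR_gt0 //.
  apply: le_trans (h1 X X0) _; rewrite ler_wpM2r ?expR_ge0 // /K; lra.
move=> v hv.
have -> : (X ^+ j * expR (- (X * (1 + v))))%:C - (X ^+ j * expR (- X))%:C - (- (X ^+ j.+1 * expR (- X)))%:C * v%:C =
   (X ^+ j * expR (- X))%:C * (cexp (- (X * v))%:C - 1 - (- (X * v))%:C).
  rewrite cexp_real mulrDr mulr1 opprD expRD exprS !rCE; ring.
rewrite cnM; apply: le_trans (_ : X ^+ j * expR (- X) * (`|X * v| ^+ 2 * expR (X / 2)) <= _).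
  apply: ler_pM; rewrite ?cn_ge0 //.
    by rewrite cn_real ger0_norm ?mulr_ge0 ?exprn_ge0 ?expR_ge0.
  apply: le_trans (cexp_lin _) _; rewrite cn_real normrN ler_wpM2l ?exprn_ge0 // ler_expR normrM (ger0_norm X0).
  by rewrite ler_wpM2l.
rewrite normrM (ger0_norm X0) exprMn real_normK ?num_real //.
have -> : X ^+ j * expR (- X) * (X ^+ 2 * v ^+ 2 * expR (X / 2)) = (X ^+ j.+2 * expR (- (X / 2))) * v ^+ 2.
  have -> : expR (- (X / 2)) = expR (- X) * expR (X / 2) by rewrite -expRD; congr expR; field.
  by move: (expR _) (expR _) => u w; rewrite (_ : X ^+ j.+2 = X ^+ j * X ^+ 2); [ring|by rewrite -exprD addn2].
rewrite ler_wpM2r ?sqr_ge0 // expRN ler_pdivrMr ?expR_gt0 //.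
have e : X ^+ j.+2 = 2 ^+ j.+2 * (X / 2) ^+ j.+2 by rewrite -exprMn; congr (_ ^+ _); field.
rewrite e; apply: le_trans (ler_wpM2l _ (h2 (X / 2) _)) _; rewrite ?exprn_ge0 ?divr_ge0 //.
rewrite mulrA ler_wpM2r ?expR_ge0 // /K; lra.
Qed.

(* [Gamma(a, X) / Gamma(a)] *)
Definition Qg (a : nat) (X : R) : R := expR (- X) * \sum_(j < a) X ^+ j / (j`!)%:R.

Lemma lin2_Qg (a : nat) : exists2 K : R, 0 < K & forall (lam : R[i]) (X : R), 16 <= cn lam -> 0 <= X ->
  lin2 (cn lam)^-1 K (fun r => (Qg a (X * (1 + vshift lam r)))%:C).
Proof.
have /choice [K hK] : forall j, exists K : R, 0 < K /\ forall (lam : R[i]) (X : R), 16 <= cn lam -> 0 <= X ->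
  lin2 (cn lam)^-1 K (fun r => (X ^+ j * expR (- (X * (1 + vshift lam r))))%:C).
  by move=> j; have [K h1 h2] := lin2_exp j; exists K.
pose M : R := 1 + \sum_(j < a) 18 * K j * (18 * (1 + 58)) ^+ j.
have M0 j : 0 <= 18 * K j * (18 * (1 + 58)) ^+ j.
  by have [h _] := hK j; rewrite !mulr_ge0 ?exprn_ge0 ?(ltW h).
have hM j : (j < a)%N -> 18 * K j * (18 * (1 + 58)) ^+ j <= M.
  move=> ja; rewrite /M (bigD1 (Ordinal ja)) //=; move: (18 * _ * _) => u.
  rewrite addrCA lerDl addr_ge0 //; exact: sumr_ge0.
have Mge1 : 1 <= M by rewrite lerDl; apply: sumr_ge0 => i _.
exists (1 + a%:R * M) => [|lam X hlam X0].
  by rewrite ltr_pwDl // mulr_ge0 //; lra.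
have M00 : 0 <= M by lra.
apply: (lin2W (rho0 _) (M := a%:R * M)); first by rewrite lerDr.
pose phi j r : R[i] := (j`!)%:R^-1 * ((X ^+ j * expR (- (X * (1 + vshift lam r))))%:C * (1 + vshift lam r)%:C ^+ j).
apply: (lin2_ext (phi := fun r => \sum_(j < a) phi j r)) => [r|].
  rewrite /Qg mulr_sumr rC_sum; apply: eq_bigr => j _.
  by rewrite /phi exprMn !rCE; move: (expR _) => u; ring.
apply: lin2_sum => [|//|j ja]; first exact: rho0.
have [_ hj] := hK j.
apply: (lin2W (rho0 _) (M := cn (j`!%:R^-1 : R[i]) * (18 * K j * (18 * (1 + 58)) ^+ j))).
  apply: le_trans (hM j ja); rewrite ler_piMl // cnV cn_nat invf_le1 ?ler1n ?ltr0n fact_gt0 //.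
by apply: lin2Z; apply: lin2M; [exact: rho0|exact: rho16|exact: hj|exact: lin2_pow1].
Qed.

End ExpComponent.

(** * The incomplete Gamma quotient *)

Section QgBounds.
Variable R : realType.
Implicit Types (X : R) (a : nat).

Lemma is_derive_exp_partial a X :
  is_derive X (1 : R) (fun x => \sum_(j < a.+1) x ^+ j / (j`!)%:R) (\sum_(j < a) X ^+ j / (j`!)%:R).
Proof.
under eq_fun do rewrite big_ord_recl.
rewrite -[X in is_derive _ _ _ X]add0r; apply: is_deriveD.
  have -> : (fun x0 : R => x0 ^+ (ord0 : 'I_a.+1) / (ord0 : 'I_a.+1)`!%:R) = cst 1.
    by apply/funext => y; rewrite /= expr0 fact0 divr1.
  exact: is_derive_cst.
have -> : (fun x0 : R => \sum_(i < a) x0 ^+ lift ord0 i / (lift ord0 i)`!%:R) = \sum_(i < a) (fun x0 : R => x0 ^+ i.+1 / i.+1`!%:R).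
  by apply/funext => y; rewrite fct_sumE; apply: eq_bigr => i _; rewrite /= /bump /= add1n.
apply: is_derive_sum => i.
have -> : (fun x0 : R => x0 ^+ i.+1 / i.+1`!%:R) = (i.+1`!%:R^-1 \*: (fun x0 : R => x0 ^+ i.+1)).
  by apply/funext => y; rewrite /= mulrC.
have h : is_derive X (1 : R) (i.+1`!%:R^-1 \*: (fun x0 : R => x0 ^+ i.+1)) (i.+1`!%:R^-1 *: (i.+1%:R * X ^+ i *: 1)).
  apply: is_deriveZ.
  have -> : (fun x0 : R => x0 ^+ i.+1) = (id : R -> R) ^+ i.+1 by apply/funext => y; rewrite exprfctE.
  exact: (is_deriveX (f := id)).
apply: (is_derive_eq h); rewrite /GRing.scale /= mulr1 factS natrM.
have n1 : (i.+1%:R : R) != 0 by rewrite pnatr_eq0.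
have n2 : (i`!%:R : R) != 0 by rewrite pnatr_eq0 -lt0n fact_gt0.
by move: (i.+1%:R : R) (i`!%:R : R) n1 n2 => u v n1 n2; field; rewrite n1 n2.
Qed.

Lemma exp_partial_le a X : 0 <= X -> \sum_(j < a) X ^+ j / (j`!)%:R <= expR X.
Proof.
move=> X0; rewrite -subr_ge0; move: X X0.
elim: a => [|a IH] X X0; first by rewrite big_ord0 subr0 expR_ge0.
pose f (x : R) := expR x - \sum_(j < a.+1) x ^+ j / (j`!)%:R.
have f0 : f 0 = 0.
  rewrite /f expR0 big_ord_recl expr0 fact0 divr1 big1 ?addr0 ?subrr // => i _.
  by rewrite /bump /= expr0n /= mul0r.
have fd x : is_derive x (1 : R) f (expR x - \sum_(j < a) x ^+ j / (j`!)%:R).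
  exact: (@is_deriveB _ _ _ expR (fun x => \sum_(j < a.+1) x ^+ j / (j`!)%:R) _ _ _ _ _ (is_derive_exp_partial a x)).
exact: (ge0_of_deriv f0 fd IH).
Qed.

Lemma is_derive_Qg a X : is_derive X (1 : R) (Qg a.+1) (- (expR (- X) * (X ^+ a / (a`!)%:R))).
Proof.
have hN : is_derive X (1 : R) (fun x => expR (- x)) (- expR (- X)).
  have h := @is_derive1_comp R expR (fun x => - x) X (expR (- X)) (-1) _ _.
  by apply: is_derive_eq; rewrite mulrN1.
have h := is_deriveM hN (is_derive_exp_partial a X).
apply: (is_derive_eq h); rewrite /GRing.scale /= big_ord_recr /=.
by move: (\sum_(j < a) _) (expR _) => u v; ring.
Qed.

Lemma Qg_ge0 a X : 0 <= X -> 0 <= Qg a X.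
Proof.
move=> X0; rewrite mulr_ge0 ?expR_ge0 // sumr_ge0 // => j _.
by rewrite divr_ge0 ?exprn_ge0.
Qed.

Lemma Qg_le1 a X : 0 <= X -> Qg a X <= 1.
Proof.
move=> X0; rewrite /Qg expRN mulrC ler_pdivrMr ?expR_gt0 // mul1r; exact: exp_partial_le.
Qed.

Lemma Qg_mono a b X : 0 <= X -> (a <= b)%N -> Qg a X <= Qg b X.
Proof.
move=> X0 ab; rewrite /Qg ler_wpM2l ?expR_ge0 // -(subnKC ab).
elim: (b - a)%N => [|m IH]; first by rewrite addn0.
by rewrite addnS big_ord_recr /=; apply: le_trans IH _; rewrite lerDl divr_ge0 ?exprn_ge0.
Qed.

(** For [j < a] one has [X ^ j <= 2 ^ a (X / 2) ^ j], and the partial sum at [X / 2] is at most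
    [exp (X / 2)]. *)
Lemma Qg_tail a X : 0 <= X -> Qg a X <= 2 ^+ a * expR (- (X / 2)).
Proof.
move=> X0.
have -> : expR (- (X / 2)) = expR (- X) * expR (X / 2) by rewrite -expRD; congr expR; field.
rewrite /Qg mulrCA ler_wpM2l ?expR_ge0 //.
have X2 : 0 <= X / 2 by rewrite divr_ge0.
apply: le_trans (ler_wpM2l _ (exp_partial_le a X2)); last by rewrite exprn_ge0.
rewrite mulr_sumr; apply: ler_sum => j _.
have -> : X ^+ j = 2 ^+ j * (X / 2) ^+ j by rewrite -exprMn; congr (_ ^+ _); field.
rewrite -mulrA ler_wpM2r ?divr_ge0 ?exprn_ge0 //.
by rewrite ler_weXn2l ?ler1n // ltnW.
Qed.

Lemma Qg0 a : (0 < a)%N -> Qg a 0 = 1 :> R.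
Proof.
case: a => // a _; rewrite /Qg oppr0 expR0 mul1r big_ord_recl expr0 fact0 divr1 big1 ?addr0 // => i _.
by rewrite /bump /= expr0n /= mul0r.
Qed.

End QgBounds.

(** * Blocks of seven lattice points *)

Section Blocks.
Variable R : realType.
Implicit Types (s : R[i]) (d : R) (p q : int * int) (k a : nat).

(* The term of [2 L(s, chi^k)], multiplied for [d > 0] by a cutoff at norms of size
   [a / d]; the cutoff is [1] at [d = 0] and [a > 0]. *)
Definition Lt k a s d p : R[i] := ec R p * al R p ^+ k *
  cexp (- ((s + k%:R / 2) * (ln (nm R p))%:C)) * (Qg a (2 * pi / 7 * d * nm R p))%:C.

(** Adding [2 r] to the first coordinate adds the integer [r] to [al] and keeps the parity
    condition. The block of [q] consists of the shifts by -3 to 3 of the center [(7 q.1, q.2)]; as 2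
    is invertible modulo 7, the blocks partition all pairs ([bmap_inj], [bmap_surj]). *)
Definition bmap (hq : 'I_7 * (int * int)) : int * int := (7 * hq.2.1 + 2 * (hq.1%:Z - 3), hq.2.2).

(* Summation by blocks of seven numbers [al p] that differ by rational integers makes the
   series for [L] converge absolutely beyond the central point. *)
Definition bl k a s d q : R[i] := \sum_(h < 7) Lt k a s d (bmap (h, q)).

Lemma al_bmap h q : al R (bmap (h, q)) = al R (7 * q.1, q.2) + (h%:Z - 3)%:~R.
Proof.
rewrite !alE /bmap; cbn [fst snd].
rewrite (_ : forall m n : int, (m + 2 * n)%:~R = m%:~R + 2 * n%:~R :> R[i]); last first.
  by move=> m n; rewrite intrD; congr (_ + _); rewrite intrM.
by move: (_%:~R) ((h%:Z - 3)%:~R) => u v; field.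
Qed.

Lemma ec_bmap h q : ec R (bmap (h, q)) = if (2 %| q.1 - q.2)%Z then (chi (h%:Z - 3))%:~R else 0.
Proof.
rewrite /ec /bmap; cbn [fst snd].
have -> : (2 %| 7 * q.1 + 2 * (h%:Z - 3) - q.2)%Z = (2 %| q.1 - q.2)%Z by apply/idP/idP; lia.
by rewrite [7 * _]mulrC chi_mod chi2.
Qed.

Lemma cn_al_exp p : 0 < nm R p -> cn (al R p) = expR (ln (nm R p) / 2).
Proof.
move=> h; apply/eqP; rewrite -(eqrXn2 (n := 2)) ?cn_ge0 ?expR_ge0 //.
by rewrite cn_al2 -expRM_natl mulrC divfK // lnK.
Qed.

Lemma cn_al_cpow k s p : 0 < nm R p ->
  cn (al R p ^+ k * cexp (- ((s + k%:R / 2) * (ln (nm R p))%:C))) = expR (- (complex.Re s * ln (nm R p))).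
Proof.
move=> h; rewrite cnM cnX cn_cexp cn_al_exp // -expRM_natl -expRD; congr expR.
have -> : (k%:R / 2 : R[i]) = (k%:R / 2 : R)%:C by rewrite !rCE.
rewrite ReN ReM ReD /=; by field.
Qed.

(** Under the parity condition the norm is the integer [m ^ 2 + m y + 2 y ^ 2]; it is positive
    because [chi x] is not 0. *)
Lemma ec_nm p : ec R p != 0 -> 1 <= nm R p.
Proof.
rewrite /ec; case: ifP => [h|_]; last by rewrite eqxx.
case: p h => x y /= h c0.
have x0 : x != 0 by apply: contraNneq c0 => ->.
have -> : nm R (x, y) = (((x - y) %/ 2)%Z ^+ 2 + ((x - y) %/ 2)%Z * y + 2 * y ^+ 2)%:~R.
  have e : x = 2 * ((x - y) %/ 2)%Z + y by lia.
  rewrite /nm; cbn [fst snd]; rewrite {1}e; move: ((x - y) %/ 2)%Z => m.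
  have -> : (2 * m + y)%:~R = 2 * m%:~R + y%:~R :> R by rewrite intrD intrM.
  have -> : (m ^+ 2 + m * y + 2 * y ^+ 2)%:~R = m%:~R ^+ 2 + m%:~R * y%:~R + 2 * y%:~R ^+ 2 :> R.
    by rewrite !expr2 !intrD !intrM.
  by move: (m%:~R : R) (y%:~R : R) => u v; field.
rewrite (ler_int R 1).
set m := ((x - y) %/ 2)%Z.
have e : x = 2 * m + y by rewrite /m; lia.
have e2 : 4 * (m ^+ 2 + m * y + 2 * y ^+ 2) = x ^+ 2 + 7 * y ^+ 2 by rewrite e; ring.
have : 0 < x ^+ 2 by rewrite lt0r sqr_ge0 sqrf_eq0 x0.
have : 0 <= y ^+ 2 by exact: sqr_ge0.
by move: e2; move: (m ^+ 2 + m * y + 2 * y ^+ 2) (x ^+ 2) (y ^+ 2) => *; lia.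
Qed.

Lemma c7_ge0 : 0 <= 2 * pi / 7 :> R.
Proof. by rewrite divr_ge0 // mulr_ge0 // pi_ge0. Qed.

Lemma arg_ge0 d p : 0 <= d -> 0 <= 2 * pi / 7 * d * nm R p.
Proof. by move=> d0; apply: mulr_ge0 (nm_ge0 _ _); exact: mulr_ge0 c7_ge0 d0. Qed.

Lemma Lt_le k a s d p : 0 <= d -> cn (Lt k a s d p) <= if ec R p != 0 then expR (- (complex.Re s * ln (nm R p))) else 0.
Proof.
move=> d0; rewrite /Lt; case: eqP => [->|/eqP h]; first by rewrite !mul0r cn0.
have n1 := ec_nm h; have n0 : 0 < nm R p by apply: lt_le_trans n1.
have X0 := arg_ge0 p d0.
rewrite -(mulrA (ec R p)) (cnM (_ * _)) (cnM (ec R p)) cn_al_cpow // cn_real ger0_norm ?Qg_ge0 //.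
rewrite -[leRHS]mulr1; apply: ler_pM; [|exact: Qg_ge0| |exact: Qg_le1].
  by rewrite mulr_ge0 ?cn_ge0 ?expR_ge0.
by rewrite ler_piMl ?expR_ge0 ?cn_ec.
Qed.

Lemma Lt_le1 k a s d p : 0 <= d -> 0 <= complex.Re s -> cn (Lt k a s d p) <= 1.
Proof.
move=> d0 s0; apply: le_trans (Lt_le _ _ _ _ d0) _; case: eqP => //= /eqP h.
by rewrite -expR0 ler_expR oppr_le0 mulr_ge0 // ln_ge0 // ec_nm.
Qed.

Lemma bl_le7 k a s d q : 0 <= d -> 0 <= complex.Re s -> cn (bl k a s d q) <= 7.
Proof.
move=> d0 s0; apply: le_trans (cn_sum _ _ _) _.
apply: le_trans (_ : \sum_(h < 7) (1 : R) <= _); last by rewrite sumr_const card_ord.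
by apply: ler_sum => h _; exact: Lt_le1.
Qed.

Lemma qroot_exp (x : R) : 0 < x -> qroot x ^+ 5 = expR (- (5 / 4 * ln x)).
Proof.
move=> x0; have : qroot x = expR (- (ln x / 4)).
  rewrite /qroot expRN; congr _^-1; rewrite -{1}[x]lnK ?posrE //.
  have sq (y : R) : Num.sqrt (expR y) = expR (y / 2).
    by rewrite -[expR y](_ : expR (y / 2) ^+ 2 = _) ?sqrtr_sqr ?ger0_norm ?expR_ge0 // -expRM_natl mulrC divfK.
  rewrite !sq; congr expR; by field.
move=> ->; rewrite -expRM_natl; congr expR; by field.
Qed.

(** The value [E] at the center [lam] is factored out, and [phi] is the relative variation in the
    block, of class [lin2] with constants independent of [d]. Then [chi_lin2] saves
    [|lam| ^ (-2) = nm ^ (-1)], and [E] is at most [nm ^ (-1/4)]. *)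
Lemma block_decay k a (W : R) : exists2 K : R, 0 < K & forall s d q, 0 <= d ->
  cn (s + k%:R / 2) <= W -> 4^-1 <= complex.Re s -> 16 <= cn (al R (7 * q.1, q.2)) ->
  cn (bl k a s d q) <= K * qroot (nm R (7 * q.1, q.2)) ^+ 5.
Proof.
have [K3 K30 hQ] := lin2_Qg R a.
pose K1 : R := (18 * (1 + 1)) ^+ k.
pose K2 : R := 58 * (1 + 2 * W + 4 * W ^+ 2 * expR W).
pose K : R := 18 * (18 * K1 * K2) * K3.
exists (7 * `|K| + 1) => [|s d q d0 hw hs hlam]; first by rewrite ltr_wpDl // mulr_ge0.
set p : int * int := (7 * q.1, q.2) in hlam *.
set lam := al R p in hlam *.
have lam0 := lam_neq0 hlam.
have np : nm R p = cn lam ^+ 2 by rewrite cn_al2.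
have n0 : 0 < nm R p by rewrite np exprn_gt0 // cn_gt0.
set w := s + k%:R / 2 in hw *.
set X := 2 * pi / 7 * d * nm R p.
have X0 : 0 <= X by exact: arg_ge0.
pose phi r : R[i] := (1 + r%:~R / lam) ^+ k * cexp (- (w * (ln (1 + vshift lam r))%:C)) * (Qg a (X * (1 + vshift lam r)))%:C.
have h16 := rho16 hlam; have h0 := rho0 lam.
have hphi : lin2 (cn lam)^-1 K phi.
  apply: lin2M => //; last exact: hQ.
  by apply: lin2M => //; [apply: lin2X => //; exact: lin2_base|exact: lin2_cpow].
pose E : R[i] := (if (2 %| q.1 - q.2)%Z then 1 else 0) * (lam ^+ k * cexp (- (w * (ln (nm R p))%:C))).
have -> : bl k a s d q = E * \sum_(h < 7) (chi (h%:Z - 3))%:~R * phi (h%:Z - 3).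
  rewrite /bl mulr_sumr; apply: eq_bigr => h _.
  have hr : (`|h%:Z - 3| <= 3)%N by have := ltn_ord h; clear; lia.
  have hv := vshift_half hlam hr.
  have v0 : 0 < 1 + vshift lam (h%:Z - 3).
    by move: hv; rewrite ler_norml => /andP[v1 v2]; lra.
  have eal : al R (bmap (h, q)) = lam * (1 + (h%:Z - 3)%:~R / lam).
    by rewrite al_bmap -/p -/lam; field.
  have enm : nm R (bmap (h, q)) = nm R p * (1 + vshift lam (h%:Z - 3)).
    by rewrite -cn_al2 eal cnM exprMn cn_shift2 np.
  have eL : (ln (nm R p * (1 + vshift lam (h%:Z - 3))))%:C = (ln (nm R p))%:C + (ln (1 + vshift lam (h%:Z - 3)))%:C :> R[i].
    by rewrite lnM ?posrE // rC_D.
  have eC : cexp (- ((s + k%:R / 2) * (ln (nm R p * (1 + vshift lam (h%:Z - 3))))%:C)) =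
    cexp (- (w * (ln (nm R p))%:C)) * cexp (- (w * (ln (1 + vshift lam (h%:Z - 3)))%:C)).
    by rewrite eL -cexpD -/w; congr cexp; ring.
  rewrite /Lt ec_bmap eal enm eC exprMn.
  rewrite /E /phi /X [2 * pi / 7 * d * (_ * _)]mulrA.
  by case: ifP => _; move: (cexp _) (cexp _) (_ ^+ k) (_ ^+ k) => *; ring.
apply: le_trans (_ : (expR (- (4^-1 * ln (nm R p)))) * (7 * K * (cn lam)^-1 ^+ 2) <= _).
  apply: cn_le_mul; last exact: chi_lin2.
  rewrite /E (cnM (if _ then _ else _)) cn_al_cpow // -[leRHS]mul1r; apply: ler_pM; rewrite ?cn_ge0 ?expR_ge0 //.
    by case: ifP => _; rewrite ?cn0 ?cn1.
  rewrite ler_expR lerN2 ler_wpM2r // ln_ge0 // np exprn_ege1 //; apply: le_trans hlam; by rewrite ler1n.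
have -> : (cn lam)^-1 ^+ 2 = expR (- ln (nm R p)).
  by rewrite expRN lnK // np exprVn.
have -> : qroot (nm R p) ^+ 5 = expR (- (4^-1 * ln (nm R p))) * expR (- ln (nm R p)).
  by rewrite qroot_exp // -expRD; congr expR; field.
rewrite mulrCA; apply: ler_wpM2r; first exact: mulr_ge0 (expR_ge0 _) (expR_ge0 _).
by have := ler_norm K; move: `|K| => *; lra.
Qed.

End Blocks.

(** * Absolute convergence of the series of blocks *)

Section BlockSums.
Variable R : realType.
Implicit Types (s : R[i]) (d : R) (p q : int * int) (k a : nat).

Lemma wt_antitone m n : (m <= n)%N -> wt R n <= wt R m.
Proof.
by move=> h; rewrite /wt lerXn2r ?nnegrE ?qroot_ge0 // qroot_le ?ltr0n // ler_nat.
Qed.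

(** For norms at least 1 one has [(|x| + 1) (|y| + 1) <= 16 nm], and [qroot (1 / 16) = 2]. *)
Lemma qroot_nm p : 1 <= nm R p -> qroot (nm R p) ^+ 5 <= 2 ^+ 5 * wi2 R p.
Proof.
case: p => x y; rewrite /wi2 /wi /wt /= => h.
set m := `|x|%N; set n := `|y|%N.
have h1 : 16^-1 * (m.+1%:R * n.+1%:R) <= nm R (x, y).
  move: h; rewrite /nm /= !int_sqr -/m -/n -[m.+1%:R]natr1 -[n.+1%:R]natr1.
  have m0 : 0 <= m%:R :> R by []. have n0 : 0 <= n%:R :> R by [].
  move: (m%:R : R) (n%:R : R) m0 n0 => u v u0 v0 h.
  have h2 : 0 <= (u - v) ^+ 2 by exact: sqr_ge0.
  have h3 : 0 <= (u - 1) ^+ 2 by exact: sqr_ge0.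
  have h4 : 0 <= (v - 1) ^+ 2 by exact: sqr_ge0.
  have h5 : 0 <= v ^+ 2 by exact: sqr_ge0.
  nra.
have q2 : qroot (16^-1 : R) = 2.
  rewrite /qroot.
  have -> : (16^-1 : R) = (4^-1) ^+ 2 by field.
  rewrite sqrtr_sqr ger0_norm ?invr_ge0 //.
  have -> : (4^-1 : R) = (2^-1) ^+ 2 by field.
  by rewrite sqrtr_sqr ger0_norm ?invr_ge0 // invrK.
rewrite -!exprMn lerXn2r ?nnegrE ?mulr_ge0 ?qroot_ge0 // -q2 -!qrootM ?invr_ge0 //.
by apply: qroot_le => //; rewrite mulr_gt0 ?invr_gt0.
Qed.

Lemma wi2_shrink q : wi2 R (7 * q.1, q.2) <= wi2 R q.
Proof. by rewrite /wi2 /= ler_wpM2r ?wt_ge0 // /wi wt_antitone // abszM leq_pmull. Qed.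

Lemma block_bound k a (W : R) : exists2 C : R, 0 < C & forall s d q, 0 <= d ->
  cn (s + k%:R / 2) <= W -> 4^-1 <= complex.Re s -> cn (bl k a s d q) <= C * wi2 R q.
Proof.
have [K K0 hK] := block_decay k a W.
(* A center with [|lam| < 16] has [|q.1|] and [|q.2|] at most 20, so its weight is at least [wt 20]
   squared, against the trivial bound 7 for a block. *)
have w0 : 0 < wt R 20 by rewrite exprn_gt0 // invr_gt0 !sqrtr_gt0.
pose C2 := 7 / (wt R 20 * wt R 20).
have C20 : 0 < C2 by rewrite divr_gt0 // mulr_gt0.
exists (K * 2 ^+ 5 + C2) => [|s d q d0 hw hs]; first by rewrite addr_gt0 // mulr_gt0 // exprn_gt0.
have wq : 0 <= wi2 R q by rewrite mulr_ge0 ?wt_ge0.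
have [h|h] := leP 16 (cn (al R (7 * q.1, q.2))).
  apply: le_trans (hK s d q d0 hw hs h) _.
  apply: le_trans (_ : K * 2 ^+ 5 * wi2 R q <= _); last by rewrite ler_wpM2r // lerDl ltW.
  rewrite -mulrA ler_wpM2l ?(ltW K0) //.
  apply: le_trans (qroot_nm _) _.
    rewrite -cn_al2 exprn_ege1 //; apply: le_trans h; by rewrite ler1n.
  by rewrite ler_wpM2l ?exprn_ge0 // wi2_shrink.
apply: le_trans (_ : C2 * wi2 R q <= _); last first.
  by rewrite ler_wpM2r // lerDr mulr_ge0 ?exprn_ge0 // ltW.
have s0 : 0 <= complex.Re s by apply: le_trans hs; rewrite invr_ge0.
apply: le_trans (bl_le7 k a q d0 s0) _.
have -> : (7 : R) = C2 * (wt R 20 * wt R 20) by rewrite /C2 divfK // gt_eqF // mulr_gt0.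
apply: ler_wpM2l; first exact: ltW.
have : nm R (7 * q.1, q.2) < 256.
  rewrite -cn_al2 (_ : 256 = 16 ^+ 2); last by ring.
  by rewrite ltrXn2r ?nnegrE ?cn_ge0.
rewrite /nm /= !int_sqr abszM natrM (_ : absz 7 = 7%N) // => hb.
have m0 : 0 <= `|q.1|%N%:R :> R by []. have n0 : 0 <= `|q.2|%N%:R :> R by [].
rewrite /wi2 /wi ler_pM ?wt_ge0 //; apply: wt_antitone; rewrite leqNgt -(ltr_nat R); apply/negP.
  by move: hb; move: (`|q.1|%:R : R) (`|q.2|%:R : R) m0 n0 => u v u0 v0 hb hu; nra.
by move: hb; move: (`|q.1|%:R : R) (`|q.2|%:R : R) m0 n0 => u v u0 v0 hb hu; nra.
Qed.

Lemma Lt_dom k a s d p : 0 <= d -> 5 / 4 <= complex.Re s -> cn (Lt k a s d p) <= 2 ^+ 5 * wi2 R p.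
Proof.
move=> d0 hs; apply: le_trans (Lt_le _ _ _ _ d0) _.
case: eqP => /= [_|/eqP h]; first by rewrite mulr_ge0 ?exprn_ge0 // mulr_ge0 ?wt_ge0.
have n1 := ec_nm h; apply: le_trans (qroot_nm n1).
rewrite qroot_exp ?(lt_le_trans _ n1) // ler_expR lerN2 ler_wpM2r // ln_ge0 //.
Qed.

Lemma hasSum_flat (T : eqType) n (F : 'I_n * T -> R[i]) l :
  hasSum F l -> hasSum (fun t => \sum_(i < n) F (i, t)) l.
Proof.
move=> h e e0; have [A0 hA] := h e e0; exists (map snd A0) => A uA sA.
have -> : \sum_(t <- A) \sum_(i < n) F (i, t) = \sum_(p <- [seq (i, t) | i <- enum 'I_n, t <- A]) F p.
  by rewrite exchange_big /= big_allpairs big_enum.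
apply: hA.
  by apply: allpairs_uniq => //; [exact: enum_uniq|move=> [? ?] [? ?]].
move=> [i t] hp; apply/allpairsP; exists (i, t); split; rewrite ?mem_enum //=.
by apply: sA; apply/mapP; exists (i, t).
Qed.

Lemma bmap_inj : injective bmap.
Proof.
move=> [h [u y]] [h' [u' y']]; rewrite /bmap /= => -[e1 e2].
have a1 := ltn_ord h; have a2 := ltn_ord h'.
have e3 : u = u' by lia.
have e4 : (h : nat) = h' by lia.
by rewrite e2 e3; congr pair; apply: val_inj.
Qed.

Lemma bmap_surj p : exists t, bmap t = p.
Proof.
case: p => x y.
have x0 : 0 <= ((4 * x + 3) %% 7)%Z by apply: modz_ge0.
have x7 : ((4 * x + 3) %% 7)%Z < 7 by apply: ltz_pmod.
have hn : (absz ((4 * x + 3) %% 7)%Z < 7)%N by lia.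
exists (Ordinal hn, ((x - 2 * (((4 * x + 3) %% 7)%Z - 3)) %/ 7, y)%Z); rewrite /bmap /=.
congr pair; rewrite gez0_abs //; lia.
Qed.

Lemma bl_hasSum k a s d l : hasSum (Lt k a s d) l -> hasSum (bl k a s d) l.
Proof.
move=> h; apply: (hasSum_flat (F := Lt k a s d \o bmap)).
apply: (hasSum_inj _ bmap_inj _).2 h => u hu.
by have [t e] := bmap_surj u; case: (hu t).
Qed.

End BlockSums.

(** * Analytic continuation with a damping factor *)

Section Continuation.
Variable R : realType.
Implicit Types (s : R[i]) (d : R) (p q : int * int) (k a : nat).

Lemma cdiff_cexp (u c s : R[i]) : exists D, cdiff (fun z => cexp (- ((z + u) * c))) D s.
Proof.
exists (- c * cexp (- ((s + u) * c))) => e e0.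
set E := cexp (- ((s + u) * c)).
pose B := cn E * (cn c ^+ 2 * expR (cn c)).
have B0 : 0 <= B by rewrite !mulr_ge0 ?exprn_ge0 ?cn_ge0 ?expR_ge0.
have B1 : 0 < B + 1 by rewrite ltr_wpDl.
exists (Num.min 1 (e / (B + 1))) => [|z]; first by rewrite lt_min ltr01 divr_gt0.
rewrite le_min => /andP[h1 h2].
pose h := z - s.
have -> : cexp (- ((z + u) * c)) = E * cexp (- (h * c)) by rewrite -cexpD; congr cexp; rewrite /h; ring.
rewrite -/h (_ : _ - _ - _ = E * (cexp (- (h * c)) - 1 - - (h * c))); last by ring.
rewrite cnM; apply: le_trans (_ : cn E * ((cn h * cn c) ^+ 2 * expR (cn c)) <= _).
  rewrite ler_wpM2l ?cn_ge0 //; apply: le_trans (cexp_lin _) _; rewrite cnN cnM.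
  by rewrite ler_wpM2l ?exprn_ge0 ?mulr_ge0 ?cn_ge0 // ler_expR ler_piMl ?cn_ge0.
have -> : cn E * ((cn h * cn c) ^+ 2 * expR (cn c)) = (B * cn h) * cn h by rewrite /B; ring.
rewrite ler_wpM2r ?cn_ge0 //.
apply: le_trans (_ : (B + 1) * cn h <= _); first by rewrite ler_wpM2r ?cn_ge0 // lerDl.
by rewrite mulrC -ler_pdivlMr.
Qed.

Lemma cdiff_sum (T : Type) (A : seq T) (F : T -> R[i] -> R[i]) s :
  (forall t, exists D, cdiff (F t) D s) -> exists D, cdiff (fun z => \sum_(t <- A) F t z) D s.
Proof.
move=> h; elim: A => [|t A [D hD]].
  exists 0; apply: (cdiff_local (h := fun=> 0) (r := 1)) (cdiff_cst 0 s) => // z _.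
  by rewrite big_nil.
have [E hE] := h t; exists (E + D).
apply: (cdiff_local (h := fun z => F t z + \sum_(t <- A) F t z) (r := 1)) (cdiffD hE hD) => // z _.
by rewrite big_cons.
Qed.

Lemma cdiff_Lt k a d p s : exists D, cdiff (fun z => Lt k a z d p) D s.
Proof.
have [D hD] := cdiff_cexp (k%:R / 2) (ln (nm R p))%:C s.
have h := cdiffM (cdiffM (cdiff_cst (ec R p * al R p ^+ k) s) hD) (cdiff_cst (Qg a (2 * pi / 7 * d * nm R p))%:C s).
by eexists; exact: h.
Qed.

(* Equal to [1] at the central point, and of modulus less than [1] on the part of the boundary
   of a rectangle that lies outside the half-plane of absolute convergence. *)
Definition damp s : R[i] := (20 + (s - 2^-1) + 2 * (s - 2^-1) ^+ 2) / 20.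

Lemma cdiff_damp s : exists D, cdiff damp D s.
Proof.
have h1 := cdiffD (cdiff_id s) (cdiff_cst (- 2^-1) s).
have h := cdiffM (cdiffD (cdiffD (cdiff_cst 20 s) h1) (cdiffM (cdiff_cst 2 s) (cdiffM h1 h1))) (cdiff_cst 20^-1 s).
by eexists; exact: h.
Qed.

Lemma damp_center : damp (2^-1 +i* 0) = 1.
Proof.
have -> : 2^-1 +i* 0 = 2^-1 :> R[i] by rewrite -[RHS](_ : (2^-1)%:C = _) // rC_V rC_nat.
by rewrite /damp subrr; field.
Qed.

Lemma dampE (x y : R) : damp ((2^-1 + x) +i* y) = ((20 + x + 2 * (x ^+ 2 - y ^+ 2)) / 20) +i* ((y + 4 * x * y) / 20).
Proof.
have e : (2^-1 + x) +i* y - 2^-1 = x +i* y.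
  have -> : (2^-1 : R[i]) = (2^-1)%:C by rewrite rC_V rC_nat.
  by apply: ext_complex; rewrite /=; ring.
have e20 : (20 : R[i]) = (20 : R)%:C by rewrite rC_nat.
have e2 : (2 : R[i]) = (2 : R)%:C by rewrite rC_nat.
rewrite /damp e e20 e2 -rC_V expr2.
by apply: ext_complex; rewrite /=; ring.
Qed.

(** Here [x] and [y] are coordinates around the center, and [x > 3 / 4] is left to absolute
    convergence. On the left side the imaginary part [y (1 + 4 x) / 20] vanishes and the real part
    is [159 / 160 - y ^ 2 / 10]; on the horizontal sides [y ^ 2 = 4] lowers the real part to at most
    [111 / 160]. *)
Lemma damp_left : exists2 r : R, 0 <= r < 1 & forall x y : R,
  (x = - 4^-1 /\ `|y| <= 2) \/ (- 4^-1 <= x <= 3 / 4 /\ `|y| = 2) -> cn (damp ((2^-1 + x) +i* y)) <= r.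
Proof.
have r0 : 0 <= (159 / 160 : R) by lra.
exists (159 / 160) => [|x y h]; first by apply/andP; split; lra.
rewrite dampE.
have : cn (((20 + x + 2 * (x ^+ 2 - y ^+ 2)) / 20) +i* ((y + 4 * x * y) / 20)) ^+ 2 <= (159 / 160) ^+ 2.
  rewrite cn_sqr /=.
  case: h => [[-> hy]|[/andP[x1 x2] hy]].
    have y2 : y ^+ 2 <= 4.
      rewrite -[leLHS]ger0_norm ?sqr_ge0 // normrX (_ : 4 = 2 ^+ 2) ?lerXn2r ?nnegrE //; ring.
    have y0 : 0 <= y ^+ 2 by exact: sqr_ge0.
    clear hy.
    have -> : (y + 4 * - 4^-1 * y) / 20 = 0 by field.
    have -> : (20 + - 4^-1 + 2 * ((- 4^-1) ^+ 2 - y ^+ 2)) / 20 = 159 / 160 - y ^+ 2 / 10 by field.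
    move: (y ^+ 2) y2 y0 => z z2 z0.
    by rewrite expr0n addr0; apply: lerXn2r; rewrite ?nnegrE; lra.
  have y2 : y ^+ 2 = 4.
    by rewrite -[LHS]ger0_norm ?sqr_ge0 // normrX hy; ring.
  rewrite y2 (_ : y + 4 * x * y = y * (1 + 4 * x)); last by ring.
  rewrite [X in _ + X](_ : _ = y ^+ 2 * (1 + 4 * x) ^+ 2 / 400); last by field.
  rewrite y2.
  clear y2 hy y; have a0 : 0 <= x ^+ 2 by exact: sqr_ge0.
  have a00 : x ^+ 2 <= 1 / 2 * x + 3 / 16.
    rewrite -subr_ge0 (_ : _ - _ = (x + 4^-1) * (3 / 4 - x)); last by field.
    by rewrite mulr_ge0 //; lra.
  have a1 : 0 <= (20 + x + 2 * (x ^+ 2 - 4)) / 20 by lra.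
  have a2 : (20 + x + 2 * (x ^+ 2 - 4)) / 20 <= 111 / 160 by lra.
  have a3 : ((20 + x + 2 * (x ^+ 2 - 4)) / 20) ^+ 2 <= (111 / 160) ^+ 2 by apply: lerXn2r; rewrite ?nnegrE; lra.
  have a4 : (1 + 4 * x) ^+ 2 <= 16.
    by rewrite (_ : _ ^+ 2 = 1 + 8 * x + 16 * x ^+ 2); [lra|ring].
  lra.
by rewrite ler_sqr ?nnegrE ?cn_ge0 ?r0.
Qed.

Lemma damp_rect (x y : R) : - 4^-1 <= x <= 1 -> `|y| <= 2 -> cn (damp ((2^-1 + x) +i* y)) <= 2.
Proof.
move=> /andP[x1 x2]; rewrite ler_norml => /andP[y1 y2]; rewrite dampE.
apply: le_trans (cn_le_ReIm _) _; rewrite /=.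
have h1 : `|(20 + x + 2 * (x ^+ 2 - y ^+ 2)) / 20| <= 23 / 20 by rewrite ler_norml; apply/andP; split; nra.
have h2 : `|(y + 4 * x * y) / 20| <= 1 / 2 by rewrite ler_norml; apply/andP; split; nra.
lra.
Qed.

Lemma ccat_side_bound (f : R[i] -> R[i]) (P : R -> R[i]) (x1 x2 : R) : x1 <= x2 ->
  (forall s, ccat f s) -> (forall t u, cn (P t - P u) = `|t - u|) ->
  exists2 M : R, 0 <= M & forall t, x1 <= t <= x2 -> cn (f (P t)) <= M.
Proof.
move=> x12 hf hP.
have [hr hi] := ccat_rcont hP (fun t => hf (P t)).
have bnd (g : R -> R) : continuous g -> exists2 M : R, 0 <= M & forall t, x1 <= t <= x2 -> `|g t| <= M.
  move=> hg.
  have [c1 _ h1] := EVT_max x12 (continuous_subspaceT hg).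
  have [c2 _ h2] := EVT_min x12 (continuous_subspaceT hg).
  exists (`|g c1| + `|g c2|) => [|t ht]; first by rewrite addr_ge0.
  have /h1 u1 : t \in `[x1, x2]%R by rewrite in_itv.
  have /h2 u2 : t \in `[x1, x2]%R by rewrite in_itv.
  have v1 := ler_norm (g c1);
  have v3 : - `|g c2| <= g c2 by rewrite lerNl -normrN ler_norm.
  have v4 := normr_ge0 (g c1); have v5 := normr_ge0 (g c2).
  rewrite ler_norml; apply/andP; split; lra.
have [M1 M10 h1] := bnd _ hr; have [M2 M20 h2] := bnd _ hi.
exists (M1 + M2) => [|t ht]; first exact: addr_ge0.
by apply: le_trans (cn_le_ReIm _) _; apply: lerD; [exact: h1|exact: h2].
Qed.

Lemma small_geometric (r B e : R) : 0 <= r < 1 -> 0 <= B -> 0 < e -> exists m : nat, B * r ^+ m <= e.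
Proof.
move=> /andP[r0 r1] B0 e0.
have h : `|r| < 1 by rewrite ger0_norm.
have B1 : 0 < B + 1 by rewrite ltr_wpDl.
have /cvgrPdist_le /(_ (e / (B + 1)) ltac:(by rewrite divr_gt0)) [m _ hm] := cvg_expr h.
exists m; have := hm m (leqnn m); rewrite /= sub0r normrN ger0_norm; last by rewrite exprn_ge0.
rewrite ler_pdivlMr // => h2; apply: le_trans h2; rewrite mulrC ler_wpM2l ?lerDl // exprn_ge0 //.
Qed.

(* A large power of [damp] times the difference of [f] and half a partial sum over blocks is small
   on the boundary of a rectangle, hence at its center: on the left part because of [damp], on
   the right because the sum converges to [2 f] there. *)
Theorem central_value (f : R[i] -> R[i]) k a : (forall s, exists D, cdiff f D s) ->
  (forall s, 5 / 4 <= complex.Re s -> hasSum (Lt k a s 0) (2 * f s)) ->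
  hasSum (bl k a (2^-1 +i* 0) 0) (2 * f (2^-1 +i* 0)).
Proof.
move=> hf hs.
have fc s : ccat f s by have [D hD] := hf s; exact: cdiff_ccat hD.
have [r r01 hr] := damp_left; have /andP[r0 r1'] := r01.
pose W : R := k%:R / 2 + 4.
have [C C0 hC] := block_bound k a W.
have r1 : (4^-1 : R) < (2^-1 : R) < (3 / 2 : R) by apply/andP; split; lra.
have r2 : (- 2 : R) < (0 : R) < (2 : R) by apply/andP; split; lra.
have [CB CB0 hCB] := cauchy_bound r1 r2.
have x12 : (4^-1 : R) <= (3 / 2 : R) by lra.
have y12 : (- 2 : R) <= (2 : R) by lra.
have [M1 M10 hM1] := ccat_side_bound x12 fc (cn_hline (- 2)).
have [M2 M20 hM2] := ccat_side_bound x12 fc (cn_hline 2).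
have [M3 M30 hM3] := ccat_side_bound y12 fc (cn_vline 4^-1).
have [M4 M40 hM4] := ccat_side_bound y12 fc (cn_vline (3 / 2)).
have [w0 [T hT]] := wsum_wi2 R.
have T0 : 0 <= T by have := hT [::] isT; rewrite big_nil.
pose M := M1 + M2 + M3 + M4; pose B := M + C * T.
have M0 : 0 <= M by rewrite !addr_ge0.
have B0 : 0 <= B by rewrite addr_ge0 // mulr_ge0 // ltW.
move=> e e0.
(* The order of choices matters: [B] bounds the difference on the left part for every finite [A], so
   [m] can be fixed first; only then is [A] taken so large that the error on the right part is small
   against [2 ^ m], the bound of the damping there. *)
have [m hm] := @small_geometric r (CB * B) (e / 4) r01 ltac:(by rewrite mulr_ge0 // ltW) ltac:(by rewrite divr_gt0).
have P0 : 0 < 2 ^+ m :> R by rewrite exprn_gt0.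
pose eps := e / (4 * CB * 2 ^+ m).
have eps0 : 0 < eps by rewrite divr_gt0 // !mulr_gt0.
have [A0 uA0 hA0] := wsum_tail (wsumZ (wsum_wi2 R) (ltW C0)) eps0.
exists A0 => A uA sA.
pose h s := f s - 2^-1 * \sum_(q <- A) bl k a s 0 q.
pose g s := h s * damp s ^+ m.
have hb s q : 4^-1 <= complex.Re s <= 3 / 2 -> `|complex.Im s| <= 2 -> cn (bl k a s 0 q) <= C * wi2 R q.
  move=> /andP[s1 s2] s3; apply: hC => //.
  apply: le_trans (cnD _ _) _.
  have -> : (k%:R / 2 : R[i]) = (k%:R / 2 : R)%:C by rewrite !rCE.
  rewrite cn_real ger0_norm ?divr_ge0 // /W [leRHS]addrC lerD2r.
  apply: le_trans (cn_le_ReIm _) _; clear -s1 s2 s3; rewrite ger0_norm; lra.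
have bd (x y : R) : - 4^-1 <= x <= 1 -> `|y| <= 2 -> (x = - 4^-1 \/ x = 1 \/ `|y| = 2) ->
    cn (f ((2^-1 + x) +i* y)) <= M -> cn (g ((2^-1 + x) +i* y)) <= B * r ^+ m + 2 ^+ m * eps.
  move=> hx hy hxy hfM; have /andP[hx1 hx2] := hx.
  set s := (2^-1 + x) +i* y.
  have hbs q : cn (bl k a s 0 q) <= C * wi2 R q.
    by apply: hb => //=; clear -hx1 hx2; apply/andP; split; lra.
  have [x3|x3] := leP x (3 / 4).
    rewrite -[leLHS]addr0; apply: lerD; last by rewrite mulr_ge0 ?(ltW P0) ?(ltW eps0).
    rewrite /g cnM cnX; apply: ler_pM; rewrite ?cn_ge0 ?exprn_ge0 ?cn_ge0 //.
      rewrite /h; apply: le_trans (cnB _ _) _; apply: lerD => //.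
      rewrite cnM cnV cn_nat; apply: le_trans (_ : \sum_(q <- A) C * wi2 R q <= _); last first.
        by rewrite -mulr_sumr ler_wpM2l ?(ltW C0) // hT.
      apply: le_trans (_ : cn (\sum_(q <- A) bl k a s 0 q) <= _).
        by rewrite ler_piMl ?cn_ge0 // invf_le1 ?ler1n.
      by apply: le_trans (cn_sum _ _ _) _; apply: ler_sum => q _.
    rewrite lerXn2r ?nnegrE ?cn_ge0 //.
    apply: hr; case: hxy => [->|[e1|->]]; [by left|exfalso; clear -x3 e1; lra|right; split=> //].
    by rewrite hx1.
  rewrite -[leLHS]add0r; apply: lerD; first by rewrite mulr_ge0 ?exprn_ge0.
  rewrite /g cnM cnX mulrC; apply: ler_pM; rewrite ?cn_ge0 ?exprn_ge0 ?cn_ge0 //.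
    by rewrite lerXn2r ?nnegrE ?cn_ge0 // damp_rect.
  have hS : hasSum (bl k a s 0) (2 * f s) by apply/bl_hasSum/hs; rewrite /=; clear -x3; lra.
  have : cn (\sum_(q <- A) bl k a s 0 q - 2 * f s) <= eps.
    apply: (hasSum_tail hS hbs uA) => A' uA'.
    apply: le_trans (hA0 A' uA').
    rewrite big_mkcond [leRHS]big_mkcond; apply: ler_sum => q _.
    case: ifPn => h1; case: ifPn => h2 //; last by rewrite mulr_ge0 // ltW.
    by case/negP: h1; apply: sA; rewrite negbK in h2.
  have -> : \sum_(q <- A) bl k a s 0 q - 2 * f s = - 2 * h s by rewrite /h; field.
  by rewrite cnM cnN cn_nat; move: (cn_ge0 (h s)); move: (cn (h s)) => u; clear; lra.
have gdiff s : exists D, cdiff g D s.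
  have [D1 hD1] := hf s.
  have [D2 hD2] : exists D, cdiff (fun z => \sum_(q <- A) bl k a z 0 q) D s.
    by apply: cdiff_sum => q; apply: cdiff_sum => i; exact: cdiff_Lt.
  have [D3 hD3] := cdiff_damp s.
  have [D4 hD4] := cdiffX m hD3.
  have hh := cdiffM (cdiffD hD1 (cdiffM (cdiff_cst (- 2^-1) s) hD2)) hD4.
  eexists; apply: cdiff_local hh; first exact: ltr01.
  by move=> z _; rewrite /g /h mulNr.
have /choice [D hD] := gdiff.
have bH t y : 4^-1 <= t <= 3 / 2 -> `|y| = 2 -> cn (f (t +i* y)) <= M ->
    cn (g (t +i* y)) <= B * r ^+ m + 2 ^+ m * eps.
  move=> ht hy hfM; have e1 : t = 2^-1 + (t - 2^-1) by ring.
  rewrite e1; apply: bd; rewrite -?e1 ?hy //; last by right; right.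
  by move: ht => /andP[t1 t2]; clear -t1 t2; apply/andP; split; lra.
have bV t x : -2 <= t <= 2 -> x = 4^-1 \/ x = 3 / 2 -> cn (f (x +i* t)) <= M ->
    cn (g (x +i* t)) <= B * r ^+ m + 2 ^+ m * eps.
  move=> ht hx hfM; have e1 : x = 2^-1 + (x - 2^-1) by ring.
  rewrite e1; apply: bd; rewrite -?e1 ?ler_norml //.
    by clear -hx; apply/andP; split; case: hx => ->; lra.
  by case: hx => ->; [left|right; left]; field.
have hfin := hCB g D (B * r ^+ m + 2 ^+ m * eps) hD.
have n2 : `|- 2 : R| = 2 by rewrite normrN ger0_norm.
have n2' : `|2 : R| = 2 by rewrite ger0_norm.
have le1 : M1 <= M /\ M2 <= M /\ M3 <= M /\ M4 <= M by rewrite /M; clear -M10 M20 M30 M40; do !split; lra.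
case: le1 => l1 [l2 [l3 l4]].
have {}hfin : cn (g (2^-1 +i* 0)) <= CB * (B * r ^+ m + 2 ^+ m * eps).
  apply: hfin => t ht.
- by split; apply: bH => //; [apply: le_trans l1; exact: hM1|apply: le_trans l2; exact: hM2].
- by split; apply: bV => //; [left|apply: le_trans l3; exact: hM3|right|apply: le_trans l4; exact: hM4].
move: hfin; rewrite /g damp_center expr1n mulr1 => hfin.
have -> : \sum_(q <- A) bl k a (2^-1 +i* 0) 0 q - 2 * f (2^-1 +i* 0) = - 2 * h (2^-1 +i* 0) by rewrite /h; field.
rewrite cnM cnN cn_nat; apply: le_trans (_ : 2 * (CB * (B * r ^+ m + 2 ^+ m * eps)) <= _).
  by rewrite ler_wpM2l.
have : CB * 2 ^+ m * eps = e / 4 by rewrite /eps; field; rewrite !gt_eqF.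
move=> h4; rewrite (_ : 2 * (CB * (B * r ^+ m + 2 ^+ m * eps)) =
  2 * (CB * B * r ^+ m) + 2 * (CB * 2 ^+ m * eps)); last by ring.
by rewrite h4; move: hm; move: (CB * B * r ^+ m) => u hm; clear -hm; lra.
Qed.

End Continuation.

(** * The given continuation and its Dirichlet series *)

Section LfunctionCenter.
Variable R : realType.
Implicit Types (s : R[i]) (p q : int * int).

Lemma lecC (x y : R) : (x%:C <= y%:C :> R[i]) = (x <= y).
Proof. exact: lecR. Qed.

Lemma gt0_complex (e : R[i]) : 0 < e -> exists2 r : R, 0 < r & e = r%:C.
Proof.
case: e => a b; rewrite ltcE /= => /andP[/eqP h1 h2].
by exists a => //; rewrite h1.
Qed.

Lemma entire_cdiff (f : R[i] -> R[i]) : entire f -> forall s, exists D, cdiff f D s.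
Proof.
move=> hf s; have := hf s; rewrite /derivable => /cvg_ex[D hD].
exists D => e e0.
have e0' : 0 < e%:C :> R[i] by rewrite ltcR.
move/cvgrPdist_le : hD => /(_ _ e0') /nbhs_ballP[r /= r0 hr].
have [d d0 ed] := gt0_complex r0.
exists (d / 2) => [|z hz]; first by rewrite divr_gt0.
have [->|zs] := eqVneq z s; first by rewrite !subrr mulr0 subrr cn0 mulr0.
pose h : R[i] := z - s.
have h0 : h != 0 by rewrite subr_eq0.
have hb : ball (0 : R[i]^o) r h.
  rewrite -ball_normE /ball_ /= sub0r normrN normr_cn ed ltcR.
  by apply: le_lt_trans hz _; rewrite ltr_pdivrMr // ltr_pMr // ltr1n.
have := hr h hb h0; rewrite /= normr_cn lecC => H.
have e1 : (h *: 1 + s : R[i]^o) = z by rewrite /h /GRing.scale /= mulr1 subrK.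
rewrite e1 in H.
have -> : f z - f s - D * (z - s) = - ((D - h^-1 * (f z - f s)) * h).
  by rewrite /h; field.
by rewrite cnN cnM ler_wpM2r ?cn_ge0.
Qed.

Lemma hasSum_sum_eq (I : choiceType) (f : I -> R[i]) l : hasSum f l ->
  summability.sum (f : I -> R[i]^o) = l.
Proof.
move=> hf; have PF := @summability.totally_filter I.
apply: cvg_lim; first exact: norm_hausdorff.
apply/cvgrPdist_le => e e0.
have [r r0 ->] := gt0_complex e0.
have [A0 hA] := hf r r0.
exists (seq_fset tt A0) => // B hB.
rewrite normr_cn lecC cnBC /summability.partial_sum.
rewrite -(big_seq_fsetE _ _ xpredT f).
apply: hA; first exact: fset_uniq.
by move=> t ht; apply: (fsubsetP (hB : (seq_fset tt A0 `<=` B)%fset)); rewrite seq_fsetE.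
Qed.

Definition lmap (ab : int * int) : int * int := (2 * ab.1 + ab.2, ab.2).

Lemma lmap_inj : injective lmap.
Proof. by move=> [a b] [a' b']; rewrite /lmap /= => -[e1 e2]; congr pair; lia. Qed.

Lemma al_lmap (a b : int) : al R (lmap (a, b)) = a%:~R + b%:~R * eta R.
Proof.
have h2 : ((2 * a + b)%:~R : R) = 2 * a%:~R + b%:~R by rewrite intrD intrM.
rewrite /al /lmap /eta; cbn [fst snd]; rewrite h2 -!(rC_int R).
by apply: ext_complex; rewrite /=; field.
Qed.

Lemma nm_lmap (a b : int) : nm R (lmap (a, b)) = (qnorm a b)%:~R.
Proof.
have h2 : ((2 * a + b)%:~R : R) = 2 * a%:~R + b%:~R by rewrite intrD intrM.
have h3 : (qnorm a b)%:~R = a%:~R ^+ 2 + a%:~R * b%:~R + 2 * b%:~R ^+ 2 :> R.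
  by rewrite /qnorm !expr2 !intrD !intrM.
by rewrite h3 /nm /lmap; cbn [fst snd]; rewrite h2; field.
Qed.

Lemma ec_lmap (a b : int) : ec R (lmap (a, b)) = (epsilon a b)%:~R.
Proof.
rewrite /ec /lmap; cbn [fst snd]; rewrite epsilon_chi.
by have -> : (2 %| 2 * a + b - b)%Z by lia.
Qed.

Lemma Lterm_Lt n s ab a : (0 < n)%N -> (0 < a)%N -> Lterm n s ab = Lt (4 * n - 3) a s 0 (lmap ab).
Proof.
case: ab => x y n0 a0; rewrite /Lt al_lmap nm_lmap ec_lmap mulr0 mul0r Qg0 // mulr1 /Lterm.
case: eqP => [[-> ->]|_].
  have -> : 0%:~R + 0%:~R * eta R = 0 by rewrite mulr0z mul0r addr0.
  by rewrite expr0n (_ : (4 * n - 3 == 0)%N = false) ?mulr0 ?mul0r //; lia.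
have eE : s + 2 * n%:R - 3 / 2 = s + (4 * n - 3)%N%:R / 2.
  have -> : (4 * n - 3)%N%:R = 4 * n%:R - 3 :> R[i] by rewrite natrB ?natrM //; lia.
  by field.
by rewrite eE /cpow cexpN.
Qed.

Lemma hasSum_Lseries n s a : (0 < n)%N -> (0 < a)%N -> 5 / 4 <= complex.Re s ->
  hasSum (Lt (4 * n - 3) a s 0) (2 * Lseries n s).
Proof.
move=> n0 a0 hs.
have [l hl] : exists l, hasSum (Lt (4 * n - 3) a s 0) l.
  apply: (hasSum_exists (wsumZ (wsum_wi2 R) _ )) => [|p]; last exact: Lt_dom.
  by rewrite exprn_ge0.
have hl2 : hasSum (Lterm n s) l.
  apply: (hasSum_ext (f := Lt (4 * n - 3) a s 0 \o lmap)) => [t|]; first by rewrite /= -Lterm_Lt.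
  (* The image of [lmap] consists of the pairs of equal parity, and [ec] vanishes on the others. *)
  apply: (hasSum_inj _ lmap_inj _).2 hl => -[x y] hu.
  rewrite /Lt /ec /=; case: ifP => h; last by rewrite !mul0r.
  case: (hu ((x - y) %/ 2, y)%Z); rewrite /lmap /=; congr pair; lia.
by rewrite /Lseries (hasSum_sum_eq hl2) mulrA divff // mul1r.
Qed.

Theorem Lfunction_center n (f : R[i] -> R[i]) a : (0 < n)%N -> (0 < a)%N -> is_Lfunction n f ->
  hasSum (bl (4 * n - 3) a (2^-1 +i* 0) 0) (2 * f 2^-1).
Proof.
move=> n0 a0 [f1 f2].
have -> : (2^-1 : R[i]) = 2^-1 +i* 0 by rewrite -[RHS]/((2^-1)%:C) rC_V rC_nat.
apply: central_value => [|s hs]; first exact: entire_cdiff.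
by rewrite f2; [exact: hasSum_Lseries|lra].
Qed.

End LfunctionCenter.

(** * A smooth formula for the central value *)

Section CentralFormula.
Variable R : realType.

Lemma wi2_ge0 (p : int * int) : 0 <= wi2 R p.
Proof. by rewrite mulr_ge0 ?wt_ge0. Qed.

Implicit Types (d t u : R) (p q : int * int) (b : nat).

Local Notation s0 := (2^-1 +i* 0 : R[i]).
Local Notation kap := (2 * pi / 7 : R).

Lemma kap_gt0 : 0 < kap.
Proof. by rewrite divr_gt0 // mulr_gt0 // pi_gt0. Qed.

Lemma Lt_tail k a d p : 0 <= d -> cn (Lt k a s0 d p) <= 2 ^+ a * expR (- (kap * d * nm R p / 2)).
Proof.
move=> d0; rewrite /Lt; have X0 := arg_ge0 p d0.
have [h|h] := eqVneq (ec R p) 0.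
  by rewrite h !mul0r cn0 mulr_ge0 ?exprn_ge0 ?expR_ge0.
have n1 := ec_nm h; have n0 : 0 < nm R p by apply: lt_le_trans n1.
rewrite -(mulrA (ec R p)) (cnM (_ * _)) (cnM (ec R p)) cn_al_cpow // cn_real ger0_norm ?Qg_ge0 //.
rewrite -[leRHS]mul1r; apply: ler_pM; [|exact: Qg_ge0| |exact: Qg_tail].
  by rewrite mulr_ge0 ?cn_ge0 ?expR_ge0.
rewrite -[leRHS]mul1r; apply: ler_pM; rewrite ?cn_ge0 ?expR_ge0 ?cn_ec //.
by rewrite expR_le1 oppr_le0 mulr_ge0 //= ?ln_ge0 // ltW.
Qed.

(** As [d] and the norm are at least 1, [2 d nm >= d + nm]; this splits the exponential into a
    summable factor and one that decays in [d], which removes the sum with cutoff at small norms in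
    the limit. *)
Lemma Lt_gauss k a : exists2 C : R, 0 < C & forall d p, 1 <= d ->
  cn (Lt k a s0 d p) <= C / d * wi2 R p.
Proof.
have k0 := kap_gt0.
have [C C0 hC] := @gauss2_wi R (kap / 4) 0 0 ltac:(by rewrite divr_gt0).
have k4 : 0 < 4 / kap by rewrite divr_gt0.
exists (2 ^+ a * (C * (1 + 4 / kap))) => [|d p d1].
  by rewrite !mulr_gt0 ?exprn_gt0 // addr_gt0.
have d0 : 0 < d by apply: lt_le_trans d1.
have w0 : 0 <= wi2 R p by rewrite wi2_ge0.
have [h|h] := eqVneq (ec R p) 0.
  rewrite /Lt h !mul0r cn0 mulr_ge0 // mulr_ge0 // ?invr_ge0 ?(ltW d0) //.
  by rewrite !mulr_ge0 ?exprn_ge0 ?addr_ge0 ?(ltW C0) // ltW.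
have n1 := ec_nm h.
apply: le_trans (Lt_tail _ _ _ (ltW d0)) _.
have -> : 2 ^+ a * (C * (1 + 4 / kap)) / d * wi2 R p = 2 ^+ a * (C * wi2 R p * ((1 + 4 / kap) / d)).
  by move: (wi2 R p) (4 / kap) (d^-1) (2 ^+ a) => *; ring.
apply: ler_wpM2l; first by rewrite exprn_ge0.
have e1 : expR (- (kap * d * nm R p / 2)) <= expR (- (kap / 4 * nm R p)) * expR (- (kap / 4 * d)).
  rewrite -expRD ler_expR -opprD lerN2.
  have h1 : 0 <= (d - 1) * (nm R p - 1) by rewrite mulr_ge0 // subr_ge0.
  have h2 : nm R p + d <= 2 * (d * nm R p).
    have : 0 <= (d - 1) + (nm R p - 1) by rewrite addr_ge0 // subr_ge0.
    move: h1; move: (nm R p) => v; nra.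
  have -> : kap / 4 * nm R p + kap / 4 * d = kap / 4 * (nm R p + d) by ring.
  have -> : kap * d * nm R p / 2 = kap / 4 * (2 * (d * nm R p)) by move: (pi : R) => P; field.
  by rewrite ler_wpM2l // divr_ge0 // ltW.
apply: le_trans e1 _.
have e2 : expR (- (kap / 4 * nm R p)) <= C * wi2 R p.
  by have := hC p; rewrite expr0 mul1r mul0r add0r.
have e3 : expR (- (kap / 4 * d)) <= (1 + 4 / kap) / d.
  rewrite expRN ler_pdivlMr // mulrC ler_pdivrMr ?expR_gt0 //.
  have h1 := expR_ge1Dx (kap / 4 * d).
  have h2 : d = 4 / kap * (kap / 4 * d).
    by move: (pi : R) (pi_gt0 R) => P P0; field; rewrite gt_eqF.
  rewrite {1}h2; apply: le_trans (_ : 4 / kap * expR (kap / 4 * d) <= _).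
    by rewrite ler_wpM2l ?(ltW k4) //; apply: le_trans h1; rewrite lerDr.
  by rewrite ler_wpM2r ?expR_ge0 // lerDr.
exact: ler_pM (expR_ge0 _) (expR_ge0 _) e2 e3.
Qed.

Lemma Lt_sum k a d : 0 < d -> exists U, hasSum (Lt k a s0 d) U.
Proof.
move=> d0; have [C C0 hC] := @gauss2_wi R (kap * d / 2) 0 0 ltac:(by rewrite divr_gt0 // mulr_gt0 // kap_gt0).
apply: (hasSum_exists (W := fun p => 2 ^+ a * C * wi2 R p)).
  by apply: wsumZ (wsum_wi2 R) _; rewrite mulr_ge0 ?exprn_ge0 // ltW.
move=> p; apply: le_trans (Lt_tail _ _ _ (ltW d0)) _.
rewrite -[leRHS]mulrA; apply: ler_wpM2l; first by rewrite exprn_ge0.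
apply: le_trans (hC p).
by rewrite expr0 mul1r mul0r add0r mulrAC.
Qed.

(* The normalizing power of the norm, as [s0 + k / 2 = b + 1] for [k = 2 b + 1]. *)
Lemma center_pow b p : al R p ^+ b.*2.+1 * cexp (- ((s0 + b.*2.+1%:R / 2) * (ln (nm R p))%:C)) * (nm R p ^+ b.+1)%:C =
  al R p ^+ b.*2.+1.
Proof.
have [h|h] := eqVneq (nm R p) 0.
  have : al R p = 0.
    apply/eqP; rewrite -cn_eq0 -[_ == 0]/((0 < 2)%N && _) -expf_eq0 cn_al2 h //.
  by move=> ->; rewrite expr0n /= !mul0r.
have n0 : 0 < nm R p by rewrite lt0r h nm_ge0.
have -> : s0 + b.*2.+1%:R / 2 = (b.+1%:R)%:C.
  have -> : s0 = 2^-1 by rewrite -[LHS]/((2^-1)%:C) rC_V rC_nat.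
  by rewrite rC_nat -muln2 -!natr1 natrM; field.
rewrite -rC_M -rC_N cexp_real expRN expRM_natl lnK ?posrE // -mulrA -rC_M mulVf ?mulr1 //.
by rewrite expf_neq0 // gt_eqF.
Qed.

Definition kcoef b : R := kap ^+ b.+1 / (b`!)%:R.

(** The derivative of the cutoff contributes [X ^ b exp (- X)] times the derivative of [X], thus the
    power [nm ^ (b + 1)], which cancels the normalizing power of the norm and leaves a term of the
    theta series. The flag [e] chooses between the cutoff parameters [exp u] and [exp (- u)]. *)
Lemma cderiv_Lt b p u (e : bool) :
  let t := expR ((-1) ^+ e * u) in
  cderiv (fun u => Lt b.*2.+1 b.+1 s0 (expR ((-1) ^+ e * u)) p)
    (- (-1) ^+ e * (kcoef b * t ^+ b.+1)%:C * Tk t b.*2.+1 p) u.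
Proof.
move=> t.
pose z : R[i] := ec R p * al R p ^+ b.*2.+1 * cexp (- ((s0 + b.*2.+1%:R / 2) * (ln (nm R p))%:C)).
pose g u := kap * expR ((-1) ^+ e * u) * nm R p.
have hg : is_derive u (1 : R) g ((-1) ^+ e * (kap * t * nm R p)).
  have h0 : is_derive u (1 : R) (fun v : R => (-1) ^+ e * v) ((-1) ^+ e).
    have h := @is_deriveZ _ _ _ id ((-1) ^+ e) u 1 1 (is_derive_id _ _).
    by apply: (is_derive_eq h); rewrite /GRing.scale /= mulr1.
  have h1 := @is_derive1_comp R expR _ u _ _ (is_derive_expR _) h0.
  have h2 := @is_deriveZ _ _ _ _ (kap * nm R p) _ _ _ h1.
  have -> : g = (kap * nm R p) \*: (expR \o (fun v : R => (-1) ^+ e * v)).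
    by apply/funext => v; rewrite /g /= /GRing.scale /= mulrAC.
  by apply: (is_derive_eq h2); rewrite /GRing.scale /= -/t; move: t ((-1) ^+ e) (nm R p) (pi : R) => t' e' n' P; ring.
have hQ := @is_derive1_comp R (Qg b.+1) g u _ _ (is_derive_Qg b (g u)) hg.
have hz := cderivM_cst z hQ.
have -> : - (-1) ^+ e * (kcoef b * t ^+ b.+1)%:C * Tk t b.*2.+1 p =
  (- (expR (- g u) * (g u ^+ b / b`!%:R)) * ((-1) ^+ e * (kap * t * nm R p)))%:C * z.
  rewrite /Tk -(center_pow b p) /g -/t /kcoef /z.

  rewrite [kap ^+ b.+1]exprS [t ^+ b.+1]exprS [nm R p ^+ b.+1]exprS !exprMn.
  have -> : ((-1) ^+ e : R[i]) = ((-1) ^+ e : R)%:C by rewrite rC_X rC_N.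
  move: (cexp _) (al R p ^+ _) (expR _) (b`!%:R^-1 : R) ((-1) ^+ e : R) => c1 c2 c3 c4 c5.
  by rewrite !rC_M !rC_N !rC_M; ring.
apply: cderiv_ext hz => v.
by rewrite /Lt /z /g /= mulrC.
Qed.

Lemma Tk_antitone k d t p : d <= t -> cn (Tk t k p) <= cn (Tk d k p).
Proof.
move=> dt; rewrite /Tk !(cnM (ec R p * _)) ler_wpM2l ?cn_ge0 // !cn_real !ger0_norm ?expR_ge0 //.
rewrite ler_expR lerN2; apply: ler_wpM2r; first exact: nm_ge0.
by apply: ler_wpM2l; [rewrite ltW // kap_gt0|].
Qed.

(* The root number; its modulus is all that matters. *)
Definition rootw : R[i] := gauss7 R / ('i%C * (Num.sqrt 7)%:C).

Lemma cn_rootw : cn rootw <= 7.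
Proof.
have ci : cn ('i%C : R[i]) = 1 by rewrite /cn /= expr0n add0r expr1n sqrtr1.
rewrite /rootw cnM cnV cnM ci mul1r cn_real ger0_norm ?sqrtr_ge0 //.
have s1 : 1 <= Num.sqrt (7 : R) by rewrite -[X in X <= _]sqrtr1; apply: ler_wsqrtr; rewrite ler1n.
rewrite ler_pdivrMr ?(lt_le_trans _ s1) //.
by apply: le_trans (cn_gauss7 R) _; rewrite ler_peMr.
Qed.

(** For even [b] the exponent [2 b + 1] is 1 modulo 4, so [i ^ k = i] and the root number is
    independent of [b]; since [t t ^ k = (t ^ (b + 1)) ^ 2], the power of [t] divides evenly between
    the two sides. *)
Lemma theta_sym b t S S' : ~~ odd b -> 0 < t -> hasSum (Tk t b.*2.+1) S -> hasSum (Tk t^-1 b.*2.+1) S' ->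
  (t^-1 ^+ b.+1)%:C * S' = rootw * ((t ^+ b.+1)%:C * S).
Proof.
move=> hb t0 h1 h2; have := theta_inversion t0 h1 h2.
have ik : 'i%C ^+ b.*2.+1 = 'i%C :> R[i].
  rewrite -(odd_double_half b) (negbTE hb) add0n -!muln2 -mulnA exprS exprM.
  have -> : ('i%C : R[i]) ^+ b./2 ^+ (2 * 2) = ('i%C ^+ 2 ^+ 2) ^+ b./2 by rewrite -!exprM mulnC mulnA.
  by rewrite sqr_i sqrrN expr1n expr1n mulr1.
have i0 : ('i%C : R[i]) != 0 by rewrite -cn_gt0 /cn /= expr0n add0r expr1n sqrtr1.
have s0 : (Num.sqrt 7)%:C != 0 :> R[i] by apply: sqrt_real_neq0; rewrite sqrtr_gt0.
have t1 := sqrt_real_neq0 t0.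
rewrite expr_div_n ik /rootw => h.
have e : S' = gauss7 R * t%:C / (Num.sqrt 7)%:C * S * t%:C ^+ b.*2.+1 / 'i%C.
  rewrite -h; move: (t%:C ^+ _) (expf_neq0 b.*2.+1 t1) => T T0; field; rewrite T0 i0 //.
have e2 : t%:C * t%:C ^+ b.*2.+1 = t%:C ^+ b.+1 * t%:C ^+ b.+1 :> R[i].
  by rewrite -exprS -exprD; congr (_ ^+ _); lia.
have e3 : (t^-1 ^+ b.+1)%:C = (t%:C ^+ b.+1)^-1 :> R[i] by rewrite exprVn rC_V rC_X.
rewrite e e3 [(t ^+ b.+1)%:C]rC_X.
have -> : gauss7 R * t%:C / (Num.sqrt 7)%:C * S * t%:C ^+ b.*2.+1 / 'i%C =
  gauss7 R / (Num.sqrt 7)%:C * S * (t%:C * t%:C ^+ b.*2.+1) / 'i%C by ring.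
rewrite e2; move: (t%:C ^+ b.+1) (expf_neq0 b.+1 t1) (gauss7 R) => T T0 G; field.
by rewrite s0 i0 T0.
Qed.

(* The functional equation of the theta series makes the left side independent of [D]; the two
   cutoffs in it tend to [0] and to [1] as [D] grows. *)
Lemma center_const b (D : R) U1 UD UV : ~~ odd b -> 1 <= D ->
  hasSum (Lt b.*2.+1 b.+1 s0 1) U1 -> hasSum (Lt b.*2.+1 b.+1 s0 D) UD -> hasSum (Lt b.*2.+1 b.+1 s0 D^-1) UV ->
  rootw * UD + UV = (1 + rootw) * U1.
Proof.
move=> hb D1 h1 hD hV; have D0 : 0 < D by apply: lt_le_trans D1.
have Di0 : 0 < D^-1 by rewrite invr_gt0.
set k := b.*2.+1 in h1 hD hV.
pose T := ln D.
have T0 : 0 <= T by rewrite ln_ge0.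
pose F u p := rootw * Lt k b.+1 s0 (expR ((-1) ^+ false * u)) p + Lt k b.+1 s0 (expR ((-1) ^+ true * u)) p.
have F0 p : F 0 p = (1 + rootw) * Lt k b.+1 s0 1 p by rewrite /F !mulr0 expR0; ring.
have FT p : F T p = rootw * Lt k b.+1 s0 D p + Lt k b.+1 s0 D^-1 p.
  by rewrite /F expr0 expr1 mul1r mulN1r expRN /T lnK // posrE.
have hG : hasSum (fun p => F T p - F 0 p) (rootw * UD + UV - (1 + rootw) * U1).
  have h := hasSumD (hasSumD (hasSumZ rootw hD) hV) (hasSumZ (-1) (hasSumZ (1 + rootw) h1)).
  rewrite -[- (_ * U1)]mulN1r; apply: hasSum_ext h => p.
  by rewrite F0 FT mulN1r.
apply/eqP; rewrite -subr_eq0; apply/eqP; apply: (hasSum_unique hG).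
move=> e e0.
have [C C0 hC] := @Tk_dom R D^-1 k Di0.
pose K := kcoef b * D ^+ b.+1.
have kc0 : 0 <= kcoef b by rewrite divr_ge0 ?exprn_ge0 // ltW // kap_gt0.
have K0 : 0 <= K by rewrite mulr_ge0 ?exprn_ge0 // ltW.
(* The factor 8 is [1 + 7]: the tails of the two theta series enter with coefficients of modulus at
   most [K] and [7 K], the latter by [cn_rootw]. *)
pose M := 8 * K * T + 1.
have KT0 : 0 <= 8 * K * T by apply: mulr_ge0 T0; apply: mulr_ge0 K0.
have M0 : 0 < M by rewrite ltr_wpDl.
have [A0 uA0 hA0] := wsum_tail (wsumZ (wsum_wi2 R) (ltW C0)) (divr_gt0 e0 M0).
exists A0 => A uA sA; rewrite subr0 sumrB.
have tl (S : R[i]) x : D^-1 <= x -> hasSum (Tk x k) S -> cn (\sum_(p <- A) Tk x k p - S) <= e / M.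
  move=> hx hS; apply: (hasSum_tail (W := fun p => C * wi2 R p) hS _ uA) => [p|A' uA'].
    by apply: le_trans (hC p); exact: Tk_antitone.
  apply: le_trans (hA0 A' uA').
  rewrite big_mkcond [leRHS]big_mkcond; apply: ler_sum => p _.
  case: ifPn => g1; case: ifPn => g2 //; last by rewrite mulr_ge0 ?(ltW C0) // wi2_ge0.
  by case/negP: g1; apply: sA; rewrite negbK in g2.
(* Only finite sums are differentiated. The corresponding combination of the full theta series is 0
   by [theta_sym], so [DF] is a combination of two tails, small uniformly in [u]. *)
pose DF u : R[i] := rootw * \sum_(p <- A) (- (-1) ^+ false * (kcoef b * expR ((-1) ^+ false * u) ^+ b.+1)%:C * Tk (expR ((-1) ^+ false * u)) k p) +
  \sum_(p <- A) (- (-1) ^+ true * (kcoef b * expR ((-1) ^+ true * u) ^+ b.+1)%:C * Tk (expR ((-1) ^+ true * u)) k p).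
have cs (f : R -> int * int -> R[i]) (d : int * int -> R[i]) v : (forall p, cderiv (f ^~ p) (d p) v) ->
    cderiv (fun u => \sum_(p <- A) f u p) (\sum_(p <- A) d p) v.
  move=> hf; elim: (A) => [|p A' IH].
    rewrite big_nil; apply: cderiv_ext (cderiv_cst 0 v) => x; by rewrite big_nil.
  rewrite big_cons; apply: cderiv_ext (cderivD (hf p) IH) => x; by rewrite big_cons.
have hder u : 0 <= u <= T -> cderiv (fun u => \sum_(p <- A) F u p) (DF u) u.
  move=> _; have h := cderivD (cderivZ rootw (cs _ _ u (fun p => @cderiv_Lt b p u false))) (cs _ _ u (fun p => @cderiv_Lt b p u true)).
  apply: cderiv_ext h => x /=.
  by rewrite /F big_split /= mulr_sumr.
have := cn_mvt (M := 8 * K * (e / M)) T0 hder.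
rewrite subr0 => hm.
apply: le_trans (hm _) _; last first.
  have -> : 8 * K * (e / M) * T = (8 * K * T) / M * e by ring.
  by rewrite ler_piMl ?(ltW e0) // ler_pdivrMr // mul1r lerDl.
move=> u /andP[u0 uT].
set t := expR u.
have ef : expR ((-1) ^+ false * u) = t by rewrite expr0 mul1r.
have et : expR ((-1) ^+ true * u) = t^-1 by rewrite expr1 mulN1r expRN.
rewrite /DF ef et expr0 expr1 opprK.
have t1 : 1 <= t by rewrite /t -expR0 ler_expR.
have tD : t <= D by rewrite -[D]lnK ?posrE // ler_expR.
have t0 : 0 < t by apply: lt_le_trans t1.
have ti0 : 0 < t^-1 by rewrite invr_gt0.
have tiD : D^-1 <= t^-1 by rewrite lef_pV2 ?posrE.
have [S hS] := @Tk_sum R t k t0; have [S' hS'] := @Tk_sum R t^-1 k ti0.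
have hsym := theta_sym hb t0 hS hS'.
have b2 := tl S' t^-1 tiD hS'.
have it1 : t^-1 <= 1 by rewrite invf_le1.
have b1 := tl S t (le_trans tiD (le_trans it1 t1)) hS.
rewrite -!mulr_sumr.
have -> : rootw * (-1 * (kcoef b * t ^+ b.+1)%:C * \sum_(p <- A) Tk t k p) + 1 * (kcoef b * t^-1 ^+ b.+1)%:C * \sum_(p <- A) Tk t^-1 k p =
  (kcoef b * t^-1 ^+ b.+1)%:C * (\sum_(p <- A) Tk t^-1 k p - S') + (- rootw) * (kcoef b * t ^+ b.+1)%:C * (\sum_(p <- A) Tk t k p - S).
  have -> : (kcoef b * t^-1 ^+ b.+1)%:C * (\sum_(p <- A) Tk t^-1 k p - S') =
     (kcoef b * t^-1 ^+ b.+1)%:C * \sum_(p <- A) Tk t^-1 k p - (kcoef b)%:C * ((t^-1 ^+ b.+1)%:C * S').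
    by rewrite [(kcoef b * t^-1 ^+ b.+1)%:C]rC_M; ring.
  rewrite hsym [(kcoef b * t ^+ b.+1)%:C]rC_M; move: (kcoef b)%:C (rootw) (\sum_(p <- A) Tk t k p) => x1 x2 x3; ring.
have tb : t ^+ b.+1 <= D ^+ b.+1 by rewrite lerXn2r ?nnegrE // ltW.
have tib : t^-1 ^+ b.+1 <= D ^+ b.+1.
  by rewrite lerXn2r ?nnegrE ?(ltW ti0) ?(ltW D0) // (le_trans _ D1) // invf_le1.
have nn x : 0 < x -> 0 <= kcoef b * x ^+ b.+1.
  by move=> x0; apply: mulr_ge0 kc0 _; rewrite exprn_ge0 // ltW.
have c1 : cn (kcoef b * t^-1 ^+ b.+1)%:C <= K.
  by rewrite cn_real (ger0_norm (nn _ ti0)); exact: ler_wpM2l.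
have c2 : cn (kcoef b * t ^+ b.+1)%:C <= K.
  by rewrite cn_real (ger0_norm (nn _ t0)); exact: ler_wpM2l.
have cw : cn (- rootw) <= 7 by rewrite cnN cn_rootw.
apply: le_trans (cn_le_add (cn_le_mul c1 b2) (cn_le_mul (cn_le_mul cw c2) b1)) _.
by rewrite le_eqVlt; apply/orP; left; apply/eqP; ring.
Qed.

(** [center_const] is used with [D = m + 1] tending to infinity. The sum at [1 / D] has no summable
    majorant term by term at the central point; grouped into blocks it has one, uniform in [d], and
    [tannery] identifies the limit with the sum of [Lfunction_center]. *)
Theorem center_formula n (f : R[i] -> R[i]) : (0 < n)%N -> is_Lfunction n f ->
  exists2 U, hasSum (Lt (4 * n - 3) (2 * n - 1) s0 1) U & 2 * f 2^-1 = (1 + rootw) * U.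
Proof.
move=> n0 hf.
pose b := (n.-1).*2.
have -> : (4 * n - 3)%N = b.*2.+1 by rewrite /b; lia.
have -> : (2 * n - 1)%N = b.+1 by rewrite /b; lia.
have hb : ~~ odd b by rewrite odd_double.
have hc : hasSum (bl b.*2.+1 b.+1 s0 0) (2 * f 2^-1).
  have -> : b.*2.+1 = (4 * n - 3)%N by rewrite /b; lia.
  exact: Lfunction_center.
set k := b.*2.+1 in hc *.
have [U1 h1] := @Lt_sum k b.+1 1 ltr01.
exists U1 => //.
have np m : (0 : R) < m.+1%:R by [].
have /choice [UD hD] := fun m => @Lt_sum k b.+1 m.+1%:R (np m).
have /choice [UV hV] := fun m => @Lt_sum k b.+1 (m.+1%:R)^-1 ltac:(by rewrite invr_gt0).
have hcst m : rootw * UD m + UV m = (1 + rootw) * U1.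
  by apply: (@center_const b m.+1%:R) => //; rewrite ler1n.
have cV : ccvg \oo UV (2 * f 2^-1).
  have [C C0 hC] := block_bound k b.+1 (cn (s0 + k%:R / 2)).
  apply: (tannery (f := fun m => bl k b.+1 s0 (m.+1%:R)^-1) (g := bl k b.+1 s0 0) (W := fun q => C * wi2 R q)) => //.
  - exact: wsumZ (wsum_wi2 R) (ltW C0).
  - by near=> m => q; apply: hC => //=; rewrite ?invr_ge0 //; lra.
  - move=> q; apply: ccvg_sum => h; rewrite /Lt.
    apply: ccvgM; first exact: ccvg_cst.
    have hq : {for 0, continuous (fun x : R => Qg b.+1 (kap * x * nm R (bmap (h, q))))}.
      have hd : derivable (Qg b.+1) (0 : R) 1 by have := is_derive_Qg b (0 : R) => -[].
      have c1 : {for 0, continuous (Qg b.+1 : R -> R)} by apply: differentiable_continuous; apply/derivable1_diffP.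
      apply: continuous_comp; last by rewrite mulr0 mul0r.
      by apply: cvgM; [apply: cvgM; [exact: cvg_cst|exact: cvg_id]|exact: cvg_cst].
    have h0 : ((m.+1%:R)^-1 : R) @[m --> \oo] --> (0 : R) by exact: cvg_harmonic.
    have hr : Qg b.+1 (kap * (m.+1%:R)^-1 * nm R (bmap (h, q))) @[m --> \oo] --> Qg b.+1 (kap * 0 * nm R (bmap (h, q))).
      exact: (continuous_cvg _ hq h0).
    by move/ccvg_real : hr.
  - by near=> m; apply: bl_hasSum.
have cD : ccvg \oo UD 0.
  have [C C0 hC] := Lt_gauss k b.+1.
  have [_ [M hM]] := wsum_wi2 R.
  have M0 : 0 <= M by have := hM [::] isT; rewrite big_nil.
  apply/ccvgP => e e0.
  have h0 : ((m.+1%:R)^-1 : R) @[m --> \oo] --> (0 : R) by exact: cvg_harmonic.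
  have CM : 0 < C * M + 1 by rewrite ltr_wpDl // mulr_ge0 // ltW.
  have /cvgrPdist_le /(_ (e / (C * M + 1)) (divr_gt0 e0 CM)) := h0.
  apply: filterS => m; rewrite sub0r normrN ger0_norm ?invr_ge0 // => hm.
  rewrite subr0; apply: (hasSum_le (hD m) (W := fun p => C / m.+1%:R * wi2 R p)) => [p|A uA].
    by apply: hC; rewrite ler1n.
  rewrite -mulr_sumr; apply: le_trans (_ : C / m.+1%:R * M <= _).
    by rewrite ler_wpM2l ?hM // divr_ge0 // ltW.
  move: hm; rewrite ler_pdivlMr // => hm; apply: le_trans hm.
  by rewrite mulrAC mulrC ler_wpM2l ?invr_ge0 // lerDl.
have c2 : ccvg \oo (fun m => rootw * UD m + UV m) (rootw * 0 + 2 * f 2^-1).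
  by apply: ccvgD => //; apply: ccvgM => //; exact: ccvg_cst.
have c3 : ccvg \oo (fun m => rootw * UD m + UV m) ((1 + rootw) * U1).
  rewrite (_ : (fun m => _) = fun=> (1 + rootw) * U1); first exact: ccvg_cst.
  by apply/funext.
have e0 : rootw * 0 + 2 * f 2^-1 = 2 * f 2^-1 by move: (f _) => y; ring.
by rewrite -e0; exact: ccvg_unique c2 c3.
Unshelve. all: by end_near.
Qed.

End CentralFormula.

(** * The mean square *)

Section AbelSums.
Variable R : realType.

(** Summation by parts. In [H] the boundary term is kept inside the modulus, so each induction step
    adds exactly the increment of the weight. *)
Lemma abel_geometric (z : R[i]) (c : nat -> R) N : cn z = 1 -> 0 <= c 0%N -> (forall n, c n <= c n.+1) ->
  cn ((1 - z) * \sum_(n < N) z ^+ n * (c n)%:C) <= 2 * c N.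
Proof.
move=> z1 c0 cm.
have cge n : 0 <= c n by elim: n => // n IH; apply: le_trans (cm n).
have H M : cn ((1 - z) * \sum_(n < M.+1) z ^+ n * (c n)%:C + z ^+ M.+1 * (c M)%:C) <= c M.
  elim: M => [|M IH].
    rewrite big_ord_recl big_ord0 addr0 expr0 mul1r expr1.
    by rewrite (_ : _ + _ = (c 0%N)%:C); [rewrite cn_real ger0_norm|ring].
  rewrite big_ord_recr /= (_ : z ^+ M.+2 = z * z ^+ M.+1); last by rewrite exprS.
  set s := \sum_(n < M.+1) _ in IH *.
  have -> : (1 - z) * (s + z ^+ M.+1 * (c M.+1)%:C) + z * z ^+ M.+1 * (c M.+1)%:C =
    ((1 - z) * s + z ^+ M.+1 * (c M)%:C) + z ^+ M.+1 * (c M.+1 - c M)%:C.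
    by rewrite rC_D rC_N; ring.
  apply: le_trans (cn_le_add IH (lexx _)) _.
  by rewrite cnM cnX z1 expr1n mul1r cn_real ger0_norm ?subr_ge0 // addrC subrK.
case: N => [|N]; first by rewrite big_ord0 mulr0 cn0 mulr_ge0.
have -> : (1 - z) * (\sum_(n < N.+1) z ^+ n * (c n)%:C) =
  ((1 - z) * (\sum_(n < N.+1) z ^+ n * (c n)%:C) + z ^+ N.+1 * (c N)%:C) - z ^+ N.+1 * (c N)%:C by ring.
apply: le_trans (cnB _ _) _; rewrite [X in _ + X]cnM cnX z1 expr1n mul1r cn_real (ger0_norm (cge N)).
by have := H N; have := cm N; lra.
Qed.

Lemma abel_decreasing (c : nat -> R) (w : nat -> R) (A : R) K : 0 <= A ->
  (forall m, `|\sum_(i < m) c i| <= A) -> (forall m, 0 <= w m) -> (forall m, w m.+1 <= w m) ->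
  `|\sum_(m < K) c m * w m| <= A * w 0%N.
Proof.
move=> A0 hc w0 wd.
have H M : `|\sum_(m < M.+1) c m * w m - (\sum_(m < M.+1) c m) * w M| <= A * (w 0%N - w M).
  elim: M => [|M IH].
    by rewrite !big_ord_recl !big_ord0 !addr0 !subrr normr0 mulr0.
  rewrite big_ord_recr /= [X in _ - X * _]big_ord_recr /=.
  have h := hc M.+1.
  set s := \sum_(m < M.+1) c m * w m in IH *; set t := \sum_(m < M.+1) c m in IH h *.
  have -> : s + c M.+1 * w M.+1 - (t + c M.+1) * w M.+1 = (s - t * w M) + t * (w M - w M.+1) by ring.
  apply: le_trans (ler_normD _ _) _; rewrite normrM.
  have w1 : 0 <= w M - w M.+1 by rewrite subr_ge0.
  rewrite (ger0_norm w1).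
  have : `|t| * (w M - w M.+1) <= A * (w M - w M.+1) by rewrite ler_wpM2r // subr_ge0.
  by move: IH; move: `|_| (_ * _) => *; lra.
case: K => [|K]; first by rewrite big_ord0 normr0 mulr_ge0.
rewrite -[\sum_(m < K.+1) c m * w m](subrK ((\sum_(m < K.+1) c m) * w K)).
apply: le_trans (ler_normD _ _) _; rewrite normrM (ger0_norm (w0 K)).
have := H K; have : `|\sum_(m < K.+1) c m| * w K <= A * w K by rewrite ler_wpM2r.
by move: `|_ - _| (`|_| * _) => *; lra.
Qed.

Lemma chi_partial (e : bool) m : `|\sum_(i < m) (if e || (2 %| i.+1)%N then (chi i.+1%:Z)%:~R else 0 : R)| <= 14.
Proof.
pose f (i : nat) : int := if e || (2 %| i.+1)%N then chi i.+1%:Z else 0.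
have -> : \sum_(i < m) (if e || (2 %| i.+1)%N then (chi i.+1%:Z)%:~R else 0 : R) = (\sum_(i < m) f i)%:~R.
  by rewrite rmorph_sum; apply: eq_bigr => i _; rewrite /f; case: ifP.
have per n : f (14 + n)%N = f n.
  rewrite /f (_ : (2 %| (14 + n).+1)%N = (2 %| n.+1)%N); last by apply/idP/idP; lia.
  by rewrite (_ : (14 + n).+1%:Z = 2 * 7 + n.+1%:Z) ?chi_mod //; lia.
have fle n : (`|f n| <= 1)%R by rewrite /f; case: ifP => // _; exact: chi_norm.
have s14 q r : \sum_(i < 14 * q + r) f i = \sum_(i < r) f i.
  elim: q => [|q IH]; first by rewrite muln0.
  rewrite mulnS -addnA big_split_ord /=.
  rewrite (eq_bigr (fun i : 'I_(14 * q + r) => f i)) ?IH; last by move=> i _; exact: per.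
  rewrite [X in X + _](_ : _ = 0) ?add0r //.
  by rewrite /f; case: (e); rewrite !big_ord_recl big_ord0.
rewrite (divn_eq m 14) mulnC s14 -intr_norm.
have -> : (14 : R) = (14 : int)%:~R by [].
rewrite ler_int; apply: le_trans (ler_norm_sum _ _ _) _.
apply: le_trans (_ : \sum_(i < m %% 14) (1 : int) <= _); first by apply: ler_sum => i _; exact: fle.
rewrite sumr_const card_ord; have := ltn_pmod m (isT : (0 < 14)%N); lia.
Qed.

End AbelSums.

Section Terms.
Variable R : realType.
Implicit Types (p q : int * int) (j N B : nat).
Local Notation kap := (2 * pi / 7 : R).

Definition eterm j p : R[i] := ec R p * (al R p ^+ (4 * j).+1 / (nm R p)%:C ^+ (2 * j).+1) *
  (Qg (2 * j).+1 (kap * nm R p))%:C.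

Lemma Lt_eterm j p : Lt (4 * j.+1 - 3) (2 * j.+1 - 1) (2^-1 +i* 0) 1 p = eterm j p.
Proof.
have e1 : (4 * j.+1 - 3 = (2 * j).*2.+1)%N by lia.
have e2 : (2 * j.+1 - 1 = (2 * j).+1)%N by lia.
have e3 : ((4 * j).+1 = (2 * j).*2.+1)%N by lia.
rewrite /Lt /eterm e1 e2 e3 mulr1; congr (_ * _).
have := center_pow R (2 * j) p.
have [h|h] := eqVneq (nm R p) 0.
  have a0 : al R p = 0.
    by apply/eqP; rewrite -cn_eq0 -[_ == 0]/((0 < 2)%N && _) -expf_eq0 cn_al2 h.
  by rewrite a0 expr0n /= !mul0r mulr0 mul0r.
have n0 : (nm R p)%:C != 0 :> R[i] by rewrite -cn_gt0 cn_real normr_gt0.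
rewrite rC_X -(mulrA (ec R p)); move: (cexp _) => c hc; congr (_ * _).
by rewrite -[in RHS]hc mulfK // expf_neq0.
Qed.

Lemma cn_eterm j p : cn (eterm j p) <= if ec R p != 0 then (cn (al R p))^-1 * Qg (2 * j).+1 (kap * nm R p) else 0.
Proof.
rewrite /eterm; case: eqP => [->|/eqP h]; first by rewrite !mul0r cn0.
have n1 := ec_nm h; have n0 : 0 < nm R p by apply: lt_le_trans n1.
have a0 : 0 < cn (al R p) by rewrite lt0r cn_ge0 andbT -[_ == 0]/((0 < 2)%N && _) -expf_eq0 cn_al2 gt_eqF.
have X0 : 0 <= kap * nm R p by rewrite mulr_ge0 ?c7_ge0 // ltW.
rewrite cnM cn_real (ger0_norm (Qg_ge0 _ X0)); apply: ler_wpM2r; first exact: Qg_ge0.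
rewrite cnM cnM cnX cnV cnX cn_real (gtr0_norm n0) -cn_al2 -exprM.
have -> : cn (al R p) ^+ (4 * j).+1 / cn (al R p) ^+ (2 * (2 * j).+1) = (cn (al R p))^-1.
  have -> : (2 * (2 * j).+1 = (4 * j).+1 + 1)%N by lia.
  by rewrite exprD expr1 invfM mulrA divff ?mul1r // expf_neq0 // gt_eqF.
by rewrite ler_piMl ?cn_ec // invr_ge0 cn_ge0.
Qed.

Lemma kap_ge : 4 / 7 <= kap.
Proof. by have := pi_ge2 R; move: (pi : R) => P; lra. Qed.

Definition box B : seq (int * int) := [seq (x, y) | x <- cint_range B, y <- cint_range B].

Lemma box_uniq B : uniq (box B).
Proof. by apply: allpairs_uniq; rewrite ?cint_range_uniq // => -[? ?] [? ?]. Qed.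

Lemma mem_box B p : (p \in box B) = (`|p.1| <= B)%N && (`|p.2| <= B)%N.
Proof.
apply/allpairsP/andP => [[[x y] /= [h1 h2 ->]]|[h1 h2]].
  by rewrite -!mem_cint_range.
by exists p; rewrite !mem_cint_range; split => //; case: (p).
Qed.

(* [eterm j] decays exponentially for norms much larger than [j]. *)
Lemma eterm_tail : exists2 C : R, 0 <= C & forall N B j U, (j < N)%N -> (56 * N <= B ^ 2)%N ->
  hasSum (eterm j) U -> cn (U - \sum_(p <- box B) eterm j p) <= C.
Proof.
have k0 := kap_gt0 R.
have [C C0 hC] := @gauss2_wi R (kap / 4) 0 0 ltac:(by rewrite divr_gt0).
have [w0 [M hM]] := wsum_wi2 R.
have M0 : 0 <= M by have := hM [::] isT; rewrite big_nil.
exists (C * M) => [|N B j U jN hB hU]; first by rewrite mulr_ge0 // ltW.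
pose f p : R[i] := if p \in box B then eterm j p else 0.
have hf : hasSum f (\sum_(p <- box B) eterm j p).
  have -> : \sum_(p <- box B) eterm j p = \sum_(p <- box B) f p.
    by apply: eq_big_seq => p hp; rewrite /f hp.
  by apply: hasSum_fin; [exact: box_uniq|move=> p; rewrite /f => /negbTE ->].
have hd := hasSumD hU (hasSumZ (-1) hf).
rewrite -[- (\sum_(_ <- _) _)]mulN1r.
apply: (hasSum_le (W := fun p => C * wi2 R p) hd) => [p|A uA]; last first.
  by rewrite -mulr_sumr ler_wpM2l ?(ltW C0) // hM.
rewrite mulN1r /f; case: ifPn => hp; first by rewrite subrr cn0 mulr_ge0 ?(ltW C0) // wi2_ge0.
rewrite oppr0 addr0; apply: le_trans (cn_eterm _ _) _.
case: eqP => /= [_|/eqP h]; first by rewrite mulr_ge0 ?(ltW C0) // wi2_ge0.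
have n1 := ec_nm h; have n0 : 0 < nm R p by apply: lt_le_trans n1.
have X0 : 0 <= kap * nm R p by rewrite mulr_ge0 ?c7_ge0 // ltW.
have nB : 14 * N%:R <= nm R p.
  have hb : 56 * N%:R <= B%:R ^+ 2 :> R by rewrite -natrX -(natrM _ 56) ler_nat.
  move: hp; rewrite mem_box negb_and -!ltnNge => hp.
  have : B%:R ^+ 2 <= 4 * nm R p.
    rewrite /nm mulrC divfK // !int_sqr.
    have s1 : 0 <= (`|p.1|%N%:R : R) ^+ 2 by exact: sqr_ge0.
    have s2 : 0 <= (`|p.2|%N%:R : R) ^+ 2 by exact: sqr_ge0.
    case/orP: hp => hp.
      have : B%:R ^+ 2 <= (`|p.1|%N%:R : R) ^+ 2 by rewrite lerXn2r ?nnegrE // ler_nat ltnW.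
      by clear -s1 s2; move: (B%:R ^+ 2 : R) (`|p.1|%N%:R ^+ 2 : R) (`|p.2|%N%:R ^+ 2 : R) s1 s2 => *; lra.
    have : B%:R ^+ 2 <= (`|p.2|%N%:R : R) ^+ 2 by rewrite lerXn2r ?nnegrE // ler_nat ltnW.
    by clear -s1 s2; move: (B%:R ^+ 2 : R) (`|p.1|%N%:R ^+ 2 : R) (`|p.2|%N%:R ^+ 2 : R) s1 s2 => *; lra.
  by clear -hb; move: hb; move: (B%:R ^+ 2) (N%:R : R) (nm R p) => *; lra.
have hC' : expR (- (kap / 4 * nm R p)) <= C * wi2 R p.
  by have := hC p; rewrite expr0 mul1r mul0r add0r.
apply: le_trans hC'; apply: le_trans (_ : Qg (2 * j).+1 (kap * nm R p) <= _).
  apply: ler_piMl; first exact: Qg_ge0.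
  rewrite invf_le1; last by rewrite cn_al_exp // expR_gt0.
  by rewrite cn_al_exp // -expR0 ler_expR divr_ge0 // ln_ge0.
apply: le_trans (Qg_tail _ X0) _.
have h2 : (2 : R) ^+ (2 * j).+1 <= expR (2 * N%:R).
  apply: le_trans (_ : expR 1 ^+ (2 * N) <= _); last by rewrite -expRM_natl natrM mulr1.
  apply: le_trans (_ : 2 ^+ (2 * N) <= _).
    have le : ((2 * j).+1 <= 2 * N)%N by clear -jN; lia.
    by rewrite ler_weXn2l ?ler1n.
  by rewrite lerXn2r ?nnegrE ?expR_ge0 //; have := expR_ge1Dx (1 : R); lra.
apply: le_trans (ler_wpM2r (expR_ge0 _) h2) _.
rewrite -expRD ler_expR.
have : 4 / 7 * (14 * N%:R) <= kap * nm R p by apply: ler_pM => //; exact: kap_ge.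
have -> : kap / 4 * nm R p = kap * nm R p / 4 by ring.
by move: (kap * nm R p) (N%:R : R) => *; lra.
Qed.

End Terms.

Section PairBound.
Variable R : realType.
Implicit Types (p q : int * int) (j N B : nat).
Local Notation kap := (2 * pi / 7 : R).

Definition dotp p q : int := p.1 * q.1 + 7 * p.2 * q.2.
Definition crsp p q : int := p.2 * q.1 - p.1 * q.2.

Lemma ec_chi p : ec R p != 0 -> chi p.1 != 0.
Proof. by rewrite /ec; case: ifP => _; [rewrite intr_eq0|rewrite eqxx]. Qed.

Lemma dotp_neq0 p q : ec R p != 0 -> ec R q != 0 -> dotp p q != 0.
Proof.
move=> /ec_chi h1 /ec_chi h2; apply/eqP => h.
have : chi (p.1 * q.1) = 0 by apply: chi_dvd; apply/dvdzP; exists (- (p.2 * q.2)); move: h; rewrite /dotp; lia.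
by rewrite chiM => /eqP; rewrite mulf_eq0 (negbTE h1) (negbTE h2).
Qed.

Lemma al_conj p q : al R p * conjc (al R q) = ((dotp p q)%:~R / 4) +i* (Num.sqrt 7 * (crsp p q)%:~R / 4).
Proof.
have e1 : (dotp p q)%:~R = p.1%:~R * q.1%:~R + 7 * p.2%:~R * q.2%:~R :> R by rewrite /dotp intrD !intrM.
have e2 : (crsp p q)%:~R = p.2%:~R * q.1%:~R - p.1%:~R * q.2%:~R :> R by rewrite /crsp intrB !intrM.
have s7 : Num.sqrt (7 : R) ^+ 2 = 7 by rewrite sqr_sqrtr.
rewrite e1 e2 /al; move: (Num.sqrt 7) s7 => s s7.
apply: ext_complex; rewrite /=; last by field.
have -> : p.1%:~R * q.1%:~R + 7 * p.2%:~R * q.2%:~R = p.1%:~R * q.1%:~R + s ^+ 2 * p.2%:~R * q.2%:~R by rewrite s7.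
by field.
Qed.

Lemma cn_conj (z : R[i]) : cn (conjc z) = cn z.
Proof.
apply/eqP; rewrite -(eqrXn2 (n := 2)) ?cn_ge0 //; apply/eqP; rewrite !cn_sqr.
by case: z => a b /=; ring.
Qed.

Lemma mul_conj (z : R[i]) : z * conjc z = (cn z ^+ 2)%:C.
Proof. by rewrite cn_sqr; case: z => a b; apply: ext_complex; rewrite /=; ring. Qed.

Lemma conjM (z w : R[i]) : conjc (z * w) = conjc z * conjc w.
Proof. exact: rmorphM. Qed.

Lemma conjX (z : R[i]) n : conjc (z ^+ n) = conjc z ^+ n.
Proof. exact: rmorphXn. Qed.

Lemma eterm_geometric j p : nm R p != 0 -> eterm R j p =
  ec R p * al R p / (nm R p)%:C * (al R p ^+ 4 / (nm R p)%:C ^+ 2) ^+ j * (Qg (2 * j).+1 (kap * nm R p))%:C.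
Proof.
move=> n0; have n1 : (nm R p)%:C != 0 :> R[i] by rewrite -cn_gt0 cn_real normr_gt0.
rewrite /eterm; congr (_ * _).
rewrite exprS exprM [_ ^+ (2 * j).+1]exprS [_ ^+ (2 * j)]exprM expr_div_n.
move: ((al R p ^+ 4) ^+ j) (((nm R p)%:C ^+ 2) ^+ j) (expf_neq0 j (expf_neq0 2 n1)) => u v v0.
by move: ((nm R p)%:C) n1 => w w0; field; rewrite w0 v0.
Qed.

Lemma cn_coef p : 0 < nm R p -> cn (ec R p * al R p / (nm R p)%:C) <= (cn (al R p))^-1.
Proof.
move=> n0; have a0 : 0 < cn (al R p) by rewrite cn_al_exp // expR_gt0.
rewrite !cnM cnV cn_real gtr0_norm // -cn_al2.
have -> : (cn (al R p))^-1 = cn (al R p) / cn (al R p) ^+ 2 by field; rewrite gt_eqF.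
by rewrite ler_wpM2r ?invr_ge0 ?exprn_ge0 ?cn_ge0 // ler_piMl ?cn_ge0 ?cn_ec.
Qed.

(* [al p * conj (al q)] has polar angle [t] with [|sin t cos t|] equal to [sqrt 7 / 16] times
   [|dotp p q * crsp p q|], over the product of the norms. The sum over [j] is a geometric sum of
   ratio [exp (4 i t)] with monotone weights. *)
Lemma pair_bound p q N : ec R p != 0 -> ec R q != 0 -> crsp p q != 0 ->
  cn (\sum_(j < N) eterm R j p * conjc (eterm R j q)) <=
    2 / `|(dotp p q)%:~R| + 2 / `|(crsp p q)%:~R|.
Proof.
move=> hp hq hc; have hd := dotp_neq0 hp hq.
have np1 := ec_nm hp; have nq1 := ec_nm hq.
have np0 : 0 < nm R p by apply: lt_le_trans np1.
have nq0 : 0 < nm R q by apply: lt_le_trans nq1.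
have np0' := sqrt_real_neq0 np0; have nq0' := sqrt_real_neq0 nq0.
set A := al R p; set B := al R q.
pose g := A * conjc B.
pose G : R := nm R p * nm R q.
have G0 : 0 < G by rewrite mulr_gt0.
have gG : cn g ^+ 2 = G by rewrite /g cnM cn_conj exprMn !cn_al2.
have g0 : 0 < cn g by rewrite lt0r cn_ge0 andbT -[_ == 0]/((0 < 2)%N && _) -expf_eq0 gG gt_eqF.
pose X : R := (dotp p q)%:~R / 4.
pose Y : R := Num.sqrt 7 * (crsp p q)%:~R / 4.
have gXY : g = X +i* Y by rewrite /g al_conj.
pose z := g ^+ 4 / (G ^+ 2)%:C.
have GC0 : (G ^+ 2)%:C != 0 :> R[i] by rewrite sqrt_real_neq0 // exprn_gt0.
have z1 : cn z = 1.
  rewrite /z cnM cnV cnX cn_real ger0_norm ?exprn_ge0 ?(ltW G0) // -gG -exprM divff // expf_neq0 // gt_eqF //.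
have s7 : 0 < Num.sqrt (7 : R) by rewrite sqrtr_gt0.
have s71 : 1 <= Num.sqrt (7 : R) by rewrite -[X in X <= _]sqrtr1; apply: ler_wsqrtr; rewrite ler1n.
have r0 : (crsp p q)%:~R != 0 :> R by rewrite intr_eq0.
have q4 : (4 : R)^-1 != 0 by rewrite invr_eq0 pnatr_eq0.
have s70 : Num.sqrt 7 != 0 :> R by rewrite gt_eqF.
have X0 : 0 < `|X| by rewrite normr_gt0 mulf_neq0 ?intr_eq0 // invr_eq0 pnatr_eq0.
have Y0 : 0 < `|Y| by rewrite normr_gt0 /Y; apply: mulf_neq0 q4; apply: mulf_neq0.
have hz : cn (1 - z) * G = 4 * `|X| * `|Y|.
  have e : (1 - z) * (G ^+ 2)%:C = - (4 * 'i%C * X%:C * Y%:C) * g ^+ 2.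
    have eG : (G ^+ 2)%:C = (g * conjc g) ^+ 2 by rewrite mul_conj gG rC_X.
    rewrite mulrBl mul1r /z divfK // eG gXY.
    have -> : conjc (X +i* Y) = X%:C - 'i%C * Y%:C by apply: ext_complex; rewrite /=; ring.
    have -> : X +i* Y = X%:C + 'i%C * Y%:C by apply: ext_complex; rewrite /=; ring.
    have i2 := sqr_i R.
    move: (X%:C) (Y%:C) => x y.
    have -> : (x + 'i%C * y) * (x - 'i%C * y) = x ^+ 2 - 'i%C ^+ 2 * y ^+ 2 by ring.
    have -> : (x + 'i%C * y) ^+ 4 = (x ^+ 2 + 2 * 'i%C * x * y + 'i%C ^+ 2 * y ^+ 2) ^+ 2 by ring.
    have -> : (x + 'i%C * y) ^+ 2 = x ^+ 2 + 2 * 'i%C * x * y + 'i%C ^+ 2 * y ^+ 2 by ring.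
    rewrite i2.
    have -> : (x ^+ 2 + 2 * 'i%C * x * y + -1 * y ^+ 2) ^+ 2 = (x ^+ 2 - y ^+ 2) ^+ 2 + 4 * 'i%C ^+ 2 * x ^+ 2 * y ^+ 2 + 4 * 'i%C * x * y * (x ^+ 2 - y ^+ 2) by ring.
    have -> : - (4 * 'i%C * x * y) * (x ^+ 2 + 2 * 'i%C * x * y + -1 * y ^+ 2) = - 8 * 'i%C ^+ 2 * x ^+ 2 * y ^+ 2 - 4 * 'i%C * x * y * (x ^+ 2 - y ^+ 2) by ring.
    by rewrite i2; ring.
  have ci : cn ('i%C : R[i]) = 1 by rewrite /cn /= expr0n add0r expr1n sqrtr1.
  have : cn (1 - z) * G ^+ 2 = 4 * `|X| * `|Y| * G.
    have := congr1 (@cn R) e.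
    rewrite cnM cn_real ger0_norm ?exprn_ge0 ?(ltW G0) // => ->.
    rewrite cnM cnN cnX gG; congr (_ * _).
    by rewrite cnM cnM cnM cn_nat ci mulr1 !cn_real.
  by rewrite expr2 mulrA => /(mulIf _) -> //; rewrite gt_eqF.
pose c j : R := Qg (2 * j).+1 (kap * nm R p) * Qg (2 * j).+1 (kap * nm R q).
have Xp : 0 <= kap * nm R p by rewrite mulr_ge0 ?c7_ge0 // ltW.
have Xq : 0 <= kap * nm R q by rewrite mulr_ge0 ?c7_ge0 // ltW.
have cm j : c j <= c j.+1.
  have j2 : ((2 * j).+1 <= (2 * j.+1).+1)%N by rewrite ltnS leq_mul2l leqnSn.
  exact: ler_pM (Qg_ge0 _ Xp) (Qg_ge0 _ Xq) (Qg_mono Xp j2) (Qg_mono Xq j2).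
have c1 : c N <= 1 by rewrite -[leRHS]mulr1; apply: ler_pM; [exact: Qg_ge0|exact: Qg_ge0|exact: Qg_le1|exact: Qg_le1].
have c0 : 0 <= c 0%N by apply: mulr_ge0; exact: Qg_ge0.
have hS := abel_geometric N z1 c0 cm.
set S := \sum_(j < N) _ in hS.
pose cf : R[i] := (ec R p * A / (nm R p)%:C) * conjc (ec R q * B / (nm R q)%:C).
have cj_real (x : R) : conjc x%:C = x%:C :> R[i] by apply: ext_complex; rewrite /= ?oppr0.
have -> : \sum_(j < N) eterm R j p * conjc (eterm R j q) = cf * S.
  rewrite mulr_sumr; apply: eq_bigr => j _.
  have -> : z = (A ^+ 4 / (nm R p)%:C ^+ 2) * conjc (B ^+ 4 / (nm R q)%:C ^+ 2).
    rewrite conjM conjc_inv !conjX cj_real /z /g /G rC_X rC_M.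
    move: (conjc B) ((nm R p)%:C) np0' ((nm R q)%:C) nq0' => v5 v7 h7 v8 h8.
    by field; rewrite h7 h8.
  rewrite (eterm_geometric j (lt0r_neq0 np0)) (eterm_geometric j (lt0r_neq0 nq0)) -/A -/B.
  have conj3 (u v : R[i]) (w : R) i : conjc (u * v ^+ i * w%:C) = conjc u * conjc v ^+ i * w%:C.
    by rewrite conjM conjM conjX cj_real.
  have conj4 (u v u' v' : R[i]) (w w' : R) i : u * v ^+ i * w%:C * (conjc u' * conjc v' ^+ i * w'%:C) =
      u * conjc u' * ((v * conjc v') ^+ i * (w * w')%:C).
    by rewrite exprMn rC_M; ring.
  by rewrite conj3 conj4.
have hS2 : cn S <= G / (2 * `|X| * `|Y|).
  rewrite ler_pdivlMr ?mulr_gt0 //.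
  have : cn S * (4 * `|X| * `|Y|) <= 2 * G.
    by rewrite -hz mulrA ler_wpM2r ?(ltW G0) // mulrC -cnM; apply: le_trans hS _; rewrite -[leRHS]mulr1 ler_wpM2l.
  have -> : cn S * (4 * `|X| * `|Y|) = 2 * (cn S * (2 * `|X| * `|Y|)) by ring.
  by rewrite ler_pM2l.
have hcf : cn cf <= (cn g)^-1.
  have -> : (cn g)^-1 = (cn A)^-1 * (cn B)^-1 by rewrite /g cnM cn_conj invfM.
  by rewrite /cf cnM cn_conj; apply: ler_pM; rewrite ?cn_ge0 //; exact: cn_coef.
rewrite cnM; apply: le_trans (ler_pM (cn_ge0 _) (cn_ge0 _) hcf hS2) _.
have hg : cn g <= `|X| + `|Y| by rewrite gXY; exact: cn_le_ReIm.
have -> : (cn g)^-1 * (G / (2 * `|X| * `|Y|)) = cn g / (2 * `|X| * `|Y|).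
  by rewrite -gG; field; rewrite !gt_eqF.
apply: le_trans (_ : (`|X| + `|Y|) / (2 * `|X| * `|Y|) <= _).
  by rewrite ler_wpM2r // invr_ge0 !mulr_ge0.
have -> : (`|X| + `|Y|) / (2 * `|X| * `|Y|) = (2 * `|X|)^-1 + (2 * `|Y|)^-1 by field; rewrite !gt_eqF.
have n4 : `|(4 : R)^-1| = 4^-1 by rewrite ger0_norm.
apply: lerD.
  rewrite /X normrM n4; have d0 : 0 < `|(dotp p q)%:~R : R| by rewrite normr_gt0 intr_eq0.
  by rewrite le_eqVlt; apply/orP; left; apply/eqP; field; rewrite gt_eqF.
have d0 : 0 < `|(crsp p q)%:~R : R| by rewrite normr_gt0 intr_eq0.
rewrite /Y !normrM n4 (gtr0_norm s7).
have -> : (2 * (Num.sqrt (7 : R) * `|(crsp p q)%:~R : R| / 4))^-1 = (2 / `|(crsp p q)%:~R : R|) / Num.sqrt (7 : R).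
  by field; rewrite !gt_eqF.
by rewrite ler_pdivrMr // ler_peMr // divr_ge0.
Qed.

End PairBound.

Section LatticeSums.
Variable R : realType.
Implicit Types (p q : int * int) (B M : nat).

Definition harm M : R := \sum_(m < M) (m.+1%:R)^-1.

Lemma harm_ge0 M : 0 <= harm M.
Proof. by apply: sumr_ge0 => i _; rewrite invr_ge0. Qed.

Lemma harm_le M M' : (M <= M')%N -> harm M <= harm M'.
Proof.
move=> h; rewrite -(subnKC h); elim: (M' - M)%N => [|n IH]; first by rewrite addn0.
by rewrite addnS /harm big_ord_recr /=; apply: le_trans IH _; rewrite lerDl invr_ge0.
Qed.

Lemma harm_ln M : (0 < M)%N -> harm M <= 1 + ln M%:R.
Proof.
elim: M => // -[_ _|M /(_ isT) IH _].
  by rewrite /harm big_ord_recl big_ord0 ln1 invr1 !addr0.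
rewrite /harm big_ord_recr /=; apply: le_trans (lerD IH (lexx _)) _.
rewrite -addrA lerD2l.
have m1 : (0 : R) < M.+1%:R by [].
have m2 : (0 : R) < M.+2%:R by [].
rewrite -lerBrDl -ln_div ?posrE //.
rewrite -[X in _ <= X]opprK -lnV ?posrE ?divr_gt0 // invf_div lerNr.
have e : (M.+1%:R / M.+2%:R : R) = 1 + - (M.+2%:R)^-1.
  by rewrite -[M.+2%:R]natr1; move: (M.+1%:R : R) m1 => u u0; field; rewrite gt_eqF // addr_gt0.
rewrite e; apply: le_ln1Dx; rewrite ltrN2 invf_lt1 // ltr1n //.
Qed.

Lemma sum_inj_le (T U : eqType) (A : seq T) (phi : T -> U) (B : seq U) (F : U -> R) :
  uniq A -> uniq B -> {in A &, injective phi} -> (forall t, t \in A -> phi t \in B) ->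
  (forall u, 0 <= F u) -> \sum_(t <- A) F (phi t) <= \sum_(u <- B) F u.
Proof.
move=> uA uB inj im F0.
have um : uniq (map phi A) by rewrite map_inj_in_uniq.
have sm : {subset map phi A <= B} by move=> u /mapP[t ht ->]; exact: im.
rewrite -(big_map phi xpredT) (sum_subset _ um uB sm) lerDl.
by apply: sumr_ge0.
Qed.

Lemma sum_abs_le M (F : nat -> R) : (forall n, 0 <= F n) ->
  \sum_(h <- cint_range M) F `|h|%N <= 2 * \sum_(i < M.+1) F i.
Proof.
move=> F0.
apply: le_trans (_ : \sum_(u <- [seq (b, i) | b <- [:: true; false], i <- iota 0 M.+1]) F u.2 <= _).
  apply: (sum_inj_le (phi := fun h : int => (h < 0, `|h|%N))) => //.
  - exact: cint_range_uniq.
  - by apply: allpairs_uniq => //; [exact: iota_uniq|move=> [? ?] [? ?]].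
  - by move=> h h' _ _ [e1 e2]; move: e1 e2; case: h => n; case: h' => n' //= _; lia.
  - move=> h; rewrite mem_cint_range => hM; apply/allpairsP; exists (h < 0, `|h|%N); split => //=.
      by case: (h < 0).
    by rewrite -[_ :: _]/(iota 0 M.+1) mem_iota add0n ltnS.
rewrite big_allpairs big_cons big_cons big_nil /= addr0 mulr_natl mulr2n.
by rewrite -[_ :: iota 1 M]/(index_iota 0 M.+1) big_mkord.
Qed.

Lemma sum_inv_range M : \sum_(h <- cint_range M) (`|h|%N%:R)^-1 <= 2 * harm M.
Proof.
apply: le_trans (@sum_abs_le M (fun n => (n%:R)^-1) _) _ => [n|]; first by rewrite invr_ge0.
by rewrite big_ord_recl invr0 add0r.
Qed.

Lemma size_cint_range M : size (cint_range M) = (2 * M).+1.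
Proof. by rewrite size_map size_iota. Qed.

Lemma sum_box B (F : int -> int -> R) :
  \sum_(p <- box B) F p.1 p.2 = \sum_(x <- cint_range B) \sum_(y <- cint_range B) F x y.
Proof. by rewrite big_allpairs. Qed.

Lemma quot_inj (d : int) (u v : nat) : (d %| v%:Z - u%:Z)%Z -> (u %/ `|d| = v %/ `|d|)%N -> u = v.
Proof.
wlog uv : u v / (u <= v)%N => [h|].
  have [le|lt] := leqP u v; first exact: h.
  move=> h1 /esym h2; apply/esym; apply: h => //; [exact: ltnW|].
  by move: h1; rewrite !dvdzE (_ : absz (v%:Z - u%:Z) = absz (u%:Z - v%:Z)) //; lia.
rewrite dvdzE (_ : absz (v%:Z - u%:Z) = (v - u)%N); last by rewrite subzn.
rewrite -eqn_mod_dvd // => /eqP h1 h2.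
by rewrite (divn_eq u `|d|) (divn_eq v `|d|) h1 h2.
Qed.

Lemma line_sum (a b : int) B M : a != 0 -> coprimez a b -> ((`|a| + `|b|) * B <= M)%N ->
  \sum_(q <- box B) (`|(a * q.1 + b * q.2)%R|%N%:R)^-1 <= (1 + 2 * B%:R / `|a|%N%:R) * (2 * harm M).
Proof.
move=> a0 cab hM.
pose T := [seq (m, t) | m <- cint_range M, t <- iota 0 ((2 * B) %/ `|a|).+1].
have an : (0 < `|a|)%N by rewrite absz_gt0.
apply: le_trans (_ : \sum_(u <- T) (`|u.1|%N%:R)^-1 <= _).
  have H := @sum_inj_le _ _ (box B) (fun q : int * int => (a * q.1 + b * q.2, (absz (q.2 + B%:Z)%R %/ `|a|)%N)) T (fun u : int * nat => (`|u.1|%N%:R)^-1).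
  apply: H.
  - exact: box_uniq.
  - by apply: allpairs_uniq; rewrite ?cint_range_uniq ?iota_uniq // => -[? ?] [? ?].
  - move=> [x y] [x' y']; rewrite !mem_box /= => /andP[x1 y1] /andP[x2 y2] [e1 e2].
    have e3 : a * (x - x') = b * (y' - y).
      by apply/eqP; rewrite -subr_eq0 (_ : _ - _ = a * x + b * y - (a * x' + b * y')); [rewrite e1 subrr|ring].
    have : (a %| y' - y)%Z.
      rewrite -(Gauss_dvdzr _ cab); apply/dvdzP; exists (x - x'); rewrite -e3; ring.
    have p1 : y + B%:Z = (absz (y + B%:Z))%:Z by clear -y1; rewrite gez0_abs //; lia.
    have p2 : y' + B%:Z = (absz (y' + B%:Z))%:Z by clear -y2; rewrite gez0_abs //; lia.
    have -> : y' - y = (absz (y' + B%:Z))%:Z - (absz (y + B%:Z))%:Z by rewrite -p1 -p2; ring.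
    move=> /quot_inj /(_ e2) e4.
    have ey : y = y' by apply: (addIr B%:Z); rewrite p1 p2 e4.
    congr pair => //; apply: (mulfI a0); apply/eqP; rewrite -subr_eq0 -mulrBr e3 ey subrr mulr0 //.
  - move=> [x y]; rewrite mem_box /= => /andP[x1 y1]; apply/allpairsP; exists (a * x + b * y, (absz (y + B%:Z)%R %/ `|a|)%N); split => //=.
      rewrite mem_cint_range; apply: leq_trans hM; rewrite mulnDl.
      have h (m n : int) : (absz (m + n)%R <= `|m| + `|n|)%N by lia.
      apply: leq_trans (h _ _) _; rewrite !abszM; apply: leq_add; rewrite leq_mul2l ?x1 ?y1 orbT //.
    rewrite -[_ :: _]/(iota 0 ((2 * B) %/ `|a|).+1) mem_iota add0n ltnS.
    by apply: leq_div2r; clear -y1; lia.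
  - by move=> u; rewrite invr_ge0.
rewrite /T big_allpairs /=.
apply: le_trans (_ : \sum_(m <- cint_range M) ((2 * B) %/ `|a|).+1%:R * (`|m|%N%:R)^-1 <= _).
  apply: ler_sum => m _; rewrite big_const_seq count_predT [size _]/= size_iota iter_addr_0 -[leLHS]mulr_natl //.
rewrite -mulr_sumr; apply: ler_pM => //.
- by apply: sumr_ge0 => i _; rewrite invr_ge0.
- rewrite -natr1 addrC lerD2l ler_pdivlMr ?ltr0n // -!natrM ler_nat; exact: leq_divM.
- exact: sum_inv_range.
Qed.

Lemma line_sum_gen (a b : int) B M : ((`|a| + `|b|) * B <= M)%N ->
  \sum_(q <- box B) (`|(a * q.1 + b * q.2)%R|%N%:R)^-1 <= (1 + 2 * B%:R / (maxn 1 `|a|)%:R) * (2 * harm M).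
Proof.
move=> hM; have H0 := harm_ge0 M.
have F0 : 0 <= 1 + 2 * B%:R / (maxn 1 `|a|)%:R :> R by rewrite addr_ge0 // divr_ge0 // mulr_ge0.
have [a0|a0] := eqVneq a 0.
  have [b0|b0] := eqVneq b 0.
    rewrite big1 => [|q _]; first by rewrite !mulr_ge0.
    by rewrite a0 b0 !mul0r addr0 invr0.
  have bn : (0 < `|b|)%N by rewrite absz_gt0.
  apply: le_trans (_ : \sum_(q <- box B) (`|q.2|%N%:R)^-1 <= _).
    apply: ler_sum => q _; rewrite a0 mul0r add0r abszM.
    have [->|h] := eqVneq (q.2) 0; first by rewrite muln0 invr0.
    have qn : (0 < `|q.2|)%N by rewrite absz_gt0.
    by rewrite lef_pV2 ?posrE ?ltr0n ?muln_gt0 ?bn // ler_nat leq_pmull.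
  rewrite (sum_box B (fun x y => (`|y|%N%:R)^-1)) big_const_seq count_predT size_cint_range iter_addr_0 -[leLHS]mulr_natl.
  rewrite a0 (_ : maxn 1 `|0| = 1)%N // divr1.
  apply: ler_pM => //; first by apply: sumr_ge0 => i _; rewrite invr_ge0.
    by rewrite -natr1 natrM addrC.
  apply: le_trans (sum_inv_range B) _; rewrite ler_wpM2l // harm_le // (leq_trans _ hM) //.
  by rewrite leq_pmull // addn_gt0 bn orbT.
pose g := gcdz a b; have g0 : g != 0 by rewrite gcdz_eq0 negb_and a0.
have gn : (0 < `|g|)%N by rewrite absz_gt0.
have ea : a = (a %/ g)%Z * g by rewrite divzK // dvdz_gcdl.
have eb : b = (b %/ g)%Z * g by rewrite divzK // dvdz_gcdr.
set a1 := (a %/ g)%Z in ea; set b1 := (b %/ g)%Z in eb.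
have a10 : a1 != 0 by apply: contraNneq a0 => h; rewrite ea h mul0r.
have a1n : (0 < `|a1|)%N by rewrite absz_gt0.
have cab : coprimez a1 b1.
  have [u [v e]] := Bezoutz a b.
  apply/coprimezP; exists (u, v) => /=; apply: (mulIf g0).
  by rewrite mul1r -[RHS]e mulrDl -!mulrA -ea -eb.
have hM1 : ((`|a1| + `|b1|) * B <= M)%N.
  apply: leq_trans hM; rewrite leq_mul2r; apply/orP; right.
  by rewrite ea eb !abszM; apply: leq_add; rewrite leq_pmulr.
have := line_sum a10 cab hM1.
have -> : \sum_(q <- box B) (`|(a * q.1 + b * q.2)%R|%N%:R)^-1 = (`|g|%N%:R)^-1 * \sum_(q <- box B) (`|(a1 * q.1 + b1 * q.2)%R|%N%:R)^-1 :> R.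
  rewrite mulr_sumr; apply: eq_bigr => q _; rewrite -invfM -natrM -abszM; congr (_%:R^-1); congr absz.
  rewrite {1}ea {1}eb; ring.
move=> h; apply: le_trans (ler_wpM2l _ h) _; first by rewrite invr_ge0.
rewrite mulrA; apply: ler_wpM2r; first by rewrite mulr_ge0.
have gR : (0 : R) < `|g|%N%:R by rewrite ltr0n.
have aR : (0 : R) < `|a1|%N%:R by rewrite ltr0n.
have -> : (maxn 1 `|a|)%:R = `|a1|%N%:R * `|g|%N%:R :> R.
  by rewrite -natrM -abszM -ea; congr (_%:R); apply/maxn_idPr; rewrite absz_gt0.
rewrite mulrDr mulr1; apply: lerD; first by rewrite invf_le1 // ler1n.
by rewrite le_eqVlt; apply/orP; left; apply/eqP; field; rewrite !gt_eqF.
Qed.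

End LatticeSums.

Section OffDiagonal.
Variable R : realType.
Implicit Types (p q : int * int) (j N B M : nat).

Lemma sum_weight B : \sum_(x <- cint_range B) (1 + 2 * B%:R / (maxn 1 `|x|)%:R) <=
  (2 * B).+1%:R * (3 + 2 * harm R B) :> R.
Proof.
rewrite big_split /= big_const_seq count_predT size_cint_range iter_addr_0 -mulr_sumr.
have h : \sum_(x <- cint_range B) (maxn 1 `|x|)%:R^-1 <= 2 * (1 + harm R B) :> R.
  apply: le_trans (sum_abs_le B (F := fun n => (maxn 1 n)%:R^-1) _) _ => [n|]; first by rewrite invr_ge0.
  rewrite ler_wpM2l // big_ord_recl invr1 lerD2l; apply: ler_sum => i _.
  by rewrite /= /bump /= add1n (maxn_idPr _).
have H0 := harm_ge0 R B.
have h2 : 2 * B%:R * (\sum_(x <- cint_range B) (maxn 1 `|x|)%:R^-1) <= (2 * B).+1%:R * (2 * (1 + harm R B)) :> R.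
  have s0 : 0 <= \sum_(x <- cint_range B) (maxn 1 `|x|)%:R^-1 :> R.
    by apply: sumr_ge0 => i _; rewrite invr_ge0.
  by apply: ler_pM; rewrite // -natrM ?ler0n ?ler_nat.
apply: le_trans (lerD (lexx _) h2) _; rewrite -[X in X + _]/((2 * B).+1%:R).
by rewrite le_eqVlt; apply/orP; left; apply/eqP; ring.
Qed.

Lemma combine_sum B M : (B <= M)%N ->
  (2 * B).+1%:R * ((2 * B).+1%:R * (3 + 2 * harm R B) * (2 * harm R M)) <= 6 * (1 + harm R M) ^+ 2 * (2 * B).+1%:R ^+ 2.
Proof.
move=> h; have h1 := harm_le R h; have h0 := harm_ge0 R B.
move: (harm R B) (harm R M) ((2 * B).+1%:R : R) h1 h0 => u v w h1 h0.
have : (3 + 2 * u) * (2 * v) <= 6 * (1 + v) ^+ 2.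
  apply: le_trans (_ : (3 + 2 * v) * (2 * v) <= _); first by rewrite ler_wpM2r //; lra.
  have : 0 <= v ^+ 2 by exact: sqr_ge0.
  have -> : 6 * (1 + v) ^+ 2 = 6 + 12 * v + 6 * v ^+ 2 by ring.
  have -> : (3 + 2 * v) * (2 * v) = 6 * v + 4 * v ^+ 2 by ring.
  by move: (v ^+ 2) => *; lra.
have w0 : 0 <= w ^+ 2 by exact: sqr_ge0.
move=> /(ler_wpM2r w0); congr (_ <= _); ring.
Qed.

Lemma dot_sum B M : (8 * B * B <= M)%N ->
  \sum_(p <- box B) \sum_(q <- box B) (`|dotp p q|%N%:R)^-1 <= 6 * (1 + harm R M) ^+ 2 * (2 * B).+1%:R ^+ 2.
Proof.
move=> hM; have H0 := harm_ge0 R M.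
apply: le_trans (_ : \sum_(p <- box B) (1 + 2 * B%:R / (maxn 1 `|p.1|)%:R) * (2 * harm R M) <= _).
  rewrite big_seq [leRHS]big_seq; apply: ler_sum => p; rewrite mem_box => /andP[p1 p2].
  apply: (line_sum_gen R (a := p.1) (b := 7 * p.2)); apply: leq_trans hM; rewrite leq_mul2r; apply/orP; right.
  rewrite abszM (_ : 8 * B = B + 7 * B)%N; last by lia.
  by apply: leq_add => //; rewrite leq_mul2l p2 orbT.
have BM : (B <= M)%N by apply: leq_trans hM; case: (B) => // n; rewrite leq_pmull.
apply: le_trans (combine_sum BM).
rewrite -mulr_suml (sum_box B (fun x y => 1 + 2 * B%:R / (maxn 1 `|x|)%:R)).
rewrite (eq_bigr (fun x : int => (2 * B).+1%:R * (1 + 2 * B%:R / (maxn 1 `|x|)%:R))); last first.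
  by move=> x _; rewrite big_const_seq count_predT size_cint_range iter_addr_0 -[LHS]mulr_natl.
rewrite -mulr_sumr -[leLHS]mulrA; apply: ler_wpM2l => //.
by apply: ler_wpM2r; [exact: mulr_ge0|exact: sum_weight].
Qed.

Lemma crs_sum B M : (8 * B * B <= M)%N ->
  \sum_(p <- box B) \sum_(q <- box B) (`|crsp p q|%N%:R)^-1 <= 6 * (1 + harm R M) ^+ 2 * (2 * B).+1%:R ^+ 2.
Proof.
move=> hM; have H0 := harm_ge0 R M.
apply: le_trans (_ : \sum_(p <- box B) (1 + 2 * B%:R / (maxn 1 `|p.2|)%:R) * (2 * harm R M) <= _).
  rewrite big_seq [leRHS]big_seq; apply: ler_sum => p; rewrite mem_box => /andP[p1 p2].
  under eq_bigr do rewrite /crsp -mulNr.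
  apply: (line_sum_gen R (a := p.2) (b := - p.1)); apply: leq_trans hM; rewrite leq_mul2r; apply/orP; right.
  by rewrite abszN; apply: leq_trans (leq_add p2 p1) _; clear; lia.
have BM : (B <= M)%N by apply: leq_trans hM; case: (B) => // n; rewrite leq_pmull.
apply: le_trans (combine_sum BM).
rewrite -mulr_suml (sum_box B (fun x y => 1 + 2 * B%:R / (maxn 1 `|y|)%:R)).
rewrite big_const_seq count_predT size_cint_range iter_addr_0 -[X in X * _]mulr_natl.
rewrite -[leLHS]mulrA; apply: ler_wpM2l => //.
by apply: ler_wpM2r; [exact: mulr_ge0|exact: sum_weight].
Qed.

End OffDiagonal.

Section Diagonal.
Variable R : realType.
Implicit Types (p q : int * int) (j N B M : nat).
Local Notation kap := (2 * pi / 7 : R).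

Lemma Qg_antitone a (X Y : R) : 0 <= X -> X <= Y -> Qg a.+1 Y <= Qg a.+1 X.
Proof.
move=> X0 XY; pose f (t : R) := Qg a.+1 X - Qg a.+1 (X + t).
have f0 : f 0 = 0 by rewrite /f addr0 subrr.
have fd t : is_derive t (1 : R) f (expR (- (X + t)) * ((X + t) ^+ a / (a`!)%:R)).
  have h1 : is_derive t (1 : R) (fun t : R => X + t) 1.
    have h := @is_deriveD _ _ _ (cst X) id t 1 0 1 _ _.
    by apply: is_derive_eq; rewrite ?add0r.
  have h2 := @is_derive1_comp R (Qg a.+1) (fun t : R => X + t) t _ _ (is_derive_Qg a (X + t)) h1.
  have h3 := @is_deriveB _ _ _ (cst (Qg a.+1 X)) _ t 1 0 _ (is_derive_cst _ _ _) h2.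
  by apply: (is_derive_eq h3); rewrite mulr1 sub0r opprK.
have f'0 t : 0 <= t -> 0 <= expR (- (X + t)) * ((X + t) ^+ a / (a`!)%:R).
  by move=> t0; rewrite mulr_ge0 ?expR_ge0 // divr_ge0 // exprn_ge0 // addr_ge0.
have := ge0_of_deriv f0 fd f'0 (x := Y - X); rewrite subr_ge0 => /(_ XY).
by rewrite /f (_ : X + (Y - X) = Y) ?subr_ge0 //; ring.
Qed.

Lemma sum_cint_split K (F : int -> R[i]) : F 0 = 0 -> (forall m, F (- m) = F m) ->
  \sum_(m <- cint_range K) F m = 2 * \sum_(i < K) F i.+1%:Z.
Proof.
move=> F0 Fe; rewrite sum_cint_range.
elim: K => [|K IH]; first by rewrite big_ord_recl !big_ord0 subrr F0 addr0 mulr0.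
rewrite (_ : (2 * K.+1).+1 = (2 * K).+1.+2); last by lia.
rewrite big_ord_recl big_ord_recr [in RHS]big_ord_recr /= mulrDr -IH.
rewrite (eq_bigr (fun i : 'I_(2 * K).+1 => F (i%:Z - K%:Z))); last first.
  by move=> i _; congr F; rewrite /= /bump /= /bump /=; lia.
rewrite sub0r Fe (_ : (bump 0 (2 * K).+1)%:Z - K.+1%:Z = K.+1%:Z); last by rewrite /bump /=; lia.
by rewrite mulr_natl mulr2n; move: (\sum_(_ < _) _) (F _) => u v; ring.
Qed.

Definition scalep (m : int) p : int * int := (m * p.1, m * p.2).

Lemma al_scalep m p : al R (scalep m p) = m%:~R * al R p.
Proof. by rewrite !alE /= 2!intrM; move: (m%:~R) => u; field. Qed.

Lemma nm_scalep m p : nm R (scalep m p) = m%:~R ^+ 2 * nm R p.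
Proof. by rewrite /nm /= 2!intrM; move: (m%:~R : R) => u; field. Qed.

Definition pgcd p : nat := gcdn `|p.1| `|p.2|.
Definition prim p : int * int := (p.1 %/ (pgcd p)%:Z, p.2 %/ (pgcd p)%:Z)%Z.

Lemma scale_prim p : scalep (pgcd p)%:Z (prim p) = p.
Proof.
have h1 : ((pgcd p)%:Z %| p.1)%Z by rewrite dvdzE /=; exact: dvdn_gcdl.
have h2 : ((pgcd p)%:Z %| p.2)%Z by rewrite dvdzE /=; exact: dvdn_gcdr.
by rewrite /scalep /prim /= ![_%:Z * _]mulrC !divzK //; case: (p).
Qed.

Lemma pgcd_gt0 p : p != (0, 0) -> (0 < pgcd p)%N.
Proof. by case: p => x y h; rewrite gcdn_gt0 !absz_gt0 /= -negb_and; apply: contra h => /andP[/eqP -> /eqP ->]. Qed.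

Lemma prim_coprime p : p != (0, 0) -> coprimez (prim p).1 (prim p).2.
Proof.
move=> /pgcd_gt0 g0.
have h := congr1 pgcd (scale_prim p).
have e : pgcd (scalep (pgcd p)%:Z (prim p)) = (pgcd p * pgcd (prim p))%N.
  by rewrite /pgcd /scalep /= !abszM -muln_gcdr.
by rewrite e -[RHS]muln1 in h; move/eqP: h; rewrite eqn_pmul2l.
Qed.

(* The points of the lattice line through [p], in terms of the primitive point [p / gcd p]. *)
Lemma parallel_box B p : p != (0, 0) -> exists K, perm_eq [seq q <- box B | crsp p q == 0]
  [seq scalep m (prim p) | m <- cint_range K].
Proof.
move=> p0; have cp := prim_coprime p0; have g0 := pgcd_gt0 p0.
set x := (prim p).1 in cp *; set y := (prim p).2 in cp *.
pose N := maxn `|x| `|y|.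
have N0 : (0 < N)%N.
  rewrite leq_max !absz_gt0 -negb_and; apply/negP => /andP[/eqP hx /eqP hy].
  by move: cp; rewrite hx hy.
exists (B %/ N)%N; apply: uniq_perm.
- by rewrite filter_uniq // box_uniq.
- rewrite map_inj_uniq ?cint_range_uniq // => m m' [e1 e2].
  have : (x != 0) || (y != 0) by move: N0; rewrite /N leq_max !absz_gt0.
  by case/orP => h; apply: (mulIf h).
move=> [u v]; rewrite mem_filter mem_box; cbn [fst snd]; apply/idP/idP.
- move=> /andP[/eqP hc /andP[hu hv]].
  have hc' : y * u = x * v.
    have : (pgcd p)%:Z * (y * u - x * v) = 0.
      by rewrite -hc /crsp -{2 3}(scale_prim p) /scalep /= -/x -/y; ring.
    by move/eqP; rewrite mulf_eq0 eqz_nat -[(pgcd p == 0)%N]negbK -lt0n g0 /= subr_eq0 => /eqP.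
  have [[s t] st] := coprimezP _ _ cp; cbn [fst snd] in st; rewrite -/x -/y in st.
  have hu' : (s * u + t * v) * x = u.
    rewrite -[RHS]mul1r -st mulrDl mulrDl [_ * y * u](_ : _ = t * (y * u)); last by ring.
    by rewrite hc'; ring.
  have hv' : (s * u + t * v) * y = v.
    rewrite -[RHS]mul1r -st mulrDl mulrDl [_ * x * v](_ : _ = s * (x * v)); last by ring.
    by rewrite -hc'; ring.
  apply/mapP; exists (s * u + t * v); last by rewrite /scalep -/x -/y hu' hv'.
  rewrite mem_cint_range leq_divRL // /N maxnMr geq_max -!abszM hu' hv'.
  by apply/andP.
move=> /mapP[m]; rewrite mem_cint_range leq_divRL // /N maxnMr geq_max -!abszM => /andP[h1 h2] [-> ->].
rewrite -/x -/y h1 h2 /= andbT; apply/eqP.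
have e1 : p.1 = (pgcd p)%:Z * x by rewrite -{1}(scale_prim p).
have e2 : p.2 = (pgcd p)%:Z * y by rewrite -{1}(scale_prim p).
change (crsp p (m * x, m * y) = 0).
by rewrite /crsp; cbn [fst snd]; rewrite e1 e2; ring.
Qed.

Lemma eterm_scale j m p : m != 0 -> eterm R j (scalep m p) =
  ((if (2 %| m * (p.1 - p.2))%Z then (chi m)%:~R else 0) / m%:~R *
   Qg (2 * j).+1 (kap * (m%:~R ^+ 2 * nm R p)))%:C *
  ((chi p.1)%:~R * (al R p ^+ (4 * j).+1 / (nm R p)%:C ^+ (2 * j).+1)).
Proof.
move=> m0; rewrite /eterm al_scalep nm_scalep.
have -> : ec R (scalep m p) = (if (2 %| m * (p.1 - p.2))%Z then (chi m)%:~R else 0) * (chi p.1)%:~R.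
  by rewrite /ec /= -mulrBr; case: ifP => _; rewrite ?mul0r // chiM intrM.
have m1 : m%:~R != 0 :> R[i] by rewrite intr_eq0.
have h : (m%:~R * al R p) ^+ (4 * j).+1 / (m%:~R ^+ 2 * nm R p)%:C ^+ (2 * j).+1 =
    m%:~R^-1 * (al R p ^+ (4 * j).+1 / (nm R p)%:C ^+ (2 * j).+1).
  have -> : (m%:~R ^+ 2 * nm R p)%:C ^+ (2 * j).+1 = m%:~R * m%:~R ^+ (4 * j).+1 * (nm R p)%:C ^+ (2 * j).+1.
    rewrite rC_M rC_X rC_int exprMn -exprM -exprS; congr (_ ^+ _ * _); lia.
  rewrite exprMn.
  move: (m%:~R ^+ (4 * j).+1) (expf_neq0 (4 * j).+1 m1) => w w0.
  move: ((nm R p)%:C ^+ _) => v; rewrite !invfM.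
  by move: (v^-1) => v'; field; rewrite m1 w0.
have eR (x w : R) : (x / m%:~R * w)%:C = x%:C / m%:~R * w%:C :> R[i] by rewrite !rC_M rC_V rC_int.
rewrite h eR.
have -> : (if (2 %| m * (p.1 - p.2))%Z then (chi m)%:~R else 0 : R)%:C = if (2 %| m * (p.1 - p.2))%Z then (chi m)%:~R else 0.
  by case: ifP => _ //; rewrite rC_int.
by case: ifP => _; move: (Qg _ _)%:C (al R p ^+ _ / _) (m%:~R^-1) => *; ring.
Qed.

Lemma inner_bound j B p : p != (0, 0) ->
  cn (\sum_(q <- box B | crsp p q == 0) eterm R j q) <= 28 * (pgcd p)%:R / cn (al R p).
Proof.
move=> p0; have [K hK] := parallel_box B p0.
rewrite -big_filter (perm_big _ hK) big_map.
have g0 := pgcd_gt0 p0.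
set p1 := prim p; set c0 : R[i] := (chi p1.1)%:~R * (al R p1 ^+ (4 * j).+1 / (nm R p1)%:C ^+ (2 * j).+1).
have alp : cn (al R p) = (pgcd p)%:R * cn (al R p1).
  by rewrite -{1}(scale_prim p) al_scalep cnM cn_int.
have np : p1 != (0, 0).
  apply: contra_neq p0 => h; rewrite -(scale_prim p) -/p1 h /scalep /= mulr0 //.
have n1 : 0 < nm R p1.
  rewrite /nm divr_gt0 //; move: np; case: (p1) => x y /= h.
  have [x0|x0] := eqVneq x 0.
    have y0 : y != 0 by apply: contraNneq h => ->; rewrite x0.
    by apply: ltr_wpDl; rewrite ?sqr_ge0 // mulr_gt0 // lt0r sqr_ge0 sqrf_eq0 intr_eq0 y0.
  apply: ltr_wpDr; first by rewrite mulr_ge0 ?sqr_ge0.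
  by rewrite lt0r sqr_ge0 sqrf_eq0 intr_eq0 x0.
have a1 : 0 < cn (al R p1) by rewrite cn_al_exp // expR_gt0.
have hc0 : cn c0 <= (cn (al R p1))^-1.
  rewrite /c0 cnM cnM cnX cnV cnX cn_real (gtr0_norm n1) -cn_al2 -exprM.
  have -> : cn (al R p1) ^+ (4 * j).+1 / cn (al R p1) ^+ (2 * (2 * j).+1) = (cn (al R p1))^-1.
    have -> : (2 * (2 * j).+1 = (4 * j).+1 + 1)%N by lia.
    by rewrite exprD expr1 invfM mulrA divff ?mul1r // expf_neq0 // gt_eqF.
  by rewrite ler_piMl ?invr_ge0 ?cn_ge0 ?cn_chi.
pose f (m : int) : R := (if (2 %| m * (p1.1 - p1.2))%Z then (chi m)%:~R else 0) / m%:~R *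
   Qg (2 * j).+1 (kap * (m%:~R ^+ 2 * nm R p1)).
have fE m : eterm R j (scalep m p1) = c0 * (f m)%:C.
  have [->|m0] := eqVneq m 0; last by rewrite eterm_scale // mulrC.
  rewrite /f mul0r dvdz0 (_ : chi 0 = 0) // mulr0z !mul0r mulr0.
  rewrite /eterm (_ : ec R (scalep 0 p1) = 0) ?mul0r // /ec /scalep /= mul0r (_ : chi 0 = 0) //.
  by case: ifP.
under eq_bigr do rewrite fE.
rewrite -mulr_sumr.
have fe m : f (- m) = f m.
  rewrite /f mulNr chiN !intrN sqrrN.
  have -> : (2 %| - (m * (p1.1 - p1.2)))%Z = (2 %| m * (p1.1 - p1.2))%Z by rewrite !dvdzE abszN.
  by case: ifP => _; rewrite ?mul0r // invrN mulrNN.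
have f0 : f 0 = 0 by rewrite /f mul0r dvdz0 (_ : chi 0 = 0) // mulr0z !mul0r.
rewrite (@sum_cint_split K (fun m => (f m)%:C)); [|by rewrite f0|by move=> m; rewrite fe].
pose e := (2 %| p1.1 - p1.2)%Z.
pose cc (i : nat) : R := if e || (2 %| i.+1)%N then (chi i.+1%:Z)%:~R else 0.
pose ww (i : nat) : R := (i.+1%:R)^-1 * Qg (2 * j).+1 (kap * (i.+1%:R ^+ 2 * nm R p1)).
have hX i : 0 <= kap * (i.+1%:R ^+ 2 * nm R p1).
  by rewrite mulr_ge0 ?c7_ge0 // mulr_ge0 ?exprn_ge0 // ltW.
have hS : `|\sum_(i < K) cc i * ww i| <= 14 * ww 0%N.
  apply: abel_decreasing => // [m|m|m].
  - exact: chi_partial.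
  - by apply: mulr_ge0; [rewrite invr_ge0|exact: Qg_ge0].
  - apply: ler_pM; [by rewrite invr_ge0|exact: Qg_ge0| |].
      by rewrite lef_pV2 ?posrE // ler_nat.
    apply: Qg_antitone => //; apply: ler_wpM2l; first exact: c7_ge0.
    by rewrite ler_wpM2r ?(ltW n1) // lerXn2r ?nnegrE // ler_nat.
have w1 : ww 0%N <= 1 by rewrite /ww invr1 mul1r; exact: Qg_le1.
have -> : \sum_(i < K) (f i.+1%:Z)%:C = (\sum_(i < K) cc i * ww i)%:C.
  rewrite rC_sum; apply: eq_bigr => i _; congr (_%:C); rewrite /f /cc /ww.
  have -> : (2 %| i.+1%:Z * (p1.1 - p1.2))%Z = e || (2 %| i.+1)%N.
    by rewrite dvdzE abszM Euclid_dvdM // orbC /e dvdzE.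
  exact: esym (mulrA _ _ _).
rewrite cnM cnM cn_nat cn_real.
apply: le_trans (_ : (cn (al R p1))^-1 * (2 * 14) <= _).
  apply: ler_pM; rewrite ?cn_ge0 ?mulr_ge0 // ler_wpM2l //.
  by apply: le_trans hS _; rewrite -[leRHS]mulr1 ler_wpM2l.
rewrite alp; have gR : (0 : R) < (pgcd p)%:R by rewrite ltr0n.
by rewrite le_eqVlt; apply/orP; left; apply/eqP; field; rewrite !gt_eqF.
Qed.

End Diagonal.

Section MeanSquare.
Variable R : realType.
Implicit Types (p q : int * int) (j N B M : nat).

Lemma row_sum (m K : nat) : (0 < m)%N -> \sum_(n < K) ((m ^ 2 + n ^ 2)%N%:R)^-1 <= 4 / m%:R :> R.
Proof.
move=> m0; have mR : (0 : R) < m%:R by rewrite ltr0n.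
suff : \sum_(n < K) ((m ^ 2 + n ^ 2)%N%:R)^-1 <= 4 / m%:R - 4 / (m + K)%:R :> R.
  by move/le_trans; apply; rewrite lerBlDr lerDl divr_ge0.
elim: K => [|K IH]; first by rewrite big_ord0 addn0 subrr.
rewrite big_ord_recr /=; apply: le_trans (lerD IH (lexx _)) _.
rewrite -addrA lerD2l addrC lerBlDr addrC -lerBlDr opprK addrC.
set a : R := (m + K)%:R; have a0 : 1 <= a by rewrite ler1n addn_gt0 m0.
have a00 : 0 < a by lra.
have -> : (m + K.+1)%:R = a + 1 :> R by rewrite addnS -natr1.
have h : a ^+ 2 <= 2 * (m ^ 2 + K ^ 2)%N%:R.
  rewrite natrD !natrX /a natrD -subr_ge0.
  rewrite (_ : _ - _ = (m%:R - K%:R) ^+ 2); last by ring.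
  exact: sqr_ge0.
have s0 : 0 < (m ^ 2 + K ^ 2)%N%:R :> R by rewrite ltr0n addn_gt0 expn_gt0 m0.
move: (_%:R : R) h s0 => s h s0.
have -> : 4 / a = 4 / (a + 1) + 4 / (a * (a + 1)) by field; rewrite !gt_eqF // ltr_wpDr.
rewrite lerD2l -[s^-1]mul1r ler_pdivrMr // mulrAC ler_pdivlMr ?mulr_gt0 //; last by lra.
rewrite mul1r; nra.
Qed.

Lemma zero_row_sum K : \sum_(n < K) ((n ^ 2)%N%:R)^-1 <= 4 :> R.
Proof.
case: K => [|K]; first by rewrite big_ord0.
rewrite big_ord_recl /= exp0n // invr0 add0r.
apply: le_trans (_ : 4 / 1%:R <= _); last by rewrite divr1.
apply: le_trans (row_sum K (m := 1) isT); apply: ler_sum => n _.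
rewrite /bump /= add1n lef_pV2 ?posrE ?ltr0n ?addn_gt0 ?expn_gt0 // ler_nat.
by rewrite exp1n -!mulnn mulSn mulnS; lia.
Qed.

Lemma nm_inv_sum B : \sum_(p <- box B) (nm R p)^-1 <= 64 * (1 + harm R B).
Proof.
pose F m n : R := ((m ^ 2 + n ^ 2)%N%:R)^-1.
have F0 m n : 0 <= F m n by rewrite invr_ge0.
apply: le_trans (_ : \sum_(p <- box B) 4 * F `|p.1|%N `|p.2|%N <= _).
  apply: ler_sum => p _; rewrite /F natrD !natrX /nm invf_div !int_sqr.
  have s1 : 0 <= (`|p.1|%N%:R : R) ^+ 2 by exact: sqr_ge0.
  have s2 : 0 <= (`|p.2|%N%:R : R) ^+ 2 by exact: sqr_ge0.
  move: (_ ^+ 2) (_ ^+ 2) s1 s2 => u v u0 v0.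
  rewrite ler_wpM2l //; have [e|e] := eqVneq (u + v) 0.
    have -> : u = 0 by lra.
    have -> : v = 0 by lra.
    by rewrite mulr0 addr0.
  have e0 : 0 < u + v by rewrite lt0r e addr_ge0.
  by rewrite lef_pV2 ?posrE //; lra.
rewrite -mulr_sumr (sum_box B (fun x y => F `|x|%N `|y|%N)).
apply: le_trans (_ : 4 * (\sum_(x <- cint_range B) 2 * \sum_(n < B.+1) F `|x|%N n) <= _).
  rewrite ler_wpM2l //; apply: ler_sum => x _; exact: sum_abs_le.
rewrite -mulr_sumr.
have h := sum_abs_le B (F := fun m => \sum_(n < B.+1) F m n).
apply: le_trans (_ : 4 * (2 * (2 * \sum_(m < B.+1) \sum_(n < B.+1) F m n)) <= _).
  by rewrite !ler_wpM2l // h // => m; apply: sumr_ge0.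
rewrite big_ord_recl.
have r0 : \sum_(n < B.+1) F (ord0 : 'I_B.+1) n <= 4.
  by rewrite /F /=; under eq_bigr do rewrite exp0n // add0n; exact: zero_row_sum.
have r1 : \sum_(i < B) \sum_(n < B.+1) F (lift ord0 i) n <= 4 * harm R B.
  rewrite mulr_sumr; apply: ler_sum => i _; rewrite /= /bump /= add1n; exact: row_sum.
by move: (\sum_(n < B.+1) _) (\sum_(i < B) _) (harm R B) r0 r1 => *; lra.
Qed.

Lemma gcd_sum B : \sum_(p <- box B) (pgcd p)%:R / nm R p <= harm R B * (64 * (1 + harm R B)).
Proof.
pose F (u : nat * (int * int)) : R := (u.1%:R)^-1 * (nm R u.2)^-1.
apply: le_trans (_ : \sum_(u <- [seq (g, q) | g <- iota 0 B.+1, q <- box B]) F u <= _); last first.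
  rewrite big_allpairs /F /=.
  rewrite -[_ :: iota 1 B]/(index_iota 0 B.+1) big_mkord.
  under eq_bigr do rewrite -mulr_sumr.
  rewrite -mulr_suml big_ord_recl invr0 add0r.
  by apply: ler_wpM2l (nm_inv_sum B); exact: (harm_ge0 R B).
have E p : (pgcd p)%:R / nm R p = F (pgcd p, prim p).
  rewrite /F /= -{2}(scale_prim p) nm_scalep.
  have [->|g0] := eqVneq (pgcd p) 0%N; first by rewrite mul0r invr0 mul0r.
  have gR : (pgcd p)%:R != 0 :> R by rewrite pnatr_eq0.
  rewrite invfM -[(Posz (pgcd p))%:~R]/((pgcd p)%:R); move: ((nm R (prim p))^-1) => v; field.
  exact: gR.
under eq_bigr do rewrite E.
have H := @sum_inj_le R _ _ (box B) (fun p => (pgcd p, prim p)) [seq (g, q) | g <- iota 0 B.+1, q <- box B] F.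
apply: H.
- exact: box_uniq.
- by apply: allpairs_uniq; rewrite ?iota_uniq ?box_uniq // => -[? ?] [? ?].
- move=> p q _ _ e; have e1 : pgcd p = pgcd q := congr1 fst e.
  have e2 : prim p = prim q := congr1 snd e.
  by rewrite -[LHS]scale_prim -[RHS]scale_prim e1 e2.
- move=> p; rewrite mem_box => /andP[p1 p2]; apply/allpairsP; exists (pgcd p, prim p); split => //.
    rewrite mem_iota add0n ltnS /=.
    have [h|h] := eqVneq (p.1) 0.
      by rewrite /pgcd h gcd0n.
    by apply: leq_trans p1; apply: dvdn_leq; [rewrite absz_gt0|exact: dvdn_gcdl].
  rewrite mem_box [(_, _).2]/=.
  have [g0|g0] := posnP (pgcd p); first by rewrite /prim g0 !divz0.
  rewrite -{1}(scale_prim p) /scalep abszM in p1; rewrite -{1}(scale_prim p) /scalep abszM in p2.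
  by rewrite (leq_trans _ p1) ?(leq_trans _ p2) // leq_pmull.
- by move=> u; rewrite mulr_ge0 ?invr_ge0 ?nm_ge0.
Qed.

Lemma conj_sum (T : Type) (A : seq T) (P : pred T) (f : T -> R[i]) :
  conjc (\sum_(t <- A | P t) f t) = \sum_(t <- A | P t) conjc (f t).
Proof. exact: rmorph_sum. Qed.

Lemma diagonal_term j B p :
  cn (eterm R j p * conjc (\sum_(q <- box B | crsp p q == 0) eterm R j q)) <= 28 * ((pgcd p)%:R / nm R p).
Proof.
have r0 : 0 <= 28 * ((pgcd p)%:R / nm R p) by rewrite mulr_ge0 // divr_ge0 // nm_ge0.
have [h|h] := eqVneq (ec R p) 0.
  by rewrite /eterm h !mul0r cn0.
have n1 := ec_nm h; have n0 : 0 < nm R p by apply: lt_le_trans n1.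
have p0 : p != (0, 0).
  by apply: contraTneq n1 => ->; rewrite /nm /= expr0n /= mulr0 addr0 mul0r -ltNge.
rewrite cnM cn_conj.
have a0 : 0 < cn (al R p) by rewrite cn_al_exp // expR_gt0.
have h1 : cn (eterm R j p) <= (cn (al R p))^-1.
  apply: le_trans (cn_eterm R j p) _; rewrite h ler_piMr ?invr_ge0 ?cn_ge0 //.
  by apply: Qg_le1; rewrite mulr_ge0 ?c7_ge0 // ltW.
apply: le_trans (ler_pM (cn_ge0 _) (cn_ge0 _) h1 (inner_bound R j B p0)) _.
rewrite -cn_al2 le_eqVlt; apply/orP; left; apply/eqP; field; exact: lt0r_neq0.
Qed.

Lemma off_diagonal_term N p q : crsp p q != 0 ->
  cn (\sum_(j < N) eterm R j p * conjc (eterm R j q)) <=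
    2 * (`|dotp p q|%N%:R)^-1 + 2 * (`|crsp p q|%N%:R)^-1.
Proof.
move=> hc; have r0 : 0 <= 2 * (`|dotp p q|%N%:R)^-1 + 2 * (`|crsp p q|%N%:R)^-1 :> R.
  by rewrite addr_ge0 // mulr_ge0 ?invr_ge0.
have [h|h] := eqVneq (ec R p) 0.
  by rewrite big1 ?cn0 // => j _; rewrite /eterm h !mul0r.
have [h'|h'] := eqVneq (ec R q) 0.
  by rewrite big1 ?cn0 // => j _; rewrite [eterm R j q]/eterm h' !mul0r conjc0 mulr0.
apply: le_trans (pair_bound N h h' hc) _.
by rewrite !natr_absz !intr_norm.
Qed.

Theorem mean_square_box N B M : (8 * B * B <= M)%N ->
  \sum_(j < N) cn (\sum_(p <- box B) eterm R j p) ^+ 2 <=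
    (1 + harm R M) ^+ 2 * (1792 * N%:R + 24 * (2 * B).+1%:R ^+ 2).
Proof.
move=> hM; have BM : (B <= M)%N by apply: leq_trans hM; case: (B) => // n; rewrite leq_pmull.
have H0 := harm_ge0 R B; have H1 := harm_le R BM.
pose D := \sum_(j < N) \sum_(p <- box B) eterm R j p * conjc (\sum_(q <- box B | crsp p q == 0) eterm R j q).
pose O := \sum_(p <- box B) \sum_(q <- box B | crsp p q != 0) \sum_(j < N) eterm R j p * conjc (eterm R j q).
have E : (\sum_(j < N) cn (\sum_(p <- box B) eterm R j p) ^+ 2)%:C = D + O.
  rewrite rC_sum; under eq_bigr do rewrite -mul_conj.
  have -> : O = \sum_(j < N) \sum_(p <- box B) \sum_(q <- box B | crsp p q != 0) eterm R j p * conjc (eterm R j q).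
    rewrite [RHS]exchange_big; apply: eq_bigr => p _; exact: exchange_big.
  rewrite /D -big_split; apply: eq_bigr => j _.
  rewrite -big_split /= mulr_suml; apply: eq_bigr => p _.
  rewrite -mulr_sumr -mulrDr -conj_sum; congr (_ * _).
  by rewrite (bigID (fun q => crsp p q == 0)) /=; exact: rmorphD.
have hD : cn D <= N%:R * (28 * (harm R B * (64 * (1 + harm R B)))).
  apply: le_trans (cn_sum _ _ _) _.
  apply: le_trans (_ : \sum_(j < N) (28 * (harm R B * (64 * (1 + harm R B)))) <= _); last first.
    by rewrite sumr_const card_ord -[leLHS]mulr_natl.
  apply: ler_sum => j _; apply: le_trans (cn_sum _ _ _) _.
  apply: le_trans (_ : \sum_(p <- box B) 28 * ((pgcd p)%:R / nm R p) <= _).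
    by apply: ler_sum => p _; exact: diagonal_term.
  by rewrite -mulr_sumr ler_wpM2l // gcd_sum.
have hO : cn O <= 24 * (1 + harm R M) ^+ 2 * (2 * B).+1%:R ^+ 2.
  apply: le_trans (cn_sum _ _ _) _.
  apply: le_trans (_ : \sum_(p <- box B) \sum_(q <- box B) (2 * (`|dotp p q|%N%:R)^-1 + 2 * (`|crsp p q|%N%:R)^-1) <= _).
    apply: ler_sum => p _; apply: le_trans (cn_sum _ _ _) _.
    rewrite [leLHS]big_mkcond; apply: ler_sum => q _; case: ifPn => h; first exact: off_diagonal_term.
    by rewrite addr_ge0 // mulr_ge0 ?invr_ge0.
  under eq_bigr do rewrite big_split /= -!mulr_sumr.
  rewrite big_split /= -!mulr_sumr.
  have := dot_sum R hM; have := crs_sum R hM.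
  move: (\sum_(_ <- _) _) (\sum_(_ <- _) _) => u v h1 h2.
  have -> : 24 * (1 + harm R M) ^+ 2 * (2 * B).+1%:R ^+ 2 =
    2 * (6 * (1 + harm R M) ^+ 2 * (2 * B).+1%:R ^+ 2) + 2 * (6 * (1 + harm R M) ^+ 2 * (2 * B).+1%:R ^+ 2) by ring.
  by apply: lerD; rewrite ler_wpM2l.
have hh : harm R B * (1 + harm R B) <= (1 + harm R M) ^+ 2.
  by rewrite expr2; apply: ler_pM => //; lra.
have S0 : 0 <= \sum_(j < N) cn (\sum_(p <- box B) eterm R j p) ^+ 2.
  by apply: sumr_ge0 => j _; rewrite exprn_ge0 // cn_ge0.
rewrite -[leLHS]ger0_norm // -cn_real E; apply: le_trans (cnD _ _) _.
apply: le_trans (lerD hD hO) _.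
move: hh (ler0n R N); clear; move: (N%:R) (harm R B) (harm R M) ((2 * B).+1%:R) => n x y b hh n0.
have : n * (x * (1 + x)) <= n * (1 + y) ^+ 2 by rewrite ler_wpM2l.
by move=> h; nra.
Qed.

End MeanSquare.

Lemma box_size N : (0 < N)%N -> exists B, [/\ (56 * N <= B ^ 2)%N, ((2 * B).+1 ^ 2 <= 2304 * N)%N &
  (8 * B * B <= 2048 * N)%N].
Proof.
move=> N0; have [s /andP[h1 h2]] : exists s, (s * s <= N < s.+1 * s.+1)%N.
  elim: (N) => [|n [s /andP[h1 h2]]]; first by exists 0%N.
  by have [h|h] := ltnP n.+1 (s.+1 * s.+1); [exists s|exists s.+1]; apply/andP; split; nia.
have s1 : (0 < s)%N by case: (s) h2 => //; lia.
exists (8 * s.+1)%N; rewrite -!mulnn; split; nia.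
Qed.

Section MeanValue.
Variable R : realType.

Lemma central_square (L : nat -> R[i] -> R[i]) : (forall n, (0 < n)%N -> is_Lfunction n (L n)) ->
  exists2 C : R, 0 <= C & forall N B M, (56 * N <= B ^ 2)%N -> (8 * B * B <= M)%N ->
  \sum_(1 <= n < N.+1) cn (L n 2^-1) ^+ 2 <=
    32 * ((1 + harm R M) ^+ 2 * (1792 * N%:R + 24 * (2 * B).+1%:R ^+ 2)) + C * N%:R.
Proof.
move=> hL; have [C C0 hC] := eterm_tail R; exists (32 * C ^+ 2) => [|N B M hB hM].
  by rewrite mulr_ge0 // exprn_ge0.
rewrite big_add1 /= big_mkord.
apply: le_trans (_ : \sum_(j < N) (32 * cn (\sum_(p <- box B) eterm R j p) ^+ 2 + 32 * C ^+ 2) <= _).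
  apply: ler_sum => j _; have [U hU E] := center_formula (ltn0Sn j) (hL j.+1 (ltn0Sn j)).
  have hU' : hasSum (eterm R j) U.
    by rewrite (_ : eterm R j = Lt (4 * j.+1 - 3) (2 * j.+1 - 1) (2^-1 +i* 0) 1) //; apply/funext => p; rewrite Lt_eterm.
  have h1 := hC N B j U (ltn_ord j) hB hU'.
  have h2 : cn U <= cn (\sum_(p <- box B) eterm R j p) + C.
    rewrite -[U](subrK (\sum_(p <- box B) eterm R j p)); apply: le_trans (cnD _ _) _.
    by rewrite addrC lerD2l.
  have h3 : cn (1 + rootw R) <= 8.
    by apply: le_trans (cnD _ _) _; rewrite cn1; have := cn_rootw R; lra.
  have h4 : 2 * cn (L j.+1 2^-1) <= 8 * cn U.
    by rewrite -(cn_nat R 2) -cnM E cnM ler_wpM2r // cn_ge0.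
  have := cn_ge0 (L j.+1 2^-1); have := cn_ge0 U; have := cn_ge0 (\sum_(p <- box B) eterm R j p).
  move: h2 h4; move: (cn _) (cn _) (cn _) => u x y; clear -C0 => h1 h2 u0 x0 y0.
  apply: le_trans (_ : (4 * (x + C)) ^+ 2 <= _); first by rewrite ler_sqr ?nnegrE; lra.
  rewrite -subr_ge0 (_ : _ - _ = 16 * (x - C) ^+ 2); last by ring.
  by rewrite mulr_ge0 // sqr_ge0.
rewrite big_split /= -mulr_sumr sumr_const card_ord -[X in _ + X]mulr_natr.
apply: lerD; last exact: lexx.
apply: ler_wpM2l (mean_square_box R N hM); exact: ler0n.
Qed.

Lemma ln_ge_half (x : R) : 2 <= x -> 2^-1 <= ln x.
Proof.
move=> x2; have x0 : 0 < x by lra.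
have h : x^-1 <= 2^-1 by rewrite lef_pV2 ?posrE.
have := expR_ge1Dx (- ln x); rewrite expRN lnK ?posrE //.
by clear -h; lra.
Qed.

Lemma harm_mul_ln c N : (0 < c <= N)%N -> harm R (c * N) <= 1 + 2 * ln N%:R.
Proof.
move=> /andP[c0 cN]; have N0 : (0 < N)%N by apply: leq_trans cN.
apply: le_trans (harm_ln R _) _; first by rewrite muln_gt0 c0.
rewrite natrM lnM ?posrE ?ltr0n // lerD2l mulr2n mulrDl mul1r lerD2r.
by rewrite ler_ln ?posrE ?ltr0n // ler_nat.
Qed.

Lemma mean_square_arith (n l h b c : R) : 0 <= n -> 0 <= c -> 0 <= h -> 2^-1 <= l -> h <= 6 * l -> b <= 2304 * n ->
  32 * (h ^+ 2 * (1792 * n + 24 * b)) + c * n <= (32 * 36 * (1792 + 24 * 2304) + 4 * c) * l ^+ 2 * n.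
Proof.
move=> n0 c0 h0 l2 hl hb.
have h2 : h ^+ 2 <= 36 * l ^+ 2 by nra.
have l3 : 1 <= 4 * l ^+ 2 by nra.
have H0 : 0 <= h ^+ 2 by rewrite exprn_ge0.
move: (h ^+ 2) (l ^+ 2) h2 l3 H0; clear -n0 c0 hb => u v uv v4 u0.
have e1 : c * n <= 4 * c * v * n.
  by rewrite (_ : 4 * c * v * n = c * n * (4 * v)); [rewrite ler_peMr // mulr_ge0|ring].
have e2 : u * b <= u * (2304 * n) by rewrite ler_wpM2l.
have e3 : u * n <= 36 * v * n by rewrite ler_wpM2r.
by lra.
Qed.

End MeanValue.

Theorem theorem2p3 (R : realType) (L : nat -> R[i] -> R[i])
    (L_continuation : forall n : nat, (0 < n)%N -> is_Lfunction n (L n)) :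
  (fun N : nat => N%:R^-1 * (\sum_(1 <= n < N.+1) L n 2^-1 ^+ 2) : R[i]^o)
    =O_\oo (fun N : nat => ((ln N%:R : R) ^+ 2)%:C : R[i]^o).
Proof.
have [C C0 hC] := central_square L_continuation.
pose K : R := 32 * 36 * (1792 + 24 * 2304) + 4 * C.
apply/eqO_exP; exists K%:C; first by rewrite ltcR /K; lra.
exists 2048%N => // N /= hN.
have N0 : (0 < N)%N by apply: leq_trans hN.
have NR : 0 < (N%:R : R) by rewrite ltr0n.
rewrite !normr_cn -rmorphM lecC cnM cnV cn_nat cn_real ger0_norm ?exprn_ge0 //; last first.
  by rewrite ln_ge0 // ler1n.
have [B [h1 h2 h3]] := box_size N0.
have l2 : 2^-1 <= ln (N%:R : R) by apply: ln_ge_half; rewrite ler_nat; apply: leq_trans hN.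
have hM : 1 + harm R (2048 * N) <= 6 * ln (N%:R : R).
  have := @harm_mul_ln R 2048 N hN; move: (harm _ _) l2; clear => h; lra.
have H0 : 0 <= 1 + harm R (2048 * N) by rewrite addr_ge0 ?harm_ge0.
have hB : ((2 * B).+1%:R : R) ^+ 2 <= 2304 * N%:R by rewrite -natrX -natrM ler_nat.
rewrite mulrC ler_pdivrMr //.
apply: le_trans (cn_sum _ _ _) _.
under eq_bigr do rewrite cnX.
apply: le_trans (hC _ _ _ h1 h3) _.
exact: mean_square_arith (ltW NR) C0 H0 l2 hM hB.
Qed.
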